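(* Let $(a,\gamma,\nu)$ be a characteristic triplet and let $\omega:\mathbb{R}^d\to\mathbb{R}$ be an admissible weight. If $$\int_{|r|>1}|r|\int_0^{1/|r|}\omega^{\rightarrow}\big(c\log(|\alpha|^{-1})\big)^d\,\lambda^1(d\alpha)\,\nu(dr)<\infty$$ for some $c\in(0,\infty)$, then there exists a Lévy white noise $\dot L:(\Omega,\mathcal{F})\to(\mathcal{S}'_\omega,C(\mathcal{S}'_\omega))$ with characteristic triplet $(a,\gamma,\nu)$.
   Context: Notation: $\lambda^d$ is Lebesgue measure on $\mathbb{R}^d$; $\mathcal{F}f(x)=\int_{\mathbb{R}^d}e^{-i\langle z,x\rangle}f(z)\,\lambda^d(dz)$ for functions $f$; $D^\alpha=\partial_{x_1}^{\alpha_1}\cdots\partial_{x_d}^{\alpha_d}$. Admissible weight: a function $\omega:\mathbb{R}^d\to\mathbb{R}$ with $\omega(x)=\sigma(\|x\|)$, where $\sigma$ is an increasing continuous concave function on $[0,\infty)$ with $\sigma(0)=0$, $\int_0^\infty\frac{\sigma(t)}{1+t^2}\lambda^1(dt)<\infty$, and $\sigma(t)\ge c_0+m\log(1+t)$ for all $t\ge0$, for some $c_0\in\mathbb{R}$ and $m>0$. For $\alpha\in(0,\infty)$, $\omega^{\rightarrow}(\alpha):=\sup\{x\in[0,\infty):\omega(xe_1)<\alpha\}$, with $e_1=(1,0,\dots,0)$. $\mathcal{S}_\omega$ is the set of all infinitely differentiable $\varphi:\mathbb{R}^d\to\mathbb{C}$ such that $p_{\alpha,\eta}(\varphi)=\sup_x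 e^{\eta\omega(x)}|D^\alpha\varphi(x)|<\infty$ and $\pi_{\alpha,\eta}(\varphi)=\sup_x e^{\eta\omega(x)}|D^\alpha(\mathcal{F}\varphi)(x)|<\infty$ for every multi-index $\alpha$ and every $\eta>0$, with the topology given by these seminorms; $\mathcal{S}'_\omega$ is its topological dual (the space of tempered ultradistributions). A characteristic triplet $(a,\gamma,\nu)$ consists of $a\ge0$, $\gamma\in\mathbb{R}$ and a Lévy measure $\nu$ on $\mathbb{R}$ ($\nu(\{0\})=0$, $\int\min(1,x^2)\nu(dx)<\infty$). For a test function space $A$ with dual $A'$ (here $A=\mathcal{S}_\omega$), an $A'$-valued generalized random process is a measurable mapping from a probability space $(\Omega,\mathcal{F})$ (with probability measure $\mathcal{P}$) to $(A',C(A'))$, where $C(A')$ is the $\sigma$-field generated by the cylindrical sets $\{u\in A':\langle u,\varphi_j\rangle\in B,\ j=1,\dots,n\}$, $\varphi_1,\dots,\varphi_n\in A$, $B$ Borel. Its characteristic functional is $\widehat{\mathcal{P}}_s(\varphi)=\int_{A'}\exp(i\langle u,\varphi\rangle)\,d\mathcal{P}_s(u)$, $\mathcal{P}_s$ being the law of $s$. A Lévy white noise $\dot L$ on $A'$ with characteristic triplet $(a,\gamma,\nu)$ is an $A'$-valued generalized random process whose characteristic functional is $\exp\big(\int_{\mathbb{R}^d}\psi(\varphi(x))\lambda^d(dx)\big)$ for all real-valued $\varphi\in A$, where $\psi(z)=i\gamma z-\frac12az^2+\int_{\mathbb{R}}(e^{ixz}-1-ixz\mathbf{1}_{|x|\le1})\nu(dx)$.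 For complex-valued $\varphi$, $\langle\dot L,\varphi\rangle:=\langle\dot L,\Re\varphi\rangle+i\langle\dot L,\Im\varphi\rangle$. The existence claim includes the existence of the underlying probability space. *)

(* Defs.v *)
From HB Require Import structures.
From mathcomp Require Import all_boot all_order all_algebra.
From mathcomp Require Import all_classical all_reals all_analysis.
From mathcomp.real_closed Require Export complex.

Set Implicit Arguments.
Unset Strict Implicit.
Unset Printing Implicit Defensive.

Import Order.TTheory GRing.Theory Num.Theory.
Import numFieldTopology.Exports numFieldNormedType.Exports.

Local Open Scope classical_set_scope.
Local Open Scope ring_scope.
Local Open Scope complex_scope.

Local Notation Re := complex.Re.
Local Notation Im := complex.Im.

Definition measure_rV_display : measure_display -> measure_display.
Proof. exact. Qed.

Section measurable_rV.
Context {d} {T : measurableType d}.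
Variable n : nat.

Let coord : 'I_n -> 'rV[T]_n -> T := fun i x => x ord0 i.

Let rV_set0 : g_sigma_preimage coord set0.
Proof. exact: sigma_algebra0. Qed.

Let rV_setC A : g_sigma_preimage coord A -> g_sigma_preimage coord (~` A).
Proof. exact: sigma_algebraC. Qed.

Let rV_bigcup (F : _^nat) : (forall i, g_sigma_preimage coord (F i)) ->
  g_sigma_preimage coord (\bigcup_i (F i)).
Proof. exact: sigma_algebra_bigcup. Qed.

(* Same construction as the sigma-algebra on n.-tuple T. *)
HB.instance Definition _ := @isMeasurable.Build (measure_rV_display d)
  'rV[T]_n (g_sigma_preimage coord) rV_set0 rV_setC rV_bigcup.

Lemma measurable_coord_rV (i : 'I_n) :
  measurable_fun [set: 'rV[T]_n] (fun x : 'rV[T]_n => x ord0 i).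
Proof.
move=> _ Y mY; rewrite setTI; apply: sub_sigma_algebra => /=.
rewrite -bigcup_seq/=; exists i => /=; first by rewrite mem_index_enum.
by exists Y => //; rewrite setTI.
Qed.

Lemma measurable_fun_rV d1 (T1 : measurableType d1) (f : T1 -> 'rV[T]_n) :
  (forall i, measurable_fun [set: T1] (fun x => f x ord0 i)) ->
  measurable_fun [set: T1] f.
Proof.
move=> mf _ A mA; rewrite setTI.
have : preimage_set_system [set: T1] f (g_sigma_preimage coord) (f @^-1` A).
  by exists A => //; rewrite setTI.
rewrite -g_sigma_preimage_comp; apply: smallest_sub.
  exact: sigma_algebra_measurable.
rewrite -bigcup_seq/=; apply: bigcup_sub => i _ B [C mC <-]; exact: mf.
Qed.

End measurable_rV.

Section lebesgue_rV.
Context {R : realType}.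

Definition cons_rV n (p : measurableTypeR R * 'rV[R]_n) : 'rV[R]_n.+1 :=
  row_mx (p.1)%:M p.2 : 'rV[R]_(1 + n).

Lemma measurable_cons_rV n : measurable_fun [set: _] (@cons_rV n).
Proof.
apply: measurable_fun_rV => i; rewrite /cons_rV.
case: (@split_ordP 1 n i) => j ->.
- apply: (eq_measurable_fun fst); last exact: measurable_fst.
  by move=> x _; rewrite /= [RHS](@row_mxEl _ 1 1 n) mxE (ord1 j) mulr1n.
- apply: (eq_measurable_fun ((fun y : 'rV[R]_n => y ord0 j) \o snd)).
    by move=> x _; rewrite /= [RHS](@row_mxEr _ 1 1 n).
  apply: measurableT_comp; first exact: measurable_coord_rV.
  exact: measurable_snd.
Qed.

HB.instance Definition _ n := @isMeasurableFun.Build _ _ _ _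
  (@cons_rV n) (@measurable_cons_rV n).

Definition uncons_rV n (x : 'rV[R]_n.+1) : measurableTypeR R * 'rV[R]_n :=
  (x ord0 ord0, \row_j x ord0 (lift ord0 j)).

Lemma measurable_uncons_rV n : measurable_fun [set: _] (@uncons_rV n).
Proof.
apply/measurable_fun_pairP; split => /=.
  exact: (@measurable_coord_rV _ R n.+1 ord0).
apply: measurable_fun_rV => j.
apply: (eq_measurable_fun (fun x : 'rV[R]_n.+1 => x ord0 (lift ord0 j))).
  by move=> x _; rewrite /= mxE.
exact: measurable_coord_rV.
Qed.

Lemma cons_rVK n : cancel (@cons_rV n) (@uncons_rV n).
Proof.
move=> [x y]; rewrite /uncons_rV /cons_rV /=; congr pair.
  have -> : ord0 = lshift n (ord0 : 'I_1) by exact/val_inj.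
  by rewrite [LHS](@row_mxEl _ 1 1 n) mxE eqxx mulr1n.
apply/rowP => j; rewrite mxE.
have -> : lift ord0 j = rshift 1 j by exact/val_inj.
by rewrite [LHS](@row_mxEr _ 1 1 n).
Qed.

Section step.
Variables (n : nat) (mu : {sigma_finite_measure set 'rV[R]_n -> \bar R}).

Definition lebesgue_rVS : set 'rV[R]_n.+1 -> \bar R :=
  pushforward (lebesgue_measure \x mu)%E (@cons_rV n).

Let lebesgue_rVS0 : lebesgue_rVS set0 = 0%E.
Proof. exact: measure0. Qed.

Let lebesgue_rVS_ge0 A : (0 <= lebesgue_rVS A)%E.
Proof. exact: measure_ge0. Qed.

Let lebesgue_rVS_sigma_additive : semi_sigma_additive lebesgue_rVS.
Proof. exact: measure_semi_sigma_additive. Qed.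

HB.instance Definition _ := isMeasure.Build _ _ _ lebesgue_rVS
  lebesgue_rVS0 lebesgue_rVS_ge0 lebesgue_rVS_sigma_additive.

Let lebesgue_rVS_sigma_finite : sigma_finite setT lebesgue_rVS.
Proof.
have /sigma_finiteP[F [FT ndF Foo]] := sigma_finiteT (@lebesgue_measure R).
have /sigma_finiteP[G [GT ndG Goo]] := sigma_finiteT mu.
exists (fun k => @uncons_rV n @^-1` (F k `*` G k)) => [|k].
  rewrite -preimage_bigcup; apply/esym/seteqP; split=> // x _ /=.
  have [i _ Fi] : (\bigcup_k F k) (uncons_rV x).1 by rewrite -FT.
  have [j _ Gj] : (\bigcup_k G k) (uncons_rV x).2 by rewrite -GT.
  exists (maxn i j) => //; split => /=.
    by move: Fi; exact/subsetPset/ndF/leq_maxl.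
  by move: Gj; exact/subsetPset/ndG/leq_maxr.
have [mF Fk] := Foo k; have [mG Gk] := Goo k; split.
  rewrite -[X in measurable X]setTI; apply: measurable_uncons_rV => //.
  exact: measurableX.
rewrite /lebesgue_rVS /pushforward -comp_preimage.
rewrite (_ : _ \o _ = id) ?preimage_id.
  by rewrite product_measure1E// lte_mul_pinfty// ge0_fin_numE.
by apply/funext => p /=; exact: cons_rVK.
Qed.

HB.instance Definition _ := Measure_isSigmaFinite.Build _ _ _ lebesgue_rVS
  lebesgue_rVS_sigma_finite.

End step.

Fixpoint lebesgue_rV n : {sigma_finite_measure set 'rV[R]_n -> \bar R} :=
  match n with
  | 0 => \d_(0 : 'rV[R]_0)
  | m.+1 => lebesgue_rVS (lebesgue_rV m)
  end.

Lemma measurable_box_rV n (A : 'I_n -> set R) : (forall i, measurable (A i)) ->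
  measurable [set x : 'rV[R]_n | forall i, A i (x ord0 i)].
Proof.
move=> mA; have -> : [set x : 'rV[R]_n | forall i, A i (x ord0 i)] =
    \bigcap_(i in [set: 'I_n]) ((fun x : 'rV[R]_n => x ord0 i) @^-1` A i).
  by apply/seteqP; split => [x + i _|x + i]; exact.
apply: fin_bigcap_measurable => // i _.
by rewrite -[X in measurable X]setTI; exact: measurable_coord_rV.
Qed.

Lemma lebesgue_rV_box n (A : 'I_n -> set R) : (forall i, measurable (A i)) ->
  lebesgue_rV n [set x | forall i, A i (x ord0 i)] =
  (\prod_(i < n) lebesgue_measure (A i))%E.
Proof.
elim: n A => [|n IH] A mA /=.
  by rewrite big_ord0 /lebesgue_rV diracE mem_set// => -[].
rewrite big_ord_recl -IH//.
rewrite -(product_measure1E lebesgue_measure (lebesgue_rV n)); first last.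
- exact: (@measurable_box_rV n (fun i => A (lift ord0 i))).
- exact: mA.
rewrite /lebesgue_rVS /pushforward; congr ((_ \x _)%E _); apply/seteqP; split => -[x y] /=.
  move=> Axy; split => [|i].
    have := Axy ord0; have -> : ord0 = lshift n (ord0 : 'I_1) by exact/val_inj.
    by rewrite /cons_rV (@row_mxEl _ 1 1 n) mxE mulr1n.
  have := Axy (lift ord0 i).
  have -> : lift ord0 i = rshift 1 i by exact/val_inj.
  by rewrite /cons_rV (@row_mxEr _ 1 1 n).
move=> [Ax Ay] i; case: (unliftP ord0 i) => [j|] ->.
  have <- : rshift 1 j = lift ord0 j by exact/val_inj.
  rewrite /cons_rV (@row_mxEr _ 1 1 n).
  have -> : rshift 1 j = lift ord0 j by exact/val_inj.
  exact: Ay.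
have <- : lshift n (ord0 : 'I_1) = ord0 by exact/val_inj.
rewrite /cons_rV (@row_mxEl _ 1 1 n) mxE mulr1n.
by have -> : lshift n (ord0 : 'I_1) = ord0 by exact/val_inj.
Qed.

End lebesgue_rV.

Section complex_valued.
Context {R : realType}.

Definition cexp (z : R[i]) : R[i] :=
  (expR (Re z))%:C * (cos (Im z) +i* sin (Im z)).

Context d {T : measurableType d}.
Implicit Types (mu : {measure set T -> \bar R}) (D : set T) (f : T -> R[i]).

Definition cintegrable mu D f :=
  mu.-integrable D (EFin \o (fun x => Re (f x))) /\
  mu.-integrable D (EFin \o (fun x => Im (f x))).

Definition cintegral mu D f : R[i] :=
  (\int[mu]_(x in D) Re (f x)) +i* (\int[mu]_(x in D) Im (f x)).

End complex_valued.

Section euclidean.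
Context {R : realType} {d : nat}.
Implicit Types (f : 'rV[R]_d -> R) (phi : 'rV[R]_d -> R[i]).

Definition dotp (x y : 'rV[R]_d) : R := \sum_i x ord0 i * y ord0 i.

(* The library's norm on 'rV_d is the sup norm. *)
Definition enorm (x : 'rV[R]_d) : R := Num.sqrt (dotp x x).

Definition e1 : 'rV[R]_d := \row_(j < d) ((j : nat) == 0)%:R.

Definition partial (i : 'I_d) f : 'rV[R]_d -> R :=
  fun x => 'D_(delta_mx ord0 i) f x.

Definition Dmulti (alpha : 'I_d -> nat) f :=
  foldr (fun i g => iter (alpha i) (partial i) g) f (enum 'I_d).

Definition smooth f :=
  forall (s : seq 'I_d) x, differentiable (foldr partial f s) x.

Definition csmooth phi := smooth (fun x => Re (phi x)) /\ smooth (fun x => Im (phi x)).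

Definition cDmulti alpha phi : 'rV[R]_d -> R[i] := fun x =>
  Dmulti alpha (fun x => Re (phi x)) x +i* Dmulti alpha (fun x => Im (phi x)) x.

Definition fourier phi : 'rV[R]_d -> R[i] := fun x =>
  cintegral (lebesgue_rV d) setT (fun z => cexp (- ('i * (dotp z x)%:C)) * phi z).

End euclidean.

Section weight.
Context {R : realType} {d : nat}.

Definition admissible_weight (omega : 'rV[R]_d -> R) :=
  exists sigma : R -> R,
  (forall x, omega x = sigma (enorm x)) /\
  [/\ {in `[0, +oo[ &, {homo sigma : s t / s <= t}},
      {within `[0, +oo[, continuous sigma},
      convex_function (`[0, +oo[ : set (convex_lmodType R^o)) (fun t => - sigma t),
      sigma 0 = 0 &
      (\int[lebesgue_measure]_(t in `[0%R, +oo[) (sigma t / (1 + t ^+ 2))%:E < +oo)%E /\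
      exists c0 m : R, 0 < m /\ forall t, 0 <= t -> c0 + m * ln (1 + t) <= sigma t].

Definition weight_inv (omega : 'rV[R]_d -> R) (alpha : R) : R :=
  sup [set x | 0 <= x /\ omega (x *: e1) < alpha].

End weight.

Section test_functions.
Context {R : realType} {d : nat}.
Variable omega : 'rV[R]_d -> R.
Implicit Types (alpha : 'I_d -> nat) (eta : R) (phi : 'rV[R]_d -> R[i]).

Definition weighted_sup eta phi : \bar R :=
  ereal_sup [set (expR (eta * omega x) * Normc.normc (phi x))%:E | x in setT].

Definition p_seminorm alpha eta phi := weighted_sup eta (cDmulti alpha phi).

Definition pi_seminorm alpha eta phi :=
  weighted_sup eta (cDmulti alpha (fourier phi)).

(* The conditions on phi make it integrable with all its moments, so that
   fourier phi is smooth and its cDmulti derivatives are genuine. *)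
Definition S_omega_set : set ('rV[R]_d -> R[i]) :=
  [set phi | csmooth phi /\ forall alpha eta, 0 < eta ->
    (p_seminorm alpha eta phi < +oo)%E /\ (pi_seminorm alpha eta phi < +oo)%E].

Lemma smooth0 : smooth (fun _ : 'rV[R]_d => 0 : R).
Proof.
move=> s x; rewrite (_ : foldr _ _ _ = cst 0); first exact: differentiable_cst.
elim: s => [//|i s /= ->]; apply/funext => y; rewrite /partial.
exact: derive_cst.
Qed.

Lemma cDmulti0 alpha : cDmulti alpha (fun _ : 'rV[R]_d => 0 : R[i]) = fun=> 0.
Proof.
suff D0 : Dmulti alpha (fun _ : 'rV[R]_d => 0 : R) = cst 0.
  by apply/funext => x; rewrite /cDmulti /= D0.
rewrite /Dmulti; elim: (enum _) => [//|i s /= ->].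
elim: (alpha i) => [//|k /= ->]; apply/funext => y; rewrite /partial.
exact: derive_cst.
Qed.

Lemma fourier0 : fourier (fun _ : 'rV[R]_d => 0 : R[i]) = fun=> 0.
Proof.
apply/funext => x; rewrite /fourier /cintegral.
by under eq_Rintegral do rewrite mulr0; under [X in _ +i* X]eq_Rintegral do rewrite mulr0;
  rewrite /= !Rintegral_cst ?mul0r.
Qed.

Lemma weighted_sup0 eta : (weighted_sup eta (fun=> 0%R) <= 0)%E.
Proof.
apply: ge_ereal_sup => _ [x _ <-].
by rewrite /= expr0n /= addr0 sqrtr0 mulr0.
Qed.

Lemma S_omega_set0 : S_omega_set (fun=> 0).
Proof.
split => [|alpha eta _]; first by split; exact: smooth0.
by rewrite /p_seminorm /pi_seminorm fourier0 !cDmulti0; split;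
  apply: le_lt_trans (weighted_sup0 _) _.
Qed.

Definition S_omega : Type := set_type S_omega_set.

HB.instance Definition _ := Choice.on S_omega.
HB.instance Definition _ := isPointed.Build S_omega (SigSub (mem_set S_omega_set0)).

Definition test_fun (phi : S_omega) : 'rV[R]_d -> R[i] := val phi.

(* The index (b, alpha, eta, phi, eps) stands for the open ball of radius eps
   around phi for p_seminorm alpha eta (b = true), pi_seminorm alpha eta
   (b = false). *)
Definition S_omega_ball
    (k : bool * ('I_d -> nat) * R * S_omega * R) : set S_omega :=
  let: (b, alpha, eta, phi, eps) := k in
  let q := if b then p_seminorm else pi_seminorm in
  [set psi | (q alpha eta (fun x => test_fun psi x - test_fun phi x)%R < eps%:E)%E].

HB.instance Definition _ := isSubBaseTopological.Build S_omega
  [set k : bool * ('I_d -> nat) * R * S_omega * R | 0 < k.1.1.2 /\ 0 < k.2]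
  S_omega_ball.

End test_functions.

Section dual.
Context {R : realType} {d : nat}.
Variable omega : 'rV[R]_d -> R.

(* S_omega omega carries no module structure here, so linearity is stated through
   the values of the test functions. *)
Record S_omega_dual := SOmegaDual {
  pairing :> S_omega omega -> R[i]^o;
  pairing_linear : forall (k : R[i]) (f g h : S_omega omega),
    (forall x, test_fun h x = k * test_fun f x + test_fun g x) ->
    pairing h = k * pairing f + pairing g;
  pairing_continuous : continuous pairing
}.

Definition S_omega_dual0 : S_omega_dual.
Proof.
exists (fun=> 0) => [k f g h _|]; last exact: cst_continuous.
by rewrite mulr0 addr0.
Defined.

HB.instance Definition _ := gen_eqMixin S_omega_dual.
HB.instance Definition _ := gen_choiceMixin S_omega_dual.
HB.instance Definition _ := isPointed.Build S_omega_dual S_omega_dual0.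

Definition cylindrical : set (set S_omega_dual) :=
  [set C | exists n (phi : 'I_n -> S_omega omega) (B : set R[i]^o),
    <<s open >> B /\ C = [set u | forall j, B (pairing u (phi j))]].

HB.instance Definition _ :=
  Measurable.copy S_omega_dual (g_sigma_algebraType cylindrical).

End dual.

Section levy_white_noise.
Context {R : realType}.

Definition levy_measure (nu : {measure set R -> \bar R}) :=
  nu [set 0] = 0%E /\ (\int[nu]_x (Num.min 1 (x ^+ 2))%:E < +oo)%E.

Definition characteristic_triplet (a gamma : R) (nu : {measure set R -> \bar R}) :=
  0 <= a /\ levy_measure nu.

Definition levy_exponent (a gamma : R) (nu : {measure set R -> \bar R}) (z : R)
    : R[i] :=
  'i * (gamma * z)%:C - (2^-1 * a * z ^+ 2)%:C +
  cintegral nu setT (fun x =>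
    cexp ('i * (x * z)%:C) - 1 - 'i * (x * z * (`|x| <= 1)%R%:R)%:C).

Context {d : nat} (omega : 'rV[R]_d -> R).
Context {dO : measure_display} {Omega : measurableType dO}.
Variable P : probability Omega R.

Definition characteristic_functional (s : {RV P >-> S_omega_dual omega})
    (phi : S_omega omega) : R[i] :=
  cintegral (distribution P s) setT (fun u => cexp ('i * pairing u phi)).

Definition real_valued (phi : S_omega omega) := forall x, Im (test_fun phi x) = 0.

(* pairing (L w) is C-linear, so that its value at a complex-valued test function
   is determined by its values at real-valued ones; the latter are real. The
   integrability clause says that the integral in the characteristic functional
   is well defined (cintegral is total). *)
Definition levy_white_noise (a gamma : R) (nu : {measure set R -> \bar R})
    (L : {RV P >-> S_omega_dual omega}) :=
  forall phi : S_omega omega, real_valued phi ->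
  let psi_phi x := levy_exponent a gamma nu (Re (test_fun phi x)) in
  [/\ forall w, Im (pairing (L w) phi) = 0,
      cintegrable (lebesgue_rV d) setT psi_phi &
      characteristic_functional L phi = cexp (cintegral (lebesgue_rV d) setT psi_phi)].

End levy_white_noise.

(* Main.v *)
Require Import Defs.
From HB Require Import structures.
From mathcomp Require Import all_boot all_order all_algebra.
From mathcomp Require Import all_classical all_reals all_analysis.
From mathcomp Require Import measurable_realfun.
From mathcomp Require Import ring lra zify.

(** The noise is built by hand as a random linear functional, so that no
    Bochner-Minlos theorem is involved. The sample space is the space of
    sequences of fair coin tosses: reading the even and the odd tosses gives two
    independent copies of the space ([coinP_interleave]), hence countably many
    ([block]), and quantiles turn tosses into a variable of any prescribed law
    ([coin_realizes]).

    A noise ([is_noise]) is a family of random variables X f, linear in f for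
    every outcome, together with one random M, almost surely finite, such that
    X f is at most M * C for every f of size C. This uniform bound is what makes
    each outcome a continuous functional. The quantity that is controlled is the
    mean of min(1, M): when these means are summable, a series of independent
    noises is again a noise, whose exponent is the sum of the exponents
    ([noise_series]).

    On a unit cube, a function with bounded mixed first derivatives has a tensor
    Haar expansion with absolutely summable coefficients: there are c_i with
    finite sum that bound the i-th coefficient of every function of size 1
    ([haar_frame_exists]). Therefore a family of variables Z_i with bounded means
    of |Z_i| yields a linear functional, the series of coef_i f * Z_i, with
    M the series of c_i * |Z_i|. With independent Gaussian Z_i this is the Gaussian
    part ([gaussian_noise]); with Z_i the compensated jump sum of h_i it is the part
    of the small jumps, cut into shells whose variances decrease geometrically
    ([small_jumps_noise]). The large jumps are a finite compound Poisson sum over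
    random points (x, r); there M is the sum of |r| v(x), where v dominates the test
    functions, and the mean of min(1, M) is at most the integral of min(1, |r| v(x))
    ([large_jump_noise]).

    Summing over the unit cubes of the lattice ([whole_space_noise]) requires that
    v and the integral of min(1, |r| v(x)) over |r| > 1 be integrable in x. For
    v = exp(- eta * omega) the first follows from the logarithmic lower bound on the
    weight, and the second is the hypothesis of the theorem in disguise: by the layer
    cake formula the integral over x is an integral over alpha < 1/|r| of the volume
    of the set where omega < c log(1/alpha), and this set lies in a cube of side
    twice the generalized inverse of the weight ([layer_cake_bound]). Finally, the
    real and imaginary parts of a test function have size at most a finite sum of its
    seminorms ([wbound_seminorms]), so that each outcome of the noise is an element of
    the dual, and the exponent is the Levy exponent ([levy_exponentE]). *)

Set Implicit Arguments.
Unset Strict Implicit.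
Unset Printing Implicit Defensive.
Import Order.TTheory GRing.Theory Num.Theory.
Import numFieldTopology.Exports numFieldNormedType.Exports.
Local Open Scope classical_set_scope.
Local Open Scope ring_scope.
Local Open Scope complex_scope.

Local Notation Re := complex.Re.
Local Notation Im := complex.Im.

(** * Fair coin tosses *)

Lemma measurable_fun_to_nat d (T : measurableType d) (f : T -> nat) :
  (forall k, measurable (f @^-1` [set k])) -> measurable_fun [set: T] f.
Proof.
move=> mf _ A _; rewrite setTI.
rewrite (_ : f @^-1` A = \bigcup_(k in A) f @^-1` [set k]); last first.
  by apply/seteqP; split => [x Ax|x [k Ak /= fk]]; [exists (f x)|rewrite fk].
by apply: bigcup_measurable => k _; exact: mf.
Qed.

Definition coin : Type := nat -> bool.
HB.instance Definition _ := Pointed.copy coin (nat -> bool).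

Definition cyl (p : seq bool) : set coin := [set w | mkseq w (size p) = p].

(** The cylinders form a pi-system (the empty set is added for this reason), so
    that a finite measure is determined by its values on them. *)
Definition cyls : set (set coin) := [set A | A = set0 \/ exists p, A = cyl p].

HB.instance Definition _ := Measurable.copy coin (g_sigma_algebraType cyls).

Lemma measurable_cyl p : measurable (cyl p).
Proof. by apply: sub_sigma_algebra; right; exists p. Qed.

Lemma mkseq_take (T : Type) (w : nat -> T) m n :
  (m <= n)%N -> take m (mkseq w n) = mkseq w m.
Proof. by move=> mn; rewrite /mkseq -map_take take_iota (minn_idPl mn). Qed.

Lemma cylI p q : (size p <= size q)%N ->
  cyl p `&` cyl q = if take (size p) q == p then cyl q else set0.
Proof.
move=> pq; case: eqP => [e|ne]; apply/seteqP; split => w //=.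
- by case.
- move=> qw; split=> //; rewrite /cyl/= -[in RHS]e -qw mkseq_take//.
- by case=> pw qw; apply: ne; rewrite -qw mkseq_take.
Qed.

Lemma cyls_setI : setI_closed cyls.
Proof.
move=> A B [->|[p ->]]; first by left; rewrite set0I.
case=> [->|[q ->]]; first by left; rewrite setI0.
have [pq|/ltnW qp] := leqP (size p) (size q).
  by rewrite cylI//; case: ifP => _; [right; exists q|left].
by rewrite setIC cylI//; case: ifP => _; [right; exists p|left].
Qed.

Lemma cyl_nil : cyl [::] = setT.
Proof. by apply/seteqP; split. Qed.

Lemma coin_measure_unique (R : realType) (m1 m2 : {measure set coin -> \bar R}) :
  (m1 setT < +oo)%E -> (forall p, m1 (cyl p) = m2 (cyl p)) ->
  forall A, measurable A -> m1 A = m2 A.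
Proof.
move=> m1oo m12 A mA; apply: (measure_unique cyls (fun=> setT)) => //.
- exact: cyls_setI.
- by move=> _; right; exists [::]; rewrite cyl_nil.
- by rewrite bigcup_const//; exists 0%N.
- by move=> _ [->|[p ->]]; rewrite ?measure0.
Qed.

Lemma measurable_fun_coin d (T : measurableType d) (f : T -> coin) :
  (forall i, measurable_fun setT (fun x => f x i)) -> measurable_fun setT f.
Proof.
move=> mf; apply: (measurability cyls) => // _ [_ [->|[p ->]] <-].
  by rewrite preimage_set0 setI0.
rewrite setTI (_ : f @^-1` cyl p =
  \bigcap_(i in `I_(size p)) (fun x => f x i) @^-1` [set nth false p i]).
  apply: fin_bigcap_measurable => // i _.
  by rewrite -[X in measurable X]setTI; exact: mf.
apply/seteqP; split => x /=.
  by move=> e i /= ip; rewrite -e nth_mkseq.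
move=> e; apply: (@eq_from_nth _ false); rewrite size_mkseq// => i ip.
by rewrite nth_mkseq// e.
Qed.

Lemma measurable_coin_coord i : measurable_fun setT (fun w : coin => w i).
Proof.
have sl (w : coin) (p : seq bool) : cyl p w -> (i < size p)%N -> w i = nth false p i.
  by move=> e ip; rewrite -e nth_mkseq.
move=> _ B _; rewrite setTI.
rewrite (_ : _ @^-1` B = \bigcup_p
   (if (size p == i.+1) && `[< B (nth false p i) >] then cyl p else set0)).
  apply: countable_bigcupT_measurable => [|p]; first exact: countableP.
  by case: ifP => // _; exact: measurable_cyl.
apply/seteqP; split => w /=.
  move=> Bw; exists (mkseq w i.+1) => //.
  rewrite size_mkseq eqxx nth_mkseq// ifT; last exact/asboolP.
  by rewrite /cyl /mkset size_mkseq.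
by move=> [p _]; case: ifP => // /andP[/eqP sp /asboolP Bp] pw; rewrite (sl _ _ pw) ?sp.
Qed.

Section digits.
Context {R : realType}.

Definition digits (x : R) : coin := fun i => odd (Num.truncn (2 ^+ i.+1 * x)).

(** The integer whose binary digits, most significant first, are the letters of
    p. *)
Definition bitval (p : seq bool) : nat := foldl (fun k (b : bool) => (k.*2 + b)%N) 0%N p.

Lemma bitval_rcons p b : bitval (rcons p b) = ((bitval p).*2 + b)%N.
Proof. by rewrite /bitval -cats1 foldl_cat. Qed.

Lemma bitval_lt p : (bitval p < 2 ^ size p)%N.
Proof.
elim/last_ind: p => // p b ih; rewrite bitval_rcons size_rcons expnS mul2n.
by case: b; lia.
Qed.

Lemma truncn_half (y : R) : 0 <= y -> (Num.truncn (2 * y))./2 = Num.truncn y.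
Proof.
move=> y0; apply/esym/eqP; rewrite truncn_eq//.
have /andP[h1 h2] : (Num.truncn (2 * y))%:R <= 2 * y < (Num.truncn (2 * y)).+1%:R.
  by apply: truncn_itv; rewrite mulr_ge0.
set k := Num.truncn _ in h1 h2 *.
have e : k%:R = (odd k)%:R + 2 * (k./2)%:R :> R.
  by rewrite -natrM -natrD mul2n odd_double_half.
move: h1 h2; rewrite -!natr1 e.
by case: (odd k) => /= h1 h2; apply/andP; split; lra.
Qed.

(** The first n binary digits of x determine, and are determined by, the integer
    part of 2^n x; hence cylinders pull back to dyadic intervals. *)
Lemma digitsP (x : R) p : 0 <= x < 1 ->
  cyl p (digits x) <-> Num.truncn (2 ^+ size p * x) = bitval p.
Proof.
move=> /andP[x0 x1]; elim/last_ind: p => [|p b ih].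
  rewrite /cyl/=; split => // _; rewrite expr0 mul1r; apply/eqP.
  by rewrite truncn_eq//= x0 x1.
rewrite /cyl /= !size_rcons mkseqS bitval_rcons.
have th : (Num.truncn (2 ^+ (size p).+1 * x))./2 = Num.truncn (2 ^+ size p * x).
  by rewrite exprS -mulrA truncn_half// mulr_ge0// exprn_ge0.
split.
  move=> /rcons_inj[/ih <- <-]; rewrite -th addnC; exact/esym/odd_double_half.
move=> e; rewrite {2}/digits e oddD odd_double/= oddb; congr rcons.
apply/ih; rewrite -th e; case: (b); lia.
Qed.

Lemma digits_itv (p : seq bool) : `[0, 1[ `&` (digits @^-1` cyl p) =
  `[(bitval p)%:R / 2 ^+ size p, (bitval p).+1%:R / 2 ^+ size p[%classic :> set R.
Proof.
have p0 : 0 < 2 ^+ size p :> R by rewrite exprn_gt0.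
apply/seteqP; split => x /=; rewrite !in_itv/=.
  move=> [x01 /digitsP -/(_ x01) e]; move: x01 => /andP[x0 x1].
  have /andP[h1 h2] : (bitval p)%:R <= 2 ^+ size p * x < (bitval p).+1%:R.
    by rewrite -e truncn_itv// mulr_ge0// ltW.
  by rewrite ler_pdivrMr// ltr_pdivlMr// mulrC h1 h2.
rewrite ler_pdivrMr// ltr_pdivlMr// => /andP[h1 h2].
have x01 : 0 <= x < 1.
  apply/andP; split.
    by rewrite -(pmulr_lge0 _ p0) (le_trans _ h1).
  rewrite -(ltr_pM2r p0) mul1r (lt_le_trans h2)// -natrX ler_nat.
  exact: bitval_lt.
split=> //; apply/digitsP => //; apply/eqP.
by case/andP: x01 => x0 _; rewrite truncn_eq ?mulr_ge0 ?(ltW p0)// mulrC h1 h2.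
Qed.

Lemma measurable_truncn (c : R) : measurable_fun setT (fun x : R => Num.truncn (c * x)).
Proof.
apply: measurable_fun_to_nat => k.
have mc : measurable_fun [set: R] (fun x : R => c * x) by exact: measurable_funM.
rewrite (_ : _ @^-1` _ = (fun x => c * x) @^-1`
   (if k == 0%N then `]-oo, 1[ else `[k%:R, k.+1%:R[)%classic).
  rewrite -[X in measurable X]setTI; apply: mc => //; by case: ifP.
apply/seteqP; split => x /=.
  move=> <-; have [x0|x0] := leP 0 (c * x).
    have := truncn_itv x0; case: ifP => // /eqP -> /=; rewrite in_itv/=.
    by case/andP.
  have -> : Num.truncn (c * x) = 0%N.
    by apply/truncn0Pn; rewrite -ltNge (lt_trans x0).
  by rewrite /= in_itv/= (lt_trans x0).
case: ifPn => [/eqP ->|k0]; rewrite /= in_itv/=.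
  by move=> h; apply/truncn0Pn; rewrite -ltNge.
move=> h; apply/eqP; rewrite truncn_eq// (le_trans _ (proj1 (andP h)))//.
Qed.

Lemma measurable_digits : measurable_fun setT digits.
Proof.
apply: measurable_fun_coin => i.
by apply: (@measurableT_comp _ _ _ _ _ _ odd) => //; exact: measurable_truncn.
Qed.
End digits.
Section coin_probability.
Context {R : realType}.

Definition unif01 : set (measurableTypeR R) -> \bar R :=
  mrestr (@lebesgue_measure R) (measurable_itv `[0, 1[).

HB.instance Definition _ := Measure.on unif01.

Lemma unif01_setT : unif01 setT = 1%E.
Proof.
by rewrite /unif01 /mrestr setTI lebesgue_measure_itv/= lte_fin ltr01 sube0.
Qed.

HB.instance Definition _ :=
  @Measure_isProbability.Build _ _ R unif01 unif01_setT.

Definition digits_mfun : {mfun measurableTypeR R >-> coin} :=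
  HB.pack (@digits R) (@isMeasurableFun.Build _ _ (measurableTypeR R) coin
    (@digits R) (@measurable_digits R)).

(** The law of the binary digits of a uniform point of [0, 1[, which avoids any
    extension theorem for infinite products. *)
Definition coinP : probability coin R :=
  distribution (unif01 : probability _ R) digits_mfun.

Local Arguments coinP : simpl never.

Lemma coinP_digits (A : set coin) :
  coinP A = lebesgue_measure (@digits R @^-1` A `&` `[0%R, 1%R[).
Proof. by []. Qed.

Lemma coinP_setT : coinP setT = 1%E.
Proof. exact: probability_setT. Qed.

Lemma coinP_cyl p : coinP (cyl p) = (2 ^- size p)%:E.
Proof.
rewrite coinP_digits setIC digits_itv lebesgue_measure_itv/= lte_fin.
rewrite ltr_pM2r ?invr_gt0 ?exprn_gt0// ltr_nat ltnSn -EFinB -mulrBl.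
by rewrite -natr1 addrAC subrr add0r mul1r.
Qed.

Definition evens (w : coin) : coin := fun i => w i.*2.
Definition odds (w : coin) : coin := fun i => w i.*2.+1.
Definition interleave (z : coin * coin) : coin :=
  fun i => if odd i then z.2 i./2 else z.1 i./2.

Lemma measurable_evens : measurable_fun setT evens.
Proof. by apply: measurable_fun_coin => i; exact: measurable_coin_coord. Qed.

Lemma measurable_odds : measurable_fun setT odds.
Proof. by apply: measurable_fun_coin => i; exact: measurable_coin_coord. Qed.

Lemma measurable_interleave : measurable_fun setT interleave.
Proof.
apply: measurable_fun_coin => i; rewrite /interleave; case: (odd i).
  exact: (measurableT_comp (measurable_coin_coord _) measurable_snd).
exact: (measurableT_comp (measurable_coin_coord _) measurable_fst).
Qed.

Lemma evens_interleave z : evens (interleave z) = z.1.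
Proof. by apply/funext => i; rewrite /evens /interleave odd_double doubleK. Qed.

Lemma odds_interleave z : odds (interleave z) = z.2.
Proof.
by apply/funext => i; rewrite /odds /interleave /= odd_double /= uphalf_double.
Qed.

Lemma cylP p w : cyl p w <-> forall i, (i < size p)%N -> w i = nth false p i.
Proof.
split=> [e i ip|e]; first by rewrite -e nth_mkseq.
apply: (@eq_from_nth _ false); rewrite size_mkseq// => i ip.
by rewrite nth_mkseq// e.
Qed.

Lemma interleave_cyl p : interleave @^-1` cyl p =
  cyl (mkseq (fun i => nth false p i.*2) (uphalf (size p))) `*`
  cyl (mkseq (fun i => nth false p i.*2.+1) (size p)./2).
Proof.
apply/seteqP; split => -[w1 w2] /=.
  move/cylP => h; split; apply/cylP; rewrite size_mkseq => i ip.
    rewrite nth_mkseq// -h; last by move: ip; lia.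
    by rewrite -[LHS](congr1 (fun f => f i) (evens_interleave (w1, w2))).
  rewrite nth_mkseq// -h; last by move: ip; lia.
  by rewrite -[LHS](congr1 (fun f => f i) (odds_interleave (w1, w2))).
move=> [/cylP h1 /cylP h2]; apply/cylP => i ip; rewrite /interleave/=.
have e := odd_double_half i; case: ifP e => io e.
  rewrite h2 ?size_mkseq; last by lia.
  by rewrite nth_mkseq; [rewrite -[in RHS]e|lia].
rewrite h1 ?size_mkseq; last by lia.
by rewrite nth_mkseq; [rewrite -[in RHS]e|lia].
Qed.

HB.instance Definition _ := @isMeasurableFun.Build _ _ _ _ interleave measurable_interleave.

(** Both measures give a cylinder the mass 2^-n, where n is its length: the even
    and the odd tosses are independent copies of the whole sequence. *)
Lemma coinP_interleave (A : set coin) : measurable A ->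
  (coinP \x coinP)%E (interleave @^-1` A) = coinP A.
Proof.
move=> mA.
rewrite -[LHS]/(pushforward (coinP \x coinP)%E interleave A).
apply: coin_measure_unique => //.
  change ((coinP \x coinP)%E (interleave @^-1` setT) < +oo)%E.
  rewrite preimage_setT -setXTT product_measure1E//.
  by change ((coinP setT : \bar R) * coinP setT < +oo)%E; rewrite coinP_setT mule1 ltry.
move=> p; change ((coinP \x coinP)%E (interleave @^-1` cyl p) = coinP (cyl p)).
rewrite interleave_cyl product_measure1E; [|exact: measurable_cyl..].
transitivity (coinP (cyl (mkseq (fun i => nth false p i.*2) (uphalf (size p)))) *
  coinP (cyl (mkseq (fun i => nth false p i.*2.+1) (size p)./2)))%E; first by [].
rewrite !coinP_cyl !size_mkseq -EFinM -invfM -exprD; congr (_ ^- _)%:E.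
by rewrite uphalf_half -addnA addnn odd_double_half.
Qed.

(** Independence of the even and odd tosses in the form in which it is used
    throughout. *)
Lemma ge0_integral_split (F : coin * coin -> \bar R) : measurable_fun setT F ->
  (forall z, (0 <= F z)%E) ->
  (\int[coinP]_w F (evens w, odds w) = \int[coinP]_w1 \int[coinP]_w2 F (w1, w2))%E.
Proof.
move=> mF F0; rewrite -(fubini_tonelli1 (m2 := coinP))//.
rewrite (eq_measure_integral (pushforward (coinP \x coinP)%E interleave)); last first.
  by move=> A mA _; exact: (esym (coinP_interleave mA)).
rewrite ge0_integral_pushforward//=.
  by apply: eq_integral => -[w1 w2] _ /=; rewrite evens_interleave odds_interleave.
apply: (measurableT_comp mF); apply/measurable_fun_pairP; split => /=.
  exact: measurable_evens.
exact: measurable_odds.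
Qed.

End coin_probability.
Arguments coinP {R} : simpl never.

(** * Realizing a law on the line *)

Section quantile.
Context {R : realType}.

Definition dyadic_sum (w : coin) (n : nat) : R := (bitval (mkseq w n))%:R / 2 ^+ n.

(** The inverse of the binary expansion; on digit sequences of points of [0, 1[
    it recovers the point, hence its law is uniform. *)
Definition unif_of_coin (w : coin) : R := limn (dyadic_sum w).

Lemma dyadic_sum_digits (x : R) n : 0 <= x < 1 ->
  dyadic_sum (digits x) n = (Num.truncn (2 ^+ n * x))%:R / 2 ^+ n.
Proof.
move=> x01; rewrite /dyadic_sum; congr (_%:R / _).
have /digitsP : cyl (mkseq (digits x) n) (digits x) by rewrite /cyl /mkset size_mkseq.
by move=> /(_ x01); rewrite size_mkseq.
Qed.

Lemma dyadic_sum_nd w : nondecreasing_seq (dyadic_sum w).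
Proof.
apply/nondecreasing_seqP => n; rewrite /dyadic_sum mkseqS bitval_rcons.
rewrite ler_pdivlMr ?exprn_gt0// exprS mulrCA mulfVK ?expf_neq0//.
by rewrite -natrM ler_nat; case: (w n); lia.
Qed.

Lemma dyadic_sum_cvg w : cvgn (dyadic_sum w).
Proof.
apply: nondecreasing_is_cvgn; first exact: dyadic_sum_nd.
exists 1 => _ [n _ <-]; rewrite /dyadic_sum ler_pdivrMr ?exprn_gt0// mul1r.
by rewrite -natrX ler_nat ltnW// -[X in (2 ^ X)%N](size_mkseq w n) bitval_lt.
Qed.

Lemma measurable_unif_of_coin : measurable_fun setT unif_of_coin.
Proof.
apply: (@measurable_fun_cvg _ _ _ _ (fun n w => dyadic_sum w n)); last first.
  by move=> w _; exact: dyadic_sum_cvg.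
move=> n; rewrite /dyadic_sum; apply: measurable_funM => //.
apply: (@measurableT_comp _ _ _ _ _ _ (fun k : nat => k%:R : R)) => //.
elim: n => [//|n ih]; under eq_fun do rewrite mkseqS bitval_rcons.
apply: measurable_fun_addn.
  by apply: (@measurableT_comp _ _ _ _ _ _ double) => //.
by apply: (@measurableT_comp _ _ _ _ _ _ nat_of_bool) => //; exact: measurable_coin_coord.
Qed.

Lemma unif_of_coin_digits (x : R) : 0 <= x < 1 -> unif_of_coin (digits x) = x.
Proof.
move=> x01; apply/cvg_lim => //; have /andP[x0 x1] := x01.
rewrite (_ : dyadic_sum _ = fun n => (Num.truncn (2 ^+ n * x))%:R / 2 ^+ n); last first.
  by apply/funext => n; exact: dyadic_sum_digits.
apply: (@squeeze_cvgr _ _ _ _ (fun n => x - 2^-1 ^+ n) (fun=> x)).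
- near=> n; have p0 : 0 < 2 ^+ n :> R by rewrite exprn_gt0.
  have /andP[h1 h2] := truncn_itv (mulr_ge0 (ltW p0) x0).
  rewrite ler_pdivlMr// ler_pdivrMr// exprVn mulrBl mulVf ?gt_eqF//.
  by rewrite (mulrC x) h1 andbT; move: h2; rewrite -natr1; lra.
- rewrite -[X in _ --> X]subr0; apply: cvgB; first exact: cvg_cst.
  by apply: cvg_expr; rewrite ger0_norm ?invr_ge0// invf_lt1// ltr1n.
- exact: cvg_cst.
Unshelve. all: end_near. Qed.

Section law.
Variable mu : probability (measurableTypeR R) R.

Let idTR : measurableTypeR R -> R := idfun.

#[local] HB.instance Definition _ :=
  @isMeasurableFun.Build _ _ _ _ idTR (@measurable_id _ _ setT).

Let F (t : R) : R := fine (cdf (idTR : {RV mu >-> R}) t).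

Let FE t : (F t)%:E = mu `]-oo, t]%classic.
Proof. by rewrite /F fineK// fin_num_measure. Qed.

Let F_nd s t : s <= t -> F s <= F t.
Proof.
by move=> st; rewrite fine_le ?fin_num_measure//; exact: cdf_nondecreasing.
Qed.

Let S (u : R) := [set t : R | u <= F t].
(* Only the values on ]0, 1[ matter, where the infimum is attained. *)
Let Q (u : R) : R := if (0 < u < 1) then inf (S u) else 0.

Let S_neq0 u : 0 < u < 1 -> S u !=set0.
Proof.
move=> /andP[u0 u1]; have F1 : F @ +oo --> (1 : R) by exact/fine_cvg/cvg_cdfy1.
have [M [_ /(_ (M + 1))]] := @cvgr_ge _ _ _ _ _ _ F1 _ u1.
by move=> h; exists (M + 1); apply: h; rewrite ltrDl.
Qed.

Let S_lb u : 0 < u < 1 -> has_lbound (S u).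
Proof.
move=> /andP[u0 u1]; have F0 : F @ -oo --> (0 : R) by exact/fine_cvg/cvg_cdfNy0.
have [M [_ /(_ (M - 1))]] := @cvgr_lt _ _ _ _ _ _ F0 _ u0.
rewrite gtrDl ltrN10 => /(_ isT) h; exists (M - 1) => t St; rewrite leNgt; apply/negP => tM.
by have := le_lt_trans St (le_lt_trans (F_nd (ltW tM)) h); rewrite ltxx.
Qed.

Let QP u t : 0 < u < 1 -> (Q u <= t) <-> (u <= F t).
Proof.
move=> u01; rewrite /Q u01; split; last first.
  by move=> h; apply: ge_inf => //; exact: S_lb.
move=> h; have hs s : t < s -> u <= F s.
  move=> ts; have [||y Sy ys] := @inf_lt _ (S u) s; first exact: S_neq0.
    exact: le_lt_trans ts.
  by rewrite (le_trans Sy)// F_nd// ltW.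
have rc : F x @[x --> t^'+] --> F t.
  apply: fine_cvg; rewrite fineK ?fin_num_measure//.
  exact: (@cdf_right_continuous _ _ _ mu (idTR : {RV mu >-> R}) t).
apply: (cvgr_to_ge rc); near=> s; apply: hs.
by near: s; exact: nbhs_right_gt.
Unshelve. all: end_near. Qed.

Let measQ : measurable_fun [set: R] Q.
Proof.
apply: (measurability (@RGenOInfty.G R)); first exact: RGenOInfty.measurableE.
move=> _ [_ [t ->] <-]; rewrite setTI.
rewrite (_ : _ @^-1` _ =
  (`]0, 1[%classic `&` `]F t, +oo[%classic ) `|`
  (if 0 > t then ~` `]0, 1[%classic else set0))%classic.
  apply: measurableU; last by case: ifP => // _; exact: measurableC.
  exact: measurableI.
apply/seteqP; split => u /=; rewrite !in_itv/= !andbT.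
  have [u01|u01] := boolP (0 < u < 1).
    by move=> /lt_geF tQ; left; split => //; rewrite ltNge; apply/negP => /(QP t u01); rewrite tQ.
  rewrite /Q (negbTE u01) => t0; right; rewrite t0 /= in_itv/=; exact/negP.
move=> [[u01 /lt_geF uF]|].
  by rewrite ltNge; apply/negP => /(QP t u01); rewrite uF.
case: ifP => // t0; rewrite /= in_itv/= => /negP/negbTE u01.
by rewrite /Q u01.
Qed.

(** The quantile transform Q(u) = inf {t | u <= F(t)}, where F is the
    distribution function, satisfies Q(u) <= t iff u <= F(t); applied to a
    uniform variable it has law mu. *)
Lemma coin_realizes : exists2 q : coin -> R, measurable_fun setT q &
  forall A, measurable A -> coinP (R := R) (q @^-1` A) = mu A.
Proof.
have mq : measurable_fun setT (Q \o unif_of_coin).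
  exact: measurableT_comp measurable_unif_of_coin.
exists (Q \o unif_of_coin) => //.
pose q : {mfun coin >-> measurableTypeR R} := HB.pack (Q \o unif_of_coin)
  (isMeasurableFun.Build _ _ coin (measurableTypeR R) (Q \o unif_of_coin) mq).
move=> A mA; change (distribution (coinP (R := R)) q A = mu A).
apply: (@measure_unique _ R (measurableTypeR R) (@RGenOInfty.G R)
  (fun n => `]- n%:R, +oo[%classic) _ _ _ _ (distribution (coinP (R := R)) q) mu) => //.
- exact: RGenOInfty.measurableE.
- move=> _ _ [x ->] [y ->]; exists (Num.max x y); apply/seteqP; split => z /=;
    rewrite !in_itv/= !andbT gt_max; first by move=> [-> ->].
  by case/andP.
- by move=> n; exists (- n%:R).
- apply/seteqP; split => // z _; exists (Num.truncn `|z|).+1 => //=.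
  by rewrite in_itv/= andbT ltrNl (le_lt_trans (ler_norm _))// normrN truncnS_gt.
- move=> _ [t ->].
  change (coinP (R := R) ((Q \o unif_of_coin) @^-1` `]t, +oo[%classic) = mu `]t, +oo[%classic).
  have cE (p : probability (measurableTypeR R) R) : p `]t, +oo[%classic = (1 - p `]-oo, t]%classic)%E.
    by rewrite -probability_setC// setCitvl.
  have mt : measurable ((Q \o unif_of_coin) @^-1` `]-oo, t]%classic).
    by rewrite -[X in measurable X]setTI; apply: (mq).
  have cT : coinP (R := R) ((Q \o unif_of_coin) @^-1` `]-oo, t]%classic) = (F t)%:E; last first.
    rewrite cE -FE -cT -probability_setC//; congr (coinP _); apply/seteqP.
    by split => w /=; rewrite !in_itv/= andbT ltNge => /negP.
  rewrite coinP_digits.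
  have F0 : 0 <= F t by rewrite fine_ge0// cdf_ge0.
  have F1 : F t <= 1 by rewrite -lee_fin FE probability_le1.
  apply/eqP; rewrite eq_le; apply/andP; split.
    have -> : (F t)%:E = lebesgue_measure `[0%R, F t]%classic :> \bar R.
      by rewrite lebesgue_measure_itv/= lte_fin; case: ltP => ?; rewrite ?sube0//; congr EFin; lra.
    apply: le_measure; rewrite ?inE//.
      apply: measurableI => //; rewrite -[X in measurable X]setTI.
      exact: measurable_digits.
    move=> u /= [+ u01]; rewrite in_itv/= in u01; rewrite unif_of_coin_digits//.
    rewrite !in_itv/=; have [->|u0] := eqVneq u 0; first by rewrite lexx F0.
    have u01' : 0 < u < 1 by rewrite lt_def u0; case/andP: u01 => -> ->.
    by move=> /(QP t u01') ->; case/andP: u01 => ->.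
  have -> : (F t)%:E = lebesgue_measure `]0%R, F t[%classic :> \bar R.
    by rewrite lebesgue_measure_itv/= lte_fin; case: ltP => ?; rewrite ?sube0//; congr EFin; lra.
  apply: le_measure; rewrite ?inE//.
    apply: measurableI => //; rewrite -[X in measurable X]setTI.
    exact: measurable_digits.
  move=> u /=; rewrite !in_itv/= => /andP[u0 uf].
  have u1 : u < 1 by rewrite (lt_le_trans uf).
  rewrite unif_of_coin_digits ?(ltW u0) ?u1//; split => //.
  by apply/(QP t); rewrite ?u0 ?u1// ltW.
- by move=> n; apply: (le_lt_trans (probability_le1 _ _)) => //; rewrite ltry.
Qed.

End law.
End quantile.

(** * Characteristic functions *)

Section general_integral.
Context d (T : measurableType d) (R : realType) (mu : {measure set T -> \bar R}).

Lemma Rintegral_dominated_cvg (D : set T) (f_ : nat -> T -> R) (f g : T -> R) :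
  measurable D -> (forall n, measurable_fun D (f_ n)) -> measurable_fun D f ->
  {ae mu, forall x, D x -> f_ n x @[n --> \oo] --> f x} ->
  mu.-integrable D (EFin \o g) -> (forall n x, D x -> `|f_ n x| <= g x) ->
  \int[mu]_(x in D) f_ n x @[n --> \oo] --> \int[mu]_(x in D) f x.
Proof.
move=> mD mf_ mf ff ig fg.
have [] := @dominated_convergence _ T R mu D mD (fun n x => (f_ n x)%:E)
  (fun x => (f x)%:E) (fun x => (g x)%:E) _ _ _ ig _.
- by move=> n; exact/measurable_EFinP.
- exact/measurable_EFinP.
- by apply: filterS ff => x h Dx; apply: cvg_EFin; [exact: nearW|exact: h].
- by apply: aeW => x n Dx; rewrite lee_fin fg.
move=> fi _ h; apply: fine_cvg; rewrite fineK//.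
exact: integrable_fin_num.
Qed.

Lemma bounded_integrable (f : T -> R) (M : R) : (mu setT < +oo)%E ->
  measurable_fun setT f -> (forall x, `|f x| <= M) ->
  mu.-integrable setT (EFin \o f).
Proof.
move=> muT mf fM; apply: measurable_bounded_integrable => //.
exists M; split; first exact: num_real.
by move=> x Mx y _ /=; rewrite (le_trans (fM y))// ltW.
Qed.

End general_integral.

Section expectation.
Context {R : realType}.
Local Notation P := (@coinP R).
Local Notation E X := (\int[P]_w X w)%R.

Lemma coinP_oo : (P setT < +oo)%E.
Proof. by rewrite coinP_setT ltry. Qed.

Lemma measurable_split : measurable_fun setT (fun w => (evens w, odds w)).
Proof.
apply/measurable_fun_pairP; split => /=.
  exact: measurable_evens.
exact: measurable_odds.
Qed.

Lemma E_split_mul (f g : coin -> R) (M N : R) :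
  measurable_fun setT f -> measurable_fun setT g ->
  (forall w, `|f w| <= M) -> (forall w, `|g w| <= N) ->
  (E (fun w => f (evens w) * g (odds w)) = E f * E g)%R.
Proof.
move=> mf mg fM gN.
pose F := fun z : coin * coin => ((f z.1 * g z.2)%:E : \bar R).
have mF' : measurable_fun setT (fun z : coin * coin => f z.1 * g z.2).
  by apply: measurable_funM; exact: measurableT_comp.
have mF : measurable_fun setT F by exact/measurable_EFinP.
have FMN z : `|f z.1 * g z.2| <= M * N by rewrite normrM ler_pM.
have PPT : ((P \x P)%E setT < +oo)%E.
  rewrite -setXTT product_measure1E//.
  by change ((P setT : \bar R) * P setT < +oo)%E; rewrite coinP_setT mule1 ltry.
have iF : (P \x P)%E.-integrable setT F by exact: (bounded_integrable _ mF').
have ms := @measurable_interleave.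
have e1 : (\int[P]_w F (evens w, odds w) = \int[(P \x P)%E]_z F z)%E.
  rewrite (eq_measure_integral (pushforward (P \x P)%E interleave)); last first.
    by move=> A mA _; exact: (esym (coinP_interleave mA)).
  rewrite integral_pushforward//=.
  - by apply: eq_integral => -[w1 w2] _ /=; rewrite evens_interleave odds_interleave.
  - exact: (measurableT_comp mF measurable_split).
  - rewrite preimage_setT; apply: eq_integrable iF => //.
    by move=> -[w1 w2] _ /=; rewrite evens_interleave odds_interleave.
rewrite /Rintegral -[LHS]/(fine (\int[P]_w F (evens w, odds w))%E) e1.
rewrite -integral12_prod_meas1// /fubini_F /F/=.
have fi := bounded_integrable coinP_oo mf fM.
have gi := bounded_integrable coinP_oo mg gN.
rewrite (eq_integral (fun w1 => (f w1 * E g)%:E)); last first.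
  move=> w1 _; under eq_integral do rewrite EFinM.
  rewrite integralZl// EFinM; congr (_ * _)%E.
  by rewrite /Rintegral fineK//; exact: integrable_fin_num.
by rewrite -[LHS]/(Rintegral _ _ _) RintegralZr.
Qed.

Lemma measurable_cosX d (T : measurableType d) (X : T -> R) :
  measurable_fun setT X -> measurable_fun setT (cos \o X).
Proof.
by apply: measurableT_comp; apply: continuous_measurable_fun; exact: continuous_cos.
Qed.

Lemma measurable_sinX d (T : measurableType d) (X : T -> R) :
  measurable_fun setT X -> measurable_fun setT (sin \o X).
Proof.
by apply: measurableT_comp; apply: continuous_measurable_fun; exact: continuous_sin.
Qed.

Lemma normr_cos_le1 (x : R) : `|cos x| <= 1.
Proof. by rewrite ler_norml cos_geN1 cos_le1. Qed.

Lemma normr_sin_le1 (x : R) : `|sin x| <= 1.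
Proof. by rewrite ler_norml sin_geN1 sin_le1. Qed.

(** The expectation of exp(i X), split into its real and imaginary parts. *)
Definition charf (X : coin -> R) : R[i] := E (cos \o X) +i* E (sin \o X).

(** Independent variables have multiplicative characteristic functions; expand
    the cosine and sine of the sum. *)
Lemma charf_split (X Y : coin -> R) : measurable_fun setT X -> measurable_fun setT Y ->
  charf (fun w => X (evens w) + Y (odds w)) = charf X * charf Y.
Proof.
move=> mX mY; rewrite /charf /=.
have mul (f g : coin -> R) : measurable_fun setT f -> measurable_fun setT g ->
    (forall w, `|f w| <= 1) -> (forall w, `|g w| <= 1) ->
    P.-integrable setT (EFin \o (fun w : coin => f (evens w) * g (odds w))).
  move=> mf mg f1 g1; apply: (@bounded_integrable _ _ _ _ _ 1 coinP_oo).
    apply: measurable_funM; first exact: (measurableT_comp mf measurable_evens).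
    exact: (measurableT_comp mg measurable_odds).
  by move=> w; rewrite normrM -(mulr1 1) ler_pM.
have mcX := measurable_cosX mX; have mcY := measurable_cosX mY.
have msX := measurable_sinX mX; have msY := measurable_sinX mY.
have c1 (X0 : coin -> R) w : `|(cos \o X0) w| <= 1 by exact: normr_cos_le1.
have s1 (X0 : coin -> R) w : `|(sin \o X0) w| <= 1 by exact: normr_sin_le1.
congr (_ +i* _).
  under eq_Rintegral do rewrite cosD.
  rewrite RintegralB//; [|exact: (mul _ _ mcX mcY (c1 X) (c1 Y))|exact: (mul _ _ msX msY (s1 X) (s1 Y))]; congr (_ - _).
    exact: (E_split_mul mcX mcY (c1 X) (c1 Y)).
  exact: (E_split_mul msX msY (s1 X) (s1 Y)).
under eq_Rintegral do rewrite sinD.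
rewrite RintegralD//; [|exact: (mul _ _ msX mcY (s1 X) (c1 Y))|exact: (mul _ _ mcX msY (c1 X) (s1 Y))]; rewrite addrC; congr (_ + _).
  exact: (E_split_mul mcX msY (c1 X) (s1 Y)).
exact: (E_split_mul msX mcY (s1 X) (c1 Y)).
Qed.

Definition ccvg (u : nat -> R[i]) (l : R[i]) :=
  (Re (u n) @[n --> \oo] --> Re l) /\ (Im (u n) @[n --> \oo] --> Im l).

Lemma ccvg_unique u l l' : ccvg u l -> ccvg u l' -> l = l'.
Proof.
move=> [a b] [a' b']; case: l l' a b a' b' => [x y] [x' y'] /= a b a' b'.
by congr (_ +i* _); [exact: (cvg_unique _ a a')|exact: (cvg_unique _ b b')].
Qed.

Lemma ccvg_cexp u l : ccvg u l -> ccvg (fun n => cexp (u n)) (cexp l).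
Proof.
have ReC (x : R) y : Re (x%:C * y) = x * Re y by case: y => ? ? /=; rewrite mul0r subr0.
have ImC (x : R) y : Im (x%:C * y) = x * Im y by case: y => ? ? /=; rewrite mul0r addr0.
move=> [a b]; rewrite /ccvg /cexp; split.
  under eq_fun do rewrite ReC; rewrite ReC; apply: cvgM => /=.
    exact: (continuous_cvg _ (@continuous_expR R _) a).
  exact: (continuous_cvg _ (@continuous_cos R _) b).
under eq_fun do rewrite ImC; rewrite ImC; apply: cvgM => /=.
  exact: (continuous_cvg _ (@continuous_expR R _) a).
exact: (continuous_cvg _ (@continuous_sin R _) b).
Qed.

Lemma ccvg_charf (X_ : nat -> coin -> R) (X : coin -> R) : (forall n, measurable_fun setT (X_ n)) ->
  measurable_fun setT X -> {ae P, forall w, X_ n w @[n --> \oo] --> X w} ->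
  ccvg (fun n => charf (X_ n)) (charf X).
Proof.
move=> mX_ mX X_X; split => /=.
- apply: (@Rintegral_dominated_cvg _ _ _ _ setT _ _ (cst 1)) => //.
  + by move=> n; exact: measurable_cosX.
  + exact: measurable_cosX.
  + by apply: filterS X_X => w h _; exact: (continuous_cvg _ (@continuous_cos R _) h).
  + by apply: (bounded_integrable coinP_oo (M := 1)) => // w; rewrite normr1.
  + by move=> n w _; exact: normr_cos_le1.
- apply: (@Rintegral_dominated_cvg _ _ _ _ setT _ _ (cst 1)) => //.
  + by move=> n; exact: measurable_sinX.
  + exact: measurable_sinX.
  + by apply: filterS X_X => w h _; exact: (continuous_cvg _ (@continuous_sin R _) h).
  + by apply: (bounded_integrable coinP_oo (M := 1)) => // w; rewrite normr1.
  + by move=> n w _; exact: normr_sin_le1.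
Qed.

(** Almost sure convergence passes to characteristic functions by dominated
    convergence, since cosine and sine are bounded. *)
Lemma charf_lim (X_ : nat -> coin -> R) (X : coin -> R) u l : (forall n, measurable_fun setT (X_ n)) ->
  measurable_fun setT X -> {ae P, forall w, X_ n w @[n --> \oo] --> X w} ->
  (forall n, charf (X_ n) = cexp (u n)) -> ccvg u l -> charf X = cexp l.
Proof.
move=> mX_ mX X_X e ul; apply: (@ccvg_unique (fun n => charf (X_ n))).
  exact: ccvg_charf.
by under [X in ccvg X _]eq_fun do rewrite e; exact: ccvg_cexp.
Qed.

Lemma cexpD (a b : R[i]) : cexp (a + b) = cexp a * cexp b.
Proof.
case: a b => [a1 a2] [b1 b2]; apply/eqP; rewrite eq_complex /cexp /=.
rewrite expRD cosD sinD; apply/andP; split; apply/eqP; ring.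
Qed.

Lemma cexp0 : cexp 0 = 1 :> R[i].
Proof. by rewrite /cexp /= expR0 cos0 sin0 mul1r. Qed.

End expectation.

(** * Noises and their independent sums *)

Section series_helpers.
Context {R : realType}.
Local Open Scope ereal_scope.

(** The terms a n with min(1, a n) < 1 coincide with their truncations, and only
    finitely many others can occur. *)
Lemma nneseries_min1 (a : nat -> \bar R) : (forall n, 0 <= a n) ->
  (forall n, a n < +oo) -> \sum_(n <oo) Order.min 1 (a n) < +oo ->
  \sum_(n <oo) a n < +oo.
Proof.
move=> a0 afin smin.
have m0 n : 0 <= Order.min 1 (a n) by rewrite le_min lee01 a0.
have : Order.min 1 (a n) @[n --> \oo] --> 0.
  apply: (@squeeze_cvge _ _ _ _ (cst 0) _ (fun n => \sum_(n <= k <oo) Order.min 1 (a k))).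
  - apply: nearW => n; rewrite m0/= (nneseries_split _ 1)// addn1 big_nat1.
    by rewrite leeDl// nneseries_ge0.
  - exact: cvg_cst.
  - by apply: nneseries_tail_cvg.
move=> cv; have [N _ hN] : \forall n \near \oo, Order.min 1 (a n) < 1.
  by apply: (cv [set y | y < 1]); apply: open_ereal_lt'; exact: lte01.
rewrite (nneseries_split _ N)// add0n lte_add_pinfty//.
  by apply: lte_sum_pinfty => i _; exact: afin.
apply: le_lt_trans smin; rewrite [leRHS](nneseries_split _ N)// add0n.
apply: (@le_trans _ _ (\sum_(N <= k <oo) Order.min 1 (a k))); last first.
  by rewrite leeDr// sume_ge0.
rewrite eseries_cond [X in _ <= X]eseries_cond; apply: lee_nneseries => // n /= Nn.
by have := hN n Nn; rewrite /= minElt; case: ifPn => // _; rewrite ltxx.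
Qed.

Lemma min1_nneseries (a : nat -> \bar R) : (forall n, 0 <= a n) ->
  Order.min 1 (\sum_(n <oo) a n) <= \sum_(n <oo) Order.min 1 (a n).
Proof.
move=> a0.
have m0 n : 0 <= Order.min 1 (a n) by rewrite le_min lee01 a0.
have [[k ak]|h] := pselect (exists k, 1 <= a k).
  rewrite ge_min; apply/orP; left; rewrite (@nneseriesD1 _ _ k)//.
  by rewrite min_l// leeDl// nneseries_ge0.
rewrite ge_min; apply/orP; right; apply: lee_nneseries => // n _.
rewrite le_min lexx andbT leNgt; apply/negP => an; apply: h; exists n; exact: ltW.
Qed.

Lemma series_bound (a u : nat -> R) : (forall n, (`|u n| <= a n)%R) ->
  \sum_(n <oo) (a n)%:E < +oo ->
  cvgn (series u) /\ (`|limn (series u)|%:E <= \sum_(n <oo) (a n)%:E).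
Proof.
move=> ua soo; have a0 n : (0 <= a n)%R by exact: le_trans (ua n).
have ca := nnseries_is_cvg a0 soo.
have cu : cvgn [normed series u] by exact: (series_le_cvg _ a0 ua ca).
split; first exact: normed_cvg.
have -> : \sum_(n <oo) (a n)%:E = (limn (series a))%:E.
  by rewrite -EFin_lim//; apply/congr_lim/funext => n; rewrite /= sumEFin.
rewrite lee_fin (le_trans (lim_series_norm cu))//.
exact: lim_series_le.
Qed.

End series_helpers.

Section noise.
Context {R : realType} {T0 : Type}.
Variable Bd : (T0 -> R) -> R -> Prop.
Local Notation P := (@coinP R).

(** Bd f C is to be read: f is a test function of size at most C. *)
Definition test (f : T0 -> R) := exists C, Bd f C.

Definition noise_bound (X : coin -> (T0 -> R) -> R) (M : coin -> \bar R) :=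
  forall w f C, Bd f C -> (M w < +oo)%E -> (`|X w f| <= fine (M w) * C)%R.

Definition noise_linear (X : coin -> (T0 -> R) -> R) :=
  forall w k f g, test f -> test g -> X w (fun x => k * f x + g x) = k * X w f + X w g.

(** The last two conditions quantify the noise: eps bounds the mean of min(1,
    M), a quantity that is finite for all laws of M and subadditive, and Psi is
    the characteristic exponent. The bound by M is uniform in f, which is
    stronger than an estimate of each X f and gives continuity outcome by
    outcome. *)
Definition is_noise (Psi : (T0 -> R) -> R[i]) (eps : \bar R)
    (X : coin -> (T0 -> R) -> R) (M : coin -> \bar R) :=
  [/\ (forall f, test f -> measurable_fun setT (X ^~ f)) /\ noise_linear X,
      [/\ measurable_fun setT M, (forall w, (0 <= M w)%E),
          {ae P, forall w, (M w < +oo)%E} & noise_bound X M],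
      (\int[P]_w Order.min 1 (M w) <= eps)%E &
      forall f, test f -> charf (X ^~ f) = cexp (Psi f)].

Lemma integral_coin_cst (r : \bar R) : (\int[P]_w r = r)%E.
Proof.
rewrite (integral_cst P)//; transitivity (r * P setT)%E; first by [].
by rewrite coinP_setT mule1.
Qed.

Lemma Rintegral_coin_cst (r : R) : (\int[P]_w r)%R = r.
Proof. by rewrite /Rintegral integral_coin_cst. Qed.

Lemma ge0_integral_evens (F : coin -> \bar R) : measurable_fun setT F ->
  (forall w, 0 <= F w)%E -> (\int[P]_w F (evens w) = \int[P]_w F w)%E.
Proof.
move=> mF F0.
rewrite -[LHS]/(\int[P]_w (fun z : coin * coin => F z.1) (evens w, odds w))%E.
rewrite ge0_integral_split//=; last by apply: measurableT_comp => //.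
by apply: eq_integral => w _; exact: integral_coin_cst.
Qed.

Lemma ge0_integral_odds (F : coin -> \bar R) : measurable_fun setT F ->
  (forall w, 0 <= F w)%E -> (\int[P]_w F (odds w) = \int[P]_w F w)%E.
Proof.
move=> mF F0.
rewrite -[LHS]/(\int[P]_w (fun z : coin * coin => F z.2) (evens w, odds w))%E.
rewrite ge0_integral_split//=; last by apply: measurableT_comp => //.
exact: integral_coin_cst.
Qed.

(** The m-th of countably many independent copies of the coin sequence: drop the
    even tosses m times, then read the even tosses. *)
Definition block (m : nat) (w : coin) : coin := evens (iter m odds w).

Lemma measurable_iter_odds m : measurable_fun setT (iter m odds).
Proof.
elim: m => [|m ih]; first exact: measurable_id.
exact: (measurableT_comp measurable_odds ih).
Qed.

Lemma measurable_block m : measurable_fun setT (block m).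
Proof. exact: (measurableT_comp measurable_evens (measurable_iter_odds m)). Qed.

Lemma ge0_integral_block m (F : coin -> \bar R) : measurable_fun setT F ->
  (forall w, 0 <= F w)%E -> (\int[P]_w F (block m w) = \int[P]_w F w)%E.
Proof.
move=> mF F0; rewrite /block.
transitivity (\int[P]_w F (evens w))%E; last exact: ge0_integral_evens.
have mG : measurable_fun setT (F \o evens) := measurableT_comp mF measurable_evens.
elim: m => // m <-; under eq_integral do rewrite iterSr.
apply: (ge0_integral_odds (F := fun w => F (evens (iter m odds w)))) => //.
exact: (measurableT_comp mG (measurable_iter_odds m)).
Qed.

Lemma ae_block m (M : coin -> \bar R) : measurable_fun setT M ->
  (forall w, (0 <= M w)%E) -> {ae P, forall w, (M w < +oo)%E} ->
  {ae P, forall w, (M (block m w) < +oo)%E}.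
Proof.
move=> mM M0 aeM.
pose A := [set w | M w = +oo%E].
have mA : measurable A.
  have -> : A = M @^-1` [set +oo%E] by [].
  by rewrite -[X in measurable X]setTI; exact: mM.
have PA : P A = 0%E.
  have [N [mN N0 sN]] := aeM; apply: (subset_measure0 mA mN _ N0).
  by move=> w /= Aw; apply: sN => /=; rewrite Aw.
exists (block m @^-1` A); split.
- by rewrite -[X in measurable X]setTI; exact: measurable_block.
- have := @ge0_integral_block m (fun w => (\1_A w)%:E).
  have mi : measurable_fun setT (fun w : coin => (\1_A w : R)%:E).
    by apply/measurable_EFinP; exact: measurable_indic.
  have mB : measurable (block m @^-1` A).
    by rewrite -[X in measurable X]setTI; exact: measurable_block.
  have iE B : measurable B -> (\int[P]_w (\1_B w)%:E = P B)%E.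
    by move=> mB'; rewrite integral_indic// setIT.
  move=> /(_ mi) h; transitivity (\int[P]_w (\1_A (block m w))%:E)%E.
    exact: (esym (iE _ mB)).
  rewrite h; last by move=> w; rewrite lee_fin.
  by transitivity (P A); [exact: iE|exact: PA].
- by move=> w /= /negP; rewrite -leNgt leye_eq => /eqP.
Qed.

(** Variables read from distinct blocks are independent. *)
Lemma charf_blocks (Y : nat -> coin -> R) (u : nat -> R[i]) n :
  (forall m, measurable_fun setT (Y m)) -> (forall m, charf (Y m) = cexp (u m)) ->
  charf (fun w => \sum_(m < n) Y m (block m w)) = cexp (\sum_(m < n) u m).
Proof.
elim: n Y u => [|n ih] Y u mY eY.
  rewrite big_ord0 cexp0 /charf; apply/eqP; rewrite eq_complex /=.
  under eq_Rintegral do rewrite big_ord0.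
  under [X in _ && (X == _)]eq_Rintegral do rewrite big_ord0.
  by rewrite /= cos0 sin0 !Rintegral_coin_cst !eqxx.
rewrite big_ord_recl cexpD -eY -(ih (fun m => Y m.+1) (fun m => u m.+1))//.
rewrite -charf_split//; last first.
  apply: measurable_sum => i.
  exact: (measurableT_comp (mY _) (measurable_block i)).
congr charf; apply/funext => w; rewrite big_ord_recl; congr (_ + _).
by apply: eq_bigr => i _; rewrite /block/= -iterSr.
Qed.

(** The mean of min(1, M) for M the sum of the M_m is at most the sum of the
    eps_m, so that min(1, M_m) is summable almost surely, hence so is M_m. On
    that event the series of the X_m f converges absolutely with the required
    bound; elsewhere X is set to 0, which keeps it linear for every outcome. *)
Lemma noise_series (Psi_ : nat -> (T0 -> R) -> R[i]) (eps_ : nat -> \bar R)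
    (X_ : nat -> coin -> (T0 -> R) -> R) (M_ : nat -> coin -> \bar R)
    (Psi : (T0 -> R) -> R[i]) :
  (forall m, is_noise (Psi_ m) (eps_ m) (X_ m) (M_ m)) ->
  (forall f C, Bd f C -> 0 <= C) ->
  (\sum_(m <oo) eps_ m < +oo)%E ->
  (forall f, test f -> ccvg (fun n => \sum_(m < n) Psi_ m f) (Psi f)) ->
  exists X M, is_noise Psi (\sum_(m <oo) eps_ m)%E X M.
Proof.
move=> noi C0 epsoo Psif.
pose M w := (\sum_(m <oo) M_ m (block m w))%E.
pose S n w f := \sum_(m < n) X_ m (block m w) f.
pose X w f : R := if (M w < +oo)%E then limn (S^~ w ^~ f) else 0.
have mM_ m : measurable_fun setT (M_ m) by have [_ []] := noi m.
have M_0 m w : (0 <= M_ m w)%E by have [_ []] := noi m.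
have mMb m : measurable_fun setT (fun w => M_ m (block m w)).
  exact: (measurableT_comp (mM_ m) (measurable_block m)).
have mM : measurable_fun setT M by apply: ge0_emeasurable_sum.
have M0 w : (0 <= M w)%E by apply: nneseries_ge0.
have M_oo w m : (M w < +oo)%E -> (M_ m (block m w) < +oo)%E.
  move=> h; rewrite ltey; apply/eqP => e; move: h.
  by rewrite /M (nneseries_pinfty (k := m))// ltxx.
have ME w : (M w < +oo)%E -> M w = (\sum_(m <oo) (fine (M_ m (block m w)))%:E)%E.
  move=> h; apply: eq_eseriesr => m _; rewrite fineK// ge0_fin_numE//.
  exact: M_oo.
have Xb w f C : Bd f C -> (M w < +oo)%E ->
    cvgn (S^~ w ^~ f) /\ `|limn (S^~ w ^~ f)| <= fine (M w) * C.
  move=> fC Mw; have SE : S^~ w ^~ f = series (fun m => X_ m (block m w) f).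
    by apply/funext => n; rewrite /S /series /= big_mkord.
  rewrite SE; have sC : (\sum_(m <oo) (fine (M_ m (block m w)) * C)%:E = M w * C%:E)%E.
    rewrite (ME w Mw) muleC -nneseriesZl; last by move=> i _; rewrite lee_fin fine_ge0.
    by apply: eq_eseriesr => m _; rewrite muleC.
  have Mfin : M w \is a fin_num by rewrite ge0_fin_numE.
  have [||cv bd] := @series_bound R (fun m => fine (M_ m (block m w)) * C)
     (fun m => X_ m (block m w) f).
  - move=> m; have [_ [_ _ _ hb] _ _] := noi m; apply: hb => //; exact: M_oo.
  - by rewrite sC -(fineK Mfin) -EFinM ltry.
  split=> //; rewrite -lee_fin (le_trans bd)// sC EFinM fineK//.
have aeM : {ae P, forall w, (M w < +oo)%E}.
  have ae1 : {ae P, forall w, forall m, (M_ m (block m w) < +oo)%E}.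
    apply/ae_foralln => m; apply: ae_block => //.
    by have [_ []] := noi m.
  have mmin m : measurable_fun setT (fun w => Order.min 1%E (M_ m (block m w))).
    by apply: measurable_mine.
  have min0 m w : (0 <= Order.min 1%E (M_ m (block m w)))%E by rewrite le_min lee01 M_0.
  have ae2 : {ae P, forall w, (\sum_(m <oo) Order.min 1 (M_ m (block m w)) < +oo)%E}.
    have : P.-integrable setT (fun w => \sum_(m <oo) Order.min 1 (M_ m (block m w)))%E.
      apply/integrableP; split; first by apply: ge0_emeasurable_sum.
      under eq_integral do rewrite gee0_abs ?nneseries_ge0//.
      rewrite integral_nneseries//; apply: le_lt_trans epsoo.
      apply: lee_nneseries => [m _ _|m _]; first by apply: integral_ge0.
      rewrite (@ge0_integral_block m (fun w => Order.min 1%E (M_ m w)))//.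
      + by have [_ _ ->] := noi m.
      + by apply: measurable_mine.
      + by move=> w; rewrite le_min lee01 M_0.
    move=> /(integrable_ae measurableT); apply: filterS => w /(_ I).
    by rewrite ge0_fin_numE// nneseries_ge0.
  by apply: filterS2 ae1 ae2 => w h1 h2; exact: nneseries_min1.
have mS f n : test f -> measurable_fun setT (fun w => S n w f).
  move=> tf; apply: measurable_sum => i.
  have [[h _] _ _ _] := noi i.
  exact: (measurableT_comp (h f tf) (measurable_block i)).
have mX f : test f -> measurable_fun setT (X^~ f).
  move=> tf; have [C fC] := tf.
  apply: (@measurable_fun_cvg _ _ _ _ (fun n w => if (M w < +oo)%E then S n w f else 0)).
    move=> n; apply: measurable_fun_ifT => //; last exact: mS.
    by apply: measurable_fun_lte.
  move=> w _; rewrite /X; case: ifPn => Mw; last exact: cvg_cst.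
  by have [cv _] := Xb w f C fC Mw.
exists X, M; split.
- split => // w k f g [C fC] [D gD]; rewrite /X; case: ifPn => Mw; last by rewrite mulr0 addr0.
  have [cf _] := Xb w f C fC Mw; have [cg _] := Xb w g D gD Mw.
  have SE : S^~ w ^~ (fun x => k * f x + g x) = fun n => k * S n w f + S n w g.
    apply/funext => n; rewrite /S mulr_sumr -big_split/=; apply: eq_bigr => m _.
    by have [[_ h] _ _ _] := noi m; apply: h; [exists C|exists D].
  rewrite SE; apply/cvg_lim => //; apply: cvgD; last exact: cg.
  by apply: cvgM; [exact: cvg_cst|exact: cf].
- split => // w f C fC Mw; rewrite /X Mw.
  by have [] := Xb w f C fC Mw.
- apply: (@le_trans _ _ (\int[P]_w \sum_(m <oo) Order.min 1 (M_ m (block m w)))%E).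
    apply: ge0_le_integral => //.
    + by move=> w _; rewrite le_min lee01 M0.
    + by apply: measurable_mine.
    + apply: ge0_emeasurable_sum => [m w _ _|m _]; first by rewrite le_min lee01 M_0.
      by apply: measurable_mine.
    + by move=> w _; apply: min1_nneseries.
  rewrite integral_nneseries//; last 2 first.
  + by move=> m; apply: measurable_mine.
  + by move=> m w _; rewrite le_min lee01 M_0.
  apply: lee_nneseries => [m _ _|m _].
    by apply: integral_ge0 => w _; rewrite le_min lee01 M_0.
  rewrite (@ge0_integral_block m (fun w => Order.min 1%E (M_ m w)))//.
  + by have [_ _ ->] := noi m.
  + by apply: measurable_mine.
  + by move=> w; rewrite le_min lee01 M_0.
- move=> f tf; apply: (@charf_lim _ (fun n w => S n w f) _ (fun n => \sum_(m < n) Psi_ m f)).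
  + by move=> n; exact: mS.
  + exact: mX.
  + have [C fC] := tf; apply: filterS aeM => w Mw; rewrite /X Mw.
    by have [] := Xb w f C fC Mw.
  + move=> n; rewrite /S (charf_blocks (Y := fun m w => X_ m w f) (u := fun m => Psi_ m f))//.
      by move=> m; have [[h _] _ _ _] := noi m; exact: h.
    by move=> m; have [_ _ _ h] := noi m; exact: h.
  + exact: Psif.
Qed.

End noise.

(** * The exponential series *)

Section cexp_series.
Context {R : realType}.
Variables (z : R[i]).
Let x := Re z.
Let y := Im z.
Let r := `|x| + `|y|.
Let a n := Re (z ^+ n).
Let b n := Im (z ^+ n).

Let zE : z = x +i* y. Proof. by rewrite /x /y; case: (z). Qed.

Let aS n : a n.+1 = x * a n - y * b n.
Proof. by rewrite /a /b exprS; case: (z ^+ n) => u v; rewrite [in LHS]zE. Qed.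

Let bS n : b n.+1 = x * b n + y * a n.
Proof. by rewrite /a /b exprS; case: (z ^+ n) => u v; rewrite [in LHS]zE. Qed.

Let ab_le n : `|a n| + `|b n| <= r ^+ n * 1.
Proof.
elim: n => [|n ih]; first by rewrite /a /b !expr0 /= normr1 normr0 addr0 mulr1.
have := ler_normB (x * a n) (y * b n); have := ler_normD (x * b n) (y * a n).
rewrite -aS -bS !normrM => h1 h2.
have h3 : r * (`|a n| + `|b n|) <= r * (r ^+ n * 1).
  by rewrite ler_wpM2l// /r addr_ge0.
move: h3; rewrite exprS -mulrA; set q := r * (r ^+ n * 1).
by rewrite /r mulrDl !mulrDr; lra.
Qed.

Let coef (c : nat -> R) n := c n / n`!%:R.

Let cvg_coef (c : nat -> R) (k : nat) (K : R) :
  (forall n, `|c n| <= r ^+ (n + k)) -> cvgn (pseries (coef c) K).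
Proof.
move=> cr; apply: normed_cvg.
apply: (@series_le_cvg _ _ (fun n => r ^+ k * exp_coeff (r * `|K|) n)) => /=.
- by move=> n.
- by move=> n; rewrite mulr_ge0 ?exprn_ge0 ?addr_ge0// exp_coeff_ge0// mulr_ge0 ?addr_ge0.
- move=> n; rewrite /coef /exp_coeff /= !normrM normrX normfV (@ger0_norm _ n`!%:R)//.
  rewrite exprMn (mulrA (r ^+ k)) (mulrA (r ^+ k)) -exprD mulrAC ler_wpM2r ?invr_ge0//.
  by rewrite ler_wpM2r ?exprn_ge0// addnC cr.
- rewrite (_ : series _ = fun n => r ^+ k * series (exp_coeff (r * `|K|)) n); last first.
    by apply/funext => n; rewrite /series /= mulr_sumr.
  by apply: is_cvgM; [exact: is_cvg_cst|exact: is_cvg_series_exp_coeff].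
Qed.

Let diffs_coef c : pseries_diffs (coef c) = coef (fun n => c n.+1).
Proof.
apply/funext => n; rewrite /pseries_diffs /coef factS natrM.
have h1 : n.+1%:R != 0 :> R by rewrite pnatr_eq0.
have h2 : n`!%:R != 0 :> R by rewrite pnatr_eq0 -lt0n fact_gt0.
by rewrite invfM mulrCA mulVKf.
Qed.

Let a_le n : `|a n| <= r ^+ n.
Proof. by have := ab_le n; have := normr_ge0 (b n); lra. Qed.

Let b_le n : `|b n| <= r ^+ n.
Proof. by have := ab_le n; have := normr_ge0 (a n); lra. Qed.

Let dsum (c : nat -> R) (t : R) : (forall n, `|c n| <= r ^+ n) ->
  is_derive t 1 (fun t => limn (pseries (coef c) t)) (limn (pseries (coef (fun n => c n.+1)) t)).
Proof.
move=> cr; rewrite -diffs_coef; apply: (@pseries_snd_diffs _ _ (`|t| + 1)).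
- by apply: (@cvg_coef _ 0) => n; rewrite addn0.
- by rewrite diffs_coef; apply: (@cvg_coef _ 1) => n; rewrite addn1.
- by rewrite !diffs_coef; apply: (@cvg_coef _ 2) => n; rewrite addn2.
- by rewrite (@ger0_norm _ (_ + 1)) ?addr_ge0// ltrDl.
Qed.

Let A t := limn (pseries (coef a) t).
Let B t := limn (pseries (coef b) t).

Let cvA t : cvgn (pseries (coef a) t).
Proof. by apply: (@cvg_coef _ 0) => n; rewrite addn0. Qed.

Let cvB t : cvgn (pseries (coef b) t).
Proof. by apply: (@cvg_coef _ 0) => n; rewrite addn0. Qed.

Let pser_lin (u v : R) t : pseries (coef (fun n => u * a n + v * b n)) t =
  (fun n => u * pseries (coef a) t n + v * pseries (coef b) t n).
Proof.
apply/funext => n; rewrite /pseries /series /= !mulr_sumr -big_split /=.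
by apply: eq_bigr => i _; rewrite /coef; ring.
Qed.

Let lim_lin (u v : R) t : limn (pseries (coef (fun n => u * a n + v * b n)) t) =
  u * A t + v * B t.
Proof.
rewrite pser_lin; apply/cvg_lim => //.
by apply: cvgD; (apply: cvgM; first exact: cvg_cst); [exact: cvA|exact: cvB].
Qed.

Let dA (t : R) : is_derive t 1 A (x * A t - y * B t).
Proof.
rewrite -mulNr -lim_lin; have := @dsum a t a_le.
by rewrite (_ : (fun n => a n.+1) = (fun n => x * a n + - y * b n))//;
  apply/funext => n; rewrite aS mulNr.
Qed.

Let dB (t : R) : is_derive t 1 B (x * B t + y * A t).
Proof.
rewrite addrC -lim_lin; have := @dsum b t b_le.
by rewrite (_ : (fun n => b n.+1) = (fun n => y * a n + x * b n))//;
  apply/funext => n; rewrite bS addrC.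
Qed.

Let A0 : A 0 = 1.
Proof.
apply/cvg_lim => //; apply: cvg_near_cst; near=> n.
have n0 : (0 < n)%N by near: n; exists 1%N.
rewrite -(prednK n0) /pseries /series /= big_nat_recl// big1_seq.
  by rewrite expr0 mulr1 addr0 /coef /a expr0 fact0 divr1.
by move=> i _; rewrite exprS mul0r mulr0.
Unshelve. all: end_near. Qed.

Let B0 : B 0 = 0.
Proof.
apply/cvg_lim => //; apply: cvg_near_cst; near=> n.
have n0 : (0 < n)%N by near: n; exists 1%N.
rewrite -(prednK n0) /pseries /series /= big_nat_recl// big1_seq.
  by rewrite expr0 mulr1 addr0 /coef /b expr0 mul0r.
by move=> i _; rewrite exprS mul0r mulr0.
Unshelve. all: end_near. Qed.

Let dE (t c : R) : is_derive t 1 (fun t => expR (c * t)) (expR (c * t) * c).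
Proof.
have h : is_derive t 1 (fun t => c * t) c.
  by apply: is_derive_eq; rewrite /GRing.scale /= !mulr1.
exact: (is_derive1_comp (f := expR) _ h).
Qed.

Let dC (t : R) : is_derive t 1 (fun t => cos (y * t)) (- sin (y * t) * y).
Proof.
have h : is_derive t 1 (fun t => y * t) y.
  by apply: is_derive_eq; rewrite /GRing.scale /= !mulr1.
exact: (is_derive1_comp (f := cos) _ h).
Qed.

Let dS (t : R) : is_derive t 1 (fun t => sin (y * t)) (cos (y * t) * y).
Proof.
have h : is_derive t 1 (fun t => y * t) y.
  by apply: is_derive_eq; rewrite /GRing.scale /= !mulr1.
exact: (is_derive1_comp (f := sin) _ h).
Qed.

Let H1 t : expR (- x * t) * (A t * cos (y * t) + B t * sin (y * t)) = 1.
Proof.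
transitivity (expR (- x * 0) * (A 0 * cos (y * 0) + B 0 * sin (y * 0))); last first.
  by rewrite A0 B0 !mulr0 expR0 cos0 sin0; lra.
pose f t := expR (- x * t) * (A t * cos (y * t) + B t * sin (y * t)).
apply: (@is_derive_0_is_cst _ f) => s.
have := dE s (- x); have := dA s; have := dB s; have := dC s; have := dS s => h1 h2 h3 h4 h5.
by apply: is_derive_eq; rewrite /GRing.scale /=; ring.
Qed.

Let H2 t : expR (- x * t) * (B t * cos (y * t) - A t * sin (y * t)) = 0.
Proof.
transitivity (expR (- x * 0) * (B 0 * cos (y * 0) - A 0 * sin (y * 0))); last first.
  by rewrite A0 B0 !mulr0 expR0 cos0 sin0; lra.
pose f t := expR (- x * t) * (B t * cos (y * t) - A t * sin (y * t)).
apply: (@is_derive_0_is_cst _ f) => s.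
have := dE s (- x); have := dA s; have := dB s; have := dC s; have := dS s => h1 h2 h3 h4 h5.
by apply: is_derive_eq; rewrite /GRing.scale /=; ring.
Qed.

(** For real t, the coordinates A(t) and B(t) of the exponential series of t z
    satisfy A' = x A - y B and B' = x B + y A, as do those of cexp (t z), with
    the same value at 0. *)
Lemma cexp_series (t : R) : ccvg (fun n => \sum_(k < n) (t ^+ k / k`!%:R)%:C * z ^+ k)
  (cexp (t%:C * z)).
Proof.
have pE n : \sum_(k < n) (t ^+ k / k`!%:R)%:C * z ^+ k =
    pseries (coef a) t n +i* pseries (coef b) t n.
  rewrite /pseries /series /= !big_mkord; elim: n => [|n ih]; first by rewrite !big_ord0.
  rewrite !big_ord_recr /= ih /coef /a /b; case: (z ^+ n) => u v /=.
  by apply/eqP; rewrite eq_complex /=; apply/andP; split; apply/eqP; ring.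
have e0 : expR (- x * t) * expR (x * t) = 1 by rewrite -expRD mulNr addNr expR0.
have e1 : cos (y * t) ^+ 2 + sin (y * t) ^+ 2 = 1 by rewrite cos2Dsin2.
have := H1 t; have := H2 t; move: e0 e1.
set e := expR (- x * t); set e' := expR (x * t); set c := cos _; set s := sin _.
move=> e0 e1 h2 h1.
have AE : A t = e' * c.
  transitivity (e' * (e * (A t * c + B t * s) * c - e * (B t * c - A t * s) * s)).
    transitivity ((e * e') * (c ^+ 2 + s ^+ 2) * A t); first by rewrite e0 e1 !mul1r.
    by ring.
  by rewrite h1 h2; ring.
have BE : B t = e' * s.
  transitivity (e' * (e * (A t * c + B t * s) * s + e * (B t * c - A t * s) * c)).
    transitivity ((e * e') * (c ^+ 2 + s ^+ 2) * B t); first by rewrite e0 e1 !mul1r.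
    by ring.
  by rewrite h1 h2; ring.
rewrite [in cexp _]zE /cexp /= !mul0r subr0 addr0 (mulrC t x) (mulrC t y) -/e' -/c -/s.
split.
  under eq_fun do rewrite pE; rewrite /= mul0r subr0 -AE; exact: cvA.
under eq_fun do rewrite pE; rewrite /= mul0r addr0 -BE; exact: cvB.
Qed.

End cexp_series.

(** * Compound Poisson sums *)

Section poisson_variable.
Context {R : realType}.
Local Notation P := (@coinP R).

Definition pois (lam : R) (n : nat) : R := lam ^+ n / n`!%:R * expR (- lam).

Lemma poisson_variable (lam : R) : 0 <= lam -> exists2 N : coin -> nat,
  measurable_fun setT N & forall n, P (N @^-1` [set n]) = (pois lam n)%:E.
Proof.
rewrite le_eqVlt => /orP[/eqP <-|l0].
  exists (fun=> 0%N); first exact: measurable_cst.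
  move=> [|n]; rewrite /pois.
    rewrite (_ : _ @^-1` _ = setT); last by apply/seteqP; split.
    by rewrite expr0 fact0 oppr0 expR0 divr1 mulr1; exact: coinP_setT.
  rewrite (_ : _ @^-1` _ = set0); last by apply/seteqP; split.
  by rewrite exprS !mul0r measure0.
pose natr := (fun k : nat => k%:R : measurableTypeR R).
have mnatr : measurable_fun setT natr by [].
pose X : {mfun nat >-> measurableTypeR R} := HB.pack natr
  (isMeasurableFun.Build _ _ nat (measurableTypeR R) natr mnatr).
have [q mq qE] := coin_realizes (distribution (poisson_prob lam 0 : probability _ R) X).
have mt : measurable_fun setT (fun x : R => Num.truncn (1 * x)) by exact: measurable_truncn.
exists (fun w => Num.truncn (1 * q w)); first exact: (measurableT_comp mt mq).
move=> n; rewrite (qE ((fun x : R => Num.truncn (1 * x)) @^-1` [set n])); last first.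
  by rewrite -[X in measurable X]setTI; exact: mt.
transitivity (poisson_prob lam 0 [set n]).
  congr poisson_prob; apply/seteqP; split => k /=; rewrite /natr mul1r natrK//.
rewrite /poisson_prob l0 esum_set1 ?lee_fin ?poisson_pmf_ge0//.
by rewrite /poisson_pmf l0.
Qed.

Lemma pois_series_exp (lam : R) :
  \sum_(k < n) lam ^+ k / k`!%:R @[n --> \oo] --> expR lam.
Proof.
have -> : (fun n => \sum_(k < n) lam ^+ k / k`!%:R) = series (exp_coeff lam).
  by apply/funext => n; rewrite /series /= big_mkord.
exact: is_cvg_series_exp_coeff.
Qed.

Lemma pois_sum (lam : R) : \sum_(k < n) pois lam k @[n --> \oo] --> (1 : R).
Proof.
rewrite -(expRxMexpNx_1 lam).
under eq_fun do rewrite -mulr_suml.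
by apply: cvgM; [exact: pois_series_exp|exact: cvg_cst].
Qed.

Lemma poisS (lam : R) n : pois lam n.+1 * n.+1%:R = lam * pois lam n.
Proof.
have h1 : n.+1%:R != 0 :> R by rewrite pnatr_eq0.
rewrite /pois exprS factS natrM invfM mulrAC -!mulrA; congr (lam * _).
by congr (_ * _); rewrite mulrCA (mulrA _ n.+1%:R) mulVf// mul1r.
Qed.

Lemma pois_mean (lam : R) : \sum_(k < n) pois lam k * k%:R @[n --> \oo] --> lam.
Proof.
rewrite -cvg_shiftS /=.
rewrite (_ : (fun n => _) = (fun n => lam * \sum_(k < n) pois lam k)); last first.
  apply/funext => n; rewrite big_ord_recl mulr0 add0r mulr_sumr.
  by apply: eq_bigr => i _; rewrite /= poisS.
have h := cvgM (cvg_cst lam) (pois_sum lam); rewrite mulr1 in h; exact: h.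
Qed.

Lemma pois_fact2 (lam : R) :
  \sum_(k < n) pois lam k * (k%:R * (k%:R - 1)) @[n --> \oo] --> lam ^+ 2.
Proof.
rewrite -cvg_shiftS /= expr2.
rewrite (_ : (fun n => _) = (fun n => lam * \sum_(k < n) pois lam k * k%:R)); last first.
  apply/funext => n; rewrite big_ord_recl mul0r mulr0 add0r mulr_sumr.
  apply: eq_bigr => i _; rewrite lift0 [LHS]mulrA poisS -mulrA; congr (_ * (_ * _)).
  by rewrite -natr1 addrK.
have h := cvgM (cvg_cst lam) (@pois_mean lam); exact: h.
Qed.

Lemma pois_second (lam u v : R) :
  \sum_(k < n) pois lam k * (k%:R * u + (k%:R - lam) ^+ 2 * v) @[n --> \oo] -->
  lam * (u + v).
Proof.
have -> : lam * (u + v) = lam * (u + v - 2 * lam * v) + lam ^+ 2 * v + 1 * (lam ^+ 2 * v).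
  by ring.
have -> : (fun n => \sum_(k < n) pois lam k * (k%:R * u + (k%:R - lam) ^+ 2 * v)) =
  (fun n => (\sum_(k < n) pois lam k * k%:R) * (u + v - 2 * lam * v) +
    (\sum_(k < n) pois lam k * (k%:R * (k%:R - 1))) * v +
    (\sum_(k < n) pois lam k) * (lam ^+ 2 * v)).
  apply/funext => n; rewrite !mulr_suml -!big_split /=; apply: eq_bigr => k _; ring.
apply: cvgD; first apply: cvgD; apply: cvgM; try exact: cvg_cst.
- exact: (@pois_mean lam).
- exact: pois_fact2.
- exact: pois_sum.
Qed.

End poisson_variable.

Section compound_poisson.
Context {R : realType}.
Local Notation P := (@coinP R).
Local Notation E X := (\int[P]_w X w)%R.
Context d (T : measurableType d) (q : coin -> T) (mq : measurable_fun setT q).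
Variables (lam : R) (lam0 : 0 <= lam).
Variables (N : coin -> nat) (mN : measurable_fun setT N).
Hypothesis PN : forall n, P (N @^-1` [set n]) = (pois lam n)%:E.

Definition isum (g : T -> R) (n : nat) (w : coin) : R := \sum_(i < n) g (q (block i w)).

(** A compound Poisson sum: the even tosses choose the number of terms, the odd
    ones the points at which g is summed. *)
Definition csum (g : T -> R) (w : coin) : R := isum g (N (evens w)) (odds w).

Lemma isumS g n w : isum g n.+1 w = g (q (evens w)) + isum g n (odds w).
Proof.
rewrite /isum big_ord_recl; congr (_ + _); apply: eq_bigr => i _.
by rewrite /block/= -iterSr.
Qed.

Lemma measurable_isum g n : measurable_fun setT g -> measurable_fun setT (isum g n).
Proof.
move=> mg; apply: measurable_sum => i.
exact: (measurableT_comp mg (measurableT_comp mq (measurable_block i))).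
Qed.

Let ind n : coin -> R := \1_(N @^-1` [set n]).

Let mNn n : measurable (N @^-1` [set n]).
Proof. by rewrite -[X in measurable X]setTI; exact: mN. Qed.

Let mind n : measurable_fun setT (ind n).
Proof. exact: measurable_indic. Qed.

Let indE n w : ind n w = (N w == n)%:R.
Proof. by rewrite /ind indicE; congr (nat_of_bool _)%:R; apply/idP/eqP; rewrite inE. Qed.

Let Eind n : E (ind n) = pois lam n.
Proof.
rewrite /Rintegral integral_indic// setIT -[RHS]/(fine (pois lam n)%:E).
by congr fine; exact: PN.
Qed.

(** Condition on the number of terms, which is independent of the points. *)
Lemma ge0_integral_mix (F : nat -> coin -> \bar R) :
  (forall n, measurable_fun setT (F n)) -> (forall n w, (0 <= F n w)%E) ->
  (\int[P]_w F (N (evens w)) (odds w) =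
   \sum_(n <oo) (pois lam n)%:E * \int[P]_w F n w)%E.
Proof.
move=> mF F0.
have m2 n : measurable_fun setT (fun w => (ind n (evens w))%:E * F n (odds w))%E.
  apply: emeasurable_funM.
    by apply/measurable_EFinP; exact: (measurableT_comp (mind n) measurable_evens).
  exact: (measurableT_comp (mF n) measurable_odds).
have i0 n w : (0 <= (ind n w)%:E)%E by rewrite lee_fin indE.
transitivity (\int[P]_w \sum_(n <oo) ((ind n (evens w))%:E * F n (odds w)))%E.
  apply: eq_integral => w _; rewrite (@nneseriesD1 _ _ (N (evens w)))//; last first.
    by move=> k _; rewrite mule_ge0.
  rewrite indE eqxx mul1e eseries0 ?adde0// => k _ /= Nk.
  by rewrite indE eq_sym (negbTE Nk) mul0e.
rewrite integral_nneseries//; last by move=> n w _; rewrite mule_ge0.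
apply: eq_eseriesr => n _.
rewrite (@ge0_integral_split R (fun z => (ind n z.1)%:E * F n z.2)%E); first last.
- by move=> z; rewrite mule_ge0.
- apply: emeasurable_funM.
    by apply/measurable_EFinP; exact: (measurableT_comp (mind n) measurable_fst).
  exact: (measurableT_comp (mF n) measurable_snd).
under eq_integral => w1 _ do rewrite /= ge0_integralZl//.
rewrite ge0_integralZr//; last 2 first.
- exact/measurable_EFinP.
- by apply: integral_ge0.
congr (_ * _)%E; rewrite integral_indic// setIT; exact: PN.
Qed.

Lemma measurable_csum g : measurable_fun setT g -> measurable_fun setT (csum g).
Proof.
move=> mg.
apply: (@measurable_fun_cvg _ _ _ _ (fun n w => \sum_(k < n) ind k (evens w) * isum g k (odds w))).
  move=> n; apply: measurable_sum => k; apply: measurable_funM.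
    exact: (measurableT_comp (mind k) measurable_evens).
  exact: (measurableT_comp (measurable_isum k mg) measurable_odds).
move=> w _; apply: cvg_near_cst; near=> n.
have Nn : (N (evens w) < n)%N by near: n; exists (N (evens w)).+1.
rewrite (bigD1 (Ordinal Nn))//= indE eqxx mul1r big1 ?addr0//.
by move=> k kN; rewrite indE eq_sym (_ : _ == _ = false) ?mul0r//; apply/negbTE.
Unshelve. all: end_near. Qed.

Lemma E_mix (F : nat -> coin -> R) : (forall n, measurable_fun setT (F n)) ->
  (forall n w, `|F n w| <= 1) ->
  measurable_fun setT (fun w => F (N (evens w)) (odds w)) ->
  \sum_(k < n) pois lam k * E (F k) @[n --> \oo] --> E (fun w => F (N (evens w)) (odds w)).
Proof.
move=> mF F1 mFN.
have Ek k : E (fun w => ind k (evens w) * F k (odds w)) = pois lam k * E (F k).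
  rewrite -Eind; apply: (@E_split_mul _ (ind k) (F k) 1 1) => //.
  by move=> w; rewrite indE; case: eqP; rewrite ?normr1 ?normr0.
have mk k : measurable_fun setT (fun w => ind k (evens w) * F k (odds w)).
  apply: measurable_funM; first exact: (measurableT_comp (mind k) measurable_evens).
  exact: (measurableT_comp (mF k) measurable_odds).
have sE w n : \sum_(k < n) ind k (evens w) * F k (odds w) =
    if (N (evens w) < n)%N then F (N (evens w)) (odds w) else 0.
  case: ifPn => Nn.
    rewrite (bigD1 (Ordinal Nn))//= indE eqxx mul1r big1 ?addr0//.
    by move=> k kN; rewrite indE eq_sym (_ : _ == _ = false) ?mul0r//; apply/negbTE.
  rewrite big1// => k _; rewrite indE (_ : _ == _ = false) ?mul0r//.
  by apply/negbTE; apply: contra Nn => /eqP ->.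
have -> : (fun n => \sum_(k < n) pois lam k * E (F k)) =
    (fun n => E (fun w => \sum_(k < n) ind k (evens w) * F k (odds w))).
  apply/funext => n; under eq_bigr do rewrite -Ek.
  elim: n => [|n ih]; first by rewrite big_ord0; under [RHS]eq_Rintegral do rewrite big_ord0;
    rewrite Rintegral_coin_cst.
  rewrite big_ord_recr/= ih; under [RHS]eq_Rintegral do rewrite big_ord_recr.
  rewrite RintegralD//.
    apply: (@bounded_integrable _ _ _ _ _ 1 coinP_oo).
      by apply: measurable_sum => k; exact: mk.
    by move=> w; rewrite sE; case: ifP => _; rewrite ?F1 ?normr0.
  apply: (@bounded_integrable _ _ _ _ _ 1 coinP_oo) => // w.
  rewrite normrM indE; case: eqP => _; rewrite ?normr1 ?mul1r//.
  by rewrite normr0 mul0r.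
apply: (@Rintegral_dominated_cvg _ _ _ _ setT _ _ (cst 1)) => //.
- by move=> n; apply: measurable_sum => k; exact: mk.
- apply: aeW => w _; apply: cvg_near_cst; near=> n; rewrite sE ifT//.
  by near: n; exists (N (evens w)).+1.
- by apply: (bounded_integrable coinP_oo (M := 1)) => // w; rewrite normr1.
- by move=> n w _; rewrite sE; case: ifP => _; rewrite ?F1 ?normr0.
Unshelve. all: end_near. Qed.

Lemma charf_isum g n : measurable_fun setT g -> charf (isum g n) = charf (g \o q) ^+ n.
Proof.
move=> mg; elim: n => [|n ih].
  rewrite expr0 /charf; apply/eqP; rewrite eq_complex /=.
  under eq_Rintegral do rewrite /isum big_ord0 cos0.
  under [X in _ && (X == _)]eq_Rintegral do rewrite /isum big_ord0 sin0.
  by rewrite !Rintegral_coin_cst !eqxx.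
rewrite exprS -ih -charf_split.
- by congr charf; apply/funext => w; rewrite isumS.
- exact: (measurableT_comp mg mq).
- exact: measurable_isum.
Qed.

(** Condition on the number n of terms: the characteristic function of n terms
    is an n-th power, and the Poisson weights sum these powers to an
    exponential. *)
Lemma charf_csum g : measurable_fun setT g ->
  charf (csum g) = cexp (lam%:C * (charf (g \o q) - 1)).
Proof.
move=> mg; pose c := charf (g \o q).
have mc := measurable_csum mg.
apply: (@ccvg_unique _ (fun n => \sum_(k < n) (pois lam k)%:C * c ^+ k)).
  have pE (u : nat -> R) (z : nat -> R[i]) n : \sum_(k < n) (u k)%:C * z k =
      (\sum_(k < n) u k * Re (z k)) +i* (\sum_(k < n) u k * Im (z k)).
    elim: n => [|n ih]; first by rewrite !big_ord0.
    rewrite !big_ord_recr /= ih; case: (z n) => a b /=.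
    by apply/eqP; rewrite eq_complex /= ?mul0r ?subr0 ?addr0 !eqxx.
  split; rewrite /charf /=.
    rewrite (_ : (fun n => _) = fun n => \sum_(k < n) pois lam k * E (cos \o isum g k)).
      2: by apply/funext => n; rewrite pE /=; apply: eq_bigr => k _; rewrite -charf_isum.
    apply: (@E_mix (fun n => cos \o isum g n)).
    - by move=> n; apply: measurable_cosX; exact: measurable_isum.
    - by move=> n w; exact: normr_cos_le1.
    - exact: (measurable_cosX mc).
  rewrite (_ : (fun n => _) = fun n => \sum_(k < n) pois lam k * E (sin \o isum g k)).
    2: by apply/funext => n; rewrite pE /=; apply: eq_bigr => k _; rewrite -charf_isum.
  apply: (@E_mix (fun n => sin \o isum g n)).
  - by move=> n; apply: measurable_sinX; exact: measurable_isum.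
  - by move=> n w; exact: normr_sin_le1.
  - exact: (measurable_sinX mc).
have -> : lam%:C * (c - 1) = lam%:C * c + (- lam)%:C.
  by rewrite mulrBr mulr1 -rmorphN.
rewrite cexpD.
have -> : cexp (- lam)%:C = (expR (- lam))%:C :> R[i].
  by rewrite /cexp /= cos0 sin0; apply/eqP; rewrite eq_complex /= !mul0r !mulr0 !mulr1 !addr0 subr0 !eqxx.
have [h1 h2] := cexp_series c lam.
have -> : (fun n => \sum_(k < n) (pois lam k)%:C * c ^+ k) =
   (fun n => (\sum_(k < n) (lam ^+ k / k`!%:R)%:C * c ^+ k) * (expR (- lam))%:C).
  apply/funext => n; rewrite mulr_suml; apply: eq_bigr => k _.
  by rewrite /pois rmorphM mulrAC.
have ReC (r : R) u : Re (u * r%:C) = Re u * r by case: u => ? ? /=; rewrite mulr0 subr0.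
have ImC (r : R) u : Im (u * r%:C) = Im u * r by case: u => ? ? /=; rewrite mulr0 add0r.
split.
  under eq_fun do rewrite ReC; rewrite ReC.
  by apply: cvgM; [exact: h1|exact: cvg_cst].
under eq_fun do rewrite ImC; rewrite ImC.
by apply: cvgM; [exact: h2|exact: cvg_cst].
Qed.

Lemma nneseries_EFin_cvg (u : nat -> R) (l : R) :
  \sum_(k < n) u k @[n --> \oo] --> l -> (\sum_(n <oo) (u n)%:E = l%:E)%E.
Proof.
move=> ul; apply/cvg_lim => //; apply: cvg_EFin.
  by apply: nearW => n; rewrite sumEFin.
rewrite (_ : _ \o _ = fun n => \sum_(k < n) u k)//.
by apply/funext => n; rewrite /= sumEFin /= big_mkord.
Qed.

Section bounded_summands.
Variables (g : T -> R) (B : R) (mg : measurable_fun setT g) (gB : forall x, `|g x| <= B).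
Let mgq : measurable_fun setT (g \o q) := measurableT_comp mg mq.
Let mu := E (g \o q).
Let s := E (fun w => (g (q w)) ^+ 2).

Let isum_le n w : `|isum g n w| <= n%:R * B.
Proof.
rewrite (le_trans (ler_norm_sum _ _ _))// -[X in X%:R](card_ord n) -sum1_card natr_sum.
by rewrite mulr_suml; apply: ler_sum => i _; rewrite mul1r.
Qed.

Let EfinE (f : coin -> R) C : measurable_fun setT f -> (forall w, `|f w| <= C) ->
  (\int[P]_w (f w)%:E = (E f)%:E)%E.
Proof.
move=> mf fC; rewrite /Rintegral fineK//; apply: integrable_fin_num => //.
exact: (bounded_integrable coinP_oo mf fC).
Qed.

Let E_evens (f : coin -> R) C : measurable_fun setT f -> (forall w, `|f w| <= C) ->
  E (f \o evens) = E f.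
Proof.
move=> mf fC; have := @E_split_mul _ f (cst 1) C 1 mf.
rewrite Rintegral_coin_cst mulr1 => <-//; last by move=> w; rewrite normr1.
by apply: eq_Rintegral => w _; rewrite mulr1.
Qed.

Let E_odds (f : coin -> R) C : measurable_fun setT f -> (forall w, `|f w| <= C) ->
  E (f \o odds) = E f.
Proof.
move=> mf fC; have := @E_split_mul _ (cst 1) f 1 C _ mf.
rewrite Rintegral_coin_cst mul1r => <-//; last by move=> w; rewrite normr1.
by apply: eq_Rintegral => w _; rewrite mul1r.
Qed.

Lemma E_isum n : E (isum g n) = n%:R * mu.
Proof.
elim: n => [|n ih].
  rewrite mul0r; under eq_Rintegral do rewrite /isum big_ord0.
  exact: Rintegral_coin_cst.
under eq_Rintegral do rewrite isumS.
have mo : measurable_fun setT (isum g n \o odds).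
  exact: (measurableT_comp (measurable_isum n mg) measurable_odds).
have me : measurable_fun setT ((g \o q) \o evens) := measurableT_comp mgq measurable_evens.
rewrite RintegralD//; first last.
- by apply: (bounded_integrable coinP_oo mo) => w; exact: isum_le.
- by apply: (bounded_integrable coinP_oo me) => w; exact: gB.
rewrite (E_odds (measurable_isum n mg) (isum_le n)) ih.
rewrite (E_evens (f := g \o q) (C := B))//; last by move=> w; exact: gB.
by rewrite -/mu -natr1; ring.
Qed.

(** Bienayme: the variance of a sum of independent terms is additive. *)
Lemma E_isum_sqr n c : E (fun w => (isum g n w - c) ^+ 2) =
  n%:R * (s - mu ^+ 2) + (n%:R * mu - c) ^+ 2.
Proof.
elim: n => [|n ih].
  rewrite !mul0r add0r sub0r; under eq_Rintegral do rewrite /isum big_ord0 sub0r.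
  exact: Rintegral_coin_cst.
pose f1 w := g (q w); pose f2 w := isum g n w - c.
have mf1 : measurable_fun setT f1 := mgq.
have mf2 : measurable_fun setT f2.
  by apply: measurable_funB => //; exact: measurable_isum.
have f2_le w : `|f2 w| <= n%:R * B + `|c|.
  by rewrite (le_trans (ler_normB _ _))// lerD2r isum_le.
have f1_le w : `|f1 w| <= B by exact: gB.
have B0 : 0 <= B by rewrite (le_trans _ (f1_le point)).
have sq (f : coin -> R) C : measurable_fun setT f -> (forall w, `|f w| <= C) ->
   measurable_fun setT (fun w => f w ^+ 2) /\ (forall w, `|f w ^+ 2| <= C ^+ 2).
  move=> mf fC; split; first exact: measurable_funX.
  by move=> w; rewrite normrX lerXn2r// nnegrE// (le_trans _ (fC w)).
have [ms1 s1] := sq _ _ mf1 f1_le; have [ms2 s2] := sq _ _ mf2 f2_le.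
have mc (f : coin -> R) C : measurable_fun setT f -> (forall w, `|f w| <= C) ->
    P.-integrable setT (EFin \o (f \o evens)) /\ P.-integrable setT (EFin \o (f \o odds)).
  move=> mf fC; split.
    apply: (bounded_integrable coinP_oo (M := C)).
      exact: (measurableT_comp mf measurable_evens).
    by move=> w; exact: fC.
  apply: (bounded_integrable coinP_oo (M := C)).
    exact: (measurableT_comp mf measurable_odds).
  by move=> w; exact: fC.
have [i1 _] := mc _ _ ms1 s1; have [_ i2] := mc _ _ ms2 s2.
have i3 : P.-integrable setT (EFin \o (fun w => f1 (evens w) * f2 (odds w))).
  apply: (bounded_integrable coinP_oo (M := B * (n%:R * B + `|c|))).
    apply: measurable_funM; first exact: (measurableT_comp mf1 measurable_evens).
    exact: (measurableT_comp mf2 measurable_odds).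
  by move=> w; rewrite normrM ler_pM.
transitivity (E (fun w => (f1 (evens w) ^+ 2 + 2 * (f1 (evens w) * f2 (odds w))) + f2 (odds w) ^+ 2)).
  by apply: eq_Rintegral => w _; rewrite isumS /f1 /f2; ring.
have i23 : P.-integrable setT (EFin \o (fun w => 2 * (f1 (evens w) * f2 (odds w)))).
  exact: (integrableZl measurableT 2 i3).
have i123 : P.-integrable setT
    (EFin \o (fun w => f1 (evens w) ^+ 2 + 2 * (f1 (evens w) * f2 (odds w)))).
  exact: (integrableD measurableT i1 i23).
rewrite RintegralD// RintegralD//.
rewrite RintegralZl// (E_split_mul mf1 mf2 f1_le f2_le).
rewrite (E_evens ms1 s1) (E_odds ms2 s2) ih.
have -> : E f2 = n%:R * mu - c.
  rewrite RintegralB//; first by rewrite E_isum Rintegral_coin_cst.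
    by apply: (bounded_integrable coinP_oo (measurable_isum n mg)) => w; exact: isum_le.
  by apply: (bounded_integrable coinP_oo (M := `|c|)).
by rewrite -/mu -/s -natr1; ring.
Qed.

(** The variance of a compound Poisson sum is lam times the second moment of a
    term. This is what makes compensated small jumps summable. *)
Lemma integral_csum_sqr :
  (\int[P]_w ((csum g w - lam * mu) ^+ 2)%:E = (lam * s)%:E)%E.
Proof.
rewrite (@ge0_integral_mix (fun n w => ((isum g n w - lam * mu) ^+ 2)%:E)); last 2 first.
- move=> n; apply/measurable_EFinP; apply: measurable_funX.
  by apply: measurable_funB => //; exact: measurable_isum.
- by move=> n w; rewrite lee_fin sqr_ge0.
have -> : lam * s = lam * ((s - mu ^+ 2) + mu ^+ 2) by rewrite subrK.
transitivity (\sum_(n <oo) (pois lam n *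
    (n%:R * (s - mu ^+ 2) + (n%:R - lam) ^+ 2 * mu ^+ 2))%:E)%E; last first.
  exact: (nneseries_EFin_cvg (@pois_second R lam (s - mu ^+ 2) (mu ^+ 2))).
apply: eq_eseriesr => n _.
rewrite (@EfinE _ ((n%:R * B + `|lam * mu|) ^+ 2)); last 2 first.
- apply: measurable_funX; by apply: measurable_funB => //; exact: measurable_isum.
- move=> w; rewrite normrX lerXn2r ?nnegrE//.
    by rewrite (le_trans _ (le_trans (ler_normB (isum g n w) (lam * mu)) _)) ?lerD2r.
  by rewrite (le_trans (ler_normB _ _))// lerD2r isum_le.
by rewrite E_isum_sqr -EFinM -mulrBl exprMn.
Qed.

(** The mean of a compound Poisson sum, by Wald's identity. *)
Lemma integral_csum : (forall x, 0 <= g x) -> (\int[P]_w (csum g w)%:E = (lam * mu)%:E)%E.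
Proof.
move=> g0; rewrite (@ge0_integral_mix (fun n w => (isum g n w)%:E)); last 2 first.
- by move=> n; apply/measurable_EFinP; exact: measurable_isum.
- by move=> n w; rewrite lee_fin sumr_ge0.
have h := cvgM (@pois_mean R lam) (cvg_cst mu).
transitivity (\sum_(n <oo) (pois lam n * n%:R * mu)%:E)%E; last first.
  apply: nneseries_EFin_cvg.
  rewrite (_ : (fun n => _) = fun n => (\sum_(k < n) pois lam k * k%:R) * mu); first exact: h.
  by apply/funext => n; rewrite mulr_suml.
apply: eq_eseriesr => n _.
by rewrite (EfinE (measurable_isum n mg) (isum_le n)) E_isum -EFinM mulrA.
Qed.

End bounded_summands.

End compound_poisson.

(** * The Haar system of an interval *)

Section indicator_integrals.
Context d (T : measurableType d) (R : realType) (mu : {measure set T -> \bar R}).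

Lemma integrable_indicM (A : set T) (f : T -> R) (C : R) : measurable A ->
  (mu A < +oo)%E -> measurable_fun setT f -> (forall x, A x -> `|f x| <= C) ->
  mu.-integrable setT (EFin \o (fun x => \1_A x * f x)).
Proof.
move=> mA Aoo mf fC.
apply: (@le_integrable _ _ _ mu _ measurableT _ (fun x => (`|C|)%:E * (\1_A x)%:E)%E).
- by apply/measurable_EFinP; apply: measurable_funM => //; exact: measurable_indic.
- move=> x _ /=; rewrite lee_fin !normrM normr_id indicE mulrC.
  case: (boolP (x \in A)) => [/set_mem xA|_]; last by rewrite normr0 !mulr0.
  by rewrite normr1 !mulr1 (le_trans (fC _ xA))// ler_norm.
- apply: integrableZl => //; apply/integrableP; split.
    by apply/measurable_EFinP; exact: measurable_indic.
  under eq_integral do rewrite gee0_abs ?lee_fin//.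
  by rewrite integral_indic// setIT.
Qed.

Lemma Rintegral_indic_cst (A : set T) (r : R) : measurable A -> (mu A < +oo)%E ->
  \int[mu]_x (\1_A x * r) = r * fine (mu A).
Proof.
move=> mA Aoo; have i1 : mu.-integrable setT (EFin \o (\1_A : T -> R)).
  apply: eq_integrable (integrable_indicM (f := cst 1) (C := 1) mA Aoo _ _) => //.
  - by move=> x _ /=; rewrite mulr1.
  - by move=> x _; rewrite normr1.
rewrite RintegralZr// mulrC; congr (_ * _).
by rewrite /Rintegral integral_indic// setIT.
Qed.

Lemma normr_Rintegral_indic (A : set T) (f : T -> R) (C : R) : measurable A ->
  (mu A < +oo)%E -> measurable_fun setT f -> (forall x, A x -> `|f x| <= C) ->
  `|\int[mu]_x (\1_A x * f x)| <= C * fine (mu A).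
Proof.
move=> mA Aoo mf fC; have fi := integrable_indicM mA Aoo mf fC.
rewrite (le_trans (le_normr_Rintegral measurableT fi))//.
rewrite -Rintegral_indic_cst//; apply: le_Rintegral => //.
- have mnf : measurable_fun setT (fun x => `|f x|) by exact: measurableT_comp.
  have nfC x : A x -> `| `|f x| | <= C by move=> Ax; rewrite normr_id fC.
  apply: eq_integrable (integrable_indicM mA Aoo mnf nfC) => //.
  by move=> x _ /=; rewrite normrM; congr EFin; congr (_ * _); rewrite ger0_norm.
- by apply: (integrable_indicM (C := `|C|)).
- move=> x _; rewrite normrM indicE; case: (boolP (x \in A)) => [/set_mem xA|_].
    by rewrite normr1 !mul1r fC.
  by rewrite normr0 !mul0r.
Qed.

End indicator_integrals.

Section dyadic_index.

Lemma sum_dyadic (V : zmodType) (F : nat -> V) J :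
  \sum_(i < 2 ^ J) F i = F 0%N + \sum_(j < J) \sum_(k < 2 ^ j) F (2 ^ j + k)%N.
Proof.
elim: J => [|J ih]; first by rewrite big_ord1 big_ord0 addr0.
rewrite big_ord_recr /= addrA -ih expnS mul2n -addnn big_split_ord /=; congr (_ + _).
Qed.

Lemma trunc_log2_dyadic j k : (k < 2 ^ j)%N -> trunc_log 2 (2 ^ j + k) = j.
Proof. by move=> kj; apply: trunc_log_eq => //; rewrite expnS; lia. Qed.

Lemma nneseries_le_dyadic (R : realType) (u : nat -> R) (K : R) : (forall i, 0 <= u i) ->
  (forall J, \sum_(i < 2 ^ J) u i <= K) -> (\sum_(i <oo) (u i)%:E <= K%:E)%E.
Proof.
move=> u0 uK; apply: lime_le.
  by apply: is_cvg_nneseries => i _ _; rewrite lee_fin.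
apply: nearW => n; rewrite sumEFin lee_fin (le_trans _ (uK n))// big_mkord.
rewrite -!(big_mkord xpredT u) (big_cat_nat (n := n) (p := 2 ^ n))//=; last first.
  by apply: ltnW; exact: ltn_expl.
by rewrite lerDl sumr_ge0.
Qed.

(** Once convergence is known, the sum may be computed along the dyadic partial
    sums, which is where the Haar expansion telescopes. *)
Lemma cvg_series_dyadic (R : realType) (u : nat -> R) (l : R) : cvgn (series u) ->
  \sum_(i < 2 ^ J) u i @[J --> \oo] --> l -> series u @ \oo --> l.
Proof.
move=> cu ul; suff <- : limn (series u) = l by exact: cu.
apply: (cvg_unique _ _ ul) => //.
have h : (fun J => (2 ^ J)%N) @ \oo --> \oo.
  apply/cvgnyPge => M; near=> J; rewrite (leq_trans (n := J))//.
    by near: J; exists M.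
  by apply: ltnW; exact: ltn_expl.
have := cvg_comp _ _ h cu; rewrite /comp /series /=.
by under eq_fun do rewrite big_mkord.
Unshelve. all: end_near. Qed.

End dyadic_index.

Section haar1.
Context {R : realType}.
Variable a : R.
Local Notation mu := (@lebesgue_measure R).
Let s : R := Num.sqrt 2.
Let s2 : s ^+ 2 = 2. Proof. by rewrite sqr_sqrtr. Qed.
Let s0 : 0 < s. Proof. by rewrite sqrtr_gt0. Qed.
Let s32 : s <= 3 / 2.
Proof. by rewrite -(@ler_pXn2r _ 2)// ?nnegrE ?(ltW s0)// s2 expr_div_n; lra. Qed.

Definition dyad (j k : nat) : set R :=
  `[a + k%:R / 2 ^+ j, a + k.+1%:R / 2 ^+ j[%classic.

Definition haar_level (j k : nat) (t : R) : R :=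
  s ^+ j * (\1_(dyad j.+1 k.*2) t - \1_(dyad j.+1 k.*2.+1) t).

(** The Haar system of [a, a + 1[ numbered by one integer: index 0 is the
    constant, and index 2^j + k the wavelet of level j on the k-th dyadic
    interval. *)
Definition haar1 (i : nat) : R -> R :=
  if i == 0%N then \1_(dyad 0 0)
  else haar_level (trunc_log 2 i) (i - 2 ^ trunc_log 2 i).

(** The size of the coefficient of a function with sup norm and Lipschitz
    constant 1: a wavelet of level j has height 2^(j/2) and mean zero on an
    interval of length 2^-j, over which the function varies by at most 2^-j. *)
Definition haar1_coef (i : nat) : R :=
  if i == 0%N then 1 else s ^+ trunc_log 2 i / 4 ^+ trunc_log 2 i.

Let haar1E j k : (k < 2 ^ j)%N -> haar1 (2 ^ j + k) = haar_level j k.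
Proof.
move=> kj; rewrite /haar1 ifF ?trunc_log2_dyadic//; first by rewrite addKn.
by apply/negbTE; rewrite -lt0n addn_gt0 expn_gt0.
Qed.

Let coefE j k : (k < 2 ^ j)%N -> haar1_coef (2 ^ j + k) = s ^+ j / 4 ^+ j.
Proof.
move=> kj; rewrite /haar1_coef ifF ?trunc_log2_dyadic//.
by apply/negbTE; rewrite -lt0n addn_gt0 expn_gt0.
Qed.

Lemma haar1_coef_ge0 i : 0 <= haar1_coef i.
Proof. by rewrite /haar1_coef; case: ifP => // _; rewrite divr_ge0 ?exprn_ge0 ?(ltW s0). Qed.

Let p2 j : 0 < 2 ^+ j :> R. Proof. by rewrite exprn_gt0. Qed.

Lemma dyadP j k t : a <= t -> dyad j k t <-> Num.truncn (2 ^+ j * (t - a)) = k.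
Proof.
move=> at0; rewrite /dyad /= in_itv/=.
have -> : (a + k%:R / 2 ^+ j <= t < a + k.+1%:R / 2 ^+ j) =
    (k%:R <= 2 ^+ j * (t - a) < k.+1%:R).
  by rewrite -lerBrDl -ltrBlDl ler_pdivrMr// ltr_pdivlMr// mulrC.
rewrite -truncn_eq; first by split => /eqP.
by rewrite mulr_ge0 ?(ltW (p2 j))// subr_ge0.
Qed.

Lemma dyad_ge j k t : dyad j k t -> a <= t.
Proof.
rewrite /dyad /= in_itv/= => /andP[h _]; apply: le_trans h.
by rewrite lerDl divr_ge0// ltW.
Qed.

Lemma dyad00 t : dyad 0 0 t <-> a <= t < a + 1.
Proof. by rewrite /dyad /= in_itv/= expr0 mul0r addr0 divr1. Qed.

Lemma measurable_dyad j k : measurable (dyad j k).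
Proof. exact: measurable_itv. Qed.
#[local] Hint Resolve measurable_dyad : core.

Lemma dyad_measure j k : mu (dyad j k) = (2 ^- j)%:E.
Proof.
rewrite /dyad lebesgue_measure_itv/= lte_fin ltrD2l ltr_pM2r ?invr_gt0//.
rewrite ltr_nat ltnSn -EFinB; congr EFin.
rewrite -natr1; field; exact: lt0r_neq0.
Qed.

Lemma dyad_measure_oo j k : (mu (dyad j k) < +oo)%E.
Proof. by rewrite dyad_measure ltry. Qed.

Lemma dyad_int_cst j k (r : R) : \int[mu]_t (\1_(dyad j k) t * r) = r / 2 ^+ j.
Proof.
rewrite Rintegral_indic_cst; [|exact: measurable_dyad|exact: dyad_measure_oo].
by congr (_ * _); rewrite -[RHS]/(fine (2 ^- j)%:E) -(dyad_measure j k).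
Qed.

Lemma dyad_int_le j k (g : R -> R) (K : R) : measurable_fun setT g ->
  (forall t, dyad j k t -> `|g t| <= K) -> `|\int[mu]_t (\1_(dyad j k) t * g t)| <= K / 2 ^+ j.
Proof.
move=> mg gK.
have := @normr_Rintegral_indic _ _ _ mu _ g K (measurable_dyad j k) (dyad_measure_oo j k) mg gK.
move=> /le_trans; apply; rewrite le_eqVlt; apply/orP; left; apply/eqP.
by congr (_ * _); rewrite -[RHS]/(fine (2 ^- j)%:E) -(dyad_measure j k).
Qed.

Let kap j t := Num.truncn (2 ^+ j * (t - a)).

Let kapS j t : a <= t -> (kap j.+1 t)./2 = kap j t.
Proof.
move=> at0; rewrite /kap exprS -mulrA truncn_half// mulr_ge0 ?(ltW (p2 j))//.
by rewrite subr_ge0.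
Qed.

Lemma dyad_split j k t : \1_(dyad j k) t =
  \1_(dyad j.+1 k.*2) t + \1_(dyad j.+1 k.*2.+1) t :> R.
Proof.
have [at0|at0] := leP a t; last first.
  have nd j' k' : (t \in dyad j' k') = false.
    by apply/negbTE; rewrite notin_setE => /dyad_ge; rewrite leNgt at0.
  by rewrite !indicE !nd addr0.
have dE j' k' : (t \in dyad j' k') = (kap j' t == k').
  by apply/idP/eqP; rewrite inE => /(dyadP j' k' at0).
rewrite !indicE !dE -(kapS j at0).
have := odd_double_half (kap j.+1 t); set m := kap j.+1 t => e.
have -> : (m == k.*2) = ~~ odd m && (m./2 == k).
  apply/eqP/andP => [->|[om /eqP <-]]; first by rewrite odd_double doubleK.
  by rewrite -[LHS]e (negbTE om).
have -> : (m == k.*2.+1) = odd m && (m./2 == k).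
  apply/eqP/andP => [->|[om /eqP <-]]; first by rewrite /= odd_double /= uphalf_double.
  by rewrite -[LHS]e om.
by case: (odd m); rewrite ?add0r ?addr0.
Qed.

Lemma dyad_sub j k : (k < 2 ^ j)%N -> dyad j k `<=` dyad 0 0.
Proof.
move=> kj t tj; apply/dyad00; have at0 := dyad_ge tj; rewrite at0/=.
move: tj; rewrite /dyad /= in_itv/= => /andP[_ h]; apply: (lt_le_trans h).
by rewrite lerD2l ler_pdivrMr// mul1r -natrX ler_nat.
Qed.

Lemma dyad_children j k : dyad j.+1 k.*2 `<=` dyad j k /\ dyad j.+1 k.*2.+1 `<=` dyad j k.
Proof.
by split => t tj; have at0 := dyad_ge tj; apply/(dyadP _ _ at0); rewrite -/(kap j t) -kapS//;
  move/(dyadP _ _ at0) : tj; rewrite -/(kap j.+1 t) => ->; rewrite ?doubleK//= uphalf_double.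
Qed.

Lemma haar_level_sqr j k t : haar_level j k t ^+ 2 = 2 ^+ j * \1_(dyad j k) t.
Proof.
rewrite /haar_level exprMn -exprM mulnC exprM s2; congr (_ * _).
have /esym := dyad_split j k t; rewrite !indicE.
by do 3!case: (_ \in _) => //=; rewrite ?subr0 ?sub0r ?sqrrN ?expr1n ?expr0n//= => /eqP;
  rewrite -?natrD ?eqr_nat.
Qed.

Lemma haar_level_abs j k t : `|haar_level j k t| = s ^+ j * \1_(dyad j k) t.
Proof.
rewrite /haar_level normrM ger0_norm ?exprn_ge0 ?(ltW s0)//; congr (_ * _).
have /esym := dyad_split j k t; rewrite !indicE.
by do 3!case: (_ \in _) => //=; rewrite ?subr0 ?sub0r ?normrN ?normr1 ?subrr ?normr0//= => /eqP;
  rewrite -?natrD ?eqr_nat.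
Qed.

Lemma measurable_haar1 i : measurable_fun setT (haar1 i).
Proof.
rewrite /haar1; case: ifP => _; first exact: measurable_indic.
by apply: measurable_funM => //; apply: measurable_funB; exact: measurable_indic.
Qed.

Lemma dyadic_index i : (0 < i)%N -> exists j k, (k < 2 ^ j)%N /\ i = (2 ^ j + k)%N.
Proof.
move=> i0; exists (trunc_log 2 i), (i - 2 ^ trunc_log 2 i)%N.
have := trunc_logP (isT : (1 < 2)%N) i0; have := trunc_log_ltn i (isT : (1 < 2)%N).
by rewrite expnS; lia.
Qed.

Lemma haar1_bounded i : exists B, forall t, `|haar1 i t| <= B.
Proof.
case: i => [|i].
  by exists 1 => t; rewrite /haar1 /= indicE; case: (_ \in _); rewrite ?normr1 ?normr0.
have [j [k [kj ->]]] := dyadic_index (ltn0Sn i); rewrite haar1E//.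
exists (s ^+ j) => t; rewrite haar_level_abs indicE; case: (_ \in _); rewrite ?mulr1//.
by rewrite mulr0 exprn_ge0 ?(ltW s0).
Qed.

Lemma haar1_supp i t : ~ (a <= t < a + 1) -> haar1 i t = 0.
Proof.
move=> /dyad00 nt; case: i => [|i].
  by rewrite /haar1 /= indicE memNset.
have [j [k [kj ->]]] := dyadic_index (ltn0Sn i); rewrite haar1E//.
apply/eqP; rewrite -normr_eq0 haar_level_abs indicE memNset ?mulr0//.
by move=> h; apply: nt; exact: (dyad_sub kj).
Qed.

Let int_dyad j k : (\int[mu]_t (\1_(dyad j k) t)%:E = (2 ^- j)%:E)%E.
Proof.
rewrite integral_indic//; last exact: measurable_dyad.
by transitivity (mu (dyad j k)); [congr (mu _); exact: setIT|exact: dyad_measure].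
Qed.

Lemma haar1_norm2 i : (\int[mu]_t ((haar1 i t) ^+ 2)%:E <= 1)%E.
Proof.
have mi j k : measurable_fun setT (fun t : R => (\1_(dyad j k) t : R)%:E).
  by apply/measurable_EFinP; exact: measurable_indic.
case: i => [|i].
  have sq t : haar1 0 t ^+ 2 = \1_(dyad 0 0) t.
    by rewrite /haar1 /= indicE; case: (_ \in _); rewrite ?expr1n ?expr0n.
  under eq_integral do rewrite sq.
  by rewrite int_dyad expr0 invr1.
have [j [k [kj ->]]] := dyadic_index (ltn0Sn i); rewrite haar1E//.
under eq_integral do rewrite haar_level_sqr EFinM.
rewrite ge0_integralZl//; last exact: mi.
by rewrite int_dyad -EFinM mulfV// gt_eqF.
Qed.

Let geo (q K : R) J : 0 <= q -> q < 1 -> 1 / (1 - q) <= K -> \sum_(j < J) q ^+ j <= K.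
Proof.
move=> q0 q1 qK; apply: le_trans qK; rewrite ler_pdivlMr ?subr_gt0//.
have := subrX1 q J => e; have : 0 <= q ^+ J by rewrite exprn_ge0.
have -> : (\sum_(j < J) q ^+ j) * (1 - q) = 1 - q ^+ J.
  by rewrite -[LHS]opprK -mulrN opprB mulrC -e opprB.
by lra.
Qed.

(** There are 2^j wavelets on level j, with bounds 2^(-3j/2): a geometric series
    of ratio 2^(-1/2). *)
Lemma haar1_coef_sum : (\sum_(i <oo) (haar1_coef i)%:E <= 5%:E)%E.
Proof.
apply: nneseries_le_dyadic => [i|J]; first exact: haar1_coef_ge0.
rewrite sum_dyadic {1}/haar1_coef /=.
rewrite (eq_bigr (fun j : 'I_J => (s / 2) ^+ j)); last first.
  move=> j _; rewrite (eq_bigr (fun=> s ^+ j / 4 ^+ j)); last by move=> k _; exact: coefE.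
  rewrite sumr_const card_ord -[_ *+ (2 ^ j)]mulr_natr natrX expr_div_n.
  have -> : 4 ^+ j = 2 ^+ j * 2 ^+ j :> R by rewrite -exprMn; congr (_ ^+ _); lra.
  by field; exact: lt0r_neq0.
have := @geo (s / 2) 4 J; rewrite divr_ge0 ?(ltW s0)// => /(_ isT) h.
have h1 : s / 2 < 1 by have := s32; lra.
have h2 : 1 / (1 - s / 2) <= 4 by rewrite ler_pdivrMr; have := s32; lra.
by have := h h1 h2; lra.
Qed.

(** At a given point only one wavelet of each level is non-zero, and it has
    height 2^(j/2): the series is bounded by a geometric series of ratio 1/2. *)
Lemma haar1_pointwise_sum t : (\sum_(i <oo) (haar1_coef i * `|haar1 i t|)%:E <= 5%:E)%E.
Proof.
apply: nneseries_le_dyadic => [i|J]; first by rewrite mulr_ge0// haar1_coef_ge0.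
rewrite (sum_dyadic (fun i => haar1_coef i * `|haar1 i t|)) {1}/haar1_coef /= mul1r.
have i1 A : `|\1_A t : R| <= 1 by rewrite indicE; case: (_ \in _); rewrite ?normr1 ?normr0.
have : \sum_(j < J) \sum_(k < 2 ^ j) haar1_coef (2 ^ j + k) * `|haar1 (2 ^ j + k) t| <=
    \sum_(j < J) (2^-1) ^+ j.
  apply: ler_sum => j _.
  rewrite (eq_bigr (fun k : 'I_(2 ^ j) => 2^-1 ^+ j * \1_(dyad j k) t)); last first.
    move=> k _; rewrite coefE// haar1E// haar_level_abs.
    have -> : 4 ^+ j = 2 ^+ j * 2 ^+ j :> R by rewrite -exprMn; congr (_ ^+ _); lra.
    rewrite exprVn mulrA; congr (_ * _); rewrite mulrAC -expr2 -exprM mulnC exprM s2.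
    by field; exact: lt0r_neq0.
  rewrite -mulr_sumr -[leRHS]mulr1 ler_wpM2l ?exprn_ge0//.
  have [at0|at0] := leP a t; last first.
    rewrite big1// => k _; rewrite indicE memNset//.
    by move=> /dyad_ge; rewrite leNgt at0.
  have dE k : \1_(dyad j k) t = (kap j t == k)%:R :> R.
    rewrite indicE; congr (nat_of_bool _)%:R.
    by apply/idP/eqP; rewrite inE => /(dyadP j k at0).
  have [kj|kj] := ltnP (kap j t) (2 ^ j).
    rewrite (bigD1 (Ordinal kj))//= dE eqxx big1 ?addr0// => k kk.
    by rewrite dE eq_sym (_ : _ == _ = false)//; apply/negbTE.
  rewrite big1// => k _; rewrite dE (_ : _ == _ = false)//.
  by apply/negbTE; apply: contraL kj => /eqP ->; rewrite -ltnNge.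
move=> /le_trans/(_ (@geo (2^-1) 2 J _ _ _)) h.
have := i1 (dyad 0 0); rewrite /haar1 /=.
suff : \sum_(j < J) \sum_(k < 2 ^ j) haar1_coef (2 ^ j + k) * `|haar1 (2 ^ j + k) t| <= 2 by lra.
have hlt : 2^-1 < 1 :> R by rewrite invf_lt1// ltr1n.
apply: h => //.
by rewrite ler_pdivrMr ?subr_gt0// mulrBr mulr1 mulfV//; lra.
Qed.

Section expansion.
Variables (f : R -> R) (C : R).
Hypothesis mf : measurable_fun setT f.
Hypothesis fC : forall t, dyad 0 0 t -> `|f t| <= C.
Hypothesis fL : forall t t', dyad 0 0 t -> dyad 0 0 t' -> `|f t - f t'| <= C * `|t - t'|.

Let int j k := \int[mu]_t (\1_(dyad j k) t * f t).

Let int_i j k : (k < 2 ^ j)%N -> mu.-integrable setT (EFin \o (fun t => \1_(dyad j k) t * f t)).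
Proof.
move=> kj; apply: (integrable_indicM (C := C)) => //; first exact: measurable_dyad.
  exact: dyad_measure_oo.
by move=> t tj; apply: fC; exact: (dyad_sub kj).
Qed.

Let lt2 j k : (k < 2 ^ j)%N -> (k.*2 < 2 ^ j.+1)%N /\ (k.*2.+1 < 2 ^ j.+1)%N.
Proof. by rewrite expnS; lia. Qed.

Let int_split j k : (k < 2 ^ j)%N -> int j k = int j.+1 k.*2 + int j.+1 k.*2.+1.
Proof.
move=> /lt2[k1 k2]; rewrite /int -RintegralD//; [|exact (int_i k1)|exact (int_i k2)].
by apply: eq_Rintegral => t _; rewrite dyad_split mulrDl.
Qed.

Let int_level j k : (k < 2 ^ j)%N ->
  \int[mu]_t (haar_level j k t * f t) = s ^+ j * (int j.+1 k.*2 - int j.+1 k.*2.+1).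
Proof.
move=> /lt2[k1 k2]; rewrite /int -RintegralB//; [|exact (int_i k1)|exact (int_i k2)].
rewrite -RintegralZl//; last exact (integrableB measurableT (int_i k1) (int_i k2)).
by apply: eq_Rintegral => t _; rewrite /haar_level; ring.
Qed.

Let int_near j k j' k' t0 : (k' < 2 ^ j')%N -> dyad j k `<=` dyad j' k' -> dyad j' k' t0 ->
  `|int j k - f t0 / 2 ^+ j| <= C / 2 ^+ j' / 2 ^+ j.
Proof.
move=> kj' sub t0j; have C0 : 0 <= C.
  by rewrite (le_trans _ (fC (dyad_sub kj' t0j))).
have -> : int j k - f t0 / 2 ^+ j = \int[mu]_t (\1_(dyad j k) t * (f t - f t0)).
  have -> : f t0 / 2 ^+ j = \int[mu]_t (\1_(dyad j k) t * f t0).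
    by rewrite dyad_int_cst.
  rewrite /int -RintegralB//.
  - by apply: eq_Rintegral => t _; rewrite mulrBr.
  - apply: (integrable_indicM (C := C)) => //; [exact: measurable_dyad|exact: dyad_measure_oo|].
    by move=> t tj; apply: fC; exact/(dyad_sub kj')/sub.
  - apply: (integrable_indicM (C := `|f t0|)) => //; first exact: measurable_dyad.
    exact: dyad_measure_oo.
apply: dyad_int_le; first exact: measurable_funB.
move=> t /sub tj; rewrite (le_trans (fL (dyad_sub kj' tj) (dyad_sub kj' t0j)))//.
rewrite ler_wpM2l//; move: tj t0j; rewrite /dyad /= !in_itv/=.
have -> : a + k'.+1%:R / 2 ^+ j' = a + k'%:R / 2 ^+ j' + (2 ^+ j')^-1.
  by rewrite -natr1 mulrDl mul1r addrA.
by move=> /andP[h1 h2] /andP[h3 h4]; rewrite ler_norml; apply/andP; split; lra.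
Qed.

Lemma haar1_coef_le i : `|\int[mu]_t (haar1 i t * f t)| <= haar1_coef i * C.
Proof.
case: i => [|i].
  rewrite /haar1 /haar1_coef /= mul1r.
  by rewrite (le_trans (dyad_int_le mf fC))// expr0 divr1.
have [j [k [kj ->]]] := dyadic_index (ltn0Sn i); rewrite haar1E// coefE// int_level//.
have [t0 t0j] : exists t0, dyad j k t0.
  exists (a + k%:R / 2 ^+ j); rewrite /dyad /= in_itv/= lexx/= ltrD2l.
  by rewrite ltr_pM2r ?invr_gt0// ltr_nat ltnSn.
have [c1 c2] := dyad_children j k.
have h1 := int_near kj c1 t0j; have h2 := int_near kj c2 t0j.
rewrite normrM ger0_norm ?exprn_ge0 ?(ltW s0)// -!mulrA ler_wpM2l ?exprn_ge0 ?(ltW s0)//.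
rewrite (_ : int _ _ - _ = (int j.+1 k.*2 - f t0 / 2 ^+ j.+1) -
  (int j.+1 k.*2.+1 - f t0 / 2 ^+ j.+1)); last by ring.
rewrite (le_trans (ler_normB _ _))// (le_trans (lerD h1 h2))//.
rewrite le_eqVlt; apply/orP; left; apply/eqP.
have -> : 4 ^+ j = 2 ^+ j * 2 ^+ j :> R by rewrite -exprMn; congr (_ ^+ _); lra.
by rewrite exprS; field; exact: lt0r_neq0.
Qed.

(** The dyadic partial sum is the mean of f over the dyadic interval around t,
    which tends to f t since f is Lipschitz. *)
Lemma haar1_expansion t : dyad 0 0 t ->
  series (fun i => (\int[mu]_t (haar1 i t * f t)) * haar1 i t) @ \oo --> f t.
Proof.
move=> t01; have at0 := dyad_ge t01.
have C0 : 0 <= C by rewrite (le_trans _ (fC t01)).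
have kapt j : (kap j t < 2 ^ j)%N.
  move/dyad00 : t01 => /andP[_ t1]; rewrite /kap truncn_lt_nat; last first.
    by rewrite mulr_ge0 ?subr_ge0// ltW.
  by rewrite natrX -[ltRHS]mulr1 ltr_pM2l// ltrBlDl.
have dk j : dyad j (kap j t) t by apply/(dyadP j _ at0).
have dE j k : \1_(dyad j k) t = (kap j t == k)%:R :> R.
  rewrite indicE; congr (nat_of_bool _)%:R.
  by apply/idP/eqP; rewrite inE => /(dyadP j k at0).
apply: cvg_series_dyadic.
  have [] // := @series_bound R (fun i => haar1_coef i * `|haar1 i t| * C)
     (fun i => (\int[mu]_t (haar1 i t * f t)) * haar1 i t).
    move=> i; rewrite normrM mulrAC ler_wpM2r// haar1_coef_le//.
  under eq_eseriesr do rewrite mulrC EFinM.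
  rewrite nneseriesZl; last by move=> i _; rewrite lee_fin mulr_ge0// haar1_coef_ge0.
  apply: (@le_lt_trans _ _ (C%:E * 5%:E)%E); last by rewrite -EFinM ltry.
  by rewrite lee_wpmul2l ?lee_fin// haar1_pointwise_sum.
pose Av j := 2 ^+ j * int j (kap j t).
have e J : \sum_(i < 2 ^ J) (\int[mu]_t (haar1 i t * f t)) * haar1 i t = Av J.
  rewrite (sum_dyadic (fun i => (\int[mu]_t (haar1 i t * f t)) * haar1 i t)).
  have e1 (j : nat) : \sum_(k < 2 ^ j) (\int[mu]_t (haar1 (2 ^ j + k) t * f t)) *
      haar1 (2 ^ j + k) t = Av j.+1 - Av j.
    rewrite (bigD1 (Ordinal (kapt j)))//= big1 ?addr0; last first.
      move=> k kk; rewrite haar1E//; apply/eqP; rewrite mulf_eq0; apply/orP; right.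
      have kk' : (kap j t == k) = false by rewrite eq_sym; exact/negbTE.
      by rewrite -normr_eq0 haar_level_abs dE kk' mulr0.
    rewrite haar1E// int_level// /haar_level !dE /Av (int_split (kapt j)).
    rewrite -(kapS j at0); have := odd_double_half (kap j.+1 t).
    set m := kap j.+1 t => em.
    have ss : s ^+ j * s ^+ j = 2 ^+ j by rewrite -expr2 -exprM mulnC exprM s2.
    set X := int _ _; set Y := int _ _; rewrite mulrACA ss exprS.
    case om: (odd m).
      have m1 : m = m./2.*2.+1 by rewrite -[LHS]em om.
      have -> : int j.+1 m = Y by rewrite /Y -m1.
      rewrite -m1 eqxx (_ : (m == m./2.*2) = false); last by apply/eqP; lia.
      by rewrite /= sub0r; ring.
    have m1 : m = m./2.*2 by rewrite -[LHS]em om.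
    have -> : int j.+1 m = X by rewrite /X -m1.
    rewrite -m1 eqxx (_ : (m == m.+1) = false); last by apply/eqP; lia.
    by rewrite /= subr0; ring.
  rewrite (eq_bigr (fun j : 'I_J => Av j.+1 - Av j)); last by move=> j _; exact: e1.
  rewrite -(big_mkord xpredT (fun j => Av j.+1 - Av j)) telescope_sumr//.
  rewrite /haar1 /= dE; have : kap 0 t = 0%N.
    by have := kapt 0%N; rewrite expn0 ltnS leqn0 => /eqP.
  by move=> k0; rewrite k0 eqxx mulr1 {2}/Av k0 expr0 mul1r /int addrC subrK.
under eq_fun do rewrite e.
apply/cvgrPdist_le => eps eps0.
have : C * 2^-1 ^+ J @[J --> \oo] --> (0 : R).
  rewrite -[X in _ --> X](mulr0 C); apply: cvgM; first exact: cvg_cst.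
  by apply: cvg_expr; rewrite ger0_norm ?invr_ge0// invf_lt1// ltr1n.
move=> /cvgrPdist_le /(_ _ eps0); apply: filterS => J.
rewrite sub0r normrN; apply: le_trans.
rewrite [leRHS]ger0_norm ?mulr_ge0 ?exprn_ge0 ?invr_ge0//.
have := int_near (kapt J) (@subset_refl _ _) (dk J).
have e2 : Av J - f t = 2 ^+ J * (int J (kap J t) - f t / 2 ^+ J).
  by rewrite /Av mulrBr; congr (_ - _); field; exact: lt0r_neq0.
move=> h; rewrite distrC e2 normrM ger0_norm ?(ltW (p2 J))//.
have -> : C * 2^-1 ^+ J = 2 ^+ J * (C / 2 ^+ J / 2 ^+ J).
  by rewrite exprVn; field; exact: lt0r_neq0.
by rewrite ler_pM2l.
Qed.

End expansion.

End haar1.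

(** * Tensor Haar systems on cubes *)

Section pairing.
Context {R : realType}.

Lemma nat_pairing : exists g : nat -> nat * nat, set_bij setT setT g.
Proof. by have /card_esym/ppcard_eqP[g] := card_nat2; exists g; exact: bij. Qed.

Variable g : nat -> nat * nat.
Hypothesis gbij : set_bij setT setT g.

Lemma nneseries_pairing (a : nat -> nat -> \bar R) : (forall i j, (0 <= a i j)%E) ->
  (\sum_(k <oo) a (g k).1 (g k).2 = \sum_(j <oo) \sum_(i <oo) a i j)%E.
Proof.
move=> a0; rewrite nneseries_esumT//.
rewrite -(@reindex_esum _ _ _ setT setT g (fun p => a p.1 p.2))//.
transitivity (\esum_(i in [set: nat]) \esum_(j in [set: nat]) a i j)%E.
  by rewrite esum_esum//; congr esum; apply/seteqP; split.
rewrite nneseries_interchange// nneseries_esumT; last by move=> i; exact: nneseries_ge0.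
by apply: eq_esum => i _; rewrite nneseries_esumT.
Qed.

Lemma nneseries_EFin_lim (u : nat -> R) : (forall i, 0 <= u i) ->
  (\sum_(i <oo) (u i)%:E < +oo)%E ->
  series u @ \oo --> fine (\sum_(i <oo) (u i)%:E)%E.
Proof.
move=> u0 uoo; have cu := nnseries_is_cvg u0 uoo.
have -> : (\sum_(n <oo) (u n)%:E)%E = (limn (series u))%:E.
  by rewrite -EFin_lim//; apply/congr_lim/funext => n; rewrite /= sumEFin.
exact: cu.
Qed.

Let ge0_series_pairing (b : nat -> nat -> R) : (forall i j, 0 <= b i j) ->
  (\sum_(j <oo) \sum_(i <oo) (b i j)%:E < +oo)%E ->
  exists U L, [/\ forall j, series (b^~ j) @ \oo --> (U j : R), series U @ \oo --> (L : R) &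
    series (fun k => b (g k).1 (g k).2) @ \oo --> L].
Proof.
move=> b0 boo; pose V j := (\sum_(i <oo) (b i j)%:E)%E.
have V0 j : (0 <= V j)%E by apply: nneseries_ge0 => i _ _; rewrite lee_fin.
have Voo j : (V j < +oo)%E.
  rewrite ltey; apply/eqP => e; move: boo.
  suff -> : (\sum_(j <oo) \sum_(i <oo) (b i j)%:E = +oo)%E by rewrite ltxx.
  exact: (nneseries_pinfty (u_ := V) (k := j)).
have VE j : (fine (V j))%:E = V j by rewrite fineK// ge0_fin_numE.
exists (fun j => fine (V j)), (fine (\sum_(j <oo) V j)%E); split.
- by move=> j; exact: (nneseries_EFin_lim (fun i => b0 i j) (Voo j)).
- have e : (\sum_(j <oo) (fine (V j))%:E = \sum_(j <oo) V j)%E.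
    by apply: eq_eseriesr => j _; exact: VE.
  by rewrite -e; apply: nneseries_EFin_lim => [j|]; [exact: (fine_ge0 (V0 j))|rewrite e].
- have := @nneseries_EFin_lim (fun k => b (g k).1 (g k).2).
  rewrite (nneseries_pairing (a := fun i j => (b i j)%:E)); last by move=> i j; rewrite lee_fin.
  by apply.
Qed.

(** Fubini for absolutely convergent double series, along an enumeration g of
    the pairs. *)
Lemma series_pairing (b : nat -> nat -> R) (s : nat -> R) (S : R) :
  (\sum_(j <oo) \sum_(i <oo) (`|b i j|)%:E < +oo)%E ->
  (forall j, series (b^~ j) @ \oo --> s j) -> series s @ \oo --> S ->
  series (fun k => b (g k).1 (g k).2) @ \oo --> S.
Proof.
move=> boo bs sS.
pose p i j : R := Num.max (b i j) 0; pose n i j : R := Num.max (- b i j) 0.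
have pn i j : [/\ 0 <= p i j, 0 <= n i j, b i j = p i j - n i j,
    p i j <= `|b i j| & n i j <= `|b i j|].
  rewrite /p /n; have [b0|/ltW b0] := leP 0 (b i j).
    by rewrite ger0_norm// max_r ?oppr_le0// subr0; split.
  by rewrite ler0_norm// max_l ?oppr_ge0// sub0r opprK; split => //; rewrite oppr_ge0.
have le_oo (u : nat -> nat -> R) : (forall i j, 0 <= u i j) ->
    (forall i j, u i j <= `|b i j|) -> (\sum_(j <oo) \sum_(i <oo) (u i j)%:E < +oo)%E.
  move=> u0 ub; apply: le_lt_trans boo; apply: lee_nneseries => [j _ _|j _].
    by apply: nneseries_ge0 => i _ _; rewrite lee_fin.
  by apply: lee_nneseries => [i _ _|i _]; rewrite lee_fin.
have [U [L [pU UL pL]]] : exists U L, [/\ forall j, series (p^~ j) @ \oo --> (U j : R),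
    series U @ \oo --> (L : R) & series (fun k => p (g k).1 (g k).2) @ \oo --> L].
  apply: ge0_series_pairing; first by move=> i j; have [] := pn i j.
  by apply: le_oo => i j; have [] := pn i j.
have [V [M [nV VM nM]]] : exists U L, [/\ forall j, series (n^~ j) @ \oo --> (U j : R),
    series U @ \oo --> (L : R) & series (fun k => n (g k).1 (g k).2) @ \oo --> L].
  apply: ge0_series_pairing; first by move=> i j; have [] := pn i j.
  by apply: le_oo => i j; have [] := pn i j.
have serB (u v : nat -> R) : series (fun k => u k - v k) = (fun m => series u m - series v m).
  by apply/funext => m; rewrite /series /= sumrB.
have sE j : s j = U j - V j.
  apply: (cvg_unique _ (bs j)) => //.
  rewrite (_ : b^~ j = fun i => p i j - n i j).
    by rewrite serB; apply: cvgB; [exact: pU|exact: nV].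
  by apply/funext => i; have [] := pn i j.
have SE : S = L - M.
  apply: (cvg_unique _ sS) => //.
  rewrite (_ : s = fun j => U j - V j); first by rewrite serB; apply: cvgB.
  exact/funext.
rewrite SE (_ : (fun k => _) = fun k => p (g k).1 (g k).2 - n (g k).1 (g k).2).
  by rewrite serB; apply: cvgB.
by apply/funext => k; have [] := pn (g k).1 (g k).2.
Qed.

End pairing.

Section rV_fubini.
Context {R : realType}.
Local Notation mu := (@lebesgue_measure R).
Local Notation leb := (@lebesgue_rV R).

Lemma uncons_rVK n : cancel (@uncons_rV R n) (@cons_rV R n).
Proof.
move=> x; have := @cons_rVK R n (uncons_rV x) => e.
have inj : injective (@uncons_rV R n).
  move=> u v /pair_equal_spec[e0 e1]; apply/rowP => i.
  case: (unliftP ord0 i) => [j|] ->//.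
  by have /rowP/(_ j) := e1; rewrite !mxE.
exact: inj.
Qed.

(** The measure of dimension n + 1 is the image under cons_rV of a product
    measure. *)
Lemma rV_fubini_ge0 n (F : 'rV[R]_n.+1 -> \bar R) : measurable_fun setT F ->
  (forall x, (0 <= F x)%E) ->
  (\int[leb n.+1]_x F x = \int[mu]_t \int[leb n]_y F (cons_rV (t, y)))%E.
Proof.
move=> mF F0; rewrite /= /lebesgue_rVS (ge0_integral_pushforward (@measurable_cons_rV R n))//=.
rewrite -(@fubini_tonelli1 _ _ _ _ _ mu (leb n) (F \o @cons_rV R n))//.
  exact: (measurableT_comp mF (@measurable_cons_rV R n)).
by move=> x; exact: F0.
Qed.

Lemma rV_fubini n (F : 'rV[R]_n.+1 -> R) : (leb n.+1).-integrable setT (EFin \o F) ->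
  (forall t, (leb n).-integrable setT (fun y => (F (cons_rV (t, y)))%:E)) ->
  measurable_fun setT (fun t : R => \int[leb n]_y F (cons_rV (t, y))) /\
  \int[leb n.+1]_x F x = \int[mu]_t \int[leb n]_y F (cons_rV (t, y)).
Proof.
move=> iF iFt; have mF := measurable_int _ iF.
pose G := EFin \o F \o @cons_rV R n.
have mG : measurable_fun setT G.
  exact: (measurableT_comp mF (@measurable_cons_rV R n)).
have iG : (mu \x leb n)%E.-integrable setT G.
  apply/integrableP; split => //.
  have /integrableP[_] := iF; rewrite /= /lebesgue_rVS.
  rewrite (ge0_integral_pushforward (@measurable_cons_rV R n))//.
  by apply/measurable_EFinP; apply: measurableT_comp => //; exact/measurable_EFinP.
have inE t : (\int[leb n]_y G (t, y) = (\int[leb n]_y F (cons_rV (t, y)))%:E)%E.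
  by rewrite /Rintegral fineK//; apply: integrable_fin_num => //; exact: iFt.
split.
  have := measurable_fubini_F iG; rewrite /fubini_F.
  under eq_fun do rewrite inE.
  by move=> /measurable_EFinP.
rewrite /Rintegral; congr fine.
under [RHS]eq_integral do rewrite -inE.
rewrite [RHS](integral12_prod_meas1 iG) /= /lebesgue_rVS (integral_pushforward (@measurable_cons_rV R n))//.
Qed.

End rV_fubini.

Section haar_frame.
Context {R : realType}.
Local Notation mu := (@lebesgue_measure R).
Local Notation leb := (@lebesgue_rV R).

Definition ntail (a : nat -> R) : nat -> R := fun i => a i.+1.

Definition ucube n (a : nat -> R) : set 'rV[R]_n :=
  [set x | forall i : 'I_n, a i <= x ord0 i < a i + 1].

(** Bounds of size C on all mixed differences: for a smooth function this says
    that the mixed first derivatives, at most one in each direction, are bounded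
    by C. It is the regularity that one Haar expansion in each variable
    consumes. *)
Fixpoint mixed_lipschitz n (a : nat -> R) (C : R) : ('rV[R]_n -> R) -> Prop :=
  match n with
  | 0 => fun g => forall x, `|g x| <= C
  | m.+1 => fun g =>
    (forall t, a 0%N <= t < a 0%N + 1 ->
      mixed_lipschitz (ntail a) C (fun y => g (cons_rV (t, y)))) /\
    (forall t t', a 0%N <= t < a 0%N + 1 -> a 0%N <= t' < a 0%N + 1 ->
      mixed_lipschitz (ntail a) (C * `|t - t'|)
        (fun y => g (cons_rV (t, y)) - g (cons_rV (t', y))))
  end.

Lemma ucube_cons n a t y : ucube a (cons_rV (t, y) : 'rV[R]_n.+1) <->
  a 0%N <= t < a 0%N + 1 /\ ucube (ntail a) y.
Proof.
have := cons_rVK (t, y) => -[e0 e1].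
have e0' : (cons_rV (t, y) : 'rV[R]_n.+1) ord0 ord0 = t by [].
have ej j : (cons_rV (t, y) : 'rV[R]_n.+1) ord0 (lift ord0 j) = y ord0 j.
  by rewrite -[in RHS]e1 mxE.
split=> [h|[h1 h2] i].
  by split; [have := h ord0; rewrite e0'|move=> i; have := h (lift ord0 i); rewrite ej].
by case: (unliftP ord0 i) => [j|] ->; [rewrite ej; exact: h2|rewrite e0'].
Qed.

Lemma measurable_ucube n a : measurable (@ucube n a).
Proof.
apply: (@measurable_box_rV R n (fun i => `[a i, a i + 1[%classic)) => i.
exact: measurable_itv.
Qed.

Lemma lebesgue_ucube n a : leb n (@ucube n a) = 1%E.
Proof.
transitivity (\prod_(i < n) lebesgue_measure (`[a i, (a i + 1)%R[%classic : set R))%E.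
  rewrite -lebesgue_rV_box; last by move=> i; exact: measurable_itv.
  by congr (leb n _); apply/seteqP; split => x h i; have := h i; rewrite /= ?in_itv.
apply: big1 => i _; transitivity ((a i + 1)%R%:E - (a i)%:E)%E.
  by rewrite lebesgue_measure_itv/= lte_fin ltrDl ltr01.
by rewrite -EFinB addrAC subrr add0r.
Qed.

Lemma mixed_lipschitz_le n a C (g : 'rV[R]_n -> R) : mixed_lipschitz a C g ->
  forall x, ucube a x -> `|g x| <= C.
Proof.
elim: n a C g => [|n ih] a C g /=; first by move=> h x _; exact: h.
move=> [h _] x; rewrite -(uncons_rVK x); case: (uncons_rV x) => t y.
by move=> /ucube_cons[/h gt /(ih _ _ _ gt)].
Qed.

Lemma mixed_lipschitz_ext n a C (g g' : 'rV[R]_n -> R) :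
  (forall x, ucube a x -> g x = g' x) -> mixed_lipschitz a C g -> mixed_lipschitz a C g'.
Proof.
elim: n a C g g' => [|n ih] a C g g' e /=.
  by move=> h x; rewrite -e// => -[].
move=> [h1 h2]; split => [t ht|t t' ht ht'].
  by apply: ih (h1 t ht) => y hy; apply: e; apply/ucube_cons.
by apply: ih (h2 t t' ht ht') => y hy; rewrite !e//; apply/ucube_cons.
Qed.

(** What is needed of a Haar basis of the cube: normalized functions h and
    bounds c, summable both in total and at every point against |h|, such that
    functions of mixed Lipschitz size C have coefficients at most c * C and are
    the pointwise sum of their expansions. *)
Definition haar_frame n a (h : nat -> 'rV[R]_n -> R) (c : nat -> R) (K : R) :=
  [/\ [/\ forall i, measurable_fun setT (h i), forall i, exists B, forall x, `|h i x| <= B &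
          forall i x, ~ ucube a x -> h i x = 0],
      forall i, (\int[leb n]_x ((h i x) ^+ 2)%:E <= 1)%E,
      [/\ forall i, 0 <= c i, (\sum_(i <oo) (c i)%:E <= K%:E)%E &
          forall x, (\sum_(i <oo) (c i * `|h i x|)%:E <= K%:E)%E],
      forall g C, measurable_fun setT g -> mixed_lipschitz a C g ->
        forall i, `|\int[leb n]_x (h i x * g x)| <= c i * C &
      forall g C, measurable_fun setT g -> mixed_lipschitz a C g ->
        forall x, ucube a x ->
        series (fun i => (\int[leb n]_x (h i x * g x)) * h i x) @ \oo --> g x].

Lemma integrable_ucube n a (f : 'rV[R]_n -> R) C : measurable_fun setT f ->
  (forall x, ucube a x -> `|f x| <= C) -> (forall x, ~ ucube a x -> f x = 0) ->
  (leb n).-integrable setT (EFin \o f).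
Proof.
move=> mf fC f0.
have Aoo : (leb n (@ucube n a) < +oo)%E.
  by have -> : leb n (@ucube n a) = 1%E by [exact: lebesgue_ucube]; rewrite ltry.
apply: eq_integrable (@integrable_indicM _ _ _ (leb n) (ucube a) f C (@measurable_ucube n a) Aoo mf fC) => // x _ /=.
rewrite indicE; case: (boolP (x \in ucube a)) => [_|]; first by rewrite mul1r.
by rewrite notin_setE => /f0 ->; rewrite mulr0.
Qed.

Let leb0 (f : 'rV[R]_0 -> R) : measurable_fun setT f -> \int[leb 0]_x f x = f 0.
Proof.
move=> mf; rewrite /Rintegral /= integral_dirac//; last exact/measurable_EFinP.
by rewrite diracT mul1e.
Qed.

Lemma haar_frame0 a : @haar_frame 0 a (fun i _ => (i == 0%N)%:R) (fun i => (i == 0%N)%:R) 1.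
Proof.
have x0 (x : 'rV[R]_0) : x = 0 by apply/rowP => -[].
have s1 (u : nat -> R) : (forall i, i != 0%N -> u i = 0) -> 0 <= u 0%N ->
    (\sum_(i <oo) (u i)%:E = (u 0%N)%:E)%E.
  move=> ui u0; have un i : (0 <= (u i)%:E)%E.
    by rewrite lee_fin; case: (eqVneq i 0%N) => [->//|/ui ->].
  rewrite (@nneseriesD1 _ _ 0%N)// eseries0 ?adde0// => i _ /= i0.
  by rewrite ui.
split.
- split => [i|i|i x nx]; first exact: measurable_cst.
    by exists 1 => _; case: eqP; rewrite ?normr1 ?normr0.
  by exfalso; apply: nx => -[].
- move=> i; apply: (@le_trans _ _ (\int[leb 0]_x 1)%E).
    apply: ge0_le_integral => //; try by move=> x _; rewrite lee_fin sqr_ge0.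
    by move=> x _; rewrite lee_fin; case: eqP; rewrite ?expr1n ?expr0n.
  by rewrite integral_cst// mul1e /= diracT.
- split => [i|| x]; first by [].
    by rewrite (s1 (fun i => (i == 0%N)%:R))// => i /negbTE ->.
  rewrite (s1 (fun i => (i == 0%N)%:R * `|(i == 0%N)%:R|))/= ?mul1r ?normr1//.
  by move=> i /negbTE ->; rewrite mul0r.
- move=> g C mg gC i; rewrite leb0; last exact: measurable_funM.
  by case: eqP => _; rewrite ?mul1r ?mul0r ?normr0// gC.
- move=> g C mg gC x _; rewrite (x0 x).
  have leb0' i : \int[leb 0]_x ((i == 0%N)%:R * g x) = (i == 0%N)%:R * g 0.
    by rewrite leb0//; exact: measurable_funM.
  under [X in series X]eq_fun do rewrite leb0'.
  apply: cvg_near_cst; near=> m.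
  have m0 : (0 < m)%N by near: m; exists 1%N.
  rewrite -(prednK m0) /series /= big_nat_recl//= big1_seq ?addr0 ?mul1r ?mulr1//.
  by move=> i _; rewrite mulr0.
Unshelve. all: end_near. Qed.

Section step.
Variables (n : nat) (a : nat -> R) (h' : nat -> 'rV[R]_n -> R) (c' : nat -> R) (K' : R).
Hypothesis fr : haar_frame (ntail a) h' c' K'.
Variable pr : nat -> nat * nat.
Hypothesis prb : set_bij setT setT pr.

Let hh (i j : nat) (x : 'rV[R]_n.+1) : R :=
  haar1 (a 0%N) i (uncons_rV x).1 * h' j (uncons_rV x).2.

Definition frame_step (k : nat) := hh (pr k).1 (pr k).2.
Definition coef_step (k : nat) : R := haar1_coef (pr k).1 * c' (pr k).2.

Let hhE i j t y : hh i j (cons_rV (t, y)) = haar1 (a 0%N) i t * h' j y.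
Proof. by rewrite /hh cons_rVK. Qed.

Let mhh i j : measurable_fun setT (hh i j).
Proof.
have [[m1 _ _] _ _ _ _] := fr; have mu' := @measurable_uncons_rV R n.
apply: measurable_funM.
  apply: (measurableT_comp (measurable_haar1 (a 0%N) i)).
  exact: (measurableT_comp measurable_fst mu').
apply: (measurableT_comp (m1 j)); exact: (measurableT_comp measurable_snd mu').
Qed.

Let hh_supp i j x : ~ ucube a x -> hh i j x = 0.
Proof.
have [[_ _ s1] _ _ _ _] := fr.
rewrite -(uncons_rVK x); case: (uncons_rV x) => t y nx; rewrite hhE.
have [ty|ty] := pselect (a 0%N <= t < a 0%N + 1); last by rewrite haar1_supp// mul0r.
by rewrite s1 ?mulr0// => hy; apply: nx; apply/ucube_cons.
Qed.

Let hh_bounded i j : exists B, forall x, `|hh i j x| <= B.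
Proof.
have [[_ b1 _] _ _ _ _] := fr.
have [B1 hB1] := haar1_bounded (a 0%N) i; have [B2 hB2] := b1 j.
by exists (B1 * B2) => x; rewrite normrM ler_pM.
Qed.

Section fixed_g.
Variables (g : 'rV[R]_n.+1 -> R) (C : R).
Hypothesis mg : measurable_fun setT g.
Hypothesis gC : forall x, `|g x| <= C.
Hypothesis gS : forall x, ~ ucube a x -> g x = 0.
Hypothesis g_lip : mixed_lipschitz a C g.

Let f j t := \int[leb n]_y (h' j y * g (cons_rV (t, y))).

Let cons_m t : measurable_fun setT (fun y : 'rV[R]_n => cons_rV (t, y)).
Proof.
apply: (measurableT_comp (@measurable_cons_rV R n)).
exact: pair1_measurable.
Qed.

Let gt_m t : measurable_fun setT (fun y : 'rV[R]_n => g (cons_rV (t, y))).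
Proof. exact: (measurableT_comp mg (cons_m t)). Qed.

Let f_int j t : (leb n).-integrable setT (fun y => (h' j y * g (cons_rV (t, y)))%:E).
Proof.
have [[m1 b1 s1] _ _ _ _] := fr; have [B hB] := b1 j.
apply: (@integrable_ucube n (ntail a) (fun y => h' j y * g (cons_rV (t, y))) (B * C)).
- exact: measurable_funM.
- by move=> y _; rewrite normrM ler_pM.
- by move=> y /s1 ->; rewrite mul0r.
Qed.

Let f_meas j : measurable_fun setT (f j).
Proof.
have [[m1 b1 s1] _ _ _ _] := fr; have [B hB] := b1 j.
have mF : measurable_fun setT (fun x : 'rV[R]_n.+1 => h' j (uncons_rV x).2 * g x).
  apply: measurable_funM => //.
  exact: (measurableT_comp (m1 j) (measurableT_comp measurable_snd (@measurable_uncons_rV R n))).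
have [] := @rV_fubini R n (fun x => h' j (uncons_rV x).2 * g x).
- apply: (integrable_ucube (a := a) (C := B * C)) => //.
    by move=> x _; rewrite normrM ler_pM.
  by move=> x /gS ->; rewrite mulr0.
- by move=> t; under eq_fun do rewrite cons_rVK; exact: f_int.
by move=> + _; under eq_fun do under eq_Rintegral do rewrite cons_rVK.
Qed.

Let f_le j t : dyad (a 0%N) 0 0 t -> `|f j t| <= c' j * C.
Proof.
move=> /dyad00 ht; have [_ _ _ v _] := fr.
by apply: v; [exact: gt_m|exact: (g_lip.1 t ht)].
Qed.

Let f_lip j t t' : dyad (a 0%N) 0 0 t -> dyad (a 0%N) 0 0 t' ->
  `|f j t - f j t'| <= c' j * C * `|t - t'|.
Proof.
move=> /dyad00 ht /dyad00 ht'; have [_ _ _ v _] := fr.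
rewrite /f -RintegralB//; [|exact (f_int j t)|exact (f_int j t')].
rewrite -mulrA; under eq_Rintegral do rewrite -mulrBr.
by apply: v; [exact: measurable_funB|exact: (g_lip.2 t t' ht ht')].
Qed.

Let coefE i j : \int[leb n.+1]_x (hh i j x * g x) =
  \int[mu]_t (haar1 (a 0%N) i t * f j t).
Proof.
have [B hB] := hh_bounded i j.
have [] := @rV_fubini R n (fun x => hh i j x * g x).
- apply: (integrable_ucube (a := a) (C := B * C)).
  + exact: measurable_funM.
  + by move=> x _; rewrite normrM ler_pM.
  + by move=> x /gS ->; rewrite mulr0.
- move=> t; under eq_fun do rewrite hhE -mulrA EFinM.
  by apply: integrableZl => //; exact: f_int.
move=> _ ->; apply: eq_Rintegral => t _.
rewrite /f -RintegralZl//; last exact: f_int.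
by apply: eq_Rintegral => y _; rewrite hhE mulrA.
Qed.

Let C0 : 0 <= C. Proof. exact: le_trans (gC 0). Qed.
Let c0 j : 0 <= c' j. Proof. by have [_ _ [] ] := fr. Qed.

Let coef_le i j : `|\int[leb n.+1]_x (hh i j x * g x)| <= haar1_coef i * c' j * C.
Proof. by rewrite coefE -mulrA; exact: (haar1_coef_le (f_meas j) (f_le j) (f_lip j) i). Qed.

Lemma coef_step_le k : `|\int[leb n.+1]_x (frame_step k x * g x)| <= coef_step k * C.
Proof. exact: coef_le. Qed.

Lemma expansion_step x : ucube a x ->
  series (fun k => (\int[leb n.+1]_x (frame_step k x * g x)) * frame_step k x) @ \oo --> g x.
Proof.
rewrite -(uncons_rVK x); case: (uncons_rV x) => t y /ucube_cons[ht hy].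
have tI : dyad (a 0%N) 0 0 t by apply/dyad00.
have [_ _ [_ _ psum] _ e'] := fr.
apply: (@series_pairing R pr prb
  (fun i j => (\int[leb n.+1]_x (hh i j x * g x)) * hh i j (cons_rV (t, y)))
  (fun j => f j t * h' j y)).
- apply: (@le_lt_trans _ _ (\sum_(j <oo) ((C * (c' j * `|h' j y|))%:E * 5%:E))%E).
    apply: lee_nneseries => [j _ _|j _]; first by apply: nneseries_ge0.
    have w0 : 0 <= C * (c' j * `|h' j y|) by rewrite !mulr_ge0.
    apply: (@le_trans _ _ ((C * (c' j * `|h' j y|))%:E *
       \sum_(i <oo) (haar1_coef i * `|haar1 (a 0%N) i t|)%:E)%E).
      rewrite -nneseriesZl; last by move=> i _; rewrite lee_fin mulr_ge0// haar1_coef_ge0.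
      apply: lee_nneseries => // i _; rewrite -EFinM lee_fin hhE !normrM.
      have := coef_le i j; have := normr_ge0 (haar1 (a 0%N) i t); have := normr_ge0 (h' j y).
      move=> p1 p2 p3.
      rewrite (le_trans (ler_wpM2r (mulr_ge0 p2 p1) p3))//.
      by rewrite le_eqVlt; apply/orP; left; apply/eqP; ring.
    by rewrite lee_wpmul2l ?lee_fin// haar1_pointwise_sum.
  under eq_eseriesr do rewrite muleC EFinM muleA.
  rewrite -EFinM nneseriesZl; last by move=> j _; rewrite lee_fin mulr_ge0.
  apply: (@le_lt_trans _ _ ((5 * C)%:E * K'%:E)%E); last by rewrite -EFinM ltry.
  by rewrite lee_wpmul2l ?lee_fin ?mulr_ge0.
- move=> j; have he := haar1_expansion (f_meas j) (f_le j) (f_lip j) tI.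
  have -> : series (fun i => \int[leb n.+1]_x (hh i j x * g x) * hh i j (cons_rV (t, y))) =
      (fun m => series (fun i => (\int[mu]_t (haar1 (a 0%N) i t * f j t)) * haar1 (a 0%N) i t) m
         * h' j y).
    apply/funext => m; rewrite /series /= mulr_suml; apply: eq_bigr => i _.
    by rewrite coefE hhE mulrA.
  by apply: cvgM; [exact: he|exact: cvg_cst].
- exact: (e' _ C (gt_m t) (g_lip.1 t ht) y hy).
Qed.

End fixed_g.

Let trunc_g (g : 'rV[R]_n.+1 -> R) x := \1_(ucube a) x * g x.

Let trunc_gE g x : ucube a x -> trunc_g g x = g x.
Proof. by move=> ax; rewrite /trunc_g indicE mem_set// mul1r. Qed.

Let trunc_g0 g x : ~ ucube a x -> trunc_g g x = 0.
Proof. by move=> ax; rewrite /trunc_g indicE memNset// mul0r. Qed.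

Let trunc_int g k : \int[leb n.+1]_x (frame_step k x * g x) =
  \int[leb n.+1]_x (frame_step k x * trunc_g g x).
Proof.
apply: eq_Rintegral => x _; have [ax|ax] := pselect (ucube a x).
  by rewrite trunc_gE.
by rewrite /frame_step hh_supp// !mul0r.
Qed.

(** Tensor a Haar basis in the first variable with a system in the others: the
    coefficient of g is a Haar coefficient of the partial coefficients t |->
    f_j(t), which are again Lipschitz of size c'_j * C by the mixed condition.
    Both summability bounds are products. *)
Lemma haar_frameS : haar_frame a frame_step coef_step (5 * K').
Proof.
have [[m1 b1 s1] n1 [c0 csum psum] _ _] := fr.
have K0 : 0 <= K' by rewrite -lee_fin (le_trans _ csum)//; apply: nneseries_ge0 => i _ _; rewrite lee_fin.
have pr1 (u : nat -> nat -> R) (v w : nat -> R) K1 : (forall i, 0 <= v i) -> (forall j, 0 <= w j) ->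
   (forall i j, u i j = v i * w j) -> (\sum_(i <oo) (v i)%:E <= 5%:E)%E ->
   (\sum_(j <oo) (w j)%:E <= K1%:E)%E ->
   (\sum_(k <oo) (u (pr k).1 (pr k).2)%:E <= (5 * K1)%:E)%E.
  move=> v0 w0 uE sv sw.
  rewrite (nneseries_pairing prb (a := fun i j => (u i j)%:E)); last first.
    by move=> i j; rewrite lee_fin uE mulr_ge0.
  apply: (@le_trans _ _ (\sum_(j <oo) (5%:E * (w j)%:E))%E).
    apply: lee_nneseries => [j _ _|j _].
      by apply: nneseries_ge0 => i _ _; rewrite lee_fin uE mulr_ge0.
    under eq_eseriesr do rewrite uE mulrC EFinM.
    rewrite nneseriesZl; last by move=> i _; rewrite lee_fin.
    by rewrite muleC lee_wpmul2r// lee_fin.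
  by rewrite nneseriesZl ?EFinM ?lee_wpmul2l// => j _; rewrite lee_fin.
split.
- by split => [k|k|k x]; [exact: mhh|exact: hh_bounded|exact: hh_supp].
- move=> k; have mk := mhh (pr k).1 (pr k).2.
  rewrite rV_fubini_ge0; last 2 first.
  + by apply/measurable_EFinP; exact: measurable_funX.
  + by move=> x; rewrite lee_fin sqr_ge0.
  apply: (@le_trans _ _ (\int[mu]_t ((haar1 (a 0%N) (pr k).1 t) ^+ 2)%:E)%E); last first.
    exact: haar1_norm2.
  have m2 : measurable_fun setT (fun y : 'rV[R]_n => ((h' (pr k).2 y) ^+ 2)%:E).
    by apply/measurable_EFinP; exact: measurable_funX.
  have m3 : measurable_fun setT (fun t : R => ((haar1 (a 0%N) (pr k).1 t) ^+ 2)%:E).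
    by apply/measurable_EFinP; apply: measurable_funX; exact: measurable_haar1.
  have eqi t : (\int[leb n]_y ((frame_step k (cons_rV (t, y)) ^+ 2)%:E) =
      ((haar1 (a 0%N) (pr k).1 t) ^+ 2)%:E * \int[leb n]_y ((h' (pr k).2 y) ^+ 2)%:E)%E.
    rewrite -ge0_integralZl//; last by rewrite lee_fin sqr_ge0.
      by apply: eq_integral => y _; rewrite /frame_step hhE exprMn EFinM.
    by move=> y _; rewrite lee_fin sqr_ge0.
  under eq_integral do rewrite eqi.
  rewrite ge0_integralZr//; last 2 first.
  + by move=> t _; rewrite lee_fin sqr_ge0.
  + by apply: integral_ge0 => y _; rewrite lee_fin sqr_ge0.
  rewrite -[leRHS]mule1 lee_wpmul2l//.
  by apply: integral_ge0 => t _; rewrite lee_fin sqr_ge0.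
- split=> [k||x].
  + by rewrite mulr_ge0// haar1_coef_ge0.
  + apply: (pr1 (fun i j => haar1_coef i * c' j) haar1_coef c') => //.
    * exact: haar1_coef_ge0.
    * exact: haar1_coef_sum.
  + rewrite -(uncons_rVK x); case: (uncons_rV x) => t y.
    apply: (pr1 (fun i j => haar1_coef i * c' j * `|hh i j (cons_rV (t, y))|)
      (fun i => haar1_coef i * `|haar1 (a 0%N) i t|) (fun j => c' j * `|h' j y|)).
    * by move=> i; rewrite mulr_ge0// haar1_coef_ge0.
    * by move=> j; rewrite mulr_ge0.
    * by move=> i j; rewrite hhE normrM mulrACA.
    * exact: haar1_pointwise_sum.
    * exact: psum.
- move=> g C mg gC k; rewrite trunc_int.
  apply: coef_step_le.
  + by apply: measurable_funM => //; apply: measurable_indic; exact: measurable_ucube.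
  + move=> x; have [ax|ax] := pselect (ucube a x).
      by rewrite trunc_gE//; exact: (mixed_lipschitz_le gC).
    rewrite trunc_g0// normr0.
    have a0 : ucube a (\row_(i < n.+1) a i) by move=> i; rewrite mxE lexx ltrDl ltr01.
    exact: le_trans (mixed_lipschitz_le gC a0).
  + by move=> x; exact: trunc_g0.
  + by apply: mixed_lipschitz_ext gC => x ax; rewrite trunc_gE.
- move=> g C mg gC x ax.
  rewrite (_ : (fun i => _) = fun k => (\int[leb n.+1]_x (frame_step k x * trunc_g g x)) * frame_step k x).
    2: by apply/funext => k; rewrite trunc_int.
  rewrite -(trunc_gE g ax); apply: (expansion_step (C := C)) => //.
  + by apply: measurable_funM => //; apply: measurable_indic; exact: measurable_ucube.
  + move=> z; have [az|az] := pselect (ucube a z).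
      by rewrite trunc_gE//; exact: (mixed_lipschitz_le gC).
    by rewrite trunc_g0// normr0 (le_trans _ (mixed_lipschitz_le gC ax)).
  + by move=> z; exact: trunc_g0.
  + by apply: mixed_lipschitz_ext gC => z az; rewrite trunc_gE.
Qed.

End step.

Lemma haar_frame_exists n : forall a : nat -> R, exists h c, @haar_frame n a h c (5 ^+ n).
Proof.
elim: n => [|n ih] a.
  by do 2!eexists; rewrite expr0; exact: haar_frame0.
have [h' [c' fr]] := ih (ntail a); have [pr prb] := nat_pairing.
exists (frame_step a h' pr), (coef_step c' pr).
by rewrite exprS; exact: haar_frameS.
Qed.

End haar_frame.

(** * Mixed derivatives and mixed Lipschitz bounds *)

Lemma measurable_nat_mix d (T : measurableType d) d' (U : measurableType d') (N : T -> nat)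
    (F : nat -> T -> U) : measurable_fun setT N ->
  (forall n, measurable_fun setT (F n)) -> measurable_fun setT (fun x => F (N x) x).
Proof.
move=> mN mF _ B mB; rewrite setTI.
rewrite (_ : _ @^-1` B = \bigcup_n ((N @^-1` [set n]) `&` (F n @^-1` B))).
  apply: bigcupT_measurable => n; apply: measurableI.
    by rewrite -[X in measurable X]setTI; exact: mN.
  by rewrite -[X in measurable X]setTI; exact: mF.
by apply/seteqP; split => [x Bx|x [n _ [/= <-]]//]; exists (N x).
Qed.

Lemma measurable_pickle_floor {R : realType} (c : R) :
  measurable_fun setT (fun t : R => pickle (Num.floor (c * t))).
Proof.
apply: measurable_fun_to_nat => k.
have mc : measurable_fun [set: R] (fun x : R => c * x) by exact: measurable_funM.
case e : (unpickle k : option int) => [z|]; last first.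
  rewrite (_ : _ @^-1` _ = set0)//; apply/seteqP; split => // t /= tk.
  by move: e; rewrite -tk pickleK.
rewrite (_ : _ @^-1` _ = (if pickle z == k then
    (fun x => c * x) @^-1` `[z%:~R, (z + 1)%:~R[%classic else set0)).
  case: eqP => // _; rewrite -[X in measurable X]setTI; exact: (mc measurableT _ (measurable_itv _)).
apply/seteqP; split => t /=.
  move=> tk; have e' : Num.floor (c * t) = z by move: e; rewrite -tk pickleK => -[].
  rewrite -e' tk eqxx /=; rewrite in_itv /=; exact: floor_itv.
by case: eqP => // <-; rewrite /= in_itv /= -floor_eq => /eqP ->.
Qed.

Section smooth_slices.
Context {R : realType}.
Implicit Types (n : nat).

Lemma derive_along_line (U V : normedModType R) (f : U -> R) (g : V -> R) x y v w :
  (forall h, f (h *: v + x) = g (h *: w + y)) ->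
  'D_v f x = 'D_w g y /\ (derivable f x v <-> derivable g y w).
Proof.
move=> fg; have fxy : f x = g y by have := fg 0; rewrite !scale0r !add0r.
suff e : (fun h : R => h^-1 *: ((f \o shift x) (h *: v) - f x)) =
    (fun h : R => h^-1 *: ((g \o shift y) (h *: w) - g y)).
  by rewrite /derive /derivable e.
by apply/funext => h /=; rewrite fg fxy.
Qed.

(** Only directional derivatives along coordinates are retained, because this
    form of smoothness passes to slices. *)
Definition lsmooth n (f : 'rV[R]_n -> R) :=
  forall (s : seq 'I_n) x i, derivable (foldr partial f s) x (delta_mx ord0 i).

Lemma smooth_lsmooth n (f : 'rV[R]_n -> R) : smooth f -> lsmooth f.
Proof. by move=> sf s x i; apply: diff_derivable; exact: sf. Qed.

Lemma foldr_partialB n (f g : 'rV[R]_n -> R) s : lsmooth f -> lsmooth g ->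
  foldr partial (f - g) s = foldr partial f s - foldr partial g s.
Proof.
move=> lf lg; elim: s => //= i s ->; apply/funext => x.
by rewrite /partial deriveB.
Qed.

Lemma lsmoothB n (f g : 'rV[R]_n -> R) : lsmooth f -> lsmooth g -> lsmooth (f - g).
Proof. by move=> lf lg s x i; rewrite foldr_partialB//; exact: derivableB. Qed.

Lemma cons_rV0 n t (y : 'rV[R]_n) : (cons_rV (t, y) : 'rV[R]_n.+1) ord0 ord0 = t.
Proof. by have := cons_rVK (t, y) => -[e0 _]. Qed.

Lemma cons_rV_lift n t (y : 'rV[R]_n) j :
  (cons_rV (t, y) : 'rV[R]_n.+1) ord0 (lift ord0 j) = y ord0 j.
Proof. by have := cons_rVK (t, y) => -[_ e1]; rewrite -[in RHS]e1 mxE. Qed.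

Lemma cons_rV_shift n t (y : 'rV[R]_n) j h :
  h *: delta_mx ord0 (lift ord0 j) + cons_rV (t, y) =
  cons_rV (t, h *: delta_mx ord0 j + y) :> 'rV[R]_n.+1.
Proof.
apply/rowP => i; rewrite mxE; case: (unliftP ord0 i) => [k|] ->.
  by rewrite !cons_rV_lift !mxE /= (inj_eq (@lift_inj _ _)).
by rewrite !cons_rV0 !mxE /= mulr0 add0r.
Qed.

Lemma cons_rV_shift0 n t (y : 'rV[R]_n) h :
  h *: delta_mx ord0 ord0 + cons_rV (t, y) = cons_rV (h + t, y) :> 'rV[R]_n.+1.
Proof.
apply/rowP => i; rewrite mxE; case: (unliftP ord0 i) => [k|] ->.
  by rewrite !cons_rV_lift !mxE /= mulr0 add0r.
by rewrite !cons_rV0 !mxE !eqxx mulr1.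
Qed.

Definition slice n (f : 'rV[R]_n.+1 -> R) t (y : 'rV[R]_n) := f (cons_rV (t, y)).

Lemma partial_slice n (f : 'rV[R]_n.+1 -> R) t j :
  partial j (slice f t) = slice (partial (lift ord0 j) f) t.
Proof.
apply/funext => y; rewrite /partial /slice.
by apply: (derive_along_line _).1 => h; rewrite cons_rV_shift.
Qed.

Lemma foldr_partial_slice n (f : 'rV[R]_n.+1 -> R) t s :
  foldr partial (slice f t) s = slice (foldr partial f (map (lift ord0) s)) t.
Proof. by elim: s => //= i s ->; rewrite partial_slice. Qed.

Lemma lsmooth_slice n (f : 'rV[R]_n.+1 -> R) t : lsmooth f -> lsmooth (slice f t).
Proof.
move=> lf s x i; rewrite foldr_partial_slice.
set F := foldr partial f _.
have [_ e] := @derive_along_line _ _ (slice F t) F x (cons_rV (t, x)) (delta_mx ord0 i)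
  (delta_mx ord0 (lift ord0 i)) (fun h => congr1 F (esym (cons_rV_shift t x i h))).
exact/e/lf.
Qed.

Lemma is_derive_line n (f : 'rV[R]_n.+1 -> R) t y :
  derivable f (cons_rV (t, y)) (delta_mx ord0 ord0) ->
  is_derive t 1 (fun t => f (cons_rV (t, y))) (partial ord0 f (cons_rV (t, y))).
Proof.
move=> df; have [e1 e2] := @derive_along_line R _ (fun t => f (cons_rV (t, y))) f t
  (cons_rV (t, y)) 1 (delta_mx ord0 ord0)
  (fun h => etrans (congr1 (fun u => f (cons_rV (u + t, y))) (mulr1 h))
     (congr1 f (esym (cons_rV_shift0 t y h)))).
by apply: DeriveDef; [exact/e2|exact: e1].
Qed.

(** Induction on the dimension, with the mean value theorem in the first
    variable: a difference of slices in that variable is controlled by the mixed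
    derivatives that contain it. *)
Lemma lsmooth_mixed_lipschitz n (a : nat -> R) (f : 'rV[R]_n -> R) C : lsmooth f ->
  (forall (P : pred 'I_n) x, ucube a x -> `|foldr partial f (seq.filter P (enum 'I_n)) x| <= C) ->
  mixed_lipschitz a C f.
Proof.
elim: n a f C => [|n ih] a f C lf fC /=.
  by move=> x; have := fC xpred0 x; rewrite filter_pred0; apply => -[].
have fE (P : pred 'I_n.+1) : seq.filter P (enum 'I_n.+1) =
    (if P ord0 then [:: ord0] else [::]) ++
    map (lift ord0) (seq.filter (fun j => P (lift ord0 j)) (enum 'I_n)).
  by rewrite enum_ordSl /= filter_map; case: (P ord0).
pose ext b (P : pred 'I_n) (i : 'I_n.+1) := if unlift ord0 i is Some j then P j else b.
have extE b P : seq.filter (ext b P) (enum 'I_n.+1) =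
    (if b then [:: ord0] else [::]) ++ map (lift ord0) (seq.filter P (enum 'I_n)).
  rewrite fE /ext unlift_none; congr (_ ++ map _ _).
  by apply: eq_filter => j; rewrite liftK.
split=> [t ht|t t' ht ht'].
  apply: (ih _ (slice f t)) => [|P y ay]; first exact: lsmooth_slice.
  rewrite foldr_partial_slice.
  by have := fC (ext false P) (cons_rV (t, y)); rewrite extE /=; apply; apply/ucube_cons.
wlog tt : t t' ht ht' / t <= t' => [hw|].
  have [/hw|/ltW /hw] := leP t t'; first by apply.
  move=> /(_ ht' ht); rewrite distrC => h.
  have le0 (m : nat) (b : nat -> R) (D : R) (u : 'rV[R]_m -> R) :
    mixed_lipschitz b D u -> mixed_lipschitz b D (fun y => - u y).
    elim: m b D u => [|m ihm] b D u /=; first by move=> hu x; rewrite normrN.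
    move=> [h1 h2]; split => [r hr|r r' hr hr']; first exact: (ihm _ _ _ (h1 r hr)).
    have := ihm _ _ _ (h2 r r' hr hr'); apply: mixed_lipschitz_ext => x _.
    by rewrite opprB opprK addrC.
  by have := le0 _ _ _ _ h; apply: mixed_lipschitz_ext => x _; rewrite opprB.
apply: (ih _ (slice f t - slice f t')) => [|P y ay].
  by apply: lsmoothB; exact: lsmooth_slice.
rewrite foldr_partialB; try exact: lsmooth_slice.
rewrite !foldr_partial_slice; set F := foldr partial f _.
have dF u : derivable F (cons_rV (u, y)) (delta_mx ord0 ord0) by exact: lf.
have [] := @MVT_segment R (fun u => F (cons_rV (u, y)))
    (fun u => partial ord0 F (cons_rV (u, y))) t t' tt.
- by move=> u _; exact: is_derive_line.
- apply: derivable_within_continuous => u _.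
  by have /is_derive_line[] := dF u.
move=> u; rewrite in_itv /= => /andP[tu ut'] e.
rewrite -normrN fctE opprB /slice e normrM (distrC t) ler_wpM2r//.
have := fC (ext true P) (cons_rV (u, y)); rewrite extE /=; apply; apply/ucube_cons; split => //.
by move/andP: ht => [t1 _]; move/andP: ht' => [_ t2]; rewrite (le_trans t1 tu) (le_lt_trans ut' t2).
Qed.

Lemma cvg_dyadic_floor (t : R) : (Num.floor (2 ^+ J * t))%:~R / 2 ^+ J @[J --> \oo] --> t.
Proof.
apply/cvgrPdist_le => e e0.
have half1 : `|2^-1 : R| < 1 by rewrite ger0_norm// invf_lt1// ltr1n.
have /cvgrPdist_le/(_ e e0) := cvg_geometric 1 half1; apply: filterS => J /=.
rewrite /geometric /= mul1r sub0r normrN exprVn ger0_norm; last first.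
  by rewrite invr_ge0 exprn_ge0.
move=> he; apply: (le_trans _ he); have J0 : 0 < 2 ^+ J :> R by rewrite exprn_gt0.
have V0 : 0 <= (2 ^+ J)^-1 :> R by rewrite invr_ge0 ltW.
have /andP[h1 h2] := floor_itv (2 ^+ J * t).
rewrite -[t in t - _](mulfK (lt0r_neq0 J0)) -mulrBl normrM.
rewrite (ger0_norm V0) -[leRHS]mul1r ler_wpM2r// (mulrC t) ger0_norm ?subr_ge0//.
by rewrite lerBlDl ltW//; move: h2; rewrite intrD addrC.
Qed.

(** Approximate the first variable by dyadic numbers, for which the slices are
    measurable by induction; f is continuous along lines. *)
Lemma measurable_lsmooth n (f : 'rV[R]_n -> R) : lsmooth f -> measurable_fun setT f.
Proof.
elim: n f => [|n ih] f lf.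
  rewrite (_ : f = cst (f 0)); first exact: measurable_cst.
  by apply/funext => x; congr f; apply/rowP => -[].
pose q J (t : R) : R := (Num.floor (2 ^+ J * t))%:~R / 2 ^+ J.
apply: (@measurable_fun_cvg _ _ _ _
  (fun J x => f (cons_rV (q J (uncons_rV x).1, (uncons_rV x).2)))); last first.
  move=> x _; rewrite -[X in _ --> f X]uncons_rVK; case: (uncons_rV x) => t y /=.
  have : {for t, continuous (fun u => f (cons_rV (u, y)))}.
    apply/differentiable_continuous/derivable1_diffP.
    by have /is_derive_line[] := lf [::] (cons_rV (t, y)) ord0.
  move=> ct; exact: (@cvg_comp _ _ _ (q^~ t) (fun u : R => f (cons_rV (u, y))) _ _ _ (@cvg_dyadic_floor t) ct).
move=> J; have mu := @measurable_uncons_rV R n.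
pose N (x : 'rV[R]_n.+1) := pickle (Num.floor (2 ^+ J * (uncons_rV x).1)).
pose F k (x : 'rV[R]_n.+1) := f (cons_rV ((odflt 0 (unpickle k : option int))%:~R / 2 ^+ J,
  (uncons_rV x).2)).
rewrite (_ : (fun x => _) = fun x => F (N x) x); last first.
  by apply/funext => x; rewrite /F /N pickleK.
apply: measurable_nat_mix.
  apply: (measurableT_comp (@measurable_pickle_floor R (2 ^+ J))).
  exact: (measurableT_comp measurable_fst mu).
move=> k; set r : R := (odflt 0 (unpickle k : option int))%:~R / 2 ^+ J.
exact: (measurableT_comp (ih _ (@lsmooth_slice _ _ r lf)) (measurableT_comp measurable_snd mu)).
Qed.

End smooth_slices.

(** * The Gaussian law *)

Local Open Scope complex_scope.
Section gaussian.
Context {R : realType}.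
Local Notation mu := (@lebesgue_measure R).
Local Notation N := (@normal_prob R 0 1).
Local Notation n := (@normal_pdf R 0 1).

Let nE x : n x = normal_peak 1 * expR (- (x ^+ 2 / 2)).
Proof. by rewrite normal_pdfE ?oner_eq0// /normal_fun subr0 expr1n mulNr. Qed.

Let n0 x : 0 <= n x. Proof. exact: normal_pdf_ge0. Qed.

Let mn : measurable_fun setT n. Proof. exact: measurable_normal_pdf. Qed.

Let xn_le x : `|x| * n x <= normal_peak 1 / normal_peak 2 * normal_pdf 0 2 x.
Proof.
have p2 : normal_peak (2 : R) != 0 by rewrite gt_eqF// normal_peak_gt0.
rewrite nE normal_pdfE// mulrCA [leRHS]mulrA divfK// ler_wpM2l ?normal_peak_ge0// /normal_fun subr0.
have -> : - x ^+ 2 / (2 ^+ 2 *+ 2) = 3 * x ^+ 2 / 8 - x ^+ 2 / 2 :> R by field.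
rewrite expRD ler_wpM2r ?expR_ge0//.
apply: le_trans (expR_ge1Dx _).
have := sqr_ge0 (`|x| - 4 / 3); rewrite -(real_normK (num_real x)).
by set y := `|x|; rewrite !expr2 => h; lra.
Qed.

Let xn_int : mu.-integrable setT (fun x => (`|x| * n x)%:E).
Proof.
apply: (@le_integrable _ _ _ mu _ measurableT _
  (fun x => ((normal_peak 1 / normal_peak 2)%:E * (normal_pdf 0 2 x)%:E)%E)).
- by apply/measurable_EFinP; apply: measurable_funM => //; exact: measurableT_comp.
- move=> x _; have A : 0 <= `|x| * n x by rewrite mulr_ge0.
  rewrite -EFinM !abse_EFin lee_fin (ger0_norm A) ger0_norm ?xn_le//.
  exact: le_trans A (xn_le x).
- by apply: integrableZl => //; exact: integrable_normal_pdf.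
Qed.

Let numu : N `<< mu. Proof. exact: normal_prob_dominates. Qed.

Let N_density_ge0 (f : R -> R) : measurable_fun setT f -> (forall x, 0 <= f x) ->
  (\int[N]_x (f x)%:E = \int[mu]_x (f x * n x)%:E)%E.
Proof.
move=> mf f0.
have mef : measurable_fun setT (EFin \o f) by exact/measurable_EFinP.
have := @Radon_Nikodym_SigmaFinite.change_of_variables _ _ _ N mu numu (EFin \o f) setT.
move=> /(_ (fun x => f0 x) measurableT mef) <-.
have mRN := measurable_int _ (Radon_Nikodym_SigmaFinite.f_integrable numu).
have ae : ae_eq mu setT (Radon_Nikodym_SigmaFinite.f N mu) (EFin \o n).
  apply: integral_ae_eq => //.
  - exact: Radon_Nikodym_SigmaFinite.f_integrable.
  - exact/measurable_EFinP.
  - by move=> A _ mA; rewrite -Radon_Nikodym_SigmaFinite.f_integral.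
apply: ge0_ae_eq_integral => //.
- exact: emeasurable_funM.
- by apply/measurable_EFinP; exact: measurable_funM.
- by move=> x _; rewrite mule_ge0 ?lee_fin//; exact: Radon_Nikodym_SigmaFinite.f_ge0.
- by move=> x _; rewrite lee_fin mulr_ge0.
- by apply: filterS ae => x h _; rewrite h// EFinM.
Qed.

Let N_density (f : R -> R) : N.-integrable setT (EFin \o f) ->
  \int[N]_x f x = \int[mu]_x (f x * n x).
Proof.
move=> fi; have mf := measurable_int _ fi; rewrite /Rintegral; congr fine.
rewrite -(@Radon_Nikodym_change_of_variables _ _ _ N mu numu _ setT)//.
have gi := @Radon_Nikodym_integrable _ _ _ (charge_of_finite_measure N) mu numu.
have ae : ae_eq mu setT (Radon_Nikodym (charge_of_finite_measure N) mu) (EFin \o n).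
  apply: integral_ae_eq => //; first exact/measurable_EFinP.
  by move=> A _ mA; rewrite -(@Radon_Nikodym_integral _ _ _ (charge_of_finite_measure N) mu A numu mA).
apply: ae_eq_integral => //.
- by apply: emeasurable_funM => //; exact: (measurable_int _ gi).
- by apply/measurable_EFinP; apply: measurable_funM => //; exact/measurable_EFinP.
- by apply: filterS ae => x h _; rewrite h// EFinM.
Qed.

Lemma N_abs_lty : (\int[N]_x (`|x|)%:E < +oo)%E.
Proof.
rewrite N_density_ge0//.
have /integrableP[_] := xn_int.
by under eq_integral do rewrite gee0_abs ?lee_fin ?mulr_ge0//.
Qed.

Let bounded_N (f : R -> R) : measurable_fun setT f -> (forall x, `|f x| <= 1) ->
  N.-integrable setT (EFin \o f).
Proof.
move=> mf f1; have Noo : (N setT < +oo)%E by rewrite probability_setT ltry.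
exact: (bounded_integrable Noo mf f1).
Qed.

Let linear_N (f : R -> R) : measurable_fun setT f -> (forall x, `|f x| <= `|x|) ->
  N.-integrable setT (EFin \o f).
Proof.
move=> mf f1; apply: (@le_integrable _ _ _ N _ measurableT _ (fun x => (`|x|)%:E)).
- exact/measurable_EFinP.
- by move=> x _; rewrite !abse_EFin lee_fin normr_id.
- apply/integrableP; split; first by apply/measurable_EFinP; exact: normr_measurable.
  by under eq_integral do rewrite gee0_abs//; exact: N_abs_lty.
Qed.

Variable a : R.
Let F t x := cos (t * x + a).
Let G t x := - (x * sin (t * x + a)).
Let phi t := \int[N]_x F t x.

Let mlin t : measurable_fun setT (fun x : R => t * x + a).
Proof. by apply: measurable_funD => //; exact: measurable_funM. Qed.

Let mF t : measurable_fun setT (F t).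
Proof.
exact: (measurableT_comp (continuous_measurable_fun (@continuous_cos R)) (mlin t)).
Qed.

Let mG t : measurable_fun setT (G t).
Proof.
apply: measurableT_comp => //; apply: measurable_funM => //.
exact: (measurableT_comp (continuous_measurable_fun (@continuous_sin R)) (mlin t)).
Qed.

Let dF t x : is_derive t (1 : R) (F ^~ x) (G t x).
Proof.
rewrite /F /G.
have : is_derive t (1 : R) (fun t : R => t * x + a) x.
  by apply: is_derive_eq; rewrite addr0 scaler0 add0r /GRing.scale /= mulr1.
move=> h; apply: is_derive_eq.
by rewrite /GRing.scale /= mulNr mulrC.
Qed.

Let G_le t x : `|G t x| <= `|x|.
Proof.
by rewrite /G normrN normrM -[leRHS]mulr1 ler_wpM2l// normr_sin_le1.
Qed.

Let d_phi t : is_derive t (1 : R) phi (\int[N]_x G t x).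
Proof.
have tI : (`]t - 1, t + 1[%classic : set R) t by rewrite /= in_itv /= ltrBlDr !ltrDl ltr01.
have xabs : N.-integrable setT (EFin \o (fun x : R => `|x|)).
  by apply: linear_N => [|x]; [exact: normr_measurable|rewrite normr_id].
have d1 t' x : (partial1of2 F) t' x = G t' x by rewrite partial1of2E; have [_] := dF t' x.
have iF (t' : R) : `]t - 1, t + 1[%classic t' -> N.-integrable setT (EFin \o F t').
  by move=> _; apply: bounded_N => // x; exact: normr_cos_le1.
have dF' (t' x : R) : `]t - 1, t + 1[%classic t' -> [set: R] x -> derivable (F ^~ x) t' 1.
  by move=> _ _; have [] := dF t' x.
have bF (t' x : R) : `]t - 1, t + 1[%classic t' -> [set: R] x -> `|(partial1of2 F) t' x| <= `|x|.
  by move=> _ _; rewrite d1.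
have := @derivable_under_integral R _ _ N F setT measurableT t (t - 1) (t + 1) tI iF dF'
  (fun x => `|x|) (fun x => normr_ge0 x) xabs bF.
have := @differentiation_under_integral R _ _ N F setT measurableT t (t - 1) (t + 1) tI iF dF'
  (fun x => `|x|) (fun x => normr_ge0 x) xabs bF.
move=> e de; apply: DeriveDef => //.
by rewrite -derive1E e; apply: eq_Rintegral => x _; rewrite d1.
Qed.

Let dn x : is_derive x (1 : R) n (- (x * n x)).
Proof.
have -> : n = fun x => normal_peak 1 * expR (- (x ^+ 2 / 2)) by apply/funext => y; exact: nE.
have h : is_derive x (1 : R) (fun x : R => - (x ^+ 2 / 2)) (- x).
  have -> : (fun x : R => - (x ^+ 2 / 2)) = (fun x : R => (- 2^-1) * x ^+ 2).
    by apply/funext => y; rewrite mulNr mulrC.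
  by apply: is_derive_eq; rewrite /GRing.scale /= !mulr1 ?expr1; field.
have d3 := is_derive1_comp (is_derive_expR _) h.
have d4 := @is_deriveZ _ _ _ (expR \o (fun x : R => - (x ^+ 2 / 2))) (normal_peak 1) x 1 _ d3.
apply: (is_derive_eq d4); rewrite /GRing.scale /=; ring.
Qed.

Section stein.
Variable t : R.
Let H x := - (n x * sin (t * x + a)).
Let h x := (x * sin (t * x + a) - t * cos (t * x + a)) * n x.

Let dlin x : is_derive x (1 : R) (fun x : R => t * x + a) t.
Proof. by apply: is_derive_eq; rewrite /GRing.scale /=; ring. Qed.

Let dH x : is_derive x (1 : R) H (h x).
Proof.
have d1 := dlin x; have d2 := dn x.
apply: is_derive_eq; rewrite /h /GRing.scale /=; ring.
Qed.

Let ch : continuous h.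
Proof.
have cl : continuous (fun x : R => t * x + a).
  by move=> x; apply/differentiable_continuous/derivable1_diffP; have [] := dlin x.
have cn : continuous n by apply: continuous_normal_pdf; rewrite oner_eq0.
move=> x; apply: cvgM; last exact: cn.
apply: cvgB; apply: cvgM; [exact: cvg_id| |exact: cvg_cst|].
  by apply: (cvg_comp (fun x => t * x + a) sin); [exact: cl|exact: continuous_sin].
by apply: (cvg_comp (fun x => t * x + a) cos); [exact: cl|exact: continuous_cos].
Qed.

Let hI : mu.-integrable setT (EFin \o h).
Proof.
apply: (@le_integrable _ _ _ mu _ measurableT _ (fun x => ((`|x| * n x)%:E + (`|t|)%:E * (n x)%:E)%E)).
- apply/measurable_EFinP; exact: continuous_measurable_fun.
- move=> x _; rewrite -EFinM -EFinD !abse_EFin lee_fin [leRHS]ger0_norm; last first.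
    by rewrite addr_ge0 ?mulr_ge0.
  rewrite /h normrM (ger0_norm (n0 x)) -mulrDl ler_wpM2r//.
  rewrite (le_trans (ler_normB _ _))// lerD// normrM -[leRHS]mulr1 ler_wpM2l//.
    exact: normr_sin_le1.
  exact: normr_cos_le1.
- apply: integrableD => //.
  by apply: integrableZl => //; exact: integrable_normal_pdf.
Qed.

Let int_h : \int[mu]_x h x = 0.
Proof.
have ftc (k : nat) : \int[mu]_x (\1_`[- k.+1%:R, k.+1%:R]%classic x * h x) =
    H k.+1%:R - H (- k.+1%:R).
  have k0 : - k.+1%:R < k.+1%:R :> R by have k1 : 0 < k.+1%:R :> R by [rewrite ltr0n]; lra.
  have -> : \int[mu]_x (\1_`[- k.+1%:R, k.+1%:R]%classic x * h x) =
      \int[mu]_(x in `[- k.+1%:R, k.+1%:R]) h x.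
    rewrite /Rintegral [in RHS]integral_mkcond; congr fine.
    apply: eq_integral => x _; rewrite patchE indicE.
    by case: ifPn => _; rewrite ?mul1r ?mul0r.
  rewrite /Rintegral (@continuous_FTC2 _ h H)//.
  - by apply: continuous_subspaceT; exact: ch.
  - have cH x : {for x, continuous H}.
      by apply/differentiable_continuous/derivable1_diffP; have [] := dH x.
    split; first by move=> x _; have [] := dH x.
      by apply: cvg_at_right_filter; exact: cH.
    by apply: cvg_at_left_filter; exact: cH.
  - by move=> x _; rewrite derive1E; have [_] := dH x.
have H0 : H k.+1%:R - H (- k.+1%:R) @[k --> \oo] --> 0.
  have Hle x : `|x| * `|H x| <= normal_peak 1 / normal_peak 2 * normal_peak 2.
    rewrite /H normrN normrM (ger0_norm (n0 x)) mulrA.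
    apply: (@le_trans _ _ (`|x| * n x)).
      by rewrite ler_piMr ?mulr_ge0// normr_sin_le1.
    rewrite (le_trans (xn_le x))// ler_wpM2l ?divr_ge0 ?normal_peak_ge0//.
    exact: normal_pdf_ub.
  set C := normal_peak 1 / _ * _ in Hle.
  have /cvgrPdist_le inv0 : (C * 2) * harmonic k @[k --> \oo] --> (0 : R).
    have cc : (fun _ : nat => C * 2) k @[k --> \oo] --> C * 2 by exact: cvg_cst.
    have hh := cvgM cc (@cvg_harmonic R).
    by rewrite mulr0 in hh; exact: hh.
  apply/cvgrPdist_le => e e0; apply: filterS (inv0 e e0) => k.
  rewrite !sub0r !normrN => ke; apply: (le_trans _ ke); apply: (le_trans _ (ler_norm _)).
  have k0 : 0 < k.+1%:R :> R by rewrite ltr0n.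
  rewrite /harmonic ler_pdivlMr// (le_trans (ler_wpM2r (ltW k0) (ler_normB _ _)))//.
  have := Hle k.+1%:R; have := Hle (- k.+1%:R).
  by rewrite normrN (ger0_norm (ltW k0)); nra.
apply: (cvg_unique _ _ H0); first by [].
rewrite (_ : (fun k : nat => _) = fun k => \int[mu]_x (\1_`[- k.+1%:R, k.+1%:R]%classic x * h x)).
  2: by apply/funext => k; rewrite ftc.
apply: (@Rintegral_dominated_cvg _ _ _ mu setT _ h (fun x => `|h x|)) => //.
- move=> k; apply: measurable_funM; last exact: continuous_measurable_fun.
  by apply: measurable_indic; exact: measurable_itv.
- exact: continuous_measurable_fun.
- apply: aeW => x _; apply: cvg_near_cst; near=> k.
  rewrite indicE mem_set ?mul1r//= in_itv /= -ler_norml.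
  have xk : `|x| <= k%:R by near: k; exact: nbhs_infty_ger.
  by rewrite (le_trans xk)// ler_nat.
- exact: integrable_norm hI.
- move=> k x _; rewrite normrM ler_piMl// indicE.
  by case: (_ \in _); rewrite ?normr1 ?normr0.
Unshelve. all: end_near. Qed.

(** Integration by parts against the Gaussian density n, with n' = - x n. *)
Lemma stein : \int[N]_x G t x = - t * phi t.
Proof.
have cosI : N.-integrable setT (EFin \o F t).
  by apply: bounded_N => // x; exact: normr_cos_le1.
have GI : N.-integrable setT (EFin \o G t) by apply: linear_N.
have := int_h.
have -> : \int[mu]_x h x = \int[mu]_x ((- G t x - t * F t x) * n x).
  by apply: eq_Rintegral => x _; rewrite /G /F opprK.
rewrite -(@N_density (fun x => - G t x - t * F t x)); last first.
  have -> : EFin \o (fun x => - G t x - t * F t x) =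
      (fun x => ((-1)%:E * (G t x)%:E + (- t)%:E * (F t x)%:E)%E).
    by apply/funext => x /=; rewrite -!EFinM -EFinD mulN1r mulNr.
  by apply: integrableD => //; apply: integrableZl.
have -> : \int[N]_x (- G t x - t * F t x) = - (\int[N]_x G t x) - t * phi t.
  rewrite RintegralB//; last 2 first.
  - have -> : EFin \o (fun x => - G t x) = (fun x => ((-1)%:E * (G t x)%:E)%E).
      by apply/funext => x /=; rewrite -EFinM mulN1r.
    exact: integrableZl.
  - exact: (integrableZl measurableT t cosI).
  have e1 : \int[N]_x (t * F t x) = t * phi t by rewrite RintegralZl.
  have e2 : \int[N]_x (- G t x) = - \int[N]_x G t x.
    by rewrite -[RHS]mulN1r -RintegralZl//; apply: eq_Rintegral => x _; rewrite mulN1r.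
  by rewrite e1 e2.
by move=> e; lra.
Qed.

End stein.

(** The phase a treats cosine and sine at once: phi' = - t phi by Stein's
    identity, and phi 0 = cos a. *)
Lemma normal_phase : forall t, \int[N]_x cos (t * x + a) = cos a * expR (- (t ^+ 2 / 2)).
Proof.
pose psi t := phi t * expR (t ^+ 2 / 2).
have dpsi t : is_derive t (1 : R) psi 0.
  have d1 := d_phi t; rewrite stein in d1.
  have d2 : is_derive t (1 : R) (fun x : R => x ^+ 2 / 2) t.
    have -> : (fun x : R => (x ^+ 2 / 2)) = (fun x : R => (2^-1) * x ^+ 2).
      by apply/funext => y; rewrite mulrC.
    by apply: is_derive_eq; rewrite /GRing.scale /= !mulr1 ?expr1; field.
  rewrite /psi; apply: is_derive_eq; rewrite /GRing.scale /=; ring.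
move=> t; have := is_derive_0_is_cst t 0 dpsi; rewrite /psi expr0n /= mul0r expR0 mulr1.
have -> : phi 0 = cos a.
  rewrite /phi /F; under eq_Rintegral do rewrite mul0r add0r.
  rewrite Rintegral_cst//.
  have -> : fine (N setT) = 1 by rewrite (@probability_setT _ _ _ N).
  by rewrite mulr1.
move=> <-; rewrite -mulrA -expRD subrr expR0 mulr1.
by [].
Qed.

End gaussian.

Lemma normal_cos {R : realType} (t : R) :
  \int[normal_prob 0 1]_x cos (t * x) = expR (- (t ^+ 2 / 2)).
Proof.
transitivity (\int[normal_prob 0 1]_x cos (t * x + 0)).
  by apply: eq_Rintegral => x _; rewrite addr0.
by rewrite normal_phase cos0 mul1r.
Qed.

Lemma normal_sin {R : realType} (t : R) : \int[normal_prob 0 1]_x sin (t * x) = 0.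
Proof.
transitivity (\int[normal_prob 0 1]_x cos (t * x + - (pi / 2))).
  by apply: eq_Rintegral => x _; rewrite cosD cosN sinN cos_pihalf sin_pihalf; ring.
by rewrite normal_phase cosN cos_pihalf mul0r.
Qed.

Section realized.
Context {R : realType} d (T : measurableType d).
Variables (q : coin -> T) (mu : {measure set T -> \bar R}).
Hypothesis mq : measurable_fun setT q.
Hypothesis qE : forall A, measurable A -> coinP (R := R) (q @^-1` A) = mu A.

Lemma ge0_integral_realized (f : T -> \bar R) : measurable_fun setT f ->
  (forall x, 0 <= f x)%E -> (\int[coinP]_w f (q w) = \int[mu]_x f x)%E.
Proof.
move=> mf f0; transitivity (\int[pushforward coinP q]_x f x)%E.
  by rewrite (ge0_integral_pushforward mq).
by apply: eq_measure_integral => A mA _; exact: qE.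
Qed.

Lemma integral_realized (f : T -> \bar R) : measurable_fun setT f ->
  (\int[coinP]_w f (q w) = \int[mu]_x f x)%E.
Proof.
move=> mf; rewrite [LHS]integralE [RHS]integralE; congr (_ - _)%E.
  rewrite -(ge0_integral_realized (measurable_funepos mf) (funepos_ge0 f)).
  by apply: eq_integral => w _; rewrite !funeposE.
rewrite -(ge0_integral_realized (measurable_funeneg mf) (funeneg_ge0 f)).
by apply: eq_integral => w _; rewrite !funenegE.
Qed.

Lemma Rintegral_realized (f : T -> R) : measurable_fun setT f ->
  \int[coinP]_w f (q w) = \int[mu]_x f x.
Proof.
move=> mf; rewrite /Rintegral; congr fine.
by rewrite (integral_realized (f := EFin \o f))//; exact/measurable_EFinP.
Qed.

End realized.

Lemma gaussian_variable {R : realType} : exists xi : coin -> R,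
  [/\ measurable_fun setT xi, (\int[coinP (R := R)]_w (`|xi w|)%:E < +oo)%E &
      forall t, charf (fun w => t * xi w) = cexp (- (t ^+ 2 / 2))%:C].
Proof.
have [q mq qE] := @coin_realizes R (normal_prob 0 1).
exists q; split => //.
  have mabs : measurable_fun [set: measurableTypeR R] (fun x : R => (`|x|)%:E).
    by apply/measurable_EFinP; exact: normr_measurable.
  have := @ge0_integral_realized R _ (measurableTypeR R) q (normal_prob 0 1) mq qE _ mabs.
  by move=> -> //; exact: N_abs_lty.
move=> t.
have mlin : measurable_fun setT (fun x : R => t * x) by exact: measurable_funM.
have mc : measurable_fun setT (fun x : R => cos (t * x)).
  exact: (measurableT_comp (continuous_measurable_fun (@continuous_cos R)) mlin).
have ms : measurable_fun setT (fun x : R => sin (t * x)).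
  exact: (measurableT_comp (continuous_measurable_fun (@continuous_sin R)) mlin).
have ec := etrans (@Rintegral_realized R _ (measurableTypeR R) q (normal_prob 0 1) mq qE _ mc)
  (normal_cos t).
have es := etrans (@Rintegral_realized R _ (measurableTypeR R) q (normal_prob 0 1) mq qE _ ms)
  (normal_sin t).
rewrite /charf [X in X +i* _]ec [X in _ +i* X]es.
by rewrite /cexp /= cos0 sin0; apply/eqP; rewrite eq_complex /=; apply/andP; split; apply/eqP; ring.
Qed.

(** * Sampling finite measures *)

Section E_split.
Context {R : realType}.
Local Notation P := (@coinP R).
Local Notation E X := (\int[P]_w X w)%R.

Lemma E_bounded_EFin (f : coin -> R) (B : R) : measurable_fun setT f -> (forall w, `|f w| <= B) ->
  (\int[P]_w (f w)%:E = (E f)%:E)%E.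
Proof.
move=> mf fB; rewrite /Rintegral fineK//; apply: integrable_fin_num => //.
exact: (bounded_integrable coinP_oo mf fB).
Qed.

Lemma E_shift (f : coin -> R) (B : R) : measurable_fun setT f -> (forall w, `|f w| <= B) ->
  (\int[P]_w (f w + B)%:E = (E f + B)%:E)%E.
Proof.
move=> mf fB; have If := bounded_integrable coinP_oo mf fB.
have mfB : measurable_fun setT (fun w => f w + B) by exact: measurable_funD.
rewrite (E_bounded_EFin (B := B + `|B|) mfB); last first.
  by move=> w; rewrite (le_trans (ler_normD _ _))// lerD2r.
congr (_%:E); rewrite RintegralD//; last first.
  by apply: (bounded_integrable coinP_oo (M := `|B|)).
by rewrite Rintegral_coin_cst.
Qed.

Lemma E_le (f : coin -> R) (B : R) : measurable_fun setT f -> (forall w, `|f w| <= B) ->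
  `|E f| <= B.
Proof.
move=> mf fB; have If := bounded_integrable coinP_oo mf fB.
have B0 : 0 <= B by rewrite (le_trans _ (fB (fun=> true))).
have IB : P.-integrable setT (EFin \o (fun=> B)).
  by apply: (bounded_integrable coinP_oo (M := B)) => // w; rewrite ger0_norm.
rewrite (le_trans (le_normr_Rintegral measurableT If))// -[leRHS]Rintegral_coin_cst.
by apply: le_Rintegral => //; exact: integrable_norm If.
Qed.

Context d1 (T1 : measurableType d1).

Lemma measurable_E_param (F : T1 * coin -> R) (B : R) : measurable_fun setT F ->
  (forall z, `|F z| <= B) -> measurable_fun setT (fun x => E (fun w => F (x, w))).
Proof.
move=> mF FB.
have mx x : measurable_fun setT (fun w => F (x, w)) by exact: (measurableT_comp mF (pair1_measurable x)).
have := @measurable_fun_fubini_tonelli_F _ _ T1 coin R P (fun z => (F z + B)%:E).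
have -> : fubini_F P (fun z => (F z + B)%:E) = (fun x => (E (fun w => F (x, w)) + B)%:E).
  by apply/funext => x; rewrite /fubini_F /= (E_shift (mx x)).
move=> h; have {}h : measurable_fun setT (fun x => (E (fun w => F (x, w)) + B)%:E).
  apply: h.
    by apply/measurable_EFinP; exact: measurable_funD.
  by move=> z; rewrite lee_fin -lerBlDr sub0r; have := FB z; rewrite ler_norml => /andP[].
have /measurable_EFinP h2 := h.
rewrite (_ : (fun x => _) = (fun x => E (fun w => F (x, w)) + B - B)).
  exact: measurable_funB.
by apply/funext => x; rewrite addrK.
Qed.

End E_split.

Lemma E_split {R : realType} (F : coin * coin -> R) (B : R) : measurable_fun setT F ->
  (forall z, `|F z| <= B) ->
  \int[coinP]_w F (evens w, odds w) = \int[coinP]_w1 \int[coinP]_w2 F (w1, w2).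
Proof.
move=> mF FB.
have FB0 z : (0 <= (F z + B)%:E)%E.
  by rewrite lee_fin -lerBlDr sub0r; have := FB z; rewrite ler_norml => /andP[].
have mFB : measurable_fun setT (fun z => (F z + B)%:E).
  by apply/measurable_EFinP; exact: measurable_funD.
have := @ge0_integral_split R (fun z => (F z + B)%:E) mFB FB0.
have mx x : measurable_fun setT (fun w => F (x, w)) by exact: (measurableT_comp mF (pair1_measurable x)).
have mFs := measurableT_comp mF measurable_split.
rewrite (E_shift (f := fun w => F (evens w, odds w)) mFs)//.
have -> : (\int[coinP]_w1 \int[coinP]_w2 (F (w1, w2) + B)%:E =
   \int[coinP]_w1 ((\int[coinP]_w2 F (w1, w2))%R + B)%:E)%E.
  by apply: eq_integral => w1 _; rewrite (E_shift (mx w1)).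
rewrite (E_shift (B := B) (measurable_E_param mF FB)); last by move=> w; exact: E_le.
by move=> h; apply: (addIr B); exact: (EFin_inj h).
Qed.

Section sampling.
Context {R : realType}.
Local Notation P := (@coinP R).
Local Notation leb := (@lebesgue_rV R).

Lemma ge0_integral_mrestr d (T : measurableType d) (mu : {measure set T -> \bar R})
    (D : set T) (mD : measurable D) (F : T -> \bar R) : measurable_fun setT F ->
  (forall x, 0 <= F x)%E -> (\int[mrestr mu mD]_x F x = \int[mu]_(x in D) F x)%E.
Proof.
move=> mF F0; have N0 : mrestr mu mD (~` D) = 0%E by rewrite /mrestr setICl measure0.
rewrite (ge0_negligible_integral (measurableC mD) measurableT mF (fun x _ => F0 x) N0).
rewrite setTD setCK; apply: eq_measure_integral => A mA AD.
by transitivity (mu (A `&` D)); [|rewrite setIidl].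
Qed.

(** Up to the mass mu D, the law of q is the restriction of mu to D. *)
Definition samples d (T : measurableType d) (mu : {measure set T -> \bar R}) (D : set T)
    (q : coin -> T) :=
  measurable_fun setT q /\ forall F, measurable_fun setT F -> (forall x, 0 <= F x)%E ->
  (mu D * \int[P]_w F (q w) = \int[mu]_(x in D) F x)%E.

Lemma sample (mu : {measure set (measurableTypeR R) -> \bar R}) (D : set R) :
  measurable D -> (0 < mu D < +oo)%E -> exists q : coin -> measurableTypeR R, samples mu D q.
Proof.
move=> mD /andP[D0 Doo].
pose m := mnormalize (mrestr mu mD) (dirac (0%R : measurableTypeR R)).
have [q mq qE] := @coin_realizes R m.

have Df : mu D \is a fin_num by rewrite ge0_fin_numE// ltW.
exists q; split => // F mF F0.
have fD0 : 0 <= (fine (mu D))^-1 by rewrite invr_ge0 fine_ge0// ltW.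
have e : (\int[P]_w F (q w) = \int[mscale (NngNum fD0) (mrestr mu mD)]_x F x)%E.
  rewrite (@ge0_integral_realized R _ (measurableTypeR R) q m mq qE F mF F0).
  apply: eq_measure_integral => A mA _.
  change (mnormalize (mrestr mu mD) (dirac (0%R : measurableTypeR R)) A =
    ((fine (mu D))^-1)%:E * mu (A `&` D))%E.
  rewrite /mnormalize ifF.
    change (mu (A `&` D) * ((fine (mu (setT `&` D)))^-1)%:E =
      ((fine (mu D))^-1)%:E * mu (A `&` D))%E.
    by rewrite setTI muleC.
  apply/negbTE; rewrite negb_or; apply/andP; split.
    change (mu (setT `&` D) != 0%E); by rewrite setTI gt_eqF.
  change (mu (setT `&` D) != +oo%E); by rewrite setTI lt_eqF.
rewrite e ge0_integral_mscale// ge0_integral_mrestr//= muleA.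
by rewrite -{1}(fineK Df) -EFinM divff ?mul1e// fine_eq0// gt_eqF.
Qed.

Lemma samples_real d (T : measurableType d) (mu : {measure set T -> \bar R}) (D : set T)
    (q : coin -> T) (f : T -> R) (B : R) : measurable D -> (mu D < +oo)%E ->
  samples mu D q -> measurable_fun setT f -> (forall x, `|f x| <= B) ->
  fine (mu D) * (\int[P]_w f (q w)) = \int[mu]_(x in D) f x.
Proof.
move=> mD Doo [mq qE] mf fB.
have Df : mu D \is a fin_num by rewrite ge0_fin_numE.
have mfq := measurableT_comp mf mq.
have f0 x : (0 <= (f x + B)%:E)%E.
  by rewrite lee_fin -lerBlDr sub0r; have := fB x; rewrite ler_norml => /andP[].
have mfB : measurable_fun setT (fun x => (f x + B)%:E).
  by apply/measurable_EFinP; exact: measurable_funD.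
have If : mu.-integrable D (EFin \o f).
  apply: measurable_bounded_integrable => //; first exact: measurable_funS mf.
  by exists B; split; [exact: num_real|move=> y By z _; exact: le_trans (fB z) (ltW By)].
have IB : mu.-integrable D (EFin \o (fun=> B)).
  apply: measurable_bounded_integrable => //.
  by exists `|B|; split; [exact: num_real|move=> y By z _; exact: ltW].
have := qE _ mfB f0; rewrite (E_shift mfq (fun w => fB (q w))).
have -> : (\int[mu]_(x in D) (f x + B)%:E = (\int[mu]_(x in D) f x + B * fine (mu D))%:E)%E.
  rewrite -Rintegral_cst// -RintegralD// /Rintegral fineK//.
  apply: integrable_fin_num => //.
  exact: (integrableD mD If IB).
rewrite -(fineK Df) -EFinM => h; have {h} := EFin_inj h; rewrite mulrDr (mulrC B) => /addIr.
by rewrite fineK.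
Qed.

Lemma ucube_samplesE n (a : nat -> R) q : samples (leb n) (@ucube R n a) q ->
  forall F, measurable_fun setT F -> (forall x, 0 <= F x)%E ->
  (\int[P]_w F (q w) = \int[leb n]_(x in ucube a) F x)%E.
Proof.
move=> [_ qE] F mF F0; rewrite -(qE F mF F0) -[LHS]mul1e.
by congr (_ * _)%E; exact/esym/lebesgue_ucube.
Qed.

(** Induction on the dimension, with independent tosses for the first coordinate
    and for the others. *)
Lemma sample_ucube n (a : nat -> R) : exists q : coin -> 'rV[R]_n, samples (leb n) (@ucube R n a) q.
Proof.
elim: n a => [|n ih] a.
  exists (fun=> 0); split => // F mF F0.
  have u0 : ucube a = setT :> set 'rV[R]_0 by apply/seteqP; split => // x _ [].
  rewrite u0 (integral_coin_cst (F 0)) /= diracT mul1e integral_dirac// diracT mul1e.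
  by [].
have [q' [mq' q'E]] := ih (ntail a).
have I1 : @lebesgue_measure R `[a 0%N, (a 0%N + 1)%R[%classic = 1%E.
  rewrite lebesgue_measure_itv/= lte_fin ltrDl ltr01.
  by rewrite -EFinB addrAC subrr add0r.
pose L : {measure set (measurableTypeR R) -> \bar R} := @lebesgue_measure R.
have LI : L `[a 0%N, (a 0%N + 1)%R[%classic = 1%E by exact: I1.
have [q0 [mq0 q0E]] : exists q : coin -> measurableTypeR R,
    samples L `[a 0%N, (a 0%N + 1)%R[%classic q.
  by apply: sample; [exact: measurable_itv|rewrite LI lte01 ltry].
have mc : measurable_fun setT (fun z : coin * coin => cons_rV (q0 z.1, q' z.2)).
  apply: (measurableT_comp (@measurable_cons_rV R n)).
  apply/measurable_fun_pairP; split => /=.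
    exact: (measurableT_comp mq0 measurable_fst).
  exact: (measurableT_comp mq' measurable_snd).
exists (fun w => cons_rV (q0 (evens w), q' (odds w))); split.
  exact: (measurableT_comp mc measurable_split).
move=> F mF F0.
have u1 m b : leb m (@ucube R m b) = 1%E by exact: lebesgue_ucube.
transitivity (1 * \int[P]_w F (cons_rV (q0 (evens w), q' (odds w))))%E.
  by congr (_ * _)%E; exact: u1.
rewrite mul1e (ge0_integral_split (F := fun z => F (cons_rV (q0 z.1, q' z.2))))//; last first.
  exact: (measurableT_comp mF mc).
have mt t : measurable_fun setT (fun y : 'rV[R]_n => F (cons_rV (t, y))).
  exact: (measurableT_comp mF (measurableT_comp (@measurable_cons_rV R n) (pair1_measurable t))).
have E2 t : (\int[P]_w F (cons_rV (t, q' w)) = \int[leb n]_(y in ucube (ntail a)) F (cons_rV (t, y)))%E.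
  exact: (ucube_samplesE (conj mq' q'E) (mt t) (fun y => F0 _)).
have mtot : measurable_fun setT (fun x : 'rV[R]_n.+1 => (F x * (\1_(ucube a) x)%:E)%E).
  apply: emeasurable_funM => //; apply/measurable_EFinP; apply: measurable_indic.
  exact: measurable_ucube.
have tot0 (x : 'rV[R]_n.+1) : (0 <= F x * (\1_(ucube a) x)%:E)%E by rewrite mule_ge0.
have e2 m (b : nat -> R) (G : 'rV[R]_m -> \bar R) : (\int[leb m]_(x in ucube b) G x =
    \int[leb m]_x (G x * (\1_(ucube b) x)%:E))%E.
  rewrite [LHS]integral_mkcond; apply: eq_integral => x _; rewrite patchE indicE.
  by case: ifP => _; rewrite ?mule1 ?mule0.
rewrite e2 (rV_fubini_ge0 mtot tot0).
pose G t := (\int[leb n]_(y in ucube (ntail a)) F (cons_rV (t, y)))%E.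
have mG : measurable_fun setT G.
  have := @measurable_fun_fubini_tonelli_F _ _ (measurableTypeR R) coin R P
    (fun z => F (cons_rV (z.1, q' z.2))).
  have -> : fubini_F P (fun z => F (cons_rV (z.1, q' z.2))) = G.
    by apply/funext => t; rewrite /fubini_F /= E2.
  apply => //.
  apply: (measurableT_comp mF); apply: (measurableT_comp (@measurable_cons_rV R n)).
  apply/measurable_fun_pairP; split => /=; first exact: measurable_fst.
  exact: (measurableT_comp mq' measurable_snd).
have G0 t : (0 <= G t)%E by exact: integral_ge0.
transitivity (\int[P]_w G (q0 w))%E; first by apply: eq_integral => w _; exact: (E2 (q0 w)).
have := q0E G mG G0; rewrite LI mul1e => ->.
rewrite [LHS]integral_mkcond; apply: eq_integral => t _; rewrite patchE.
have inE1 (y : 'rV[R]_n) : \1_(ucube a) (cons_rV (t, y)) =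
    (t \in `[a 0%N, (a 0%N + 1)%R[%classic)%:R * \1_(ucube (ntail a)) y :> R.
  rewrite !indicE -natrM mulnb; congr (nat_of_bool _)%:R; apply/idP/andP.
    by rewrite inE => /ucube_cons[h1 h2]; rewrite !inE /= in_itv.
  by rewrite !inE /= in_itv /= => -[h1 h2]; apply/ucube_cons.
case: ifPn => ht.
  by rewrite /G e2; apply: eq_integral => y _; rewrite inE1 ht mul1r.
by rewrite integral0_eq// => y _; rewrite inE1 (negbTE ht) mul0r mule0.
Qed.

(** A point of the cube and an independent jump size, the former uniform and the
    latter distributed as nu on A: the intensity of the jumps of size in A. *)
Lemma sample_point n (a : nat -> R) (nu : {measure set (measurableTypeR R) -> \bar R})
    (A : set R) : measurable A -> (0 < nu A < +oo)%E ->
  exists q : coin -> 'rV[R]_n * measurableTypeR R, [/\ measurable_fun setT q,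
    forall F : 'rV[R]_n * measurableTypeR R -> \bar R,
      measurable_fun setT F -> (forall x, 0 <= F x)%E ->
      (nu A * \int[P]_w F (q w) = \int[leb n]_(x in ucube a) \int[nu]_(r in A) F (x, r))%E &
    forall (F : 'rV[R]_n * measurableTypeR R -> R) B, measurable_fun setT F ->
      (forall z, `|F z| <= B) ->
      fine (nu A) * \int[P]_w F (q w) = \int[leb n]_(x in ucube a) \int[nu]_(r in A) F (x, r) ].
Proof.
move=> mA Ab; have /andP[A0 Aoo] := Ab; have [qx [mqx qxE]] := sample_ucube n a.
have [qr [mqr qrE]] := sample mA Ab.
have u1 : leb n (@ucube R n a) = 1%E by exact: lebesgue_ucube.
have uoo : (leb n (@ucube R n a) < +oo)%E.
  by have -> : leb n (@ucube R n a) = 1%E by [exact: u1]; rewrite ltry.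
have mz : measurable_fun setT (fun z : coin * coin => (qx z.1, qr z.2)).
  apply/measurable_fun_pairP; split => /=.
    exact: (measurableT_comp mqx measurable_fst).
  exact: (measurableT_comp mqr measurable_snd).
have mxr : measurable_fun setT (fun z : 'rV[R]_n * coin => (z.1, qr z.2)).
  apply/measurable_fun_pairP; split => /=; first exact: measurable_fst.
  exact: (measurableT_comp mqr measurable_snd).
exists (fun w => (qx (evens w), qr (odds w))); split.
- exact: (measurableT_comp mz measurable_split).
- move=> F mF F0.
  rewrite (ge0_integral_split (F := fun z => F (qx z.1, qr z.2)))//; last first.
    exact: (measurableT_comp mF mz).
  have mG : measurable_fun setT (fun x => \int[P]_w F (x, qr w))%E.
    apply: (@measurable_fun_fubini_tonelli_F _ _ 'rV[R]_n coin R P (fun z => F (z.1, qr z.2))) => //.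
    exact: (measurableT_comp mF mxr).
  have G0 x : (0 <= \int[P]_w F (x, qr w))%E by exact: integral_ge0.
  rewrite (ucube_samplesE (conj mqx qxE) mG G0).
  rewrite -ge0_integralZl//; last 2 first.
  + exact: measurable_ucube.
  + exact: measurable_funS mG.
  apply: eq_integral => x _; apply: qrE => //.
  exact: (measurableT_comp mF (pair1_measurable x)).
- move=> F B mF FB.
  have := @E_split R (fun z => F (qx z.1, qr z.2)) B (measurableT_comp mF mz) (fun z => FB _).
  move=> /= ->.
  have mG : measurable_fun setT (fun x => \int[P]_w F (x, qr w)).
    by apply: (@measurable_E_param R _ 'rV[R]_n (fun z => F (z.1, qr z.2)) B (measurableT_comp mF mxr)).
  have mx x : measurable_fun setT (fun r => F (x, r)) by exact: (measurableT_comp mF (pair1_measurable x)).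
  have GB x : `|\int[P]_w F (x, qr w)| <= B by apply: E_le => //; exact: (measurableT_comp (mx x) mqr).
  have := samples_real (@measurable_ucube R n a) uoo (conj mqx qxE) mG GB.
  have fu : fine (leb n (@ucube R n a)) = 1 by exact: (congr1 fine u1).
  move=> e; rewrite -[LHS]/(fine (nu A) * \int[P]_w (\int[P]_w' F (qx w, qr w'))).
  have -> : \int[P]_w (\int[P]_w' F (qx w, qr w')) = \int[leb n]_(x in ucube a) (\int[P]_w F (x, qr w)).
    by rewrite -e -[LHS]mul1r; congr (_ * _); exact: esym fu.
  rewrite -RintegralZl//; last 2 first.
  + exact: measurable_ucube.
  + apply: measurable_bounded_integrable => //; first exact: measurable_ucube.
      exact: measurable_funS mG.
    by exists B; split; [exact: num_real|move=> y By z _; exact: le_trans (GB z) (ltW By)].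
  apply: eq_Rintegral => x _.
  exact: (@samples_real _ (measurableTypeR R) nu A qr (fun r => F (x, r)) B mA Aoo
    (conj mqr qrE) (mx x) (fun r => FB (x, r))).
Qed.

End sampling.

(** * Trigonometric bounds and integrals over partitions *)

Section trigonometric_bounds.
Context {R : realType}.
Implicit Types y : R.

Let mvt0 (f df : R -> R) y : 0 <= y -> (forall x : R, is_derive x (1 : R) f (df x)) ->
  exists2 c, 0 <= c <= y & f y - f 0 = df c * y.
Proof.
move=> y0 fd; have [] := @MVT_segment R f df 0 y y0.
- by apply: derivable_within_continuous => x _; have [] := fd x.
- by move=> c; rewrite in_itv /= => cy e; exists c => //; rewrite e subr0.
Qed.

Let norm_wlog (g : R -> R) (b : R -> R) : (forall y, `|g (- y)| = `|g y|) ->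
  (forall y, b (- y) = b y) -> (forall y, 0 <= y -> `|g y| <= b y) -> forall y, `|g y| <= b y.
Proof.
move=> gN bN h y; have [y0|/ltW y0] := leP 0 y; first exact: h.
by rewrite -gN -bN h// oppr_ge0.
Qed.

Lemma norm_sin_le y : `|sin y| <= `|y|.
Proof.
move: y; apply: norm_wlog => [y|y|y y0]; rewrite ?sinN ?normrN//.
have [c _] := mvt0 y0 (@is_derive_sin R); rewrite sin0 subr0 => ->.
by rewrite normrM ler_piMl// normr_cos_le1.
Qed.

Lemma norm_cosB1_le y : `|cos y - 1| <= y ^+ 2.
Proof.
move: y; apply: norm_wlog => [y|y|y y0]; rewrite ?cosN ?sqrrN//.
have [c /andP[c0 cy]] := mvt0 y0 (@is_derive_cos R); rewrite cos0 => ->.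
rewrite normrM normrN expr2 (ger0_norm y0) ler_wpM2r//.
by rewrite (le_trans (norm_sin_le c))// ger0_norm.
Qed.

Lemma norm_sinB_le y : `|sin y - y| <= y ^+ 2.
Proof.
move: y; apply: norm_wlog => [y|y|y y0]; rewrite ?sqrrN//.
  by rewrite sinN -opprD normrN.
have d (x : R) : is_derive x (1 : R) (fun x : R => sin x - x) (cos x - 1).
  by apply: is_derive_eq.
have [c /andP[c0 cy]] := mvt0 y0 d; rewrite sin0 subr0 subr0 => ->.
rewrite normrM expr2 (ger0_norm y0) ler_wpM2r//.
have [e /andP[e0 ec]] := mvt0 c0 (@is_derive_cos R); rewrite cos0 => ->.
rewrite normrM normrN (ger0_norm c0); apply: le_trans cy.
by rewrite ler_piMl// normr_sin_le1.
Qed.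

End trigonometric_bounds.

Section partition.
Context {R : realType} d (T : measurableType d) (mu : {measure set T -> \bar R}).

(** Dominated convergence for the partial unions, with the integrable function
    itself as a bound. *)
Lemma cvg_Rintegral_partition (A_ : nat -> set T) (f : T -> R) :
  (forall j, measurable (A_ j)) -> trivIset setT A_ ->
  mu.-integrable (\bigcup_j A_ j) (EFin \o f) ->
  \sum_(j < m) \int[mu]_(x in A_ j) f x @[m --> \oo] --> \int[mu]_(x in \bigcup_j A_ j) f x.
Proof.
move=> mA tA fi; set D := \bigcup_j A_ j in fi *.
have mD : measurable D by exact: bigcupT_measurable.
have mf : measurable_fun D f by apply/measurable_EFinP; exact: measurable_int fi.
have AD j : A_ j `<=` D by exact: bigcup_sup.
have fA j : mu.-integrable (A_ j) (EFin \o f) by exact: integrableS fi.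
have mI j : measurable_fun D (\1_(A_ j) : T -> R) by exact: measurable_indic.
have e1 j : \int[mu]_(x in D) (\1_(A_ j) x * f x) = \int[mu]_(x in A_ j) f x.
  rewrite /Rintegral; congr fine; rewrite -[in RHS](setIidr (AD j)) integral_mkcondr.
  apply: eq_integral => x _; rewrite patchE indicE.
  by case: (x \in A_ j); rewrite ?mul1r ?mul0r.
have I1 j : mu.-integrable D (EFin \o (fun x => \1_(A_ j) x * f x)).
  apply: (le_integrable mD _ _ fi); first by apply/measurable_EFinP; exact: measurable_funM.
  move=> x _; rewrite lee_fin normrM ler_piMl// indicE.
  by case: (_ \in _); rewrite ?normr1 ?normr0.
have disj x i j : A_ i x -> A_ j x -> i = j.
  by move=> Ai Aj; apply: (tA i j) => //; exists x.
have S01 m x : 0 <= \sum_(j < m) (\1_(A_ j) x : R) <= 1.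
  rewrite sumr_ge0 //=; have [[j Aj]|no] := pselect (exists j : 'I_m, A_ j x).
    rewrite (bigD1 j)//= indicE mem_set// big1 ?addr0// => i ij.
    rewrite indicE memNset// => Ai; move/eqP: ij; apply; apply/val_inj; exact: disj Ai Aj.
  by rewrite big1 ?ler01// => j _; rewrite indicE memNset// => Aj; apply: no; exists j.
have eS m : \sum_(j < m) \int[mu]_(x in A_ j) f x =
    \int[mu]_(x in D) ((\sum_(j < m) \1_(A_ j) x) * f x).
  elim: m => [|m ih].
    by rewrite big_ord0; under eq_Rintegral do rewrite big_ord0 mul0r; rewrite Rintegral_cst// mul0r.
  rewrite big_ord_recr /= ih -e1 -RintegralD//; last first.
    apply: (le_integrable mD _ _ fi).
      by apply/measurable_EFinP; apply: measurable_funM => //; exact: measurable_sum.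
    move=> x _; rewrite lee_fin normrM ler_piMl//; have /andP[h1 h2] := S01 m x.
    by rewrite ger0_norm.
  by apply: eq_Rintegral => x _; rewrite big_ord_recr /= mulrDl.
under eq_fun do rewrite eS.
apply: (@Rintegral_dominated_cvg _ _ _ mu D _ _ (fun x => `|f x|)) => //.
- by move=> m; apply: measurable_funM => //; exact: measurable_sum.
- apply: aeW => x [j _ Aj]; apply: cvg_near_cst; near=> m.
  have jm : (j < m)%N by near: m; exists j.+1.
  rewrite (bigD1 (Ordinal jm))//= indicE mem_set// big1 ?addr0 ?mul1r// => i ij.
  rewrite indicE memNset// => Ai; move/eqP: ij; apply; apply/val_inj; exact: disj Ai Aj.
- exact: integrable_norm fi.
- move=> m x _; rewrite normrM ler_piMl//; have /andP[h1 h2] := S01 m x.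
  by rewrite ger0_norm.
Unshelve. all: end_near. Qed.

End partition.

Lemma measurable_Rintegral_param {R : realType} d1 (T1 : measurableType d1)
    (nu : {measure set (measurableTypeR R) -> \bar R}) (A : set R)
    (F : T1 * measurableTypeR R -> R) (B : R) :
  measurable A -> (nu A < +oo)%E -> measurable_fun setT F -> (forall z, `|F z| <= B) ->
  measurable_fun setT (fun x => \int[nu]_(r in A) F (x, r)).
Proof.
move=> mA Aoo mF FB.
have mx x : measurable_fun setT (fun r => F (x, r)) by exact: (measurableT_comp mF (pair1_measurable x)).
have [A0|A0] := eqVneq (nu A) 0%E.
  rewrite (_ : (fun x => _) = cst 0); first exact: measurable_cst.
  apply/funext => x; rewrite /Rintegral null_set_integral//.
  by apply/measurable_EFinP; exact: measurable_funS (mx x).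
have [q [mq qE]] : exists q, samples nu A q.
  by apply: sample => //; rewrite lt0e A0 measure_ge0.
rewrite (_ : (fun x => _) = fun x => fine (nu A) * \int[coinP]_w F (x, q w)); last first.
  apply/funext => x.
  exact/esym/(@samples_real _ _ (measurableTypeR R) nu A q (fun r => F (x, r)) B mA Aoo
    (conj mq qE) (mx x) (fun r => FB (x, r))).
apply: measurable_funM => //.
apply: (@measurable_E_param R _ T1 (fun z => F (z.1, q z.2)) B) => //.
apply: (measurableT_comp mF); apply/measurable_fun_pairP; split => /=.
  exact: measurable_fst.
exact: (measurableT_comp mq measurable_snd).
Qed.

(** * Small and large jumps *)

Section levy_measure.
Context {R : realType} (nu : {measure set (measurableTypeR R) -> \bar R}).
Hypothesis levy : (\int[nu]_x (Order.min 1 (x ^+ 2))%:E < +oo)%E.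

(** The origin is left out, so that a countable union of sets of finite mass
    exhausts this set. *)
Definition small_jumps : set (measurableTypeR R) := [set r | 0 < `|r| <= 1].
Definition large_jumps : set (measurableTypeR R) := [set r | 1 < `|r|].
Local Notation U := small_jumps.
Local Notation L := large_jumps.

Let mnorm : measurable_fun [set: measurableTypeR R] (fun r : measurableTypeR R => `|r| : R). Proof. exact: normr_measurable. Qed.

Lemma measurable_small_jumps : measurable U.
Proof.
have := mnorm measurableT (measurable_itv `]0, 1]); rewrite setTI.
by congr measurable; apply/seteqP; split => r /=; rewrite in_itv.
Qed.

Lemma measurable_large_jumps : measurable L.
Proof.
have := mnorm measurableT (measurable_itv `]1, +oo[); rewrite setTI.
by congr measurable; apply/seteqP; split => r /=; rewrite in_itv /= andbT.
Qed.

Let mmin : measurable_fun setT (fun x : measurableTypeR R => (Order.min 1 (x ^+ 2))%:E).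
Proof.
apply/measurable_EFinP.
exact: (measurable_minr (measurable_cst (1 : R)) (measurable_funX 2 (@measurable_id _ _ setT))).
Qed.

Let min0 (x : R) : (0 <= (Order.min 1 (x ^+ 2))%:E)%E.
Proof. by rewrite lee_fin le_min ler01 sqr_ge0. Qed.

Let mcst_lty (D : set (measurableTypeR R)) (k : R) : measurable D -> 0 < k ->
  (forall r, D r -> k <= Order.min 1 (r ^+ 2)) -> (nu D < +oo)%E.
Proof.
move=> mD k0 Dk.
have : (k%:E * nu D < +oo)%E.
  rewrite -integral_cst//; apply: le_lt_trans levy.
  apply: (@le_trans _ _ (\int[nu]_(x in D) (Order.min 1 (x ^+ 2))%:E)%E).
    apply: ge0_le_integral => //.
    - by move=> x _; rewrite lee_fin ltW.
    - exact: measurable_funS mmin.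
  by apply: ge0_subset_integral.
by move=> h; rewrite ltey; apply/eqP => e; move: h; rewrite e gt0_muley ?lte_fin// ltxx.
Qed.

Lemma large_jumps_lty : (nu L < +oo)%E.
Proof.
apply: (@mcst_lty _ 1) => //; first exact: measurable_large_jumps.
move=> r /= r1; rewrite le_min lexx /= -(real_normK (num_real r)) expr_ge1//.
exact: ltW.
Qed.

Lemma integrable_small_jumps : nu.-integrable U (EFin \o (fun r : measurableTypeR R => r ^+ 2)).
Proof.
apply/integrableP; split.
  by apply/measurable_EFinP; apply: (measurable_funS measurableT) => //; exact: measurable_funX.
apply: le_lt_trans levy.
apply: (@le_trans _ _ (\int[nu]_(x in U) (Order.min 1 (x ^+ 2))%:E)%E).
  apply: ge0_le_integral => //.
  - exact: measurable_small_jumps.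
  - apply: measurableT_comp => //; apply/measurable_EFinP.
    by apply: (measurable_funS measurableT) => //; exact: measurable_funX.
  - exact: measurable_funS mmin.
  - move=> x /andP[x0 x1]; rewrite gee0_abs ?lee_fin ?sqr_ge0// le_min lexx andbT.
    by rewrite -(real_normK (num_real x)) expr_le1.
apply: ge0_subset_integral => //; exact: measurable_small_jumps.
Qed.

Let D_ (k : nat) : set (measurableTypeR R) := [set r | k.+1%:R^-1 < `|r| <= 1].

Let mD k : measurable (D_ k).
Proof.
have := mnorm measurableT (measurable_itv `]k.+1%:R^-1, 1]); rewrite setTI.
by congr measurable; apply/seteqP; split => r /=; rewrite in_itv.
Qed.

Let DU k : D_ k `<=` U.
Proof.
by move=> r /= /andP[h1 h2]; apply/andP; split => //; apply: lt_trans h1; rewrite invr_gt0 ltr0n.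
Qed.

Let D_mono : nondecreasing_seq D_.
Proof.
move=> i j ij; apply/subsetPset => r /= /andP[h1 h2]; apply/andP; split => //.
by apply: le_lt_trans h1; rewrite lef_pV2 ?posrE ?ltr0n// ler_nat.
Qed.

Let D_lty k : (nu (D_ k) < +oo)%E.
Proof.
apply: (@mcst_lty _ ((k.+1%:R^-1) ^+ 2)) => // r /= /andP[h1 h2].
rewrite le_min; apply/andP; split.
  by rewrite expr_le1 ?invr_ge0// invf_le1// ler1n.
by rewrite -(real_normK (num_real r)) lerXn2r ?nnegrE ?invr_ge0// ltW.
Qed.

Let S := \int[nu]_(r in U) r ^+ 2.
Let I k := \int[nu]_(r in D_ k) r ^+ 2.

Let I_split k : S - I k = \int[nu]_(r in U `\` D_ k) r ^+ 2.
Proof.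
have mU := measurable_small_jumps.
have iD : nu.-integrable (D_ k) (EFin \o (fun r : measurableTypeR R => r ^+ 2)).
  exact: (integrableS mU (mD k) (@DU k) integrable_small_jumps).
have iDc : nu.-integrable (U `\` D_ k) (EFin \o (fun r : measurableTypeR R => r ^+ 2)).
  by apply: (integrableS mU _ _ integrable_small_jumps); [exact: measurableD|exact: subDsetl].
have e : U = D_ k `|` (U `\` D_ k) by exact/esym/setDUK/DU.
rewrite /S [in LHS]e Rintegral_setU//; first by rewrite /I addrC addKr.
- by apply: measurableD => //; exact: mD.
- by rewrite -e; exact: integrable_small_jumps.
- by apply/disj_setPS => r [h1 [_ h2]].
Qed.

Let I_cvg : I k @[k --> \oo] --> S.
Proof.
have mU := measurable_small_jumps.
rewrite (_ : I = fun k => \int[nu]_(r in U) (\1_(D_ k) r * r ^+ 2)); last first.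
  apply/funext => k; rewrite /I /Rintegral; congr fine.
  rewrite -[in LHS](setIidr (@DU k)) integral_mkcondr.
  apply: eq_integral => x _; rewrite patchE indicE.
  by case: (x \in D_ k); rewrite ?mul1r ?mul0r.
apply: (@Rintegral_dominated_cvg _ _ _ nu U _ _ (fun r => r ^+ 2)) => //.
- move=> k; apply: (measurable_funS measurableT) => //; apply: measurable_funM.
    exact: measurable_indic.
  exact: measurable_funX.
- apply: aeW => r /andP[r0 r1]; apply: cvg_near_cst.
  have := @near_infty_natSinv_lt R (PosNum r0); apply: filterS => k /= kr.
  have Dr : D_ k r by apply/andP; split.
  by rewrite indicE mem_set// mul1r.
- exact: integrable_small_jumps.
- move=> k r _; rewrite normrM (ger0_norm (sqr_ge0 r)) ler_piMl ?sqr_ge0// indicE.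
  by case: (_ \in _); rewrite ?normr1 ?normr0.
Qed.

Let S0 : 0 <= S.
Proof. by apply: Rintegral_ge0 => r _; exact: sqr_ge0. Qed.

(** The second moment of nu on the set where |r| > 1/k increases to its finite
    value on all small jumps; cutting at radii where the rest falls below 4^-j
    gives shells of geometrically decreasing second moment. *)
Lemma small_jump_shells : exists (A_ : nat -> set (measurableTypeR R)) (s : R), [/\ 0 < s,
  forall j, measurable (A_ j), trivIset setT A_, \bigcup_j A_ j = U &
  forall j, (nu (A_ j) < +oo)%E /\
    (\int[nu]_(r in A_ j) (r ^+ 2)%:E <= ((s * 2^-1 ^+ j) ^+ 2)%:E)%E].
Proof.
have mU := measurable_small_jumps.
have /choice[N hN] : forall j : nat, exists k, forall k', (k <= k')%N -> S - I k' <= (2^-1 ^+ j.+1) ^+ 2.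
  move=> j; have e0 : 0 < (2^-1 ^+ j.+1) ^+ 2 :> R by rewrite !exprn_gt0// invr_gt0.
  have /cvgrPdist_le/(_ _ e0)[k _ hk] := I_cvg; exists k => k' kk'.
  exact: le_trans (ler_norm _) (hk k' kk').
pose M j := \sum_(i < j.+1) (N i + i)%N.
have MS j : M j.+1 = (M j + (N j.+1 + j.+1))%N by rewrite /M big_ord_recr.
have NM j : (N j <= M j)%N by rewrite /M big_ord_recr /=; lia.
have jM j : (j <= M j)%N by rewrite /M big_ord_recr /=; lia.
have Mmono : nondecreasing_seq (D_ \o M).
  apply/nondecreasing_seqP => j; apply: D_mono; rewrite MS; exact: leq_addr.
(* Nothing makes the first shell small; the summand S of the constant covers it. *)
exists (seqD (D_ \o M)), (S + 1); split.
- by rewrite ltr_wpDl.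
- by move=> [|j]; [exact: mD|apply: measurableD; exact: mD].
- exact: trivIset_seqD.
- rewrite eq_bigcup_seqD; apply/seteqP; split => [r [j _ /DU//]|r Ur].
  have /andP[r0 r1] := Ur.
  have [k _ hk] := @near_infty_natSinv_lt R (PosNum r0).
  by exists k => //; apply/andP; split => //; apply: hk; exact: jM.
move=> j; have sub : seqD (D_ \o M) j `<=` D_ (M j) by case: j => [//|j] r [].
have mj : measurable (seqD (D_ \o M) j) by case: j {sub} => [|j]; [exact: mD|apply: measurableD; exact: mD].
have ij (D : set (measurableTypeR R)) : measurable D -> D `<=` U -> (\int[nu]_(r in D) (r ^+ 2)%:E = (\int[nu]_(r in D) r ^+ 2)%:E)%E.
  move=> mD' DU'; rewrite /Rintegral fineK//; apply: integrable_fin_num => //.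
  exact: (integrableS mU mD' DU' integrable_small_jumps).
split; first by apply: le_lt_trans (D_lty (M j)); apply: le_measure => //; rewrite inE.
case: j sub mj => [|j] sub mj.
  rewrite expr0 mulr1; apply: (@le_trans _ _ (\int[nu]_(r in U) (r ^+ 2)%:E)%E).
    apply: ge0_subset_integral => //.
    - by apply/measurable_EFinP; apply: (measurable_funS measurableT) => //; exact: measurable_funX.
    - by move=> r _; rewrite lee_fin sqr_ge0.
    - exact: subset_trans sub (@DU _).
  by rewrite ij// lee_fin -/S; have := S0; nra.
apply: (@le_trans _ _ (\int[nu]_(r in U `\` D_ (M j)) (r ^+ 2)%:E)%E).
  apply: ge0_subset_integral => //.
  - exact: measurableD.
  - apply/measurable_EFinP; apply: (measurable_funS measurableT) => //; exact: measurable_funX.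
  - by move=> r _; rewrite lee_fin sqr_ge0.
  - by move=> r [/= /DU Ur nr]; split.
rewrite ij; [|exact: measurableD|exact: subDsetl].
rewrite -I_split lee_fin (le_trans (hN j _ (NM j)))// lerXn2r ?nnegrE ?mulr_ge0 ?exprn_ge0 ?invr_ge0 ?addr_ge0//.
by rewrite ler_peMl ?exprn_ge0 ?invr_ge0// lerDr.
Qed.

Lemma integrable_small_jumps_le (g : measurableTypeR R -> R) (k : R) : measurable_fun setT g ->
  (forall r, `|g r| <= k * r ^+ 2) -> nu.-integrable U (EFin \o g).
Proof.
move=> mg gk; have mU := measurable_small_jumps.
have ik := integrableZl mU k integrable_small_jumps.
apply: (le_integrable mU _ _ ik).
  by apply/measurable_EFinP; exact: measurable_funS mg.
move=> r _; rewrite -EFinM !abse_EFin lee_fin (le_trans (gk r))//; exact: ler_norm.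
Qed.

Lemma Rintegral_small_jumps_le (g : measurableTypeR R -> R) (k : R) : measurable_fun setT g ->
  (forall r, `|g r| <= k * r ^+ 2) -> `|\int[nu]_(r in U) g r| <= k * S.
Proof.
move=> mg gk; have mU := measurable_small_jumps.
have ik := integrableZl mU k integrable_small_jumps.
have ig := integrable_small_jumps_le mg gk.
rewrite (le_trans (le_normr_Rintegral mU ig))//.
have -> : k * S = \int[nu]_(r in U) (k * r ^+ 2) by rewrite RintegralZl//; exact: integrable_small_jumps.
by apply: le_Rintegral => //; exact: integrable_norm ig.
Qed.

End levy_measure.

(** * The jump part of the exponent *)

Section jump_exponents.
Context {R : realType} (nu : {measure set (measurableTypeR R) -> \bar R}).
Local Notation U := (@small_jumps R).
Local Notation L := (@large_jumps R).
Implicit Types (A : set (measurableTypeR R)) (z : R).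

(** The exponent of the jumps in A has real part Jc and imaginary part Js, or
    Jss when the jumps are compensated by their mean. *)
Definition Jc A z : R := \int[nu]_(r in A) (cos (r * z) - 1).
Definition Js A z : R := \int[nu]_(r in A) sin (r * z).
Definition Jss A z : R := \int[nu]_(r in A) (sin (r * z) - r * z).
(** The truncated mean size of a large jump against a test function of value z;
    it controls both the exponent and the bound M of the noise. *)
Definition Jmin z : R := \int[nu]_(r in L) Order.min 1 (`|r| * `|z|).
Definition psiRe s z : R := - (s ^+ 2 / 2) * z ^+ 2 + (Jc U z + Jc L z).
Definition psiIm gamma z : R := gamma * z + (Jss U z + Js L z).

Let mcos := continuous_measurable_fun (@continuous_cos R).
Let msin := continuous_measurable_fun (@continuous_sin R).
Let mlin z : measurable_fun setT (fun r : measurableTypeR R => r * z).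
Proof. exact: measurable_funM. Qed.

Lemma measurable_sinM z : measurable_fun setT (fun r : measurableTypeR R => sin (r * z)).
Proof. exact: (measurableT_comp msin (mlin z)). Qed.

Lemma measurable_cosB1 z : measurable_fun setT (fun r : measurableTypeR R => cos (r * z) - 1).
Proof. by apply: measurable_funB => //; exact: (measurableT_comp mcos (mlin z)). Qed.

Lemma measurable_sinB z : measurable_fun setT (fun r : measurableTypeR R => sin (r * z) - r * z).
Proof. by apply: measurable_funB => //; exact: measurable_sinM. Qed.

Let mprod : measurable_fun setT (fun p : measurableTypeR R * measurableTypeR R => p.2 * p.1 : R).
Proof.
apply: measurable_funM.
  exact: (@measurable_snd _ _ (measurableTypeR R) (measurableTypeR R)).
exact: (@measurable_fst _ _ (measurableTypeR R) (measurableTypeR R)).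
Qed.

Let mJparam (G : R -> R) B A : measurable A -> (nu A < +oo)%E -> measurable_fun setT G ->
  (forall y, `|G y| <= B) ->
  measurable_fun setT (fun z : measurableTypeR R => \int[nu]_(r in A) G (r * z)).
Proof.
move=> mA Aoo mG GB.
exact: (@measurable_Rintegral_param R _ (measurableTypeR R) nu A (fun p => G (p.2 * p.1)) B mA Aoo
  (measurableT_comp mG mprod) (fun p => GB _)).
Qed.

Lemma measurable_Jc A : measurable A -> (nu A < +oo)%E -> measurable_fun setT (Jc A).
Proof.
move=> mA Aoo; apply: (mJparam (G := fun y => cos y - 1) (B := 2)) => //.
  by apply: measurable_funB.
move=> y; rewrite (le_trans (ler_normB _ _))// normr1 -[leRHS]/(1 + 1) lerD2r.
exact: normr_cos_le1.
Qed.

Lemma measurable_Js A : measurable A -> (nu A < +oo)%E -> measurable_fun setT (Js A).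
Proof.
by move=> mA Aoo; apply: (mJparam (G := sin) (B := 1)) => // y; exact: normr_sin_le1.
Qed.

Lemma measurable_Jss A : measurable A -> (nu A < +oo)%E -> (forall r, A r -> `|r| <= 1) ->
  measurable_fun setT (Jss A).
Proof.
move=> mA Aoo A1.
have bi (g : measurableTypeR R -> R) : measurable_fun setT g -> (forall r, A r -> `|g r| <= 1) ->
    nu.-integrable A (EFin \o g).
  move=> mg g1; apply: measurable_bounded_integrable => //; first exact: measurable_funS mg.
  by exists 1; split; [exact: num_real|move=> y By r Ar; exact: le_trans (g1 r Ar) (ltW By)].
rewrite (_ : Jss A = fun z => Js A z - (\int[nu]_(r in A) r) * z).
  by apply: measurable_funB; [exact: measurable_Js|exact: measurable_funM].
apply/funext => z; rewrite /Jss /Js.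
have ir : nu.-integrable A (EFin \o (fun r : measurableTypeR R => r)) by exact: bi.
rewrite RintegralB//; first by rewrite RintegralZr.
  by apply: bi => [|r _]; [exact: measurable_sinM|exact: normr_sin_le1].
by have := integrableZr mA z ir.
Qed.

Hypothesis levy : (\int[nu]_x (Order.min 1 (x ^+ 2))%:E < +oo)%E.

Let mU := @measurable_small_jumps R.
Let mL := @measurable_large_jumps R.
Let Loo := large_jumps_lty levy.
Let S := \int[nu]_(r in U) r ^+ 2.

Lemma JcU_le z : `|Jc U z| <= z ^+ 2 * S.
Proof.
apply: (Rintegral_small_jumps_le levy (measurable_cosB1 z)) => r.
by rewrite (le_trans (norm_cosB1_le _))// exprMn mulrC.
Qed.

Lemma JssU_le z : `|Jss U z| <= z ^+ 2 * S.
Proof.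
apply: (Rintegral_small_jumps_le levy (measurable_sinB z)) => r.
by rewrite (le_trans (norm_sinB_le _))// exprMn mulrC.
Qed.

Let mJU (H : R -> R -> R) : (forall z, measurable_fun setT (H z)) ->
  (forall z r, `|H z r| <= z ^+ 2 * r ^+ 2) ->
  (forall A, measurable A -> (nu A < +oo)%E -> (forall r, A r -> `|r| <= 1) ->
     measurable_fun setT (fun z : R => \int[nu]_(r in A) H z r)) ->
  measurable_fun setT (fun z : R => \int[nu]_(r in U) H z r).
Proof.
move=> mH Hb mJ; have [A_ [s [s0 mA tA AU hA]]] := small_jump_shells levy.
apply: (@measurable_fun_cvg _ _ _ _ (fun m z => \sum_(j < m) \int[nu]_(r in A_ j) H z r)).
  move=> m; apply: measurable_sum => j; apply: mJ => //; first exact: (hA j).1.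
  by move=> r Ar; have : U r by [rewrite -AU; exists j]; move=> /andP[].
move=> z _; have iz := integrable_small_jumps_le levy (mH z) (Hb z); rewrite -AU in iz.
by have := cvg_Rintegral_partition mA tA iz; rewrite AU.
Qed.

Lemma measurable_JcU : measurable_fun setT (Jc U).
Proof.
apply: (mJU (H := fun z r => cos (r * z) - 1)); first exact: measurable_cosB1.
  by move=> z r; rewrite (le_trans (norm_cosB1_le _))// exprMn mulrC.
by move=> A mA Aoo _; exact: measurable_Jc.
Qed.

Lemma measurable_JssU : measurable_fun setT (Jss U).
Proof.
apply: (mJU (H := fun z r => sin (r * z) - r * z)); first exact: measurable_sinB.
  by move=> z r; rewrite (le_trans (norm_sinB_le _))// exprMn mulrC.
by move=> A mA Aoo A1; exact: measurable_Jss.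
Qed.

Let mmin z : measurable_fun setT (fun r : measurableTypeR R => Order.min 1 (`|r| * `|z|)).
Proof.
by apply: (measurable_minr (measurable_cst (1 : R))); apply: measurable_funM => //.
Qed.

Let min0 (r z : R) : 0 <= Order.min 1 (`|r| * `|z|).
Proof. by rewrite le_min ler01 mulr_ge0. Qed.

Let bL (g : measurableTypeR R -> R) B : measurable_fun setT g -> (forall r, `|g r| <= B) ->
  nu.-integrable L (EFin \o g).
Proof.
move=> mg gB; apply: measurable_bounded_integrable => //; first exact: measurable_funS mg.
by exists B; split; [exact: num_real|move=> y By r _; exact: le_trans (gB r) (ltW By)].
Qed.

Let imin z : nu.-integrable L (EFin \o (fun r : measurableTypeR R => Order.min 1 (`|r| * `|z|))).
Proof. by apply: (@bL _ 1) => [|r]; [exact: mmin|rewrite (ger0_norm (min0 r z)) ge_min lexx]. Qed.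

Lemma Jmin_ge0 z : 0 <= Jmin z. Proof. exact: Rintegral_ge0. Qed.

Lemma Jmin_EFin z : ((Jmin z)%:E = \int[nu]_(r in L) (Order.min 1 (`|r| * `|z|))%:E)%E.
Proof. by rewrite /Jmin /Rintegral fineK//; exact: integrable_fin_num (imin z). Qed.

Lemma Jmin_le z : Jmin z <= fine (nu L).
Proof.
rewrite -[leRHS]mul1r -Rintegral_cst//; apply: le_Rintegral => //.
by apply: (@bL _ 1) => // r; rewrite normr1.
Qed.

Lemma measurable_Jmin : measurable_fun setT Jmin.
Proof.
rewrite (_ : Jmin = fun z => \int[nu]_(r in L) (fun y => Order.min 1 `|y|) (r * z)); last first.
  by apply/funext => z; apply: eq_Rintegral => r _; rewrite normrM.
apply: (mJparam (G := fun y => Order.min 1 `|y|) (B := 1)) => //.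
  by apply: (measurable_minr (measurable_cst (1 : R))); exact: normr_measurable.
move=> y; have h : 0 <= Order.min 1 `|y| by rewrite le_min ler01 normr_ge0.
by rewrite (ger0_norm h) ge_min lexx.
Qed.

Lemma JcL_le z : `|Jc L z| <= 2 * Jmin z.
Proof.
have i1 : nu.-integrable L (EFin \o (fun r : measurableTypeR R => cos (r * z) - 1)).
  apply: (@bL _ 2); first exact: measurable_cosB1.
  by move=> r; rewrite (le_trans (ler_normB _ _))// normr1 -[leRHS]/(1 + 1) lerD2r normr_cos_le1.
rewrite (le_trans (le_normr_Rintegral mL i1))// -RintegralZl//.
apply: le_Rintegral => //; first exact: integrable_norm i1.
  by have := integrableZl mL 2 (imin z).
move=> r _; rewrite -normrM; case: (leP 1 `|r * z|) => h.
  by rewrite mulr1 (le_trans (ler_normB _ _))// normr1 -[leRHS]/(1 + 1) lerD2r normr_cos_le1.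
rewrite (le_trans (norm_cosB1_le _))// -(real_normK (num_real (r * z))) expr2.
by have := normr_ge0 (r * z); nra.
Qed.

Lemma JsL_le z : `|Js L z| <= 2 * Jmin z.
Proof.
have i1 : nu.-integrable L (EFin \o (fun r : measurableTypeR R => sin (r * z))).
  by apply: (@bL _ 1); [exact: measurable_sinM|move=> r; exact: normr_sin_le1].
rewrite (le_trans (le_normr_Rintegral mL i1))// -RintegralZl//.
apply: le_Rintegral => //; first exact: integrable_norm i1.
  by have := integrableZl mL 2 (imin z).
move=> r _; rewrite -normrM; have := norm_sin_le (r * z); have := normr_sin_le1 (r * z).
by case: (leP 1 `|r * z|) => h; have := normr_ge0 (r * z); lra.
Qed.

End jump_exponents.

(** * Noise on a unit cube *)

Section noise_helpers.
Context {R : realType} {T0 : Type}.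
Variable Bd : (T0 -> R) -> R -> Prop.
Hypothesis Bd_ge0 : forall f C, Bd f C -> 0 <= C.
Local Notation P := (@coinP R).
Local Notation noise := (is_noise Bd).

Lemma noise_le Psi eps eps' X M : (eps <= eps')%E -> noise Psi eps X M -> noise Psi eps' X M.
Proof. by move=> le [h1 h2 h3 h4]; split => //; exact: le_trans le. Qed.

Lemma noise_ext Psi Psi' eps X M : (forall f, test Bd f -> Psi f = Psi' f) ->
  noise Psi eps X M -> noise Psi' eps X M.
Proof. by move=> e [h1 h2 h3 h4]; split => // f tf; rewrite h4// e. Qed.

Lemma cexp_i (c : R) : cexp ('i * c%:C) = cos c +i* sin c.
Proof.
have -> : ('i * c%:C = 0 +i* c :> R[i])%R.
  by apply/eqP; rewrite eq_complex /=; apply/andP; split; apply/eqP; ring.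
rewrite /cexp /= expR0.
by apply/eqP; rewrite eq_complex /=; apply/andP; split; apply/eqP; ring.
Qed.

Lemma charf_shift (X : coin -> R) c : measurable_fun setT X ->
  charf (fun w => X w + c) = charf X * cexp ('i * c%:C).
Proof.
move=> mX; have Ic := bounded_integrable coinP_oo (measurable_cosX mX) (fun w => normr_cos_le1 (X w)).
have Is := bounded_integrable coinP_oo (measurable_sinX mX) (fun w => normr_sin_le1 (X w)).
have Z k g : P.-integrable setT (EFin \o g) -> P.-integrable setT (EFin \o (fun w => g w * k)).
  by move=> Ig; have := integrableZr measurableT k Ig.
rewrite /charf /=.
have -> : \int[P]_w cos (X w + c) = \int[P]_w cos (X w) * cos c - \int[P]_w sin (X w) * sin c.
  rewrite -!RintegralZr// -RintegralB//; [|exact: Z Ic|exact: Z Is].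
  by apply: eq_Rintegral => w _; rewrite cosD.
have -> : \int[P]_w sin (X w + c) = \int[P]_w sin (X w) * cos c + \int[P]_w cos (X w) * sin c.
  rewrite -!RintegralZr// -RintegralD//; [|exact: Z Is|exact: Z Ic].
  by apply: eq_Rintegral => w _; rewrite sinD.
rewrite cexp_i.
by apply/eqP; rewrite eq_complex /=; apply/andP; split; apply/eqP; ring.
Qed.

Lemma charf_cst (c : R) : charf (fun=> c) = cexp ('i * c%:C).
Proof.
by rewrite cexp_i /charf /= !Rintegral_coin_cst.
Qed.

Lemma noise0 : noise (fun=> 0) 0%E (fun _ _ => 0) (fun=> 0%E).
Proof.
split.
- by split => [f tf|w k f g tf tg]; [exact: measurable_cst|rewrite mulr0 addr0].
- split => //; try by apply: aeW => w; rewrite ltry.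
  by move=> w f C Bf _; rewrite normr0 /= mul0r.
- by rewrite (_ : (\int[P]_w _ = 0)%E)//; under eq_integral do rewrite min_r//; exact: integral0.
- move=> f tf; rewrite charf_cst.
  by congr cexp; apply/eqP; rewrite eq_complex /= ; apply/andP; split; apply/eqP; ring.
Qed.

(** A series of noises with two non-zero terms. *)
Lemma noise_add Psi1 Psi2 (eps1 eps2 : R) X1 X2 M1 M2 : noise Psi1 eps1%:E X1 M1 ->
  noise Psi2 eps2%:E X2 M2 ->
  exists X M, noise (fun f => Psi1 f + Psi2 f) (eps1 + eps2)%:E X M.
Proof.
move=> n1 n2.
pose Psi_ m := match m with 0%N => Psi1 | 1%N => Psi2 | _ => fun=> 0 end.
pose e_ m : R := match m with 0%N => eps1 | 1%N => eps2 | _ => 0 end.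
pose eps_ m := (e_ m)%:E.
have two (V : zmodType) (u : nat -> V) k : (1 < k)%N -> (forall m, u m.+2 = 0) ->
    \sum_(m < k) u m = u 0%N + u 1%N.
  move=> k1 u0; rewrite -(subnKC k1) add2n !big_ord_recl /= big1 ?addr0//.
pose X_ m := match m with 0%N => X1 | 1%N => X2 | _ => (fun _ _ => 0) end.
pose M_ m := match m with 0%N => M1 | 1%N => M2 | _ => (fun=> 0%E) end.
have n_ m : noise (Psi_ m) (eps_ m) (X_ m) (M_ m).
  by case: m => [|[|m]]; [exact: n1|exact: n2|exact: noise0].
have eps0 m : (0 <= eps_ m)%E.
  have [_ [mM M0 _ _] le _] := n_ m; apply: le_trans le; apply: integral_ge0 => w _.
  by rewrite le_min lee01 M0.
have es : (\sum_(m <oo) eps_ m = (eps1 + eps2)%:E)%E.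
  by apply: nneseries_EFin_cvg; apply: cvg_near_cst; near=> k; rewrite two//; near: k; exists 2%N.
rewrite -es; apply: (noise_series n_ Bd_ge0); first by rewrite es ltry.
move=> f tf; have e k : (1 < k)%N -> \sum_(m < k) Psi_ m f = Psi1 f + Psi2 f.
  by move=> k1; rewrite (two _ (fun m => Psi_ m f)).
by split; apply: cvg_near_cst; near=> k; rewrite e//; near: k; exists 2%N.
Unshelve. all: end_near. Qed.

End noise_helpers.

Section cube_noise.
Context {R : realType} {n : nat}.
Local Notation P := (@coinP R).
Local Notation leb := (@lebesgue_rV R).
Variables (Bd : ('rV[R]_n -> R) -> R -> Prop) (v : 'rV[R]_n -> R) (a : nat -> R) (W : R).
Local Notation Q := (@ucube R n a).
Hypothesis Bd_meas : forall f C, Bd f C -> measurable_fun setT f.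
Hypothesis Bd_ge0 : forall f C, Bd f C -> 0 <= C.
Hypothesis Bd_le : forall f C, Bd f C -> forall x, `|f x| <= C * v x.
Hypothesis Bd_lip : forall f C, Bd f C -> mixed_lipschitz a (C * W) f.
Hypothesis W0 : 0 <= W.
Hypothesis vW : forall x, Q x -> v x <= W.
Local Notation noise := (is_noise Bd).

Lemma Bd_cube f C : Bd f C -> forall x, Q x -> `|f x| <= C * W.
Proof. by move=> Bf x Qx; rewrite (le_trans (Bd_le Bf x))// ler_wpM2l ?(Bd_ge0 Bf) ?vW. Qed.

Lemma ucube_oo : (leb n Q < +oo)%E.
Proof. by have -> : leb n Q = 1%E by [exact: lebesgue_ucube]; rewrite ltry. Qed.

Lemma integrable_on_ucube (f : 'rV[R]_n -> R) C : measurable_fun setT f ->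
  (forall x, Q x -> `|f x| <= C) -> (leb n).-integrable Q (EFin \o f).
Proof.
move=> mf fC; apply: measurable_bounded_integrable.
- exact: measurable_ucube.
- exact: ucube_oo.
- exact: measurable_funS mf.
- by exists C; split; [exact: num_real|move=> y By z Qz; exact: le_trans (fC z Qz) (ltW By)].
Qed.

Lemma Rintegral_ucube_le (f : 'rV[R]_n -> R) C : measurable_fun setT f ->
  (forall x, Q x -> `|f x| <= C) -> `|\int[leb n]_(x in Q) f x| <= C.
Proof.
move=> mf fC; have If := integrable_on_ucube mf fC; have mQ := @measurable_ucube R n a.
have IC : (leb n).-integrable Q (EFin \o (fun=> C)).
  by apply: (@integrable_on_ucube _ `|C|).
rewrite (le_trans (le_normr_Rintegral mQ If))//.
have : \int[leb n]_(x in Q) `|f x| <= \int[leb n]_(x in Q) C.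
  by apply: le_Rintegral => //; exact: integrable_norm If.
rewrite Rintegral_cst//.
have u1 : leb n (@ucube R n a) = 1%E by exact: lebesgue_ucube.
by rewrite (_ : fine _ = 1) ?mulr1//; exact: (congr1 fine u1).
Qed.

Let test_int f : test Bd f -> (leb n).-integrable Q (EFin \o f).
Proof. by case=> C Bf; exact: integrable_on_ucube (Bd_meas Bf) (Bd_cube Bf). Qed.

Lemma drift_noise gamma : exists X M,
  noise (fun f => 'i * (gamma * \int[leb n]_(x in Q) f x)%:C) (`|gamma| * W)%:E X M.
Proof.
have mQ := @measurable_ucube R n a.
exists (fun _ f => gamma * \int[leb n]_(x in Q) f x), (fun=> (`|gamma| * W)%:E); split.
- split => [f _|w k f g tf tg]; first exact: measurable_cst.
  rewrite RintegralD//; [|by have := integrableZl mQ k (test_int tf)|exact: test_int].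
  rewrite RintegralZl//; last exact: test_int.
  ring.
- split => //.
  + by move=> w; rewrite lee_fin mulr_ge0.
  + by apply: aeW => w; rewrite ltry.
  + move=> w f C Bf _; rewrite normrM -mulrA ler_wpM2l// mulrC.
    exact: (Rintegral_ucube_le (Bd_meas Bf) (Bd_cube Bf)).
- rewrite (integral_coin_cst (Order.min 1 (`|gamma| * W)%:E)%E).
  by rewrite ge_min lexx orbT.
- by move=> f _; rewrite charf_cst.
Qed.

Section with_frame.
Variables (h : nat -> 'rV[R]_n -> R) (c : nat -> R) (K : R).
Hypothesis fr : haar_frame a h c K.

Definition coef i f := \int[leb n]_x (h i x * f x).

Lemma coef_linear i k f g : test Bd f -> test Bd g ->
  coef i (fun x => k * f x + g x) = k * coef i f + coef i g.
Proof.
have [[mh bh sh] _ _ _ _] := fr.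
have I f' : test Bd f' -> (leb n).-integrable setT (EFin \o (fun x => h i x * f' x)).
  move=> [C Bf]; have [B hB] := bh i.
  apply: (@integrable_ucube R n a _ (B * (C * W))).
  - by apply: measurable_funM => //; exact: Bd_meas Bf.
  - by move=> x Qx; rewrite normrM ler_pM// (Bd_cube Bf).
  - by move=> x /sh ->; rewrite mul0r.
move=> tf tg; rewrite /coef -RintegralZl//; last exact: I.
rewrite -RintegralD//; [|by have := integrableZl measurableT k (I _ tf)|exact: I].
by apply: eq_Rintegral => x _; ring.
Qed.

Lemma coef_bound i f C : Bd f C -> `|coef i f| <= c i * (C * W).
Proof. by move=> Bf; have [_ _ _ + _] := fr; apply; [exact: Bd_meas Bf|exact: Bd_lip]. Qed.

Lemma coef_expansion f C : Bd f C -> forall x, Q x ->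
  series (fun i => coef i f * h i x) @ \oo --> f x.
Proof.
by move=> Bf x Qx; have [_ _ _ _ e] := fr; exact: (e f _ (Bd_meas Bf) (Bd_lip Bf) x Qx).
Qed.

Let c0 i : 0 <= c i. Proof. by have [_ _ []] := fr. Qed.

Let K0 : 0 <= K.
Proof.
have [_ _ [_ cK _] _ _] := fr; rewrite -lee_fin (le_trans _ cK)//.
by apply: nneseries_ge0 => i _ _; rewrite lee_fin.
Qed.

(** The pointwise summability of the frame bounds all partial sums, which is the
    domination used below. *)
Lemma partial_expansion_le f C : Bd f C -> forall x m,
  `|\sum_(0 <= i < m) coef i f * h i x| <= C * W * K.
Proof.
move=> Bf x m; have [_ _ [_ _ cK] _ _] := fr.
have CW0 : 0 <= C * W by rewrite mulr_ge0// (Bd_ge0 Bf).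
apply: (@le_trans _ _ (C * W * \sum_(0 <= i < m) c i * `|h i x|)).
  rewrite (le_trans (ler_norm_sum _ _ _))// mulr_sumr ler_sum// => i _.
  by rewrite normrM mulrA (mulrC (C * W)) ler_wpM2r// coef_bound.
rewrite ler_wpM2l// -lee_fin (le_trans _ (cK x))// -sumEFin.
by apply: nneseries_lim_ge => i _ _; rewrite lee_fin mulr_ge0.
Qed.

(** Parseval's identity: integrate f against its own expansion, by dominated
    convergence. *)
Lemma cvg_sum_coef_sqr f : test Bd f ->
  series (fun i => coef i f ^+ 2) @ \oo --> \int[leb n]_(x in Q) (f x) ^+ 2.
Proof.
move=> [C Bf]; have mQ := @measurable_ucube R n a; have [[mh bh sh] _ _ _ _] := fr.
have mf := Bd_meas Bf.
have coefQ i : coef i f = \int[leb n]_(x in Q) (h i x * f x).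
  rewrite /coef /Rintegral [in RHS]integral_mkcond; congr fine.
  apply: eq_integral => x _; rewrite patchE; case: ifPn => // /negP nQ.
  by rewrite sh ?mul0r// => Qx; apply: nQ; rewrite inE.
have I i : (leb n).-integrable Q (EFin \o (fun x => coef i f * (h i x * f x))).
  have [B hB] := bh i.
  apply: (@integrable_on_ucube _ (`|coef i f| * (B * (C * W)))).
    by apply: measurable_funM => //; exact: measurable_funM.
  by move=> x Qx; rewrite normrM ler_wpM2l// normrM ler_pM// (Bd_cube Bf).
have -> : series (fun i => coef i f ^+ 2) = (fun m => \int[leb n]_(x in Q)
    ((\sum_(0 <= i < m) coef i f * h i x) * f x)).
  apply/funext => m; rewrite /series /=.
  transitivity (\int[leb n]_(x in Q) (\sum_(0 <= i < m) coef i f * (h i x * f x))).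
    elim: m => [|m ih].
      rewrite big_nil; under eq_Rintegral do rewrite big_nil.
      by rewrite Rintegral_cst// mul0r.
    rewrite big_nat_recr//= ih; under [RHS]eq_Rintegral do rewrite big_nat_recr//=.
    rewrite RintegralD//; last first.
      apply: (@integrable_on_ucube _ (C * W * K * (C * W))).
        by apply: measurable_sum => i; apply: measurable_funM => //; exact: measurable_funM.
      move=> x Qx; rewrite (_ : \sum_(0 <= i < m) _ = (\sum_(0 <= i < m) coef i f * h i x) * f x).
        by rewrite normrM ler_pM// ?(partial_expansion_le Bf) ?(Bd_cube Bf).
      by rewrite mulr_suml; apply: eq_bigr => i _; rewrite mulrA.
    congr (_ + _); rewrite expr2 {2}coefQ RintegralZl//.
    have [B hB] := bh m; apply: (@integrable_on_ucube _ (B * (C * W))).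
      exact: measurable_funM.
    by move=> x Qx; rewrite normrM ler_pM// (Bd_cube Bf).
  by apply: eq_Rintegral => x _; rewrite mulr_suml; apply: eq_bigr => i _; rewrite mulrA.
apply: (@Rintegral_dominated_cvg _ _ _ (leb n) Q _ _ (fun=> C * W * K * (C * W))) => //.
- move=> m; apply: (measurable_funS measurableT) => //; apply: measurable_funM => //.
  by apply: measurable_sum => i; apply: measurable_funM.
- by apply: (measurable_funS measurableT) => //; exact: measurable_funX.
- apply: aeW => x Qx; rewrite expr2; apply: cvgM; last exact: cvg_cst.
  exact: (coef_expansion Bf Qx).
- apply: (@integrable_on_ucube _ (`|C * W * K * (C * W)|)) => //.
- by move=> m x Qx; rewrite normrM ler_pM// ?(partial_expansion_le Bf) ?(Bd_cube Bf).
Qed.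

Variables (xi : coin -> R) (m1 : R).
Hypothesis mxi : measurable_fun setT xi.
Hypothesis xi1 : (\int[P]_w (`|xi w|)%:E <= m1%:E)%E.
Hypothesis cxi : forall t, charf (fun w => t * xi w) = cexp (- (t ^+ 2 / 2))%:C.

Let gaussian_term (s : R) i : 0 <= s ->
  noise (fun f => (- (s ^+ 2 / 2 * coef i f ^+ 2))%:C) (s * W * c i * m1)%:E
    (fun w f => s * coef i f * xi w) (fun w => (s * W * c i * `|xi w|)%:E).
Proof.
move=> s0; have k0 : 0 <= s * W * c i by rewrite !mulr_ge0.
have mM : measurable_fun setT (fun w => (s * W * c i * `|xi w|)%:E).
  by apply/measurable_EFinP; apply: measurable_funM => //; exact: measurableT_comp.
split.
- split => [f _|w k f g tf tg]; first exact: measurable_funM.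
  by rewrite coef_linear//; ring.
- split => //.
  + by move=> w; rewrite lee_fin mulr_ge0.
  + by apply: aeW => w; rewrite ltry.
  + move=> w f C Bf _; rewrite /= !normrM (ger0_norm s0).
    have := coef_bound i Bf; have := normr_ge0 (xi w) => p1 p2.
    rewrite (le_trans (ler_wpM2r p1 (ler_wpM2l s0 p2)))//.
    by rewrite le_eqVlt; apply/orP; left; apply/eqP; ring.
- apply: (@le_trans _ _ (\int[P]_w (s * W * c i * `|xi w|)%:E)%E).
    apply: ge0_le_integral => //.
    + by move=> w _; rewrite le_min lee01 lee_fin mulr_ge0.
    + exact: measurable_mine.
    + by move=> w _; rewrite ge_min lexx orbT.
  under eq_integral do rewrite EFinM.
  rewrite ge0_integralZl//; last by apply/measurable_EFinP; exact: measurableT_comp.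
  by rewrite [leRHS]EFinM lee_wpmul2l// lee_fin.
- move=> f _; rewrite cxi; congr (cexp _%:C); by rewrite exprMn; lra.
Qed.

(** The series of coef i f * xi_i with independent standard Gaussian xi_i: by
    Parseval its variance is the integral of f^2, and its bound M is the series
    of c_i * |xi_i|, of finite mean. *)
Lemma gaussian_noise (s : R) : 0 <= s -> exists X M,
  noise (fun f => (- (s ^+ 2 / 2 * \int[leb n]_(x in Q) (f x) ^+ 2))%:C) (s * W * K * m1)%:E X M.
Proof.
move=> s0; have [_ _ [_ cK _] _ _] := fr.
have m10 : 0 <= m1 by rewrite -lee_fin (le_trans _ xi1)//; exact: integral_ge0.
have es : (\sum_(i <oo) (s * W * c i * m1)%:E <= (s * W * K * m1)%:E)%E.
  under eq_eseriesr do rewrite -mulrA (mulrC (c _)) mulrA EFinM.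
  rewrite nneseriesZl; last by move=> i _; rewrite lee_fin.
  rewrite (_ : s * W * K * m1 = s * W * m1 * K); last by ring.
  by rewrite [leRHS]EFinM lee_wpmul2l// lee_fin !mulr_ge0.
have [||X [M nX]] := @noise_series R _ Bd
  (fun i f => (- (s ^+ 2 / 2 * coef i f ^+ 2))%:C) (fun i => (s * W * c i * m1)%:E) _ _
  (fun f => (- (s ^+ 2 / 2 * \int[leb n]_(x in Q) (f x) ^+ 2))%:C)
  (fun i => gaussian_term i s0) Bd_ge0.
- exact: le_lt_trans es (ltry _).
- move=> f tf; split.
    have -> : (fun m => Re (\sum_(i < m) (- (s ^+ 2 / 2 * coef i f ^+ 2))%:C)) =
        (fun m => - (s ^+ 2 / 2) * series (fun i => coef i f ^+ 2) m).
      apply/funext => m; rewrite -rmorph_sum /= /series /= big_mkord mulr_sumr.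
      by apply: eq_bigr => i _; rewrite mulNr.
    have -> : Re (- (s ^+ 2 / 2 * \int[leb n]_(x in Q) f x ^+ 2))%:C =
        - (s ^+ 2 / 2) * \int[leb n]_(x in Q) f x ^+ 2 by rewrite /= mulNr.
    have cc : (fun _ : nat => - (s ^+ 2 / 2)) m @[m --> \oo] --> - (s ^+ 2 / 2) by exact: cvg_cst.
    exact: (cvgM cc (cvg_sum_coef_sqr tf)).
  have -> : (fun m => Im (\sum_(i < m) (- (s ^+ 2 / 2 * coef i f ^+ 2))%:C)) = (fun=> 0).
    by apply/funext => m; rewrite -rmorph_sum.
  exact: cvg_cst.
- by exists X, M; exact: noise_le es nX.
Qed.

Section jump.
Variables (nu : {measure set (measurableTypeR R) -> \bar R}) (A : set R).
Hypothesis mA : measurable A.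
Hypothesis A_oo : (nu A < +oo)%E.
Variables (q : coin -> 'rV[R]_n * measurableTypeR R) (N : coin -> nat).
Hypothesis mq : measurable_fun setT q.
Local Notation lam := (fine (nu A)).
Hypothesis qE : forall F : 'rV[R]_n * measurableTypeR R -> \bar R,
  measurable_fun setT F -> (forall x, 0 <= F x)%E ->
  (nu A * \int[P]_w F (q w) = \int[leb n]_(x in Q) \int[nu]_(r in A) F (x, r))%E.
Hypothesis qR : forall (F : 'rV[R]_n * measurableTypeR R -> R) B, measurable_fun setT F ->
  (forall z, `|F z| <= B) ->
  lam * \int[P]_w F (q w) = \int[leb n]_(x in Q) \int[nu]_(r in A) F (x, r).
Hypothesis mN : measurable_fun setT N.
Hypothesis PN : forall k, P (N @^-1` [set k]) = (pois lam k)%:E.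

(** The contribution to the noise of a jump of size r at the point x; the
    indicators make it vanish outside the support of the intensity. *)
Definition jump (f : 'rV[R]_n -> R) (p : 'rV[R]_n * measurableTypeR R) : R :=
  (\1_Q p.1 * \1_A p.2) * (p.2 * f p.1).

Let mQ := @measurable_ucube R n a.
Let nuAf : nu A \is a fin_num. Proof. by rewrite ge0_fin_numE. Qed.

Let mind : measurable_fun setT (fun p : 'rV[R]_n * measurableTypeR R => \1_Q p.1 * \1_A p.2 : R).
Proof.
have i1 : measurable_fun setT (\1_Q : 'rV[R]_n -> R) by exact: measurable_indic.
have i2 : measurable_fun setT (\1_A : measurableTypeR R -> R) by exact: measurable_indic.
apply: measurable_funM.
  exact: (measurableT_comp i1 measurable_fst).
exact: (measurableT_comp i2 measurable_snd).
Qed.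

Let measurable_jump (f : 'rV[R]_n -> R) : measurable_fun setT f -> measurable_fun setT (jump f).
Proof.
move=> mf; apply: (measurable_funM mind); apply: measurable_funM; last first.
  exact: (measurableT_comp mf measurable_fst).
exact: (@measurable_snd _ _ 'rV[R]_n (measurableTypeR R)).
Qed.

Let indE (p : 'rV[R]_n * measurableTypeR R) :
  \1_Q p.1 * \1_A p.2 = (`[< Q p.1 /\ A p.2 >])%:R :> R.
Proof.
rewrite !indicE -natrM mulnb; congr (nat_of_bool _)%:R; apply/andP/asboolP.
  by rewrite !inE.
by rewrite !inE.
Qed.

Let jumpE f x r : Q x -> A r -> jump f (x, r) = r * f x.
Proof. by move=> Qx Ar; rewrite /jump indE /= asboolT ?mul1r. Qed.

Let jump0 f p : ~ (Q p.1 /\ A p.2) -> jump f p = 0.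
Proof. by move=> np; rewrite /jump indE /= asboolF ?mul0r. Qed.

Let jump_integral (G : R -> R) (B : R) (f : 'rV[R]_n -> R) : measurable_fun setT G -> (forall z, `|G z| <= B) ->
  measurable_fun setT f ->
  lam * \int[P]_w G (jump f (q w)) = \int[leb n]_(x in Q) \int[nu]_(r in A) G (r * f x).
Proof.
move=> mG GB mf; rewrite (qR (F := G \o jump f) (B := B)); last 2 first.
- exact: (measurableT_comp mG (measurable_jump mf)).
- by move=> z; exact: GB.
apply: eq_Rintegral => x; rewrite inE => Qx; apply: eq_Rintegral => r; rewrite inE => Ar.
by rewrite /= jumpE.
Qed.

Let mcos1 : measurable_fun setT (fun z : R => cos z - 1).
Proof.
apply: measurable_funB => //.
exact: (continuous_measurable_fun (@continuous_cos R)).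
Qed.

Let msin : measurable_fun setT (fun z : R => sin z).
Proof. exact: (continuous_measurable_fun (@continuous_sin R)). Qed.

Lemma charf_jump f : measurable_fun setT f -> charf (csum q N (jump f)) =
  cexp ((\int[leb n]_(x in Q) \int[nu]_(r in A) (cos (r * f x) - 1)) +i*
        (\int[leb n]_(x in Q) \int[nu]_(r in A) sin (r * f x))).
Proof.
move=> mf; rewrite (charf_csum mq mN PN (measurable_jump mf)); congr cexp.
have mjq := measurableT_comp (measurable_jump mf) mq.
have cos2 z : `|cos z - 1| <= 2 :> R.
  by rewrite (le_trans (ler_normB _ _))// normr1 -[leRHS]/(1 + 1) lerD2r normr_cos_le1.
rewrite -(jump_integral mcos1 cos2 mf) -(jump_integral msin (@normr_sin_le1 R) mf).
have -> : \int[P]_w (cos (jump f (q w)) - 1) = \int[P]_w cos (jump f (q w)) - 1.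
  rewrite RintegralB//; first by rewrite Rintegral_coin_cst.
    exact: (bounded_integrable coinP_oo (measurable_cosX mjq) (fun w => normr_cos_le1 _)).
  by apply: (bounded_integrable coinP_oo (M := 1)) => // w; rewrite normr1.
by rewrite /charf /comp /=; apply/eqP; rewrite eq_complex /=; apply/andP; split; apply/eqP; ring.
Qed.

Let csum_linear (k : R) (f g : 'rV[R]_n * measurableTypeR R -> R) w : csum q N (fun p => k * f p + g p) w = k * csum q N f w + csum q N g w.
Proof. by rewrite /csum /isum mulr_sumr -big_split. Qed.

Let jump_linear (k : R) (f g : 'rV[R]_n -> R) : jump (fun x => k * f x + g x) = (fun p => k * jump f p + jump g p).
Proof. by apply/funext => p; rewrite /jump; ring. Qed.

Let min1_sum k (u : 'I_k -> R) : (forall i, 0 <= u i) ->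
  Order.min 1 (\sum_(i < k) u i) <= \sum_(i < k) Order.min 1 (u i).
Proof.
have min_add (s t : R) : 0 <= s -> 0 <= t -> Order.min 1 (s + t) <= Order.min 1 s + Order.min 1 t.
  move=> s0 t0; case: (leP 1 s) => h1; case: (leP 1 t) => h2; case: (leP 1 (s + t)) => h3; lra.
elim: k u => [|k ih] u u0; first by rewrite !big_ord0 ge_min lexx orbT.
rewrite !big_ord_recr /=; apply: (le_trans (min_add _ _ _ _)) => //; first exact: sumr_ge0.
by rewrite lerD2r ih.
Qed.

Let nuAM (f : coin -> R) B : measurable_fun setT f -> (forall w, `|f w| <= B) ->
  ((lam * \int[P]_w f w)%:E = nu A * \int[P]_w (f w)%:E)%E.
Proof. by move=> mf fB; rewrite (E_bounded_EFin mf fB) EFinM fineK. Qed.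

(** A finite sum over random points (x, r), bounded by C times the sum of |r|
    v(x). Since min(1, .) is subadditive, the mean of its truncation is at most
    the integral of min(1, |r| v(x)) against the intensity. *)
Lemma large_jump_noise : measurable_fun setT v -> (forall x, 0 <= v x) -> exists X M,
  noise (fun f => (\int[leb n]_(x in Q) \int[nu]_(r in A) (cos (r * f x) - 1)) +i*
                  (\int[leb n]_(x in Q) \int[nu]_(r in A) sin (r * f x)))
    (\int[leb n]_(x in Q) \int[nu]_(r in A) (Order.min 1 (`|r| * v x))%:E)%E X M.
Proof.
move=> mv v0.
pose V (p : 'rV[R]_n * measurableTypeR R) : R := (\1_Q p.1 * \1_A p.2) * (`|p.2| * v p.1).
have V0 p : 0 <= V p by rewrite /V indE !mulr_ge0.
have mV : measurable_fun setT V.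
  apply: (measurable_funM mind); apply: measurable_funM.
    apply: (measurableT_comp (@normr_measurable R setT)).
    exact: (@measurable_snd _ _ 'rV[R]_n (measurableTypeR R)).
  exact: (measurableT_comp mv measurable_fst).
pose V1 p := Order.min 1 (V p).
have mV1 : measurable_fun setT V1 by exact: (measurable_minr (measurable_cst (1 : R)) mV).
have V10 p : 0 <= V1 p by rewrite le_min ler01 V0.
have V11 p : `|V1 p| <= 1 by rewrite ger0_norm// ge_min lexx.
exists (fun w f => csum q N (jump f) w), (fun w => (csum q N V w)%:E).
have mM : measurable_fun setT (fun w => (csum q N V w)%:E).
  by apply/measurable_EFinP; exact: (measurable_csum mq mN).
split.
- split => [f [C Bf]|w k f g _ _]; last by rewrite jump_linear csum_linear.
  by apply: (measurable_csum mq mN); exact: (measurable_jump (Bd_meas Bf)).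
- split => //.
  + by move=> w; rewrite lee_fin; apply: sumr_ge0.
  + by apply: aeW => w; rewrite ltry.
  + move=> w f C Bf _; rewrite /= /csum /isum (le_trans (ler_norm_sum _ _ _))// mulr_suml.
    apply: ler_sum => i _; rewrite /jump /V !normrM -!mulrA.
    have := Bd_le Bf (q (block i (odds w))).1; set p := q _ => fp.
    rewrite ger0_norm; last by rewrite indicE.
    rewrite ler_wpM2l ?indicE// ger0_norm// ler_wpM2l// ler_wpM2l// mulrC.
    exact: fp.
- apply: (@le_trans _ _ (\int[P]_w (csum q N V1 w)%:E)%E).
    apply: ge0_le_integral => //.
    + by move=> w _; rewrite le_min lee01 lee_fin; apply: sumr_ge0.
    + exact: measurable_mine.
    + by apply/measurable_EFinP; exact: (measurable_csum mq mN).
    + by move=> w _; rewrite -EFin_min lee_fin; exact: min1_sum.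
  rewrite (integral_csum mq mN PN mV1 V11 V10) (nuAM (measurableT_comp mV1 mq) (fun w => V11 (q w))).
  rewrite (qE (F := fun p => (V1 p)%:E)); last 2 first.
  + exact/measurable_EFinP.
  + by move=> p; rewrite lee_fin.
  rewrite le_eqVlt; apply/orP; left; apply/eqP.
  apply: eq_integral => x; rewrite inE => Qx; apply: eq_integral => r; rewrite inE => Ar.
  by rewrite /V1 /V indE /= asboolT ?mul1r.
- by move=> f [C Bf]; exact: (charf_jump (Bd_meas Bf)).
Qed.

Section small.
Variable delta : R.
Hypothesis delta0 : 0 < delta.
Hypothesis A1 : forall r, A r -> `|r| <= 1.
Hypothesis A_var : (\int[nu]_(r in A) (r ^+ 2)%:E <= (delta ^+ 2)%:E)%E.

Let cjump w (f : 'rV[R]_n -> R) : R := csum q N (jump f) w - lam * \int[P]_w jump f (q w).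

Let jump_le (f : 'rV[R]_n -> R) (B : R) : 0 <= B -> (forall x, Q x -> `|f x| <= B) -> forall p, `|jump f p| <= B.
Proof.
move=> B0 fB p; have [[Qp Ap]|np] := pselect (Q p.1 /\ A p.2); last by rewrite jump0// normr0.
case: p Qp Ap => x r /= Qx Ar; rewrite jumpE// normrM -[leRHS]mul1r ler_pM//; first exact: A1.
exact: fB.
Qed.

Let cjump_int (f : 'rV[R]_n -> R) (B : R) : 0 <= B -> measurable_fun setT f -> (forall x, Q x -> `|f x| <= B) ->
  P.-integrable setT (EFin \o (fun w => jump f (q w))).
Proof.
move=> B0 mf fB; apply: (bounded_integrable coinP_oo (M := B)).
  exact: (measurableT_comp (measurable_jump mf) mq).
by move=> w; exact: jump_le.
Qed.

Let mcjump (f : 'rV[R]_n -> R) : measurable_fun setT f -> measurable_fun setT (cjump ^~ f).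
Proof.
by move=> mf; apply: measurable_funB => //; exact: (measurable_csum mq mN (measurable_jump mf)).
Qed.

Let cjump_L1 i : (\int[P]_w (`|cjump w (h i)|)%:E <= delta%:E)%E.
Proof.
have [[mh bh sh] h2 _ _ _] := fr; have [B' hB'] := bh i.
pose B : R := `|B'|; have B0 : 0 <= B by exact: normr_ge0.
have hB x : `|h i x| <= B by exact: le_trans (hB' x) (ler_norm _).
have jB : forall p, `|jump (h i) p| <= B by apply: jump_le.
have mj := measurable_jump (mh i).
have sq : (\int[P]_w ((cjump w (h i)) ^+ 2)%:E <= (delta ^+ 2)%:E)%E.
  rewrite (integral_csum_sqr mq mN PN mj jB).
  rewrite (nuAM (f := fun w => jump (h i) (q w) ^+ 2) (B := B ^+ 2)); last 2 first.
  - by apply: measurable_funX; exact: (measurableT_comp mj mq).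
  - by move=> w; rewrite normrX lerXn2r ?nnegrE.
  rewrite (qE (F := fun p => (jump (h i) p ^+ 2)%:E)); last 2 first.
  - by apply/measurable_EFinP; exact: measurable_funX.
  - by move=> p; rewrite lee_fin sqr_ge0.
  have mr2 : measurable_fun A (fun r : measurableTypeR R => (r ^+ 2)%:E).
    by apply/measurable_EFinP; apply: (measurable_funS measurableT) => //; exact: measurable_funX.
  have -> : (\int[leb n]_(x in Q) \int[nu]_(r in A) (jump (h i) (x, r) ^+ 2)%:E =
      \int[leb n]_(x in Q) ((h i x ^+ 2)%:E * \int[nu]_(r in A) (r ^+ 2)%:E))%E.
    apply: eq_integral => x; rewrite inE => Qx.
    rewrite -ge0_integralZl//; last 2 first.
    + by move=> r _; rewrite lee_fin sqr_ge0.
    + by rewrite lee_fin sqr_ge0.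
    by apply: eq_integral => r; rewrite inE => Ar; rewrite jumpE// exprMn mulrC EFinM.
  have mh2 : measurable_fun setT (fun x => (h i x ^+ 2)%:E).
    by apply/measurable_EFinP; exact: measurable_funX.
  rewrite ge0_integralZr//; last 3 first.
  - exact: measurable_funS mh2.
  - by move=> x _; rewrite lee_fin sqr_ge0.
  - by apply: integral_ge0 => r _; rewrite lee_fin sqr_ge0.
  apply: (@le_trans _ _ (1 * \int[nu]_(r in A) (r ^+ 2)%:E)%E); last by rewrite mul1e.
  apply: lee_wpmul2r; first by apply: integral_ge0 => r _; rewrite lee_fin sqr_ge0.
  apply: le_trans (h2 i); apply: ge0_subset_integral => // x _.
  by rewrite lee_fin sqr_ge0.
have mX := mcjump (mh i).
apply: (@le_trans _ _ (\int[P]_w ((2 * delta)^-1%:E * ((cjump w (h i)) ^+ 2)%:E + (delta / 2)%:E))%E).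
  apply: ge0_le_integral => //.
  - by apply/measurable_EFinP; exact: (measurableT_comp (@normr_measurable R setT) mX).
  - apply: emeasurable_funD => //; apply: emeasurable_funM => //.
    by apply/measurable_EFinP; exact: measurable_funX.
  - move=> w _; rewrite -EFinM -EFinD lee_fin -(real_normK (num_real (cjump w (h i)))).
    have := normr_ge0 (cjump w (h i)); set y := `|_| => y0.
    rewrite -(ler_pM2l (x := 2 * delta)) ?mulr_gt0// mulrDr mulrA divff ?mul1r; last first.
      by rewrite mulf_neq0// gt_eqF.
    have := sqr_ge0 (y - delta); rewrite !expr2 => yd; nra.
have mX2 : measurable_fun setT (fun w => ((cjump w (h i)) ^+ 2)%:E).
  by apply/measurable_EFinP; exact: measurable_funX.
have d0 : (0 <= ((2 * delta)^-1)%:E)%E by rewrite lee_fin invr_ge0 mulr_ge0// ltW.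
rewrite ge0_integralD//; last 3 first.
- by move=> w _; rewrite mule_ge0// lee_fin sqr_ge0.
- exact: emeasurable_funM.
- by move=> w _; rewrite lee_fin divr_ge0// ltW.
rewrite ge0_integralZl//; last by move=> w _; rewrite lee_fin sqr_ge0.
rewrite (integral_coin_cst (delta / 2)%:E).
apply: (@le_trans _ _ ((2 * delta)^-1%:E * (delta ^+ 2)%:E + (delta / 2)%:E)%E).
  by rewrite leeD2r// lee_wpmul2l.
rewrite -EFinM -EFinD lee_fin le_eqVlt; apply/orP; left; apply/eqP.
by field; rewrite gt_eqF.
Qed.

Let cjump_expansion w (f : 'rV[R]_n -> R) (C : R) : Bd f C ->
  series (fun i => coef i f * cjump w (h i)) @ \oo --> cjump w f.
Proof.
move=> Bf; have [[mh bh sh] _ _ _ _] := fr; have mf := Bd_meas Bf.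
have CW0 : 0 <= C * W by rewrite mulr_ge0// (Bd_ge0 Bf).
have Ih i : P.-integrable setT (EFin \o (fun w => jump (h i) (q w))).
  have [B' hB'] := bh i; apply: (@cjump_int _ `|B'|) => // x _.
  exact: le_trans (hB' x) (ler_norm _).
pose S m x := \sum_(0 <= i < m) coef i f * h i x.
have jS m p : jump (S m) p = \sum_(0 <= i < m) coef i f * jump (h i) p.
  rewrite /jump /S !mulr_sumr; apply: eq_bigr => i _; ring.
have jcvg p : jump (S m) p @[m --> \oo] --> jump f p.
  have [[Qp Ap]|np] := pselect (Q p.1 /\ A p.2); last first.
    rewrite jump0//; under eq_fun do rewrite jump0//.
    exact: cvg_cst.
  case: p Qp Ap => x r /= Qx Ar; rewrite jumpE//; under eq_fun do rewrite jumpE//.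
  by apply: cvgM; [exact: cvg_cst|exact: (coef_expansion Bf Qx)].
have SE m : series (fun i => coef i f * cjump w (h i)) m = cjump w (S m).
  rewrite /series /= /cjump.
  have -> : csum q N (jump (S m)) w = \sum_(0 <= i < m) coef i f * csum q N (jump (h i)) w.
    rewrite /csum /isum; under [RHS]eq_bigr do rewrite mulr_sumr.
    by rewrite exchange_big /=; apply: eq_bigr => i _; exact: jS.
  have -> : \int[P]_w jump (S m) (q w) = \sum_(0 <= i < m) coef i f * \int[P]_w jump (h i) (q w).
    elim: m => [|m ih].
      by rewrite big_nil; under eq_Rintegral do rewrite jS big_nil; exact: Rintegral_coin_cst.
    rewrite big_nat_recr//= -ih -RintegralZl// -RintegralD//; last 2 first.
    - apply: (@cjump_int _ (C * W * K)) => //.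
      + by rewrite mulr_ge0.
      + by apply: measurable_sum => i; exact: measurable_funM.
      + by move=> x _; exact: (partial_expansion_le Bf).
    - by have := integrableZl measurableT (coef m f) (Ih m).
    by apply: eq_Rintegral => w' _; rewrite !jS big_nat_recr.
  rewrite mulr_sumr -sumrB; apply: eq_bigr => i _; ring.
rewrite (_ : series _ = fun m => cjump w (S m)); last by apply/funext.
apply: cvgB.
  rewrite /csum /isum; elim: (N (evens w)) => [|k ih].
    by under eq_fun do rewrite big_ord0; rewrite big_ord0; exact: cvg_cst.
  under eq_fun do rewrite big_ord_recr /=; rewrite big_ord_recr /=.
  by apply: cvgD; [exact: ih|exact: jcvg].
apply: cvgM; first exact: cvg_cst.
apply: (@Rintegral_dominated_cvg _ _ _ P setT _ _ (fun=> C * W * K)) => //.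
- move=> m; apply: (measurableT_comp (measurable_jump _) mq).
  by apply: measurable_sum => i; exact: measurable_funM.
- exact: (measurableT_comp (measurable_jump mf) mq).
- by apply: aeW => w' _; exact: jcvg.
- by apply: (bounded_integrable coinP_oo (M := `|C * W * K|)).
- move=> m w' _; apply: jump_le; first by rewrite mulr_ge0.
  by move=> x _; exact: (partial_expansion_le Bf).
Qed.

(** The compensated sum is linear in f but only its second moment is small,
    which does not bound it uniformly in f. Expanding f in the frame, whose
    functions have norm at most 1 in L2, reduces the bound to the means of
    countably many variables, each at most delta by Cauchy-Schwarz. *)
Lemma small_jump_noise : exists X M,
  noise (fun f => (\int[leb n]_(x in Q) \int[nu]_(r in A) (cos (r * f x) - 1)) +i*
                  (\int[leb n]_(x in Q) \int[nu]_(r in A) (sin (r * f x) - r * f x)))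
    (W * K * delta)%:E X M.
Proof.
have [[mh bh sh] _ [_ cK _] _ _] := fr.
pose M w := (\sum_(i <oo) (W * c i * `|cjump w (h i)|)%:E)%E.
have mi i : measurable_fun setT (fun w => (W * c i * `|cjump w (h i)|)%:E).
  apply/measurable_EFinP; apply: measurable_funM => //.
  exact: (measurableT_comp (@normr_measurable R setT) (mcjump (mh i))).
have t0 i w : (0 <= (W * c i * `|cjump w (h i)|)%:E)%E by rewrite lee_fin !mulr_ge0.
have mM : measurable_fun setT M by apply: ge0_emeasurable_sum => // i w _.
have M0 w : (0 <= M w)%E by apply: nneseries_ge0 => i _ _.
have EM : (\int[P]_w M w <= (W * K * delta)%:E)%E.
  rewrite integral_nneseries//; apply: (@le_trans _ _ (\sum_(i <oo) ((W * delta)%:E * (c i)%:E))%E).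
    apply: lee_nneseries => [i _ _|i _]; first exact: integral_ge0.
    under eq_integral do rewrite EFinM.
    rewrite ge0_integralZl//; last 2 first.
    - by apply/measurable_EFinP; exact: (measurableT_comp (@normr_measurable R setT) (mcjump (mh i))).
    - by rewrite lee_fin mulr_ge0.
    rewrite (_ : ((W * delta)%:E * (c i)%:E = (W * c i)%:E * delta%:E)%E); last first.
      by rewrite -!EFinM; congr (_%:E); ring.
    by rewrite lee_wpmul2l ?cjump_L1// lee_fin mulr_ge0.
  rewrite nneseriesZl; last by move=> i _; rewrite lee_fin.
  rewrite (_ : W * K * delta = W * delta * K); last by ring.
  by rewrite [leRHS]EFinM lee_wpmul2l// lee_fin mulr_ge0// ltW.
exists cjump, M; split.
- split => [f [C Bf]|w k f g [C Bf] [D Bg]]; first exact: (mcjump (Bd_meas Bf)).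
  have If := cjump_int (mulr_ge0 (Bd_ge0 Bf) W0) (Bd_meas Bf) (Bd_cube Bf).
  have Ig := cjump_int (mulr_ge0 (Bd_ge0 Bg) W0) (Bd_meas Bg) (Bd_cube Bg).
  rewrite /cjump jump_linear csum_linear RintegralD//; last first.
    by have := integrableZl measurableT k If.
  by rewrite RintegralZl//; ring.
- split => //.
  + have IM : P.-integrable setT M.
      apply/integrableP; split => //.
      under eq_integral do rewrite gee0_abs//.
      exact: le_lt_trans EM (ltry _).
    by apply: filterS (integrable_ae measurableT IM) => w /(_ I); rewrite ge0_fin_numE.
  + move=> w f C Bf Moo.
    have Mf : M w \is a fin_num by rewrite ge0_fin_numE.
    have C0 := Bd_ge0 Bf.
    have ub i : `|coef i f * cjump w (h i)| <= C * (W * c i * `|cjump w (h i)|).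
      rewrite normrM (_ : C * _ = c i * (C * W) * `|cjump w (h i)|); last by ring.
      by rewrite ler_wpM2r// (coef_bound i Bf).
    have sE : (\sum_(i <oo) (C * (W * c i * `|cjump w (h i)|))%:E = C%:E * M w)%E.
      under eq_eseriesr do rewrite EFinM.
      by rewrite nneseriesZl.
    have soo : (\sum_(i <oo) (C * (W * c i * `|cjump w (h i)|))%:E < +oo)%E.
      by rewrite sE -(fineK Mf) -EFinM ltry.
    have [_] := series_bound ub soo.
    rewrite sE (cvg_lim _ (cjump_expansion (w := w) Bf))// -(fineK Mf) -EFinM lee_fin mulrC.
    by [].
- apply: le_trans EM; apply: ge0_le_integral => //.
  + by move=> w _; rewrite le_min lee01 M0.
  + exact: measurable_mine.
  + by move=> w _; rewrite ge_min lexx orbT.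
- move=> f [C Bf]; have mf := Bd_meas Bf.
  rewrite (charf_shift (- (lam * \int[P]_w jump f (q w)))
    (measurable_csum mq mN (measurable_jump mf))).
  rewrite charf_jump// -cexpD; congr cexp.
  have jB := jump_le (mulr_ge0 (Bd_ge0 Bf) W0) (Bd_cube Bf).
  have B0 : 0 <= C * W by rewrite mulr_ge0// (Bd_ge0 Bf).
  have -> : \int[leb n]_(x in Q) \int[nu]_(r in A) (sin (r * f x) - r * f x) =
      lam * \int[P]_w (sin (jump f (q w)) - jump f (q w)).
    rewrite (qR (F := fun p => sin (jump f p) - jump f p) (B := 1 + C * W)); last 2 first.
    - have mj := measurable_jump mf; exact: (measurable_funB (measurableT_comp msin mj) mj).
    - by move=> p; rewrite (le_trans (ler_normB _ _))// lerD// normr_sin_le1.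
    apply: eq_Rintegral => x; rewrite inE => Qx; apply: eq_Rintegral => r; rewrite inE => Ar.
    by rewrite jumpE.
  rewrite -(jump_integral msin (@normr_sin_le1 R) mf).
  rewrite RintegralB//; last 2 first.
  - apply: (bounded_integrable coinP_oo (measurable_sinX _) (fun w => normr_sin_le1 _)).
    exact: (measurableT_comp (measurable_jump mf) mq).
  - exact: (cjump_int B0 mf (Bd_cube Bf)).
  by apply/eqP; rewrite eq_complex /=; apply/andP; split; apply/eqP; ring.
Qed.

End small.

End jump.

End with_frame.

Section levy_cube.
Variable nu : {measure set (measurableTypeR R) -> \bar R}.
Hypothesis levy : (\int[nu]_x (Order.min 1 (x ^+ 2))%:E < +oo)%E.
Local Notation U := (@small_jumps R).
Local Notation L := (@large_jumps R).

Let mQ := @measurable_ucube R n a.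
Let mU := @measurable_small_jumps R.
Let mL := @measurable_large_jumps R.
Let Loo := large_jumps_lty levy.

Let mtest f : test Bd f -> measurable_fun setT f. Proof. by case=> C /Bd_meas. Qed.

Let sum_integral (G : nat -> 'rV[R]_n -> R) m :
  (forall j, (leb n).-integrable Q (EFin \o G j)) ->
  (leb n).-integrable Q (EFin \o (fun x => \sum_(j < m) G j x)) /\
  \sum_(j < m) \int[leb n]_(x in Q) G j x = \int[leb n]_(x in Q) \sum_(j < m) G j x.
Proof.
move=> iG; elim: m => [|m [ih1 ih2]].
  split; last by rewrite big_ord0; under eq_Rintegral do rewrite big_ord0; rewrite Rintegral_cst// mul0r.
  by under eq_fun do rewrite big_ord0; exact: integrable0.
have i2 := integrableD mQ ih1 (iG m).
split.
  have -> : EFin \o (fun x => \sum_(j < m.+1) G j x) =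
     (EFin \o (fun x => \sum_(j < m) G j x)) \+ (EFin \o G m).
    by apply/funext => x /=; rewrite big_ord_recr.
  exact: i2.
rewrite big_ord_recr /= ih2 -RintegralD//.
by apply: eq_Rintegral => x _; rewrite big_ord_recr.
Qed.

Let cvg_cube_series (G : nat -> 'rV[R]_n -> R) (G' : 'rV[R]_n -> R) (B : R) :
  (forall j, measurable_fun setT (G j)) -> (forall j, (leb n).-integrable Q (EFin \o G j)) ->
  measurable_fun setT G' ->
  (forall m x, Q x -> `|\sum_(j < m) G j x| <= B) ->
  (forall x, Q x -> \sum_(j < m) G j x @[m --> \oo] --> G' x) ->
  \sum_(j < m) \int[leb n]_(x in Q) G j x @[m --> \oo] --> \int[leb n]_(x in Q) G' x.
Proof.
move=> mG iG mG' GB GG'; under eq_fun do rewrite (sum_integral _ iG).2.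
apply: (@Rintegral_dominated_cvg _ _ _ (leb n) Q _ _ (fun=> B)) => //.
- move=> m; apply: (measurable_funS measurableT) => //; exact: measurable_sum.
- exact: (measurable_funS measurableT).
- by apply: aeW => x Qx; exact: GG'.
- by apply: (@integrable_on_ucube _ `|B|).
Qed.

Let S := \int[nu]_(r in U) r ^+ 2.

(** Sum the noises of the shells; the parameters delta decrease geometrically
    and the exponents converge by integrability of r^2. *)
Lemma small_jumps_noise (A_ : nat -> set (measurableTypeR R)) (s : R) :
  [/\ 0 < s, forall j, measurable (A_ j), trivIset setT A_, \bigcup_j A_ j = U &
  forall j, (nu (A_ j) < +oo)%E /\
    (\int[nu]_(r in A_ j) (r ^+ 2)%:E <= ((s * 2^-1 ^+ j) ^+ 2)%:E)%E] ->
  forall (h : nat -> 'rV[R]_n -> R) c K, haar_frame a h c K -> exists X M,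
  noise (fun f => (\int[leb n]_(x in Q) Jc nu U (f x)) +i* (\int[leb n]_(x in Q) Jss nu U (f x)))
    (W * K * (s * 2))%:E X M.
Proof.
move=> [s0 mA tA AU hA] h c K fr.
have half j : 0 < 2^-1 ^+ j :> R by rewrite exprn_gt0// invr_gt0.
have K0 : 0 <= K.
  have [_ _ [_ cK _] _ _] := fr; rewrite -lee_fin (le_trans _ cK)//.
  by apply: nneseries_ge0 => i _ _; rewrite lee_fin; have [_ _ []] := fr.
have Asub j : A_ j `<=` U by rewrite -AU; exact: bigcup_sup.
have A1 j r : A_ j r -> `|r| <= 1 by move=> /Asub /andP[].
have noi j : exists X M, noise (fun f => (\int[leb n]_(x in Q) Jc nu (A_ j) (f x)) +i*
    (\int[leb n]_(x in Q) Jss nu (A_ j) (f x))) (W * K * (s * 2^-1 ^+ j))%:E X M.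
  have [Aoo Avar] := hA j.
  have [A0|A0] := eqVneq (nu (A_ j)) 0%E.
    exists (fun _ _ => 0), (fun=> 0%E); apply: noise_ext (noise_le _ (noise0 Bd)); last first.
      by rewrite lee_fin !mulr_ge0// ltW.
    move=> f _; have J0 (F : R -> R) : measurable_fun setT F -> \int[nu]_(r in A_ j) F r = 0.
      move=> mF; rewrite /Rintegral null_set_integral//.
      by apply/measurable_EFinP; exact: (measurable_funS measurableT).
    have -> : (fun x => Jc nu (A_ j) (f x)) = fun=> 0.
      by apply/funext => x; apply: J0; exact: measurable_cosB1.
    have -> : (fun x => Jss nu (A_ j) (f x)) = fun=> 0.
      by apply/funext => x; apply: J0; exact: measurable_sinB.
    by rewrite Rintegral_cst// mul0r.
  have Ab : (0 < nu (A_ j) < +oo)%E by rewrite lt0e A0 measure_ge0.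
  have [q [mq qE qR]] := sample_point n a (mA j) Ab.
  have lam0 : 0 <= fine (nu (A_ j)) by exact: fine_ge0.
  have [N mN PN] := poisson_variable lam0.
  exact: (small_jump_noise fr (mA j) Aoo mq qE qR mN PN (mulr_gt0 s0 (half j)) (@A1 j) Avar).
have /choice[X_ /choice[M_ nXM]] := noi.
have es : (\sum_(j <oo) (W * K * (s * 2^-1 ^+ j))%:E = (W * K * (s * 2))%:E)%E.
  apply: nneseries_EFin_cvg.
  have /cvg_geometric_series : `|2^-1 : R| < 1 by rewrite ger0_norm// invf_lt1// ltr1n.
  move=> /(_ (W * K * s)); rewrite (_ : 1 - 2^-1 = 2^-1) ?invrK; last by field.
  rewrite mulrA (_ : series _ = fun m => \sum_(k < m) W * K * (s * 2^-1 ^+ k))//.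
  apply/funext => m; rewrite /series /= big_mkord; apply: eq_bigr => k _.
  by rewrite /geometric /= !mulrA.
have [||X [M nX]] := noise_series nXM Bd_ge0 (Psi := fun f =>
  (\int[leb n]_(x in Q) Jc nu U (f x)) +i* (\int[leb n]_(x in Q) Jss nu U (f x))).
- by rewrite es ltry.
- move=> f tf; have mf := mtest tf; have [C Bf] := tf.
  have fQ := Bd_cube Bf; pose B := C * W.
  have SA m : \sum_(j < m) \int[nu]_(r in A_ j) r ^+ 2 <= S.
    have ir := integrable_small_jumps levy; rewrite -AU in ir.
    have hc := cvg_Rintegral_partition mA tA ir; rewrite AU in hc.
    have nd : nondecreasing_seq (fun m => \sum_(j < m) \int[nu]_(r in A_ j) r ^+ 2).
      apply/nondecreasing_seqP => k; rewrite big_ord_recr /= lerDl.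
      by apply: Rintegral_ge0 => r _; exact: sqr_ge0.
    by have := nondecreasing_cvgn_le nd (cvgP _ hc) m; rewrite (cvg_lim _ hc).
  have ir j : nu.-integrable (A_ j) (EFin \o (fun r : measurableTypeR R => r ^+ 2)).
    exact: (integrableS mU (mA j) (@Asub j) (integrable_small_jumps levy)).
  have main (H : R -> R -> R) : (forall z, measurable_fun setT (H z)) ->
      (forall z r, `|H z r| <= z ^+ 2 * r ^+ 2) ->
      (forall j, measurable_fun setT (fun z => \int[nu]_(r in A_ j) H z r)) ->
      measurable_fun setT (fun z => \int[nu]_(r in U) H z r) /\
      \sum_(j < m) \int[leb n]_(x in Q) (\int[nu]_(r in A_ j) H (f x) r) @[m --> \oo] -->
        \int[leb n]_(x in Q) (\int[nu]_(r in U) H (f x) r).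
    move=> mH Hb mJ.
    have iH z : nu.-integrable U (EFin \o H z) := integrable_small_jumps_le levy (mH z) (Hb z).
    have cvgz z : \sum_(j < m) \int[nu]_(r in A_ j) H z r @[m --> \oo] --> \int[nu]_(r in U) H z r.
      by have := iH z; rewrite -{1}AU => iz; have := cvg_Rintegral_partition mA tA iz; rewrite AU.
    have mJU : measurable_fun setT (fun z => \int[nu]_(r in U) H z r).
      apply: (@measurable_fun_cvg _ _ _ _ (fun m z => \sum_(j < m) \int[nu]_(r in A_ j) H z r)).
        by move=> m; exact: measurable_sum.
      by move=> z _; exact: cvgz.
    have Jb j z : `|\int[nu]_(r in A_ j) H z r| <= z ^+ 2 * \int[nu]_(r in A_ j) r ^+ 2.
      have iz := integrableS mU (mA j) (@Asub j) (iH z).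
      rewrite (le_trans (le_normr_Rintegral (mA j) iz))// -RintegralZl//.
      apply: le_Rintegral => //; first exact: integrable_norm iz.
      by have := integrableZl (mA j) (z ^+ 2) (ir j).
    split => //; apply: (@cvg_cube_series (fun j x => \int[nu]_(r in A_ j) H (f x) r)
      (fun x => \int[nu]_(r in U) H (f x) r) (B ^+ 2 * S)).
    - by move=> j; exact: (measurableT_comp (mJ j) mf).
    - move=> j; apply: (@integrable_on_ucube _ (B ^+ 2 * \int[nu]_(r in A_ j) r ^+ 2)).
        exact: (measurableT_comp (mJ j) mf).
      move=> x Qx; rewrite (le_trans (Jb _ _))// ler_wpM2r//.
        by apply: Rintegral_ge0 => r _; exact: sqr_ge0.
      by rewrite -(real_normK (num_real (f x))) lerXn2r ?nnegrE ?fQ// (le_trans _ (fQ x Qx)).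
    - exact: (measurableT_comp mJU mf).
    - move=> m x Qx; rewrite (le_trans (ler_norm_sum _ _ _))//.
      apply: (@le_trans _ _ (\sum_(j < m) (f x) ^+ 2 * \int[nu]_(r in A_ j) r ^+ 2)).
        by apply: ler_sum => j _; exact: Jb.
      rewrite -mulr_sumr ler_pM ?sqr_ge0//.
        by apply: sumr_ge0 => j _; apply: Rintegral_ge0 => r _; exact: sqr_ge0.
      by rewrite -(real_normK (num_real (f x))) lerXn2r ?nnegrE ?fQ// (le_trans _ (fQ x Qx)).
    - by move=> x _; exact: cvgz.
  have sumE (u w : nat -> R) m : \sum_(j < m) (u j +i* w j) = (\sum_(j < m) u j) +i* (\sum_(j < m) w j).
    elim: m => [|m ih]; first by rewrite !big_ord0.
    by rewrite !big_ord_recr /= ih.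
  rewrite (_ : (fun m => _) = fun m => (\sum_(j < m) \int[leb n]_(x in Q) Jc nu (A_ j) (f x)) +i*
      (\sum_(j < m) \int[leb n]_(x in Q) Jss nu (A_ j) (f x))); last first.
    by apply/funext => m; rewrite (sumE (fun j => \int[leb n]_(x in Q) Jc nu (A_ j) (f x))
      (fun j => \int[leb n]_(x in Q) Jss nu (A_ j) (f x))).
  split => /=.
  + apply: (main (fun z r => cos (r * z) - 1) _ _ _).2.
    * exact: measurable_cosB1.
    * by move=> z r; rewrite (le_trans (norm_cosB1_le _))// exprMn mulrC.
    * by move=> j; exact: measurable_Jc (mA j) (hA j).1.
  + apply: (main (fun z r => sin (r * z) - r * z) _ _ _).2.
    * exact: measurable_sinB.
    * by move=> z r; rewrite (le_trans (norm_sinB_le _))// exprMn mulrC.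
    * by move=> j; exact: measurable_Jss (mA j) (hA j).1 (@A1 j).
- by exists X, M; rewrite -es.
Qed.

Lemma large_jumps_noise : measurable_fun setT v -> (forall x, 0 <= v x) -> exists X M,
  noise (fun f => (\int[leb n]_(x in Q) Jc nu L (f x)) +i* (\int[leb n]_(x in Q) Js nu L (f x)))
    (\int[leb n]_(x in Q) (Jmin nu (v x))%:E)%E X M.
Proof.
move=> mv v0.
have [A0|A0] := eqVneq (nu L) 0%E.
  exists (fun _ _ => 0), (fun=> 0%E); apply: noise_ext (noise_le _ (noise0 Bd)); last first.
    by apply: integral_ge0 => x _; rewrite lee_fin Jmin_ge0.
  move=> f _; have J0 (F : R -> R) : measurable_fun setT F -> \int[nu]_(r in L) F r = 0.
    move=> mF; rewrite /Rintegral null_set_integral//.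
    by apply/measurable_EFinP; exact: (measurable_funS measurableT).
  have -> : (fun x => Jc nu L (f x)) = fun=> 0.
    by apply/funext => x; apply: J0; exact: measurable_cosB1.
  have -> : (fun x => Js nu L (f x)) = fun=> 0.
    by apply/funext => x; apply: J0; exact: measurable_sinM.
  by rewrite Rintegral_cst// mul0r.
have Ab : (0 < nu L < +oo)%E by rewrite lt0e A0 measure_ge0.
have [q [mq qE qR]] := sample_point n a mL Ab.
have lam0 : 0 <= fine (nu L) by exact: fine_ge0.
have [N mN PN] := poisson_variable lam0.
have [X [M nX]] := large_jump_noise mL Loo mq qE qR mN PN mv v0.
exists X, M; apply: noise_le nX; rewrite le_eqVlt; apply/orP; left; apply/eqP.
apply: eq_integral => x _; rewrite (Jmin_EFin levy); apply: eq_integral => r _.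
by rewrite (ger0_norm (v0 x)).
Qed.

(** The sum of the drift, Gaussian, small-jump and large-jump noises. The shells
    are given and not chosen here, because the bound must be uniform over the
    cubes. *)
Lemma cube_levy_noise (s gamma m1 : R) : 0 <= s -> 0 <= m1 ->
  (exists xi : coin -> R, [/\ measurable_fun setT xi, (\int[P]_w (`|xi w|)%:E <= m1%:E)%E &
     forall t, charf (fun w => t * xi w) = cexp (- (t ^+ 2 / 2))%:C]) ->
  measurable_fun setT v -> (forall x, 0 <= v x) ->
  forall (A_ : nat -> set (measurableTypeR R)) (k : R),
  [/\ 0 < k, forall j, measurable (A_ j), trivIset setT A_, \bigcup_j A_ j = U &
  forall j, (nu (A_ j) < +oo)%E /\
    (\int[nu]_(r in A_ j) (r ^+ 2)%:E <= ((k * 2^-1 ^+ j) ^+ 2)%:E)%E] ->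
  exists X M,
  noise (fun f => (\int[leb n]_(x in Q) psiRe nu s (f x)) +i* (\int[leb n]_(x in Q) psiIm nu gamma (f x)))
    ((W * (`|gamma| + 5 ^+ n * (s * m1 + k * 2)))%:E + \int[leb n]_(x in Q) (Jmin nu (v x))%:E)%E X M.
Proof.
move=> s0 m10 [xi [mxi xi1 cxi]] mv v0 A_ k shells.
have [h [c fr]] := haar_frame_exists n a.
have [X1 [M1 n1]] := drift_noise gamma.
have [X2 [M2 n2]] := gaussian_noise fr mxi xi1 cxi s0.
have [X3 [M3 n3]] := small_jumps_noise shells fr.
have [X4 [M4 n4]] := large_jumps_noise mv v0.
have mJv : measurable_fun setT (fun x => Jmin nu (v x)).
  exact: (measurableT_comp (measurable_Jmin levy) mv).
pose e4 := \int[leb n]_(x in Q) Jmin nu (v x).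
have e4E : (\int[leb n]_(x in Q) (Jmin nu (v x))%:E = e4%:E)%E.
  rewrite /e4 /Rintegral fineK//; apply: integrable_fin_num => //.
  apply: (@integrable_on_ucube _ (fine (nu L))) => //.
  by move=> x _; rewrite ger0_norm ?Jmin_ge0// (Jmin_le levy).
rewrite e4E in n4.
have [X12 [M12 n12]] := noise_add Bd_ge0 n1 n2.
have [X34 [M34 n34]] := noise_add Bd_ge0 n3 n4.
have [X [M nX]] := noise_add Bd_ge0 n12 n34.
exists X, M; apply: noise_ext (noise_le _ nX); last first.
  rewrite e4E -EFinD lee_fin le_eqVlt; apply/orP; left; apply/eqP; ring.
move=> f tf; have mf := mtest tf; have [C Bf] := tf; have fQ := Bd_cube Bf.
have iJ (J : R -> R) (b : R -> R) : measurable_fun setT J -> (forall z, `|J z| <= b z) ->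
   (exists D, forall x, Q x -> b (f x) <= D) -> (leb n).-integrable Q (EFin \o (fun x => J (f x))).
  move=> mJ Jb [D bD]; apply: (@integrable_on_ucube _ D).
    exact: (measurableT_comp mJ mf).
  by move=> x Qx; exact: le_trans (Jb _) (bD x Qx).
have sqQ x : Q x -> (f x) ^+ 2 <= (C * W) ^+ 2.
  by move=> Qx; rewrite -(real_normK (num_real (f x))) lerXn2r ?nnegrE ?fQ// (le_trans _ (fQ x Qx)).
have S0 : 0 <= S by apply: Rintegral_ge0 => r _; exact: sqr_ge0.
have bU : exists D, forall x, Q x -> (f x) ^+ 2 * S <= D.
  by exists ((C * W) ^+ 2 * S) => x Qx; rewrite ler_wpM2r ?sqQ.
have bL : exists D, forall x, Q x -> 2 * Jmin nu (f x) <= D.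
  by exists (2 * fine (nu L)) => x _; rewrite ler_wpM2l ?(Jmin_le levy).
have i1 : (leb n).-integrable Q (EFin \o (fun x => - (s ^+ 2 / 2) * f x ^+ 2)).
  apply: (iJ (fun z => - (s ^+ 2 / 2) * z ^+ 2) (fun z => (s ^+ 2 / 2) * z ^+ 2)).
  - by apply: measurable_funM => //; exact: measurable_funX.
  - by move=> z; rewrite normrM normrN !ger0_norm ?sqr_ge0// divr_ge0 ?sqr_ge0.
  - by exists (s ^+ 2 / 2 * (C * W) ^+ 2) => x Qx; rewrite ler_wpM2l ?sqQ// divr_ge0 ?sqr_ge0.
have i2 := iJ _ _ (measurable_JcU levy) (JcU_le levy) bU.
have i3 := iJ _ _ (measurable_Jc mL Loo) (JcL_le levy) bL.
have i4 : (leb n).-integrable Q (EFin \o (fun x => gamma * f x)).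
  apply: (@integrable_on_ucube _ (`|gamma| * (C * W))); first exact: measurable_funM.
  by move=> x Qx; rewrite normrM ler_wpM2l ?fQ.
have i5 := iJ _ _ (measurable_JssU levy) (JssU_le levy) bU.
have i6 := iJ _ _ (measurable_Js mL Loo) (JsL_le levy) bL.
have iD (g1 g2 : 'rV[R]_n -> R) : (leb n).-integrable Q (EFin \o g1) ->
    (leb n).-integrable Q (EFin \o g2) -> (leb n).-integrable Q (EFin \o (fun x => g1 x + g2 x)).
  by move=> I1 I2; have := integrableD mQ I1 I2.
rewrite /psiRe /psiIm.
have if1 : (leb n).-integrable Q (EFin \o f) by exact: integrable_on_ucube mf fQ.
have if2 : (leb n).-integrable Q (EFin \o (fun x => f x ^+ 2)).
  apply: (@integrable_on_ucube _ ((C * W) ^+ 2)); first exact: measurable_funX.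
  by move=> x Qx; rewrite ger0_norm ?sqr_ge0 ?sqQ.
have -> : \int[leb n]_(x in Q) (- (s ^+ 2 / 2) * f x ^+ 2 + (Jc nu U (f x) + Jc nu L (f x))) =
   - (s ^+ 2 / 2) * \int[leb n]_(x in Q) f x ^+ 2 +
   (\int[leb n]_(x in Q) Jc nu U (f x) + \int[leb n]_(x in Q) Jc nu L (f x)).
  by rewrite -RintegralZl// -RintegralD// -RintegralD//; exact: iD.
have -> : \int[leb n]_(x in Q) (gamma * f x + (Jss nu U (f x) + Js nu L (f x))) =
   gamma * \int[leb n]_(x in Q) f x +
   (\int[leb n]_(x in Q) Jss nu U (f x) + \int[leb n]_(x in Q) Js nu L (f x)).
  by rewrite -RintegralZl// -RintegralD// -RintegralD//; exact: iD.
by apply/eqP; rewrite eq_complex /=; apply/andP; split; apply/eqP; ring.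
Qed.

End levy_cube.

End cube_noise.

(** * Summation over the lattice *)

Section lattice_cubes.
Context {R : realType} {d : nat}.
Local Notation leb := (@lebesgue_rV R).

Definition corner (m : 'rV[int]_d) : nat -> R :=
  fun i => if (insub i : option 'I_d) is Some j then (m ord0 j)%:~R else 0.

(** The cubes are numbered by the partial inverse of an enumeration of the
    integer points, so that each occurs once. *)
Definition cell (k : nat) : set 'rV[R]_d :=
  if (pickle_inv k : option 'rV[int]_d) is Some m then ucube (corner m) else set0.

Lemma ucube_corner m x : ucube (corner m) x <-> forall i : 'I_d, Num.floor (x ord0 i) = m ord0 i.
Proof.
have cE (i : 'I_d) : corner m i = (m ord0 i)%:~R by rewrite /corner valK.
split=> h i.
  by apply/floor_def; have := h i; rewrite cE intrD.
by rewrite cE -h; have := floor_itv (x ord0 i); rewrite intrD.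
Qed.

Lemma measurable_cell k : measurable (cell k).
Proof. by rewrite /cell; case: pickle_inv => [m|]; [exact: measurable_ucube|exact: measurable0]. Qed.

Lemma trivIset_cell : trivIset setT cell.
Proof.
apply/trivIsetP => i j _ _ ij; apply/seteqP; split => // x []; rewrite /cell.
have := @pickle_invK 'rV[int]_d i; have := @pickle_invK 'rV[int]_d j.
case: (pickle_inv i : option 'rV[int]_d) => [m|//] /=.
case: (pickle_inv j : option 'rV[int]_d) => [m'|//] /=.
move=> ej ei /ucube_corner h /ucube_corner h'; move/eqP: ij; apply.
by rewrite -ei -ej; congr pickle; apply/rowP => l; rewrite -h -h'.
Qed.

Lemma bigcup_cell : \bigcup_k cell k = setT.
Proof.
apply/seteqP; split => // x _; pose m : 'rV[int]_d := \row_i Num.floor (x ord0 i).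
exists (pickle m) => //; rewrite /cell pickleK_inv; apply/ucube_corner => i.
by rewrite mxE.
Qed.

End lattice_cubes.

Section global_noise.
Context {R : realType} {d : nat}.
Local Notation P := (@coinP R).
Local Notation leb := (@lebesgue_rV R d).
Variables (v g : 'rV[R]_d -> R).
Hypothesis mv : measurable_fun setT v.
Hypothesis v0 : forall x, 0 <= v x.
Hypothesis v1 : forall x, v x <= 1.
Hypothesis mg : measurable_fun setT g.
Hypothesis g0 : forall x, 0 <= g x.
Hypothesis gint : leb.-integrable setT (EFin \o g).
Hypothesis vg : forall (m : 'rV[int]_d) x x', ucube (corner m) x -> ucube (corner m) x' -> v x <= g x'.

(** One derivative at most in each direction, in any order of the enumeration:
    this is what the mixed Lipschitz bound requires. *)
Definition wbound (f : 'rV[R]_d -> R) (C : R) := [/\ lsmooth f, 0 <= C &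
  forall (p : pred 'I_d) x, `|foldr partial f (seq.filter p (enum 'I_d)) x| <= C * v x].

Lemma wbound_meas f C : wbound f C -> measurable_fun setT f.
Proof. by case=> /measurable_lsmooth. Qed.

Lemma wbound_ge0 f C : wbound f C -> 0 <= C. Proof. by case. Qed.

Lemma wbound_le f C : wbound f C -> forall x, `|f x| <= C * v x.
Proof. by case=> _ _ h x; have := h xpred0 x; rewrite filter_pred0. Qed.

Lemma wbound_lip (a : nat -> R) W f C : (forall x, ucube a x -> v x <= W) ->
  wbound f C -> mixed_lipschitz a (C * W) f.
Proof.
move=> vW [lf C0 h]; apply: lsmooth_mixed_lipschitz => // p x ax.
by rewrite (le_trans (h p x))// ler_wpM2l ?vW.
Qed.

Lemma v_le_g x : v x <= g x.
Proof.
have [k _] : (\bigcup_k cell k) x by rewrite bigcup_cell.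
by rewrite /cell; case: pickle_inv => // m xm; exact: (vg xm xm).
Qed.

Variable nu : {measure set (measurableTypeR R) -> \bar R}.
Hypothesis levy : (\int[nu]_x (Order.min 1 (x ^+ 2))%:E < +oo)%E.
Hypothesis Jv : (\int[leb]_x (Jmin nu (v x))%:E < +oo)%E.
Local Notation U := (@small_jumps R).
Local Notation L := (@large_jumps R).
Variables (s gamma : R).
Hypothesis s0 : 0 <= s.

Let S := \int[nu]_(r in U) r ^+ 2.
Let S0 : 0 <= S. Proof. by apply: Rintegral_ge0 => r _; exact: sqr_ge0. Qed.

Let vint : leb.-integrable setT (EFin \o v).
Proof.
apply: (le_integrable measurableT _ _ gint); first exact/measurable_EFinP.
by move=> x _; rewrite /= lee_fin !ger0_norm ?g0 ?v0 ?v_le_g.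
Qed.

Let Jint : leb.-integrable setT (EFin \o (fun x => Jmin nu (v x))).
Proof.
have mJ := measurableT_comp (measurable_Jmin levy) mv.
apply/integrableP; split; first exact/measurable_EFinP.
by under eq_integral do rewrite gee0_abs ?lee_fin ?Jmin_ge0//.
Qed.

Let f2_le f C : wbound f C -> forall x, f x ^+ 2 <= C ^+ 2 * v x.
Proof.
move=> Bf x; have C0 := wbound_ge0 Bf; have fx := wbound_le Bf x.
rewrite -(real_normK (num_real (f x))).
have h1 : `|f x| ^+ 2 <= (C * v x) ^+ 2 by rewrite lerXn2r ?nnegrE ?mulr_ge0.
rewrite (le_trans h1)// exprMn ler_wpM2l ?sqr_ge0// expr2.
by rewrite ler_piMl.
Qed.

Let Jmin_scale f C : wbound f C -> forall x, Jmin nu (f x) <= (1 + C) * Jmin nu (v x).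
Proof.
move=> Bf x; have C0 := wbound_ge0 Bf; have fx := wbound_le Bf x.
have C1 : 0 <= 1 + C by rewrite addr_ge0.
have E1 : ((1 + C) * Jmin nu (v x))%:E = (\int[nu]_(r in L) ((1 + C)%:E * (Order.min 1 (`|r| * `|v x|))%:E))%E.
  have mm : measurable_fun L (fun r : measurableTypeR R => (Order.min 1 (`|r| * `|v x|))%:E).
    apply/measurable_EFinP; apply: (measurable_funS measurableT) => //.
    apply: (measurable_minr (measurable_cst (1 : R))).
    by apply: measurable_funM => //; exact: normr_measurable.
  rewrite ge0_integralZl//; first by rewrite EFinM (Jmin_EFin levy).
  exact: measurable_large_jumps.
rewrite -lee_fin E1 (Jmin_EFin levy); apply: ge0_le_integral => //.
- exact: measurable_large_jumps.
- apply/measurable_EFinP; apply: (measurable_funS measurableT) => //.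
  apply: (measurable_minr (measurable_cst (1 : R))).
  by apply: measurable_funM => //; exact: normr_measurable.
- apply: (measurable_funS measurableT) => //; apply/measurable_EFinP; apply: measurable_funM => //.
  apply: (measurable_minr (measurable_cst (1 : R))).
  by apply: measurable_funM => //; exact: normr_measurable.
move=> r _; rewrite -EFinM lee_fin (ger0_norm (v0 x)).
have rf : `|r| * `|f x| <= C * (`|r| * v x).
  by rewrite mulrCA ler_wpM2l.
have y0 : 0 <= `|r| * v x by rewrite mulr_ge0.
move: rf y0; set y := `|r| * v x; set z := `|r| * `|f x| => zy y0.
by case: (leP 1 y) => h1; case: (leP 1 z) => h2; nra.
Qed.

(** Near zero the exponent is of order |z| + z^2, and the large jumps are
    governed by Jmin; with v at most 1 all terms are bounded by integrable
    multiples of v and Jmin(v). *)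
Lemma psi_int f C : wbound f C ->
  leb.-integrable setT (EFin \o (fun x => psiRe nu s (f x))) /\
  leb.-integrable setT (EFin \o (fun x => psiIm nu gamma (f x))).
Proof.
move=> Bf; have mf := wbound_meas Bf; have C0 := wbound_ge0 Bf.
have mL := @measurable_large_jumps R; have Loo := large_jumps_lty levy.
pose D := s ^+ 2 / 2 * C ^+ 2 + `|gamma| * C + C ^+ 2 * S; pose E := 4 * (1 + C).
have idom : leb.-integrable setT (EFin \o (fun x => D * v x + E * Jmin nu (v x))).
  by have := integrableD measurableT (integrableZl measurableT D vint) (integrableZl measurableT E Jint).
have s20 : 0 <= s ^+ 2 / 2 by rewrite divr_ge0 ?sqr_ge0.
have dom x : [/\ `|psiRe nu s (f x)| <= D * v x + E * Jmin nu (v x) &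
    `|psiIm nu gamma (f x)| <= D * v x + E * Jmin nu (v x)].
  have h1 := f2_le Bf x; have h2 := Jmin_scale Bf x; have h3 := wbound_le Bf x.
  have h4 := JcU_le levy (f x); have h5 := JcL_le levy (f x).
  have h6 := JssU_le levy (f x); have h7 := JsL_le levy (f x).
  have f20 := sqr_ge0 (f x); have J0 := Jmin_ge0 nu (v x).
  have q1 : f x ^+ 2 * S <= C ^+ 2 * S * v x.
    by rewrite [leRHS]mulrAC ler_wpM2r.
  have q2 : s ^+ 2 / 2 * f x ^+ 2 <= s ^+ 2 / 2 * C ^+ 2 * v x by rewrite -[leRHS]mulrA ler_wpM2l.
  have q3 : `|gamma| * `|f x| <= `|gamma| * C * v x by rewrite -mulrA ler_wpM2l.
  have p1 : 0 <= `|gamma| * C * v x by rewrite !mulr_ge0.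
  have p2 : 0 <= s ^+ 2 / 2 * C ^+ 2 * v x by rewrite !mulr_ge0 ?sqr_ge0.
  have p3 : 2 * Jmin nu (f x) <= E * Jmin nu (v x).
    have : 0 <= (1 + C) * Jmin nu (v x) by rewrite mulr_ge0// addr_ge0.
    by rewrite /E -mulrA; lra.
  rewrite /D; split.
    rewrite /psiRe (le_trans (ler_normD _ _))// normrM normrN (ger0_norm s20) (ger0_norm f20).
    have := ler_normD (Jc nu U (f x)) (Jc nu L (f x)); rewrite -/S in h4; lra.
  rewrite /psiIm (le_trans (ler_normD _ _))// normrM.
  have := ler_normD (Jss nu U (f x)) (Js nu L (f x)); rewrite -/S in h6; lra.
split; apply: (le_integrable measurableT _ _ idom).
- apply/measurable_EFinP; apply: measurable_funD.
    by apply: measurable_funM => //; exact: measurable_funX.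
  apply: measurable_funD; first exact: (measurableT_comp (measurable_JcU levy) mf).
  exact: (measurableT_comp (measurable_Jc mL Loo) mf).
- by move=> x _; rewrite /= lee_fin (le_trans (dom x).1)// ler_norm.
- apply/measurable_EFinP; apply: measurable_funD; first exact: measurable_funM.
  apply: measurable_funD; first exact: (measurableT_comp (measurable_JssU levy) mf).
  exact: (measurableT_comp (measurable_Js mL Loo) mf).
- by move=> x _; rewrite /= lee_fin (le_trans (dom x).2)// ler_norm.
Qed.

(** The noise of a cube has size eps at most a multiple of the maximum of v on
    the cube, which g dominates, plus the integral of Jmin(v) over the cube;
    both are summable. *)
Lemma whole_space_noise : exists eps X M, is_noise wbound
  (fun f => (\int[leb]_x psiRe nu s (f x)) +i* (\int[leb]_x psiIm nu gamma (f x))) eps X M.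
Proof.
have [xi [mxi xi1 cxi]] := @gaussian_variable R.
pose m1 := fine (\int[P]_w (`|xi w|)%:E)%E.
have xi0 : (0 <= \int[P]_w (`|xi w|)%:E)%E by exact: integral_ge0.
have m10 : 0 <= m1 by exact: fine_ge0.
have gaus : exists xi : coin -> R, [/\ measurable_fun setT xi, (\int[P]_w (`|xi w|)%:E <= m1%:E)%E &
     forall t, charf (fun w => t * xi w) = cexp (- (t ^+ 2 / 2))%:C].
  by exists xi; split => //; rewrite /m1 fineK// ge0_fin_numE.
have [A_ [k shells]] := small_jump_shells levy.
have k0 : 0 < k by have [] := shells.
(* The constants of the drift, of the Gaussian part and of the shells of small
   jumps; 5 ^+ d is the constant of the tensor Haar system. *)
pose kap := `|gamma| + 5 ^+ d * (s * m1 + k * 2).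
have kap0 : 0 <= kap by rewrite addr_ge0 ?mulr_ge0 ?exprn_ge0 ?addr_ge0 ?mulr_ge0// ltW.
have mJ : measurable_fun setT (fun x => (Jmin nu (v x))%:E).
  by apply/measurable_EFinP; exact: (measurableT_comp (measurable_Jmin levy) mv).
have mge : measurable_fun setT (EFin \o g) by exact/measurable_EFinP.
pose eps_ j := (kap%:E * \int[leb]_(x in cell j) (g x)%:E + \int[leb]_(x in cell j) (Jmin nu (v x))%:E)%E.
pose Psi_ j f := (\int[leb]_(x in cell j) psiRe nu s (f x)) +i* (\int[leb]_(x in cell j) psiIm nu gamma (f x)).
have noi j : exists X M, is_noise wbound (Psi_ j) (eps_ j) X M.
  rewrite /Psi_ /eps_; have mcj := @measurable_cell R d j; rewrite /cell in mcj *.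
  case: (pickle_inv j : option 'rV[int]_d) mcj => [m|] mcj; last first.
    exists (fun _ _ => 0), (fun=> 0%E); rewrite !integral_set0 mule0 adde0.
    by apply: noise_ext (noise0 wbound) => f _; rewrite /Rintegral !integral_set0.
  have igm : leb.-integrable (ucube (corner m)) (EFin \o g) by exact: integrableS gint.
  pose W := \int[leb]_(x in ucube (corner m)) g x.
  have WE : (\int[leb]_(x in ucube (corner m)) (g x)%:E = W%:E)%E.
    by rewrite /W /Rintegral fineK//; exact: integrable_fin_num igm.
  have W0 : 0 <= W by apply: Rintegral_ge0.
  have vW x : ucube (corner m) x -> v x <= W.
    move=> mx; have u1 : leb (ucube (corner m)) = 1%E by exact: lebesgue_ucube.
    rewrite -lee_fin -WE; apply: (@le_trans _ _ (\int[leb]_(x' in ucube (corner m)) (v x)%:E)%E).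
      by rewrite integral_cst//= [X in (_ * X)%E](_ : _ = 1%E) ?mule1//; exact: u1.
    apply: ge0_le_integral => //.
    - by move=> x' _; rewrite lee_fin.
    - exact: (measurable_funS measurableT).
    - by move=> x' mx'; rewrite lee_fin; exact: vg mx mx'.
  have := cube_levy_noise wbound_meas wbound_ge0 wbound_le
    (fun f C => @wbound_lip (corner m) W f C vW) W0 vW levy gamma s0 m10 gaus mv v0 shells.
  by rewrite WE mulrC EFinM.
have /choice[X_ /choice[M_ nXM]] := noi.
have cT := @bigcup_cell R d; have mc := @measurable_cell R d; have tc := @trivIset_cell R d.
have seps : (\sum_(j <oo) eps_ j < +oo)%E.
  rewrite nneseriesD; last 2 first.
  - by move=> j _ _; rewrite mule_ge0//; apply: integral_ge0 => x _; rewrite lee_fin.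
  - by move=> j _ _; apply: integral_ge0 => x _; rewrite lee_fin Jmin_ge0.
  rewrite nneseriesZl; last by move=> j _; apply: integral_ge0 => x _; rewrite lee_fin.
  rewrite -ge0_integral_bigcup//; last 2 first.
  - exact: (measurable_funS measurableT).
  - by move=> x _; rewrite lee_fin.
  rewrite -ge0_integral_bigcup//; last 2 first.
  - exact: (measurable_funS measurableT).
  - by move=> x _; rewrite lee_fin Jmin_ge0.
  rewrite cT lte_add_pinfty// lte_mul_pinfty//.
  have /integrableP[_] := gint.
  suff <- : (\int[leb]_x `|(EFin \o g) x| = \int[leb]_x (g x)%:E)%E by [].
  by apply: eq_integral => x _; rewrite /= ger0_norm.
exists (\sum_(j <oo) eps_ j)%E; apply: (noise_series nXM wbound_ge0 seps).
move=> f [C Bf]; have [i1 i2] := psi_int Bf.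
have sumE (u w : nat -> R) m : \sum_(j < m) (u j +i* w j) = (\sum_(j < m) u j) +i* (\sum_(j < m) w j).
  elim: m => [|m ih]; first by rewrite !big_ord0.
  by rewrite !big_ord_recr /= ih.
rewrite (_ : (fun m => _) = fun m => (\sum_(j < m) \int[leb]_(x in cell j) psiRe nu s (f x)) +i*
    (\sum_(j < m) \int[leb]_(x in cell j) psiIm nu gamma (f x))); last first.
  apply/funext => m; exact: (sumE (fun j => \int[leb]_(x in cell j) psiRe nu s (f x))
    (fun j => \int[leb]_(x in cell j) psiIm nu gamma (f x))).
rewrite -cT in i1 i2.
by rewrite -cT; split => /=; exact: cvg_Rintegral_partition.
Qed.

End global_noise.

(** * Estimates on the weight *)

Section monotone_integral.
Context {R : realType} d (T : measurableType d) (mu : {measure set T -> \bar R}).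
Local Open Scope ereal_scope.

(** The integral of a non-negative function is a supremum over the simple
    functions below it, and such a supremum is monotone for arbitrary functions.
    The inner integral of the integrability condition on the jumps, whose
    measurability is not clear, is treated in this way. *)
Lemma ge0_integral_mono (D : set T) (f g : T -> \bar R) : (forall x, D x -> 0 <= f x) ->
  (forall x, D x -> f x <= g x) -> \int[mu]_(x in D) f x <= \int[mu]_(x in D) g x.
Proof.
move=> f0 fg; have g0 x : D x -> 0 <= g x by move=> Dx; exact: le_trans (f0 x Dx) (fg x Dx).
rewrite !ge0_integralE//; apply: le_ereal_sup => _ [h /= hf <-]; exists h => //= x.
apply: le_trans (hf x) _; rewrite !patchE; case: ifPn => // xD; apply: fg; exact: set_mem.
Qed.

End monotone_integral.

Section rational_weight.
Context {R : realType}.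
Local Notation mu := (@lebesgue_measure R).
Local Notation leb := (@lebesgue_rV R).

Definition cauchy_prod n (x : 'rV[R]_n) : R := \prod_(i < n) (1 + x ord0 i ^+ 2)^-1.

Lemma cauchy_prod_ge0 n (x : 'rV[R]_n) : 0 <= cauchy_prod x.
Proof. by apply: prodr_ge0 => i _; rewrite invr_ge0 addr_ge0 ?sqr_ge0. Qed.

Lemma measurable_cauchy_prod n : measurable_fun setT (@cauchy_prod n).
Proof.
apply: measurable_prod => i _.
have c : continuous (fun t : R => (1 + t ^+ 2)^-1) by exact: continuous_oneDsqrV.
exact: (measurableT_comp (continuous_measurable_fun c) (@measurable_coord_rV _ _ n i)).
Qed.

Lemma cauchy_integral_lty : (\int[mu]_t ((1 + t ^+ 2)^-1)%:E < +oo)%E.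
Proof.
have c : continuous (fun t : R => (1 + t ^+ 2)^-1) by exact: continuous_oneDsqrV.
rewrite (@ge0_symfun_integralT R (fun t => (1 + t ^+ 2)^-1))//; last 2 first.
- by move=> t; rewrite invr_ge0 addr_ge0 ?sqr_ge0.
- by move=> t; rewrite /= sqrrN.
have := @integral0y_oneDsqr R; rewrite (_ : [set x | 0 <= x] = `[0, +oo[%classic); last first.
  by apply/seteqP; split => x /=; rewrite in_itv /= andbT.
by move=> ->; rewrite -EFinM ltry.
Qed.

Lemma cauchy_prod_lty n : (\int[leb n]_x (cauchy_prod x)%:E < +oo)%E.
Proof.
elim: n => [|n ih].
  have -> : (fun x : 'rV[R]_0 => (cauchy_prod x)%:E) = cst 1%E.
    by apply/funext => x; rewrite /cauchy_prod big_ord0.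
  by rewrite integral_cst//= diracT mul1e ltry.
rewrite rV_fubini_ge0; last 2 first.
- by apply/measurable_EFinP; exact: measurable_cauchy_prod.
- by move=> x; rewrite lee_fin cauchy_prod_ge0.
have e t (y : 'rV[R]_n) : (cauchy_prod (cons_rV (t, y)))%:E =
    (((1 + t ^+ 2)^-1)%:E * (cauchy_prod y)%:E)%E.
  rewrite /cauchy_prod big_ord_recl cons_rV0 -EFinM; congr (_ * _)%:E.
  by apply: eq_bigr => i _; rewrite cons_rV_lift.
have i0 (t : R) : 0 <= (1 + t ^+ 2)^-1 by rewrite invr_ge0 addr_ge0 ?sqr_ge0.
have mc : measurable_fun setT (fun t : R => ((1 + t ^+ 2)^-1)%:E).
  apply/measurable_EFinP; apply: continuous_measurable_fun; exact: continuous_oneDsqrV.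
have mp : measurable_fun setT (fun y : 'rV[R]_n => (cauchy_prod y)%:E).
  by apply/measurable_EFinP; exact: measurable_cauchy_prod.
under eq_integral => t _ do under eq_integral => y _ do rewrite e.
have I0 : (0 <= \int[leb n]_y (cauchy_prod y)%:E)%E.
  by apply: integral_ge0 => y _; rewrite lee_fin cauchy_prod_ge0.
have -> : (\int[mu]_t \int[leb n]_y (((1 + t ^+ 2)^-1)%:E * (cauchy_prod y)%:E) =
    \int[mu]_t (((1 + t ^+ 2)^-1)%:E * \int[leb n]_y (cauchy_prod y)%:E))%E.
  apply: eq_integral => t _; rewrite ge0_integralZl ?lee_fin// => y _.
  by rewrite lee_fin cauchy_prod_ge0.
have If : (\int[leb n]_y (cauchy_prod y)%:E)%E \is a fin_num by rewrite ge0_fin_numE.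
rewrite ge0_integralZr//; last by move=> t _; rewrite lee_fin.
have C0 : (0 <= \int[mu]_t ((1 + t ^+ 2)^-1)%:E)%E by apply: integral_ge0 => t _; rewrite lee_fin.
have Cf : (\int[mu]_t ((1 + t ^+ 2)^-1)%:E)%E \is a fin_num.
  by rewrite ge0_fin_numE// cauchy_integral_lty.
by rewrite -(fineK If) -(fineK Cf) -EFinM ltry.
Qed.

(** Within a unit interval 1 + t^2 changes by a factor at most 3. *)
Lemma cauchy_prod_cell n (a : nat -> R) (x x' : 'rV[R]_n) : ucube a x -> ucube a x' ->
  cauchy_prod x <= 3 ^+ n * cauchy_prod x'.
Proof.
move=> ax ax'; rewrite /cauchy_prod -[n in 3 ^+ n]card_ord -prodr_const -big_split /=.
apply: ler_prod => i _; rewrite invr_ge0 addr_ge0 ?sqr_ge0//=.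
have := ax i; have := ax' i; set s := x' _ _; set t := x _ _ => /andP[h1 h2] /andP[h3 h4].
have p1 : 0 < 1 + t ^+ 2 by rewrite ltr_wpDr ?sqr_ge0.
have p2 : 0 < 1 + s ^+ 2 by rewrite ltr_wpDr ?sqr_ge0.
rewrite -[leLHS]mul1r ler_pdivrMr// mulrAC ler_pdivlMr// mul1r.
have st : (s - t) ^+ 2 <= 1.
  rewrite -(real_normK (num_real (s - t))) expr_le1// ler_norml.
  by apply/andP; split; lra.
have := sqr_ge0 (s - 2 * t); move: st; rewrite !expr2; nra.
Qed.

End rational_weight.

Section weight_estimates.
Context {R : realType} {d : nat}.
Variable omega : 'rV[R]_d -> R.
Hypothesis homega : admissible_weight omega.
Local Notation leb := (@lebesgue_rV R d).
Local Notation mu := (@lebesgue_measure R).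

Let coord_le_enorm (x : 'rV[R]_d) i : `|x ord0 i| <= enorm x.
Proof.
rewrite /enorm -sqrtr_sqr ler_wsqrtr// /dotp (bigD1 i)//= -expr2 lerDl.
by apply: sumr_ge0 => j _; rewrite -expr2 sqr_ge0.
Qed.

Let enorm_ge0 (x : 'rV[R]_d) : 0 <= enorm x. Proof. exact: sqrtr_ge0. Qed.

Lemma measurable_enorm : measurable_fun setT (@enorm R d).
Proof.
have ms : measurable_fun setT (fun t : R => Num.sqrt t).
  by apply: continuous_measurable_fun; exact: sqrt_continuous.
apply: (measurableT_comp ms); apply: measurable_sum => i; apply: measurable_funM.
  exact: (@measurable_coord_rV _ _ d i).
exact: (@measurable_coord_rV _ _ d i).
Qed.

Let in0 (t : R) : 0 <= t -> t \in `[0%R, +oo[.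
Proof. by move=> t0; rewrite in_itv /= t0. Qed.

Lemma measurable_weight : measurable_fun setT omega.
Proof.
have [sigma [oE [smono _ _ _ _]]] := homega.
pose s' t := sigma (Order.max t 0).
have s'm : {homo s' : x y / x <= y}.
  move=> x y xy; apply: smono; try by apply: in0; rewrite le_max lexx orbT.
  by rewrite ge_max !le_max xy lexx /= orbT.
have ms' : measurable_fun setT s' by exact: nondecreasing_measurable.
rewrite (_ : omega = s' \o @enorm R d); first exact: (measurableT_comp ms' measurable_enorm).
by apply/funext => x; rewrite oE /s' /= max_l.
Qed.

Lemma weight_ge0 x : 0 <= omega x.
Proof.
have [sigma [oE [smono _ _ s0 _]]] := homega; rewrite oE -s0.
by apply: smono => //; exact: in0.
Qed.

Lemma weight_log : exists c0 m : R, 0 < m /\ forall x, c0 + m * ln (1 + enorm x) <= omega x.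
Proof.
have [sigma [oE [_ _ _ _ [_ [c0 [m [m0 h]]]]]]] := homega.
by exists c0, m; split => // x; rewrite oE h.
Qed.

(** From omega x >= c0 + m log(1 + |x|), the exponential is at most a constant
    times (1 + |x|)^(-2d) for eta large, and each factor 1 + x_i^2 is at most (1
    + |x|)^2. *)
Lemma expR_weight_le : exists C0 eta0 : R, [/\ 0 <= C0, 0 < eta0 &
  forall eta x, eta0 <= eta -> expR (- eta * omega x) <= C0 * cauchy_prod x].
Proof.
have [c0 [m [m0 h]]] := weight_log.
(* eta0 * m is at least 2 d, and the summand 1 keeps eta0 positive for d = 0. *)
pose eta0 := (2 * d)%:R / m + 1.
have eta00 : 0 < eta0 by rewrite ltr_wpDl ?divr_ge0// ltW.
exists (expR (- eta0 * c0)), eta0; split => //.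
move=> eta x le_eta.
have l0 : 1 <= 1 + enorm x by rewrite lerDl.
have ln0 : 0 <= ln (1 + enorm x) by exact: ln_ge0.
apply: (@le_trans _ _ (expR (- eta0 * omega x))).
  by rewrite ler_expR !mulNr lerN2 ler_wpM2r ?weight_ge0.
apply: (@le_trans _ _ (expR (- eta0 * c0) * expR (- (2 * d)%:R * ln (1 + enorm x)))).
  rewrite -expRD ler_expR.
  have e1 : eta0 * m = (2 * d)%:R + m by rewrite /eta0 mulrDl divfK ?gt_eqF// mul1r.
  have := h x; move=> /(ler_wpM2l (ltW eta00)); rewrite mulrDr mulrA e1 (mulrDl (2 * d)%:R).
  by have := mulr_ge0 (ltW m0) ln0; rewrite !mulNr; lra.
rewrite ler_wpM2l ?expR_ge0// mulNr expRN expRM_natl lnK ?posrE ?(lt_le_trans _ l0)//.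
rewrite exprM /cauchy_prod -[d in _ ^+ d]card_ord -prodr_const -prodfV.
apply: ler_prod => i _; rewrite invr_ge0 sqr_ge0 /=.
rewrite lef_pV2 ?posrE ?exprn_gt0 ?(lt_le_trans _ l0)//; last by rewrite ltr_wpDr ?sqr_ge0.
rewrite -(real_normK (num_real (x ord0 i))).
have := coord_le_enorm x i; have := normr_ge0 (x ord0 i); set y := `|_|; set z := enorm x.
by move=> y0 yz; rewrite !expr2; nra.
Qed.

Hypothesis d_gt0 : (0 < d)%N.

(** omega is radial: omega x = omega (|x| e1). The set defining the supremum is
    bounded because the weight tends to infinity. *)
Lemma weight_inv_ge (x : 'rV[R]_d) beta : omega x < beta -> enorm x <= weight_inv omega beta.
Proof.
move=> ob; have [sigma [oE [smono _ _ _ [_ [c0 [m [m0 h]]]]]]] := homega.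
have ne1 : enorm (@e1 R d) = 1.
  rewrite /enorm /dotp (bigD1 (Ordinal d_gt0))//= !mxE eqxx mulr1 big1 ?addr0 ?sqrtr1//.
  move=> i; rewrite -val_eqE /= => i0; by rewrite !mxE (negbTE i0) mul0r.
have nZ t : 0 <= t -> enorm (t *: @e1 R d) = t.
  move=> t0; rewrite /enorm (_ : dotp _ _ = t ^+ 2 * dotp (@e1 R d) (@e1 R d)).
    by rewrite sqrtrM ?sqr_ge0// sqrtr_sqr ger0_norm// -[Num.sqrt _]/(enorm _) ne1 mulr1.
  by rewrite /dotp mulr_sumr; apply: eq_bigr => i _; rewrite !mxE; ring.
apply: ub_le_sup; last by split => //; rewrite oE nZ// -oE.
exists (expR ((beta - c0) / m)) => t [t0 ot].
have := h t t0; rewrite oE nZ// in ot => ht.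
have t1 : 0 < 1 + t by rewrite ltr_wpDr.
have : ln (1 + t) <= (beta - c0) / m by rewrite ler_pdivlMr// mulrC; lra.
rewrite -ler_expR lnK ?posrE//; apply: le_trans; by rewrite lerDr.
Qed.

(** The sublevel set lies in the cube of half-side weight_inv omega beta. *)
Lemma measure_sublevel (beta : R) :
  (leb [set x | (omega x < beta)%R] <= (2 ^+ d * weight_inv omega beta ^+ d)%:E)%E.
Proof.
have [ne|em] := pselect (exists x, omega x < beta); last first.
  rewrite (_ : [set x | _] = set0); last by apply/seteqP; split => // x xb; apply: em; exists x.
  rewrite measure0 lee_fin mulr_ge0// exprn_ge0//.
  rewrite /weight_inv (_ : [set x | _] = set0) ?sup0//.
  by apply/seteqP; split => // t [_ tb]; apply: em; exists (t *: @e1 R d).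
pose w := weight_inv omega beta.
have w0 : 0 <= w by have [x /weight_inv_ge xw] := ne; exact: le_trans xw.
pose I := fun _ : 'I_d => (`[- w, w]%classic : set R).
apply: (@le_trans _ _ (leb [set x | forall i, I i (x ord0 i)])).
  apply: le_measure; rewrite ?inE.
  - rewrite -[X in measurable X]setTI (_ : [set x | _] = omega @^-1` `]-oo, beta[).
      by apply: measurable_weight => //; exact: measurable_itv.
    by apply/seteqP; split => x /=; rewrite in_itv.
  - by apply: (measurable_box_rV (A := I)) => i; exact: measurable_itv.
  - move=> x xb i; rewrite /I /= in_itv /= -ler_norml.
    exact: le_trans (coord_le_enorm x i) (weight_inv_ge xb).
rewrite lebesgue_rV_box; last by move=> i; exact: measurable_itv.
rewrite (eq_bigr (fun=> (2 * w)%:E)); last first.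
  move=> i _; rewrite lebesgue_measure_itv /=; case: ifPn => [_|].
    by rewrite -EFinD opprK; congr (_%:E); ring.
  by rewrite lte_fin -leNgt => ww; congr (_%:E); lra.
have pE k : (\prod_(i < k) (2 * w)%:E = ((2 * w) ^+ k)%:E)%E.
  by elim: k => [|k ih]; [rewrite big_ord0|rewrite big_ord_recr /= ih -EFinM exprSr].
by rewrite pE lee_fin exprMn.
Qed.

End weight_estimates.

(** * The integrability condition on the large jumps *)

Section hypothesis_estimate.
Context {R : realType} {d : nat}.
Variable omega : 'rV[R]_d -> R.
Hypothesis homega : admissible_weight omega.
Hypothesis d_gt0 : (0 < d)%N.
Local Notation leb := (@lebesgue_rV R d).
Local Notation mu := (@lebesgue_measure R).
Local Notation P := (@coinP R).
Variables (c eta : R).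
Hypothesis c0 : 0 < c.
Hypothesis eta_c : c^-1 <= eta.
Let v x := expR (- eta * omega x).
Let h (alpha : R) : R := weight_inv omega (c * ln `|alpha|^-1) ^+ d.
Let mo := measurable_weight homega.
Let o0 := weight_ge0 homega.

Let mv : measurable_fun setT v.
Proof. by apply: measurableT_comp => //; exact: measurable_funM. Qed.

Let v0 x : 0 <= v x. Proof. exact: expR_ge0. Qed.

Let u x := expR (- (omega x / c)).

Let vu x : v x <= u x.
Proof.
by rewrite ler_expR mulNr lerN2 mulrC ler_wpM2r.
Qed.

Let mu' : measurable_fun setT u.
Proof.
apply: measurableT_comp => //; apply: measurable_funN.
by apply: measurable_funM.
Qed.

Let layer_cake (rho y : R) : 0 < rho -> 0 <= y ->
  (\int[mu]_(al in `[0%R, rho]) (\1_[set z | z < y] al)%:E = (Order.min rho y)%:E)%E.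
Proof.
move=> rho0 y0; rewrite (_ : (fun al => _) = EFin \o (\1_[set z | z < y] : R -> R))//.
rewrite integral_indic//; last first.
  rewrite (_ : [set z | _] = `]-oo, y[%classic); first exact: measurable_itv.
  by apply/seteqP; split => z /=; rewrite in_itv.
have [yr|ry] := leP y rho.
  rewrite (_ : _ `&` _ = `[0, y[%classic).
    apply: (etrans (@lebesgue_measure_itv R `[0, y[)).
    rewrite /= lte_fin; case: (ltP 0 y) => yy; first by rewrite oppr0 adde0.
    by congr (_%:E); apply/eqP; rewrite eq_le y0 yy.
  apply/seteqP; split => z /=; rewrite !in_itv /=.
    by move=> [zy /andP[-> _]].
  by move=> /andP[-> zy]; split => //; rewrite (le_trans (ltW zy) yr).
rewrite (_ : _ `&` _ = `[0, rho]%classic).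
  apply: (etrans (@lebesgue_measure_itv R `[0, rho])).
  by rewrite /= lte_fin rho0 oppr0 adde0.
apply/seteqP; split => z /=; rewrite !in_itv /=; first by move=> [].
by move=> /andP[-> zr]; split => //; exact: le_lt_trans zr ry.
Qed.

Lemma weight_inv_ge0 beta : 0 <= weight_inv omega beta.
Proof.
rewrite /weight_inv; have [hs|/sup_out->//] := pselect (has_sup [set x | 0 <= x /\ omega (x *: e1) < beta]).
have [[y [y0 yb]] hu] := hs.
exact: le_trans y0 (ub_le_sup hu (conj y0 yb)).
Qed.

(** For u = exp(- omega / c), which dominates v because eta >= 1/c, min(1, |r|
    u(x)) is |r| times the length of the set of alpha <= 1/|r| with alpha <
    u(x), that is omega x < c log(1/alpha). Exchange the integrals and bound the
    volume of the sublevel set. *)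
Lemma layer_cake_bound (r : R) : 1 < `|r| ->
  ((2 ^- d)%:E * \int[leb]_x (Order.min 1 (`|r| * v x))%:E <=
   `|r|%:E * \int[mu]_(al in `[0%R, `|r|^-1%R]) (h al)%:E)%E.
Proof.
move=> r1; have r0 : 0 < `|r| := lt_trans ltr01 r1.
have mI : measurable (`[0%R, `|r|^-1] : set R) by exact: measurable_itv.
(* The indicator of the region alpha < u x, 0 <= alpha <= 1/|r| of the product
   space, over which the two integrals are exchanged. *)
pose F (z : 'rV[R]_d * measurableTypeR R) : R := \1_[set z | z < 0] (z.2 - u z.1) * \1_(`[0%R, `|r|^-1]) z.2.
have neg_itv : [set z | z < 0] = `]-oo, 0[%classic :> set R.
  by apply/seteqP; split => z /=; rewrite in_itv.
have mF : measurable_fun setT F.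
  have m1 : measurable_fun setT (\1_[set z | z < 0] : R -> R).
    by apply: measurable_indic; rewrite neg_itv; exact: measurable_itv.
  have m2 : measurable_fun setT (\1_(`[0%R, `|r|^-1]) : measurableTypeR R -> R) by exact: measurable_indic.
  apply: measurable_funM; last exact: (measurableT_comp m2 measurable_snd).
  apply: (measurableT_comp m1); apply: measurable_funB.
    exact: (@measurable_snd _ _ 'rV[R]_d (measurableTypeR R)).
  exact: (measurableT_comp mu' measurable_fst).
have F0 z : 0 <= F z by rewrite mulr_ge0// indicE.
have onI (G : R -> R) : (\int[mu]_(al in `[0%R, `|r|^-1%R]) (G al)%:E =
    \int[mu]_al (G al * \1_(`[0%R, `|r|^-1]) al)%:E)%E.
  rewrite [LHS]integral_mkcond; apply: eq_integral => al _; rewrite patchE indicE.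
  by case: ifP => _; rewrite ?mulr1 ?mulr0.
have indu x al : \1_[set z | z < 0] (al - u x) = \1_[set z | z < u x] al :> R.
  by rewrite !indicE; congr (nat_of_bool _)%:R; apply/idP/idP; rewrite !inE /= subr_lt0.
have S1 : (\int[leb]_x (Order.min 1 (`|r| * v x))%:E <= \int[leb]_x (`|r|%:E * \int[mu]_al (F (x, al))%:E))%E.
  apply: ge0_integral_mono => x _; first by rewrite lee_fin le_min ler01 mulr_ge0.
  have -> : (\int[mu]_al (F (x, al))%:E = (Order.min (`|r|^-1) (u x))%:E)%E.
    rewrite -(@layer_cake (`|r|^-1) (u x)) ?invr_gt0 ?expR_ge0// onI.
    by apply: eq_integral => al _; rewrite /F /= indu.
  rewrite -EFinM lee_fin minr_pMr ?(ltW r0)// divff ?gt_eqF//.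
  by rewrite le_min !ge_min lexx /= ler_wpM2l ?vu ?orbT// ltW.
have mI1 : measurable_fun setT (fun x => (\int[mu]_al (F (x, al))%:E)%E).
  apply: (@measurable_fun_fubini_tonelli_F _ _ 'rV[R]_d (measurableTypeR R) R mu (fun z => (F z)%:E)).
    exact/measurable_EFinP.
  by move=> z; rewrite lee_fin.
have I10 x : (0 <= \int[mu]_al (F (x, al))%:E)%E by apply: integral_ge0 => al _; rewrite lee_fin.
rewrite ge0_integralZl// in S1.
have swap : (\int[leb]_x \int[mu]_al (F (x, al))%:E = \int[mu]_al \int[leb]_x (F (x, al))%:E)%E.
  apply: (@fubini_tonelli _ _ 'rV[R]_d (measurableTypeR R) R leb mu (fun z => (F z)%:E)).
    exact/measurable_EFinP.
  by move=> z; rewrite lee_fin.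
rewrite swap in S1.
have mI2 : measurable_fun setT (fun al => (\int[leb]_x (F (x, al))%:E)%E).
  apply: (@measurable_fun_fubini_tonelli_G _ _ 'rV[R]_d (measurableTypeR R) R leb (fun z => (F z)%:E)).
    exact/measurable_EFinP.
  by move=> z; rewrite lee_fin.
have I20 al : (0 <= \int[leb]_x (F (x, al))%:E)%E by apply: integral_ge0 => x _; rewrite lee_fin.
have p2 : (0 <= (2 ^- d)%:E :> \bar R)%E by rewrite lee_fin invr_ge0 exprn_ge0.
apply: (le_trans (lee_wpmul2l p2 S1)); rewrite muleCA lee_wpmul2l//.
rewrite -ge0_integralZl//.
rewrite (@onI (fun al => h al)).
(* the value at 0, where the logarithm is not meaningful, is removed *)
apply: (@le_trans _ _ (\int[mu]_(al in setT `\` [set 0%R]) ((2 ^- d)%:E * \int[leb]_x (F (x, al))%:E))%E).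
  have n0 : mu [set 0%R] = 0%E by exact: lebesgue_measure_set1.
  rewrite (@ge0_negligible_integral _ _ _ mu setT [set 0%R])//.
    exact: emeasurable_funM.
  by move=> al _; rewrite mule_ge0.
rewrite [leLHS]integral_mkcond; apply: ge0_integral_mono => al _; rewrite patchE.
  by case: ifP => // _; rewrite mule_ge0.
have hal0 : 0 <= h al * \1_(`[0%R, `|r|^-1]) al by rewrite mulr_ge0// exprn_ge0// weight_inv_ge0.
case: ifPn => [|_]; last by rewrite lee_fin.
rewrite inE => -[_ /= al0].
have [alI|alI] := boolP (al \in (`[0%R, `|r|^-1]%classic : set R)); last first.
  rewrite [leLHS](_ : _ = 0%E) ?lee_fin//.
  rewrite (_ : (fun x => _) = cst 0%E) ?integral0 ?mule0//.
  by apply/funext => x; rewrite /F /= !indicE (negbTE alI) mulr0.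
have al_gt0 : 0 < al.
  by move: alI; rewrite inE /= in_itv /= => /andP[a0 _]; rewrite lt_neqAle eq_sym a0 andbT; apply/eqP.
rewrite [in leRHS]indicE alI mulr1.
have -> : (\int[leb]_x (F (x, al))%:E = leb [set x | (omega x < c * ln `|al|^-1)%R])%E.
  rewrite (_ : (fun x => _) = EFin \o (\1_[set x | omega x < c * ln `|al|^-1] : 'rV[R]_d -> R)).
    rewrite integral_indic ?setIT//.
    rewrite -[X in measurable X]setTI (_ : [set x | _] = omega @^-1` `]-oo, (c * ln `|al|^-1)[).
      by apply: mo => //; exact: measurable_itv.
    by apply/seteqP; split => x /=; rewrite in_itv.
  apply/funext => x /=; congr (_%:E); rewrite /F /= [X in _ * X]indicE alI mulr1 indu !indicE.
  congr (nat_of_bool _)%:R; rewrite gtr0_norm// lnV ?posrE//.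
  have e : (al < u x) = (omega x < c * - ln al).
    rewrite /u -{1}(lnK (x := al)) ?posrE// ltr_expR ltrNr ltr_pdivrMr//.
    by rewrite mulrC.
  by apply/idP/idP; rewrite !inE /= e.
apply: (le_trans (lee_wpmul2l p2 (measure_sublevel homega d_gt0 _))).
by rewrite -EFinM lee_fin mulrA mulVf ?mul1r// gt_eqF// exprn_gt0.
Qed.

Variable nu : {measure set (measurableTypeR R) -> \bar R}.
Hypothesis levy : (\int[nu]_x (Order.min 1 (x ^+ 2))%:E < +oo)%E.
Local Notation L := (@large_jumps R).

Definition weight_jumps (r : measurableTypeR R) : \bar R :=
  (\int[leb]_x (Order.min 1 (`|r| * v x))%:E)%E.

Lemma weight_jumps_ge0 r : (0 <= weight_jumps r)%E.
Proof. by apply: integral_ge0 => x _; rewrite lee_fin le_min ler01 mulr_ge0. Qed.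

Lemma measurable_weight_jumps : measurable_fun setT weight_jumps.
Proof.
apply: (@measurable_fun_fubini_tonelli_G _ _ 'rV[R]_d (measurableTypeR R) R leb
    (fun z => (Order.min 1 (`|z.2| * v z.1))%:E)).
  apply/measurable_EFinP; apply: (measurable_minr (measurable_cst (1 : R))); apply: measurable_funM.
    apply: (measurableT_comp (@normr_measurable R setT)).
    exact: (@measurable_snd _ _ 'rV[R]_d (measurableTypeR R)).
  exact: (measurableT_comp mv measurable_fst).
by move=> z; rewrite lee_fin le_min ler01 mulr_ge0.
Qed.

Hypothesis Gfin : (\int[nu]_(r in L) weight_jumps r < +oo)%E.

(** The measure nu is finite on the large jumps, hence a multiple there of the
    law of a sample; Tonelli's theorem is applied to that law. *)
Lemma large_jumps_weight_lty : (\int[leb]_x (Jmin nu (v x))%:E < +oo)%E.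
Proof.
have mL := @measurable_large_jumps R; have Loo := large_jumps_lty levy.
have [A0|A0] := eqVneq (nu L) 0%E.
  have J0 x : (Jmin nu (v x))%:E = 0%E.
    rewrite (Jmin_EFin levy) null_set_integral//; apply/measurable_EFinP.
    apply: (measurable_funS measurableT) => //.
    apply: (measurable_minr (measurable_cst (1 : R))).
    by apply: measurable_funM => //; exact: normr_measurable.
  by under eq_integral do rewrite J0; rewrite integral0 ltry.
have [q [mq qE]] : exists q, samples nu L q by apply: sample => //; rewrite lt0e A0 measure_ge0.
pose F (z : 'rV[R]_d * coin) : R := Order.min 1 (`|q z.2| * v z.1).
have mF : measurable_fun setT F.
  apply: (measurable_minr (measurable_cst (1 : R))); apply: measurable_funM.
    apply: (measurableT_comp (@normr_measurable R setT)).
    exact: (measurableT_comp mq (@measurable_snd _ _ 'rV[R]_d coin)).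
  exact: (measurableT_comp mv measurable_fst).
have mFE : measurable_fun setT (fun z => (F z)%:E) by exact/measurable_EFinP.
have F0 z : (0 <= (F z)%:E)%E by rewrite lee_fin le_min ler01 mulr_ge0.
have mm (y : R) : measurable_fun setT (fun r : measurableTypeR R => (Order.min 1 (`|r| * y))%:E).
  apply/measurable_EFinP; apply: (measurable_minr (measurable_cst (1 : R))).
  by apply: measurable_funM => //; exact: normr_measurable.
have JE x : (Jmin nu (v x))%:E = (nu L * \int[P]_w (F (x, w))%:E)%E.
  rewrite (Jmin_EFin levy) (ger0_norm (v0 x)) -(qE (fun r => (Order.min 1 (`|r| * v x))%:E))//.
  by move=> r; rewrite lee_fin le_min ler01 mulr_ge0.
have I0 x : (0 <= \int[P]_w (F (x, w))%:E)%E by exact: integral_ge0.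
under eq_integral do rewrite JE.
rewrite ge0_integralZl//; last first.
  exact: (@measurable_fun_fubini_tonelli_F _ _ 'rV[R]_d coin R P (fun z => (F z)%:E)).
rewrite (@fubini_tonelli _ _ 'rV[R]_d coin R leb P (fun z => (F z)%:E))//.
have -> : (nu L * \int[P]_w \int[leb]_x (F (x, w))%:E = \int[nu]_(r in L) weight_jumps r)%E.
  exact: (qE weight_jumps measurable_weight_jumps weight_jumps_ge0).
exact: Gfin.
Qed.

End hypothesis_estimate.

(** * The exponent of the triplet *)

Section borel_copy.
Context {R : realType} (nu : {measure set R -> \bar R}).

Let idR : R -> measurableTypeR R := fun r => r.

Let measurable_idR : measurable_fun setT idR.
Proof. by move=> _ Y mY; rewrite setTI. Qed.

(** R as a realType and measurableTypeR R carry the same Borel sets under two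
    displays; this transports a measure from one to the other. *)
Definition borel_copy : {measure set (measurableTypeR R) -> \bar R} :=
  measure_function_pushforward__canonical__measure_function_Measure nu measurable_idR.

Lemma ge0_integral_borel_copy (D : set R) (f : R -> \bar R) :
  measurable (D : set (measurableTypeR R)) ->
  measurable_fun (setT : set (measurableTypeR R)) (f : measurableTypeR R -> \bar R) ->
  (forall x, 0 <= f x)%E -> (\int[borel_copy]_(x in D) f x = \int[nu]_(x in D) f x)%E.
Proof.
move=> mD mf f0.
rewrite (_ : (\int[borel_copy]_(x in D) f x = \int[pushforward nu idR]_(x in D) f x)%E)//.
rewrite (@ge0_integral_pushforward _ _ _ _ _ idR measurable_idR nu D f)//.
exact: measurable_funS mf.
Qed.

(** The positive and the negative part are transported separately, so that
    infinite and undefined integrals agree as well. *)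
Lemma integral_borel_copy (f : R -> \bar R) :
  measurable_fun (setT : set (measurableTypeR R)) (f : measurableTypeR R -> \bar R) ->
  (\int[borel_copy]_x f x = \int[nu]_x f x)%E.
Proof.
move=> mf; rewrite integralE [RHS]integralE; congr (_ - _)%E.
  by apply: ge0_integral_borel_copy => //; exact: measurable_funepos.
by apply: ge0_integral_borel_copy => //; exact: measurable_funeneg.
Qed.

End borel_copy.

Section levy_exponent.
Context {R : realType} (a gamma : R) (nu : {measure set R -> \bar R}).
Hypothesis htriplet : characteristic_triplet a gamma nu.
Local Notation nu' := (borel_copy nu).
Local Notation U := (@small_jumps R).
Local Notation L := (@large_jumps R).

Lemma borel_copy_levy : (\int[nu']_x (Order.min 1 (x ^+ 2))%:E < +oo)%E.
Proof.
have [_ [_ lv]] := htriplet; rewrite ge0_integral_borel_copy//.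
  apply/measurable_EFinP.
  exact: (measurable_minr (measurable_cst (1 : R)) (measurable_funX 2 (@measurable_id _ _ setT))).
by move=> x; rewrite lee_fin le_min ler01 sqr_ge0.
Qed.
Let levy := borel_copy_levy.

Let mU := @measurable_small_jumps R.
Let mL := @measurable_large_jumps R.

Let split_jumps (f : measurableTypeR R -> R) : f 0 = 0 ->
  nu'.-integrable U (EFin \o f) -> nu'.-integrable L (EFin \o f) ->
  \int[nu']_x f x = \int[nu']_(x in U) f x + \int[nu']_(x in L) f x.
Proof.
move=> f0 iU iL; rewrite (Rintegral_mkcond _ U) (Rintegral_mkcond _ L) -RintegralD//.
- apply: eq_Rintegral => x _; rewrite !patchE.
  have [->|x0] := eqVneq x 0.
    by rewrite f0; case: ifP => _; case: ifP => _; rewrite addr0.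
  have [x1|x1] := leP `|x| 1.
    have xU : U x by rewrite /small_jumps /= normr_gt0 x0.
    have xL : ~ L x by rewrite /large_jumps /=; apply/negP; rewrite -leNgt.
    by rewrite mem_set// memNset// addr0.
  have xU : ~ U x by rewrite /small_jumps /=; apply/negP; rewrite negb_and -!ltNge x1 orbT.
  by rewrite memNset// mem_set// add0r.
- by have := (integrable_mkcond (mu := nu') (EFin \o f) mU).1 iU; rewrite restrict_EFin.
- by have := (integrable_mkcond (mu := nu') (EFin \o f) mL).1 iL; rewrite restrict_EFin.
Qed.

(** Split the integral at |x| = 1; the compensator acts on the small jumps only,
    and the integrand vanishes at the origin. *)
Lemma levy_exponentE z :
  levy_exponent a gamma nu z = psiRe nu' (Num.sqrt a) z +i* psiIm nu' gamma z.
Proof.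
have [a0 _] := htriplet; have Loo := large_jumps_lty levy.
pose fI (x : R) := sin (x * z) - x * z * (`|x| <= 1)%R%:R.
have cE x : cexp ('i * (x * z)%:C) - 1 - 'i * (x * z * (`|x| <= 1)%R%:R)%:C =
    (cos (x * z) - 1) +i* fI x.
  rewrite /fI; apply/eqP; rewrite eq_complex /cexp /=.
  rewrite !(mul0r, mul1r, mulr0, mulr1, subr0, sub0r, oppr0, addr0, add0r) expR0.
  by rewrite !(mul0r, mul1r, mulr0, mulr1, subr0, sub0r, oppr0, addr0, add0r) !eqxx.
have mfI : measurable_fun setT (fI : measurableTypeR R -> R).
  apply: measurable_funB; first exact: measurable_sinM.
  apply: measurable_funM; first exact: measurable_funM.
  rewrite (_ : (fun x => _) = \1_[set r : measurableTypeR R | `|r| <= 1] :> (measurableTypeR R -> R)).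
    apply: measurable_indic.
    have := @normr_measurable R setT measurableT _ (measurable_itv `]-oo, 1]); rewrite setTI.
    by congr measurable; apply/seteqP; split => r /=; rewrite in_itv.
  by apply/funext => r; rewrite indicE; congr (nat_of_bool _)%:R; apply/idP/idP; rewrite inE.
have bnd (g : measurableTypeR R -> R) B : measurable_fun setT g ->
    (forall r, `|g r| <= B) -> nu'.-integrable L (EFin \o g).
  move=> mg gB; apply: measurable_bounded_integrable => //; first exact: measurable_funS mg.
  by exists B; split; [exact: num_real|move=> y By r Ar; exact: le_trans (gB r) (ltW By)].
have iUc : nu'.-integrable U (EFin \o (fun r : measurableTypeR R => cos (r * z) - 1)).
  apply: (integrable_small_jumps_le levy (measurable_cosB1 z)) => r.
  by rewrite (le_trans (norm_cosB1_le _))// exprMn mulrC.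
have iLc : nu'.-integrable L (EFin \o (fun r : measurableTypeR R => cos (r * z) - 1)).
  apply: (bnd _ 2); first exact: measurable_cosB1.
  move=> r; rewrite (le_trans (ler_normB _ _))// normr1 -[leRHS]/(1 + 1) lerD2r.
  exact: normr_cos_le1.
have iUs : nu'.-integrable U (EFin \o (fun r : measurableTypeR R => sin (r * z) - r * z)).
  apply: (integrable_small_jumps_le levy (measurable_sinB z)) => r.
  by rewrite (le_trans (norm_sinB_le _))// exprMn mulrC.
have iLs : nu'.-integrable L (EFin \o (fun r : measurableTypeR R => sin (r * z))).
  by apply: (bnd _ 1); [exact: measurable_sinM|move=> r; exact: normr_sin_le1].
have fIU r : U r -> fI r = sin (r * z) - r * z by move=> /andP[_ r1]; rewrite /fI r1 mulr1.
have fIL r : L r -> fI r = sin (r * z).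
  by move=> r1; rewrite /fI leNgt r1 /= mulr0 subr0.
have E1 : \int[nu]_x (cos (x * z) - 1) = Jc nu' U z + Jc nu' L z.
  rewrite -split_jumps//; last by rewrite mul0r cos0 subrr.
  congr fine; apply/esym/integral_borel_copy; apply/measurable_EFinP; exact: measurable_cosB1.
have E2 : \int[nu]_x fI x = Jss nu' U z + Js nu' L z.
  rewrite (_ : Jss nu' U z = \int[nu']_(x in U) fI x); last first.
    by apply: eq_Rintegral => r; rewrite inE => /fIU.
  rewrite (_ : Js nu' L z = \int[nu']_(x in L) fI x); last first.
    by apply: eq_Rintegral => r; rewrite inE => /fIL.
  rewrite -split_jumps.
  - by congr fine; apply/esym/integral_borel_copy; apply/measurable_EFinP.
  - by rewrite /fI !mul0r sin0 subrr.
  - by apply: eq_integrable iUs => // r; rewrite inE => /fIU /= ->.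
  - by apply: eq_integrable iLs => // r; rewrite inE => /fIL /= ->.
rewrite /levy_exponent (_ : (fun x => _) = (fun x => (cos (x * z) - 1) +i* fI x)); last first.
  by apply/funext => x; rewrite cE.
rewrite /cintegral /= E1 E2 /psiRe /psiIm; apply/eqP; rewrite eq_complex /= sqr_sqrtr//.
by apply/andP; split; apply/eqP; lra.
Qed.

Context {d : nat} (omega : 'rV[R]_d -> R) (homega : admissible_weight omega).
Hypothesis d_gt0 : (0 < d)%N.
Variables (c eta : R).
Hypothesis c0 : 0 < c.
Hypothesis eta_c : c^-1 <= eta.
Hypothesis hint : (\int[nu]_(r in [set r : R | (1 < `|r|)%R])
       (`|r|%:E * \int[lebesgue_measure]_(alpha in `[0%R, `|r|^-1%R])
          (weight_inv omega (c * ln `|alpha|^-1) ^+ d)%R%:E) < +oo)%E.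

(** The integrand in hint may fail to be measurable, so it is first compared on
    the given measure with the measurable function weight_jumps, which is then
    transported. *)
Lemma weighted_jumps_lty :
  (\int[@lebesgue_rV R d]_x (Jmin nu' (expR (- eta * omega x)))%:E < +oo)%E.
Proof.
have mW := measurable_weight_jumps homega eta.
apply: (large_jumps_weight_lty homega levy).
rewrite ge0_integral_borel_copy//; last exact: weight_jumps_ge0.
have : (\int[nu]_(r in L) ((2 ^- d)%:E * weight_jumps omega eta r) < +oo)%E.
  apply: le_lt_trans hint; apply: ge0_integral_mono => r Lr.
    by rewrite mule_ge0 ?weight_jumps_ge0// lee_fin invr_ge0 exprn_ge0.
  exact: (layer_cake_bound homega d_gt0 c0 eta_c).
rewrite -(@ge0_integral_borel_copy _ nu L)//; last 2 first.
- by apply: emeasurable_funM.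
- by move=> r; rewrite mule_ge0 ?weight_jumps_ge0// lee_fin invr_ge0 exprn_ge0.
rewrite -(@ge0_integral_borel_copy _ nu L)//; last exact: weight_jumps_ge0.
rewrite ge0_integralZl//; last 2 first.
- exact: (measurable_funS measurableT).
- by move=> r _; exact: weight_jumps_ge0.
move=> hh; rewrite ltey; apply/eqP => e; move: hh; rewrite e gt0_muley ?ltxx//.
Qed.

End levy_exponent.

(** * Random functionals on test functions *)

Section linear_closure.
Context {R : realType} {n : nat}.
Implicit Types f g v : 'rV[R]_n -> R.

Lemma foldr_partial_lin k f g s : lsmooth f -> lsmooth g ->
  foldr partial (fun x => k * f x + g x) s =
  fun x => k * foldr partial f s x + foldr partial g s x.
Proof.
move=> lf lg; elim: s => //= i s ->; apply/funext => x; rewrite /partial.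
rewrite (_ : (fun x => k * _ + _) = (k \*: foldr partial f s) + foldr partial g s)//.
by rewrite deriveD//; [rewrite deriveZ|exact: derivableZ].
Qed.

Lemma lsmooth_lin k f g : lsmooth f -> lsmooth g -> lsmooth (fun x => k * f x + g x).
Proof.
move=> lf lg s x i; rewrite foldr_partial_lin//.
rewrite (_ : (fun x => k * _ + _) = (k \*: foldr partial f s) + foldr partial g s)//.
by apply: derivableD => //; exact: derivableZ.
Qed.

Lemma wbound_lin v k f g C D : wbound v f C -> wbound v g D ->
  wbound v (fun x => k * f x + g x) (`|k| * C + D).
Proof.
move=> [lf C0 fC] [lg D0 gD]; split; first exact: lsmooth_lin.
  by rewrite addr_ge0// mulr_ge0.
move=> p x; rewrite foldr_partial_lin//= (le_trans (ler_normD _ _))// mulrDl.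
by apply: lerD => //; rewrite normrM -mulrA ler_wpM2l.
Qed.

Lemma test_lin v k f g : test (wbound v) f -> test (wbound v) g ->
  test (wbound v) (fun x => k * f x + g x).
Proof. by move=> [C fC] [D gD]; eexists; exact: wbound_lin fC gD. Qed.

End linear_closure.

Section complex_modulus.
Context {R : realType}.

Lemma Re_le_normc (z : R[i]) : `|Re z| <= Normc.normc z.
Proof.
case: z => x y /=; rewrite -sqrtr_sqr ler_sqrt ?addr_ge0 ?sqr_ge0//.
by rewrite lerDl sqr_ge0.
Qed.

Lemma Im_le_normc (z : R[i]) : `|Im z| <= Normc.normc z.
Proof.
case: z => x y /=; rewrite -sqrtr_sqr ler_sqrt ?addr_ge0 ?sqr_ge0//.
by rewrite lerDr sqr_ge0.
Qed.

Lemma complex_norm_lt (z e : R[i]) : 0 < e -> `|Re z| + `|Im z| < Re e -> `|z| < e.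
Proof.
move=> e0 h; rewrite normc_def; move: z e e0 h => [x y] [r i].
rewrite !ltcE /= => /andP[/eqP -> r0] h; rewrite eqxx /=.
apply: le_lt_trans h; rewrite -[leRHS]ger0_norm ?addr_ge0// -[leRHS]sqrtr_sqr.
rewrite ler_sqrt ?sqr_ge0// sqrrD -(real_normK (num_real x)) -(real_normK (num_real y)).
by rewrite lerD2r lerDl mulrn_wge0// mulr_ge0.
Qed.

(** An open subset of the plane is a countable union of rational open squares. *)
Lemma preimage_complex_borel d' (T : measurableType d') (x y : T -> R) (B : set R[i]^o) :
  measurable_fun setT x -> measurable_fun setT y -> <<s open >> B ->
  measurable [set w | B (x w +i* y w)].
Proof.
move=> mx my; move: B.
suff : <<s open >> `<=` [set B : set R[i]^o | measurable [set w | B (x w +i* y w)]] by exact.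
apply: smallest_sub.
  split => /= [|A mA|F mF].
  - by rewrite (_ : [set w | _] = set0)//.
  - rewrite (_ : [set w | _] = setT `\` [set w | A (x w +i* y w)]); first exact: measurableD.
    by apply/seteqP; split.
  - rewrite (_ : [set w | _] = \bigcup_n [set w | F n (x w +i* y w)]); first exact: bigcup_measurable.
    by apply/seteqP; split => w [n _ h]; exists n.
move=> O oO /=.
pose G (p q r : rat) : set T :=
  if `[< forall z : R[i]^o, `|Re z - ratr p| < ratr r -> `|Im z - ratr q| < ratr r -> O z >]
  then [set w | `|x w - ratr p| < ratr r] `&` [set w | `|y w - ratr q| < ratr r] else set0.
have mdist (u : T -> R) (p r : R) : measurable_fun setT u -> measurable [set w | `|u w - p| < r].
  move=> mu; have mg : measurable_fun setT (fun w => `|u w - p|).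
    by apply: (measurableT_comp (@normr_measurable R setT)); exact: measurable_funB.
  have := mg measurableT _ (measurable_itv `]-oo, r[); rewrite setTI.
  by congr measurable; apply/seteqP; split => w /=; rewrite in_itv.
have mG p q r : measurable (G p q r).
  by rewrite /G; case: ifP => // _; apply: measurableI; exact: mdist.
rewrite (_ : [set w | _] = \bigcup_p \bigcup_q \bigcup_r G p q r).
  by apply: bigcupT_measurable_rat => p; apply: bigcupT_measurable_rat => q; apply: bigcupT_measurable_rat.
apply/seteqP; split => [w /= Ow|w [p _ [q _ [r _]]]]; last first.
  by rewrite /G; case: ifPn => // /asboolP h [h1 h2]; exact: h.
have /nbhs_normP[e /= e0 eO] : nbhs (x w +i* y w : R[i]^o) O by exact: open_nbhs_nbhs.
have [_ Re0] : Im e = 0 /\ 0 < Re e by move: (e0); rewrite ltcE /= => /andP[/eqP-> ->].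
have [r] := @rat_in_itvoo R 0 (Re e / 4) (divr_gt0 Re0 (ltr0n _ 4)).
rewrite in_itv /= => /andP[r0 re].
have rl t : t - ratr r < t + ratr r :> R by rewrite ltrBlDr -addrA ltrDl addr_gt0.
have [p] := rat_in_itvoo (rl (x w)); rewrite in_itv /= -ltr_distl => xp.
have [q] := rat_in_itvoo (rl (y w)); rewrite in_itv /= -ltr_distl => yq.
exists p => //; exists q => //; exists r => //; rewrite /G ifT; first by rewrite distrC in xp; rewrite distrC in yq.
apply/asboolP => z zp zq; apply: eO; rewrite /ball_ /=; apply: complex_norm_lt => //=.
case: z zp zq => z1 z2 /= zp zq.
have := ler_distD (ratr p) (x w) z1; have := ler_distD (ratr q) (y w) z2.
rewrite (distrC (ratr p) z1) (distrC (ratr q) z2) (distrC (x w)) (distrC (y w)).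
move: re xp yq; rewrite ltr_pdivlMr//.
have := distrC (ratr p) (x w); have := distrC (ratr q) (y w); lra.
Qed.

End complex_modulus.

Section test_values.
Context {R : realType} {d : nat}.
Variable omega : 'rV[R]_d -> R.
Variable eta : R.
Hypothesis eta0 : 0 < eta.
Local Notation v := (fun x => expR (- eta * omega x)).
Local Notation wb := (wbound v).
Local Notation So := (S_omega omega).

(** A multi-index with entries 0 and 1 is a set of directions. *)
Lemma Dmulti_pred (p : pred 'I_d) (f : 'rV[R]_d -> R) :
  Dmulti (fun i => p i : nat) f = foldr partial f (seq.filter p (enum 'I_d)).
Proof. by rewrite /Dmulti; elim: (enum _) => //= i s ->; case: (p i). Qed.

(** A finite sum of seminorms with multi-indices in {0, 1}^d, one for each set
    of directions. *)
Definition mixed_seminorms (psi : 'rV[R]_d -> R[i]) : R :=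
  \sum_(p : {ffun 'I_d -> bool}) fine (p_seminorm omega (fun i => p i : nat) eta psi).

(** The weighted seminorms bound the mixed derivatives by multiples of exp(- eta
    * omega). *)
Lemma wbound_seminorms (psi : 'rV[R]_d -> R[i]) :
  lsmooth (fun x => Re (psi x)) -> lsmooth (fun x => Im (psi x)) ->
  (forall p : {ffun 'I_d -> bool}, (p_seminorm omega (fun i => p i : nat) eta psi < +oo)%E) ->
  wb (fun x => Re (psi x)) (mixed_seminorms psi) /\ wb (fun x => Im (psi x)) (mixed_seminorms psi).
Proof.
move=> lr li fin.
have sup_ge alpha x : ((expR (eta * omega x) * Normc.normc (cDmulti alpha psi x))%:E <=
    p_seminorm omega alpha eta psi)%E by apply: ereal_sup_ubound; exists x.
have nc0 (z : R[i]) : 0 <= Normc.normc z := le_trans (normr_ge0 _) (Re_le_normc z).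
have s0 alpha : (0 <= p_seminorm omega alpha eta psi)%E.
  by apply: le_trans (sup_ge alpha 0); rewrite lee_fin mulr_ge0 ?expR_ge0.
have m0 : 0 <= mixed_seminorms psi by apply: sumr_ge0 => p _; exact: fine_ge0.
have main (p : pred 'I_d) x :
    Normc.normc (cDmulti (fun i => p i : nat) psi x) <= mixed_seminorms psi * v x.
  pose q : {ffun 'I_d -> bool} := [ffun i => p i].
  have -> : (fun i => p i : nat) = (fun i => q i : nat) by apply/funext => i; rewrite ffunE.
  rewrite mulNr expRN ler_pdivlMr ?expR_gt0// mulrC.
  apply: (@le_trans _ _ (fine (p_seminorm omega (fun i => q i : nat) eta psi))).
    by rewrite -lee_fin fineK ?ge0_fin_numE.
  by rewrite /mixed_seminorms (bigD1 q)//= lerDl; apply: sumr_ge0 => ? _; exact: fine_ge0.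
split; split => // p x; apply: le_trans (main p x); rewrite -Dmulti_pred.
  exact: (Re_le_normc (cDmulti (fun i => p i : nat) psi x)).
exact: (Im_le_normc (cDmulti (fun i => p i : nat) psi x)).
Qed.

Lemma test_seminorms (phi : So) :
  test wb (fun x => Re (test_fun phi x)) /\ test wb (fun x => Im (test_fun phi x)).
Proof.
have [[sr si] fin] := set_mem (valP phi).
have [h1 h2] := @wbound_seminorms (test_fun phi) (smooth_lsmooth sr) (smooth_lsmooth si)
   (fun p => (fin (fun i => p i : nat) eta eta0).1).
by split; eexists; [exact: h1|exact: h2].
Qed.

Let cdiff (psi phi : So) := fun x => test_fun psi x - test_fun phi x.

(** The balls are a subbase of the topology. *)
Lemma nbhs_S_omega_ball (k : bool * ('I_d -> nat) * R * So * R) (phi : So) :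
  0 < k.1.1.2 -> 0 < k.2 -> S_omega_ball k phi -> nbhs phi (S_omega_ball k).
Proof.
move=> k1 k2 kphi; rewrite nbhsE; exists (S_omega_ball k) => //; split => //.
exists [set S_omega_ball k]; last by rewrite bigcup_set1.
by move=> _ ->; apply: finI_from1; split.
Qed.

Variables (X : coin -> ('rV[R]_d -> R) -> R) (M : coin -> \bar R).
Hypothesis lin : noise_linear wb X.
Hypothesis bd : noise_bound wb X M.
Hypothesis M0 : forall w, (0 <= M w)%E.

(** Where M is infinite the functional is set to 0: linearity holds there, but
    not continuity. *)
Definition noise_value (w : coin) (phi : So) : R[i]^o :=
  if (M w < +oo)%E then X w (fun x => Re (test_fun phi x)) +i* X w (fun x => Im (test_fun phi x))
  else 0.

Lemma noise_value_linear w (k : R[i]) (f g h : So) :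
  (forall x, test_fun h x = k * test_fun f x + test_fun g x) ->
  noise_value w h = k * noise_value w f + noise_value w g.
Proof.
move=> hE; rewrite /noise_value; case: ifP => _; last by rewrite mulr0 addr0.
have [fr fi] := test_seminorms f; have [gr gi] := test_seminorms g.
case: k hE => a b hE.
rewrite (_ : (fun x => Re (test_fun h x)) = (fun x => a * Re (test_fun f x) +
  (- b * Im (test_fun f x) + Re (test_fun g x)))); last first.
  apply/funext => x; rewrite hE; case: (test_fun f x) (test_fun g x) => [? ?] [? ?] /=; ring.
rewrite (_ : (fun x => Im (test_fun h x)) = (fun x => a * Im (test_fun f x) +
  (b * Re (test_fun f x) + Im (test_fun g x)))); last first.
  apply/funext => x; rewrite hE; case: (test_fun f x) (test_fun g x) => [? ?] [? ?] /=; ring.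
rewrite !lin//; try exact: test_lin.
by apply/eqP; rewrite eq_complex /=; apply/andP; split; apply/eqP; ring.
Qed.

(** By linearity a difference of values is the value at psi - phi, which is at
    most M times the finite sum of seminorms of psi - phi. *)
Lemma noise_value_continuous w : continuous (noise_value w).
Proof.
have [Mw|Mw] := boolP (M w < +oo)%E; last first.
  by rewrite /noise_value (negbTE Mw); exact: cst_continuous.
move=> phi; have FF : Filter (nbhs phi) := nbhs_filter phi.
apply/(@cvgrPdist_lt _ R[i]^o _ _ FF) => e e0.
have Re0 : 0 < Re e by move: (e0); rewrite ltcE /= => /andP[].
set B := fine (M w); have B0 : 0 <= B by exact: fine_ge0.
pose K : R := #|{ffun 'I_d -> bool}|%:R.
have K0 : 0 <= K by rewrite ler0n.
have q0 : 0 < 2 * (B + 1) * (K + 1) by rewrite !mulr_gt0// ltr_wpDl.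
(* The factor 2 accounts for the real and imaginary parts; B + 1 and K + 1
   make the final comparison strict. *)
pose dl := Re e / (2 * (B + 1) * (K + 1)).
have dl0 : 0 < dl by exact: divr_gt0.
have near_p : \forall psi \near phi, forall p : {ffun 'I_d -> bool},
    (p_seminorm omega (fun i => p i : nat) eta (cdiff psi phi) < dl%:E)%E.
  apply: (@filter_forall So {ffun 'I_d -> bool} (fun p => [set psi : So |
    (p_seminorm omega (fun i => p i : nat) eta (cdiff psi phi) < dl%:E)%E]) (nbhs phi) FF) => p.
  apply: (@nbhs_S_omega_ball (true, (fun i => p i : nat), eta, phi, dl)) => //=.
  have e0' : cdiff phi phi = (fun=> 0) by apply/funext => x; rewrite /cdiff subrr.
  change (p_seminorm omega (fun i => p i : nat) eta (cdiff phi phi) < dl%:E)%E.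
  by rewrite e0' /p_seminorm cDmulti0; apply: le_lt_trans (weighted_sup0 omega eta) _; rewrite lte_fin.
apply: (@filterS _ _ FF _ _ _ near_p) => psi pp.
have [[sr si] _] := set_mem (valP phi); have [[tr ti] _] := set_mem (valP psi).
have eR : (fun x => Re (cdiff psi phi x)) = (fun x => -1 * Re (test_fun phi x) + Re (test_fun psi x)).
  by apply/funext => x; rewrite /cdiff; case: (test_fun psi x) (test_fun phi x) => [? ?] [? ?] /=; ring.
have eI : (fun x => Im (cdiff psi phi x)) = (fun x => -1 * Im (test_fun phi x) + Im (test_fun psi x)).
  by apply/funext => x; rewrite /cdiff; case: (test_fun psi x) (test_fun phi x) => [? ?] [? ?] /=; ring.
have [hR hI] : wb (fun x => Re (cdiff psi phi x)) (mixed_seminorms (cdiff psi phi)) /\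
    wb (fun x => Im (cdiff psi phi x)) (mixed_seminorms (cdiff psi phi)).
  apply: wbound_seminorms => [||p]; last exact: lt_trans (pp p) (ltry _).
    by rewrite eR; apply: lsmooth_lin; exact: smooth_lsmooth.
  by rewrite eI; apply: lsmooth_lin; exact: smooth_lsmooth.
have mK : mixed_seminorms (cdiff psi phi) <= K * dl.
  rewrite /mixed_seminorms /K -sum1_card natr_sum mulr_suml; apply: ler_sum => p _; rewrite mul1r.
  have h := pp p; have [h0|h0] := leP 0%E (p_seminorm omega (fun i => p i : nat) eta (cdiff psi phi)).
    by rewrite -lee_fin fineK ?ltW// ge0_fin_numE// (lt_trans h) ?ltry.
  by apply: le_trans (ltW dl0); apply: fine_le0; exact: ltW.
have [pr pi] := test_seminorms phi; have [qr qi] := test_seminorms psi.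
have bR := le_trans (bd hR Mw) (ler_wpM2l B0 mK).
have bI := le_trans (bd hI Mw) (ler_wpM2l B0 mK).
rewrite eR lin// mulN1r addrC distrC in bR; rewrite eI lin// mulN1r addrC distrC in bI.
rewrite /noise_value Mw; apply: complex_norm_lt => //=.
apply: le_lt_trans (lerD bR bI) _.
have eE : Re e = dl * (2 * (B + 1) * (K + 1)) by rewrite /dl divfK// gt_eqF.
rewrite eE; nra.
Qed.

Definition noise_functional (w : coin) : S_omega_dual omega :=
  SOmegaDual (@noise_value_linear w) (@noise_value_continuous w).

Hypothesis mM : measurable_fun setT M.
Hypothesis mX : forall f, test wb f -> measurable_fun setT (X ^~ f).

(** The sigma-field of the dual is generated by the evaluations, each of which
    is measurable. *)
Lemma measurable_noise_functional :
  measurable_fun (setT : set coin) (noise_functional : coin -> S_omega_dual omega).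
Proof.
apply: (@measurability _ _ _ _ _ _ (@cylindrical R d omega)) => //.
move=> _ [_ [n [phi [B [hB ->]]]] <-]; rewrite setTI.
rewrite (_ : _ @^-1` _ = \bigcap_(j in [set: 'I_n]) [set w | B (noise_value w (phi j))]); last first.
  by apply/seteqP; split => [w h j _|w h j]; exact: h.
apply: fin_bigcap_measurable => // j _.
pose x (f : 'rV[R]_d -> R) w := if (M w < +oo)%E then X w f else 0.
have mx f : test wb f -> measurable_fun setT (x f).
  move=> tf; apply: measurable_fun_ifT => //; last exact: mX.
  exact: measurable_fun_lte.
have := preimage_complex_borel (mx _ (test_seminorms (phi j)).1) (mx _ (test_seminorms (phi j)).2) (hB).
congr measurable; apply/seteqP; split => w /=; rewrite /noise_value /x; by case: ifP.
Qed.

End test_values.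

(** * The characteristic functional *)

Section characteristic_functional.
Context {R : realType} {d : nat} (omega : 'rV[R]_d -> R).
Local Notation dual := (S_omega_dual omega).

Lemma cexp_iE (z : R[i]) :
  cexp ('i * z) = (expR (- Im z) * cos (Re z)) +i* (expR (- Im z) * sin (Re z)).
Proof.
case: z => x y; apply/eqP; rewrite eq_complex /cexp /=.
by rewrite !(mul0r, mul1r, mulr0, mulr1, subr0, sub0r, oppr0, addr0, add0r) !eqxx.
Qed.

Lemma measurable_pairing (h : R[i]^o -> R) (phi : S_omega omega) :
  (forall x, open [set z | x < h z]) -> measurable_fun setT (fun u : dual => h (pairing u phi)).
Proof.
move=> oh; apply: (measurability _ (RGenOInfty.measurableE R)) => _ [_ [x ->] <-]; rewrite setTI.
have : <<s @cylindrical R d omega >> [set u : dual | x < h (pairing u phi)].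
  apply: sub_sigma_algebra; exists 1, (fun=> phi), [set z | x < h z]; split.
    exact: sub_sigma_algebra.
  by apply/seteqP; split => [u hu j|u /(_ ord0)].
rewrite (_ : [set u : dual | _] = (fun u : dual => h (pairing u phi)) @^-1` `]x, +oo[)//.
by apply/seteqP; split => u /=; rewrite in_itv /= andbT.
Qed.

(** Each point of the set has a disc around it on which h stays above x. *)
Lemma lipschitz_open_gt (h : R[i]^o -> R) x :
  (forall z z', `|h z - h z'| <= Normc.normc (z - z')) -> open [set z | x < h z].
Proof.
move=> hl; rewrite openE => z /= xz.
change (nbhs (z : R[i]^o) [set z : R[i]^o | x < h z]).
apply/(@nbhs_normP _ R[i]^o); exists ((h z - x)%:C).
  by rewrite /= ltcR subr_gt0.
move=> z' /=; have := hl z z'; case: (z - z') => a b /= hz.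
rewrite normc_def /= ltcR => /(le_lt_trans hz); rewrite ltr_norml; lra.
Qed.

Lemma measurable_pairing_Re (phi : S_omega omega) :
  measurable_fun setT (fun u : dual => Re (pairing u phi)).
Proof.
apply: (@measurable_pairing (fun z => Re z)) => x; apply: lipschitz_open_gt => z z'.
by have := Re_le_normc (z - z'); case: z z' => [? ?] [? ?].
Qed.

Lemma measurable_pairing_Im (phi : S_omega omega) :
  measurable_fun setT (fun u : dual => Im (pairing u phi)).
Proof.
apply: (@measurable_pairing (fun z => Im z)) => x; apply: lipschitz_open_gt => z z'.
by have := Im_le_normc (z - z'); case: z z' => [? ?] [? ?].
Qed.

Context dO (Omega : measurableType dO) (P : probability Omega R).

(** Change of variables for the positive and the negative part separately, which
    applies also when h is not integrable. *)
Lemma Rintegral_law (L : {RV P >-> dual}) (h : dual -> R) : measurable_fun setT h ->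
  \int[distribution P L]_u h u = \int[P]_w h (L w).
Proof.
move=> mh.
have mE : measurable_fun setT (EFin \o h) by exact/measurable_EFinP.
rewrite /Rintegral; congr fine; rewrite integralE [RHS]integralE; congr (_ - _)%E.
  rewrite (ge0_integral_distribution L (measurable_funepos mE))//.
  by apply: eq_integral => w _; rewrite /= !funeposE.
rewrite (ge0_integral_distribution L (measurable_funeneg mE))//.
  by apply: eq_integral => w _; rewrite /= !funenegE.
Qed.

(** On the dual the pairing may take complex values, so that the integrand is
    exp(- Im) times a cosine or a sine, which is measurable everywhere and
    reduces to a cosine or a sine almost surely. *)
Lemma characteristic_functionalE (L : {RV P >-> dual}) (phi : S_omega omega) (Y : Omega -> R) :
  measurable_fun setT Y -> {ae P, forall w, pairing (L w) phi = (Y w)%:C} ->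
  characteristic_functional L phi = (\int[P]_w cos (Y w)) +i* (\int[P]_w sin (Y w)).
Proof.
move=> mY LY.
have mexp : measurable_fun setT (fun u : dual => expR (- Im (pairing u phi))).
  by apply: measurableT_comp => //; apply: measurableT_comp => //; exact: measurable_pairing_Im.
have mc (k : R -> R) : continuous k -> measurable_fun setT
    (fun u : dual => expR (- Im (pairing u phi)) * k (Re (pairing u phi))).
  move=> ck; apply: measurable_funM => //.
  exact: (measurableT_comp (continuous_measurable_fun ck) (measurable_pairing_Re phi)).
have mL : measurable_fun setT L by [].
have main (k : R -> R) : continuous k ->
    \int[distribution P L]_u (expR (- Im (pairing u phi)) * k (Re (pairing u phi))) =
    \int[P]_w k (Y w).
  move=> ck; rewrite (Rintegral_law L (mc k ck)) /Rintegral; congr fine.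
  apply: ae_eq_integral => //.
  - by apply/measurable_EFinP; exact: (measurableT_comp (mc k ck) mL).
  - by apply/measurable_EFinP; exact: (measurableT_comp (continuous_measurable_fun ck) mY).
  - by apply: filterS LY => w -> _ /=; rewrite oppr0 expR0 mul1r.
rewrite /characteristic_functional (_ : (fun u => _) = (fun u : dual =>
  (expR (- Im (pairing u phi)) * cos (Re (pairing u phi))) +i*
  (expR (- Im (pairing u phi)) * sin (Re (pairing u phi))))); last first.
  by apply/funext => u; rewrite cexp_iE.
by rewrite /cintegral /= !main//; [exact: continuous_sin|exact: continuous_cos].
Qed.

End characteristic_functional.

Theorem theorem3p6 (R : realType) (d : nat) (d_gt0 : (0 < d)%N)
  (omega : 'rV[R]_d -> R) (homega : admissible_weight omega)
  (a gamma : R) (nu : {measure set R -> \bar R})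
  (htriplet : characteristic_triplet a gamma nu)
  (hint : exists2 c : R, 0 < c &
    (\int[nu]_(r in [set r : R | (1 < `|r|)%R])
       (`|r|%:E * \int[lebesgue_measure]_(alpha in `[0%R, `|r|^-1%R])
          (weight_inv omega (c * ln `|alpha|^-1) ^+ d)%R%:E) < +oo)%E) :
  exists (dO : measure_display) (Omega : measurableType dO)
    (P : probability Omega R) (L : {RV P >-> S_omega_dual omega}),
    levy_white_noise a gamma nu L.
Proof.
have [c c0 hc] := hint.
have [C0 [eta0 [C00 eta00 hE]]] := expR_weight_le homega.
(* Two constraints on the decay of v: it must be integrable over the lattice,
   and it must be compared with the integrability condition at the constant c. *)
pose eta := Order.max c^-1 eta0.
have eta_c : c^-1 <= eta by rewrite le_max lexx.
have eta_e : eta0 <= eta by rewrite le_max lexx orbT.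
have eta_gt0 : 0 < eta := lt_le_trans eta00 eta_e.
pose v x := expR (- eta * omega x).
pose g x := C0 * 3 ^+ d * @cauchy_prod R d x.
have o0 := weight_ge0 homega; have mo := measurable_weight homega.
have mv : measurable_fun setT v by apply: measurableT_comp => //; exact: measurable_funM.
have v0 x : 0 <= v x by exact: expR_ge0.
have v1 x : v x <= 1 by rewrite /v -expR0 ler_expR mulNr oppr_le0 mulr_ge0// ltW.
have k0 : 0 <= C0 * 3 ^+ d by rewrite mulr_ge0// exprn_ge0.
have mg : measurable_fun setT g by apply: measurable_funM => //; exact: measurable_cauchy_prod.
have g0 x : 0 <= g x by rewrite mulr_ge0// cauchy_prod_ge0.
have gint : (lebesgue_rV d).-integrable setT (EFin \o g).
  apply/integrableP; split; first exact/measurable_EFinP.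
  rewrite (_ : (\int[_]_x _ = \int[lebesgue_rV d]_x ((C0 * 3 ^+ d)%:E * (cauchy_prod x)%:E))%E); last first.
    by apply: eq_integral => x _; rewrite /= ger0_norm// -EFinM.
  rewrite ge0_integralZl//; last 2 first.
  - by apply/measurable_EFinP; exact: measurable_cauchy_prod.
  - by move=> x _; rewrite lee_fin cauchy_prod_ge0.
  by apply: lte_mul_pinfty => //; exact: cauchy_prod_lty.
have vg (m : 'rV[int]_d) x x' : ucube (corner m) x -> ucube (corner m) x' -> v x <= g x'.
  move=> mx mx'; apply: le_trans (hE eta x eta_e) _; rewrite /g -mulrA ler_wpM2l//.
  exact: cauchy_prod_cell mx mx'.
have levy := borel_copy_levy htriplet.
have Jv := weighted_jumps_lty htriplet homega d_gt0 c0 eta_c hc.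
have s0 : 0 <= Num.sqrt a by exact: sqrtr_ge0.
have [eps [X [M [[mX lin] [mM M0 Moo bd] _ ch]]]] :=
  whole_space_noise mv v0 v1 mg g0 gint vg levy Jv gamma s0.
have mT := measurable_noise_functional eta_gt0 lin bd M0 mM mX.
pose L : {RV (@coinP R) >-> S_omega_dual omega} := mfun_Sub (mem_set mT).
exists _, coin, (@coinP R), L => phi rphi psi_phi.
have psiE : psi_phi = fun x => psiRe (borel_copy nu) (Num.sqrt a) (Re (test_fun phi x)) +i*
    psiIm (borel_copy nu) gamma (Re (test_fun phi x)).
  by apply/funext => x; rewrite /psi_phi (levy_exponentE htriplet).
have [[C tC] tI] := test_seminorms eta_gt0 phi.
(* Linearity makes the value at the zero function vanish. *)
have X0 w : X w (fun x => Im (test_fun phi x)) = 0.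
  have := lin w (-1) _ _ tI tI; rewrite mulN1r addNr => <-.
  by congr (X w _); apply/funext => x; rewrite rphi mulr0 addr0.
have LE w : pairing (L w) phi =
    (if (M w < +oo)%E then X w (fun x => Re (test_fun phi x)) else 0)%:C.
  by rewrite /= /noise_value X0; case: ifP.
split.
- by move=> w; rewrite LE.
- have [h1 h2] := psi_int mv v0 v1 g0 gint vg levy Jv gamma s0 tC.
  by rewrite psiE; split.
rewrite psiE -ch; last by exists C.
apply: characteristic_functionalE; first by apply: mX; exists C.
by apply: filterS Moo => w Mw; rewrite LE Mw.
Qed.
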